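(* Assume (A1)-(A4) on the chain and $\tau$, and (B1)-(B2) on $V$, all as listed in the context, with $\alpha\in(0,1)$ and $\beta\in(0,2)$; in particular $\int V\,d\pi=0$ when $\beta\in(1,2)$. Suppose moreover that there exist $C_*>0$ and $\gamma>\max(\alpha,\beta)$ such that $$\pi\left[\tau\ge\lambda,\ |V|\ge\lambda\right]\le \frac{C_*}{\lambda^{\gamma}},\qquad \lambda>0 .$$ Let $K_N$ be an increasing sequence converging to $+\infty$, let $T^{(N)}_t:=K_N^{-1/\alpha}t_{[K_Nt]}$, and let $\{(S_t,T_t),\,t\ge0\}$ be the Lévy process on $\mathbb R^2$ with $\mathbb E e^{i\xi_1S_t+i\xi_2T_t}=e^{t(\psi_\beta(\xi_1)+\psi_\alpha(\xi_2))}$. Then: (i) If $\beta\neq1$ and $S^{(N)}_t:=K_N^{-1/\beta}S_{[K_Nt]}$, then the processes $\{(S^{(N)}_t,T^{(N)}_t),\,t\ge0\}$ converge in law, as $N\to+\infty$, to $\{(S_t,T_t),\,t\ge0\}$ on $D([0,+\infty),\mathbb R^2)$ with the $J_1$ topology. (ii) If $\beta=1$, put $V_N:=V1_{[|V|\le K_N]}$, $v_N:=\int V_N\,d\pi$ and $S^{(N)}_t:=K_N^{-1}S_{[K_Nt]}-v_Nt$, and assume in addition that for some $\beta'>1$ $$\sup_{N\ge1}\|PV_N\|_{L^{\beta'}(\pi)}<+\infty .$$ Then again $\{(S^{(N)}_t,T^{(N)}_t),\,t\ge0\}$ converge in law to $\{(S_t,T_t),\,t\ge0\}$ on $D([0,+\infty),\mathbb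 R^2)$ with the $J_1$ topology.
   Context: Setting. $(E,d)$ is a Polish space with Borel $\sigma$-algebra $\mathcal E$; $\{X_n,\,n\ge0\}$ is a Markov chain on $E$ with transition probability $P(x,dy)$ and transition operator $Pf(x)=\int f(y)P(x,dy)$; the law $\pi$ of $X_0$ is invariant and ergodic for the chain. (A1) Spectral gap: $\sup\{\|Pf\|_{L^2(\pi)}:\ \int f\,d\pi=0,\ \|f\|_{L^2(\pi)}=1\}=a<1$. (A2) There are a measurable family of Borel measures $Q(x,dy)$ and a measurable $p(x,y)\ge0$ with $P(x,dy)=P_a(x,dy)+Q(x,dy)$ for all $x\in E$, where $P_a(x,dy):=p(x,y)\pi(dy)$, and $\sup_{y\in E}\int p^2(x,y)\pi(dx)<+\infty$. (A3) $\tau:E\to[0,+\infty)$ is measurable, there is $t_*>0$ with $\tau(x)\ge t_*$ for all $x\in E$, and there are $\alpha\in(0,1)$, $c_\alpha>0$ with $\lim_{\lambda\to+\infty}\lambda^\alpha\pi(\tau\ge\lambda)=c_\alpha$. (A4) $\sup_{\lambda\ge0,x\in E}\dfrac{Q(x,[\tau\ge\lambda])}{P_a(x,[\tau\ge\lambda])}<+\infty$, i.e. $Q(x,[\tau\ge\lambda])\le C\,P_a(x,[\tau\ge\lambda])$ for all $\lambda\ge 0$, $x\in E$ and some constant $C$. (B1) $V:E\to\mathbb R$ is measurable and there are $\beta\in(0,2)$ and nonnegative constants $c_\beta^+,c_\beta^-$ with $c_\beta^++c_\beta^->0$ such that $\pi(V\ge\lambda)=c_\beta^+\lambda^{-\beta}(1+o(1))$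 and $\pi(V\le-\lambda)=c_\beta^-\lambda^{-\beta}(1+o(1))$ as $\lambda\to+\infty$; moreover $\int V\,d\pi=0$ if $\beta\in(1,2)$. (B2) $\sup_{\lambda\ge0,x\in E}\dfrac{Q(x,[|V|\ge\lambda])}{P_a(x,[|V|\ge\lambda])}<+\infty$ (in the same sense as (A4)). Notation. $t_0:=0$, $t_N:=\sum_{k=0}^{N-1}\tau(X_k)$; $S_0:=0$, $S_N:=\sum_{k=0}^{N-1}V(X_k)$ (partial sums, not to be confused with the limit process $S_t$). $[\cdot]$ is the integer part when applied to a number. $\psi_\beta(\xi):=\int_{\mathbb R}e_\beta(\xi,\lambda)\nu_\beta(d\lambda)$, where $\nu_\beta(d\lambda):=\beta c_\beta(\lambda)|\lambda|^{-1-\beta}d\lambda$, $c_\beta(\lambda)=c_\beta^+$ for $\lambda>0$ and $c_\beta^-$ for $\lambda<0$, and $e_\beta(\xi,\lambda)=e^{i\lambda\xi}-1$ for $\beta\in(0,1)$, $e^{i\lambda\xi}-1-i\xi\lambda1_{[-1,1]}(\lambda)$ for $\beta=1$, $e^{i\lambda\xi}-1-i\lambda\xi$ for $\beta\in(1,2)$. $\psi_\alpha$ is given by the same formula with $\alpha$ in place of $\beta$ and $c_\alpha^+=c_\alpha$, $c_\alpha^-=0$, i.e. $\psi_\alpha(\xi)=\int_0^\infty(e^{i\lambda\xi}-1)\,\alpha c_\alpha\lambda^{-1-\alpha}d\lambda$. *)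

(* Defs.v *)
From HB Require Import structures.
From mathcomp Require Import all_boot all_order all_algebra archimedean.
From mathcomp Require Import complex.
From mathcomp Require Import all_classical all_reals all_analysis.

Set Implicit Arguments.
Unset Strict Implicit.
Unset Printing Implicit Defensive.

Import Order.TTheory GRing.Theory Num.Theory.
Import numFieldNormedType.Exports.

Local Open Scope classical_set_scope.
Local Open Scope ring_scope.

HB.mixin Record isBorelPolish (R : realType) (d : measure_display) E
    & Metric R E & Complete E & Measurable d E := {
  polish_separable : exists2 D : set E, countable D & dense D ;
  polish_borel : @measurable d E = <<s @open E >> }.

#[short(type="borelPolishType")]
HB.structure Definition BorelPolish (R : realType) (d : measure_display) :=
  { E of Metric R E & Complete E & Measurable d E & isBorelPolish R d E }.

Section chain.
Context {R : realType} {d : measure_display} {E : measurableType d}.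
Implicit Types (P : R.-pker E ~> E) (Q : R.-ker E ~> E) (pi : probability E R).

Definition transition_op P (f : E -> R) (x : E) : \bar R :=
  (\int[P x]_y (f y)%:E)%E.

Definition invariant_law P pi :=
  forall B, measurable B -> (\int[pi]_x P x B)%E = pi B.

(* Sets that are invariant up to pi-null sets are trivial. *)
Definition ergodic_law P pi :=
  forall B, measurable B -> {ae pi, forall x, P x B = (\1_B x)%:E} ->
    pi B = 0%E \/ pi B = 1%E.

(* The sigma-algebra generated by X 0, ..., X n. *)
Definition past {d'} {Om : measurableType d'} (X : nat -> Om -> E) (n : nat) :
    set (set Om) :=
  <<s [set A | exists2 k, (k <= n)%N &
               exists2 B, measurable B & A = X k @^-1` B] >>.

(* P(X_n, B) is a version of the conditional probability of [X_(n+1) \in B]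
   given X_0, ..., X_n. *)
Definition markov_chain {d'} {Om : measurableType d'} (Pr : probability Om R)
    P (X : nat -> {RV Pr >-> E}) :=
  forall n A B, past (fun k => X k : Om -> E) n A -> measurable B ->
    Pr (A `&` X n.+1 @^-1` B) = (\int[Pr]_(w in A) P (X n w) B)%E.

Definition spectral_gap P pi :=
  (ereal_sup [set 'N[pi]_2%:E[transition_op P f] | f in
     [set f : E -> R | [/\ measurable_fun setT f,
        \int[pi]_x (f x)%:E = 0 & 'N[pi]_2%:E[EFin \o f] = 1]]] < 1)%E.

Definition ac_part pi (p : E -> E -> R) (x : E) (B : set E) : \bar R :=
  (\int[pi]_(y in B) (p x y)%:E)%E.

Definition kernel_splitting P pi Q (p : E -> E -> R) :=
  [/\ measurable_fun setT (fun z : E * E => p z.1 z.2),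
      forall x y, 0 <= p x y,
      forall x B, measurable B -> P x B = (ac_part pi p x B + Q x B)%E &
      (ereal_sup (range (fun y => \int[pi]_x ((p x y) ^+ 2)%:E)) < +oo)%E].

(* Stated without the quotient, so that levels of null ac_part are allowed
   exactly when Q also vanishes there. *)
Definition tail_domination pi Q (p : E -> E -> R) (f : E -> R) :=
  exists C : R, forall (lam : R) (x : E), 0 <= lam ->
    (Q x [set y | (lam <= f y)%R] <=
     C%:E * ac_part pi p x [set y | (lam <= f y)%R])%E.

(* pi (A lam) = c * lam^(-a) * (1 + o(1)), which for c = 0 is read as
   pi (A lam) = o(lam^(-a)). *)
Definition tail_asymptotics pi (A : R -> set E) (a c : R) :=
  lam `^ a * fine (pi (A lam)) @[lam --> +oo] --> c.

Definition truncation (V : E -> R) (k : R) (x : E) : R :=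
  V x * \1_[set y | `|V y| <= k] x.

Definition birkhoff_sum {Om : Type} (f : E -> R) (X : nat -> Om -> E)
    (w : Om) (n : nat) : R := \sum_(k < n) f (X k w).

End chain.

Section complex_exponents.
Context {R : realType}.
Local Open Scope complex_scope.

Definition cexp (z : R[i]) : R[i] :=
  expR (complex.Re z) * cos (complex.Im z) +i*
  (expR (complex.Re z) * sin (complex.Im z)).

Definition levy_kernel (b xi lam : R) : R[i] :=
  if b < 1 then cexp (0 +i* (lam * xi)) - 1
  else if b == 1 then
    cexp (0 +i* (lam * xi)) - 1 - (0 +i* (xi * lam * \1_`[-1, 1] lam))
  else cexp (0 +i* (lam * xi)) - 1 - (0 +i* (lam * xi)).

Definition levy_density (b cp cm lam : R) : R :=
  b * (if 0 < lam then cp else cm) * `|lam| `^ (-1 - b).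

(* The complex integral is taken componentwise. *)
Definition levy_exponent (b cp cm xi : R) : R[i] :=
  (\int[lebesgue_measure]_(lam in [set: R])
     (complex.Re (levy_kernel b xi lam) * levy_density b cp cm lam))%R +i*
  (\int[lebesgue_measure]_(lam in [set: R])
     (complex.Im (levy_kernel b xi lam) * levy_density b cp cm lam))%R.

Definition charfun2 {d} {Om : measurableType d} (Pr : probability Om R)
    (Y : Om -> R * R) (xi1 xi2 : R) : R[i] :=
  fine 'E_Pr[fun w => cos (xi1 * (Y w).1 + xi2 * (Y w).2)] +i*
  fine 'E_Pr[fun w => sin (xi1 * (Y w).1 + xi2 * (Y w).2)].

End complex_exponents.

Section skorokhod_space.
Context {R : realType}.

Definition cadlag {U : topologicalType} (f : R -> U) :=
  (forall t : R, 0 <= t -> f s @[s --> t^'+] --> f t) /\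
  (forall t : R, 0 < t -> exists l : U, f s @[s --> t^'-] --> l).

Definition time_change (l : R -> R) :=
  set_bij `[0, +oo[ `[0, +oo[ l /\
  {in `[0, +oo[ &, {mono l : s t / s <= t}}.

(* Paths on [0, +oo[ are represented by total functions; the values at negative
   times are never looked at, so that two representatives of the same path are
   topologically indistinguishable. *)
Record skorokhod (U : pseudoMetricType R) := Skorokhod {
  skorokhod_path :> R -> U ;
  skorokhod_cadlag : cadlag skorokhod_path }.

(* y is within e of x up to the horizon T, after a time change e-close to the
   identity. For fixed x these sets form a base of neighbourhoods of x for J1:
   y_n --> x iff there are time changes l_n with sup_(t >= 0) |l_n t - t| --> 0
   and sup_(t <= T) |y_n (l_n t) - x t| --> 0 for all T. *)
Definition J1_close {U : pseudoMetricType R} (T e : R)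
    (xy : skorokhod U * skorokhod U) :=
  exists2 l, time_change l &
    (forall t, 0 <= t -> `|l t - t| < e) /\
    (forall t, 0 <= t <= T -> ball (xy.1 t) e (xy.2 (l t))).

Definition J1_entourage (U : pseudoMetricType R) :
    set_system (skorokhod U * skorokhod U) :=
  [set A | exists Te : R * R, 0 < Te.2 /\ J1_close Te.1 Te.2 `<=` A].

Section J1_uniform.
Context {U : pseudoMetricType R}.

Lemma time_change_id : time_change (@id R).
Proof. by split=> //; split=> // t t0; exists t. Qed.

Lemma time_change_ge0 l t : time_change l -> 0 <= t -> 0 <= l t.
Proof.
move=> [[lfun _ _] _] t0; have /(_ t) := lfun.
by rewrite /= !in_itv/= !andbT; apply.
Qed.

Lemma time_change_comp l m : time_change l -> time_change m ->
  time_change (m \o l).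
Proof.
move=> [lb lm] [mb mm]; split; first exact: set_bij_comp lb mb.
move=> s t s0 t0 /=; case: lb => lfun _ _.
by rewrite mm ?lm//; exact: lfun.
Qed.

Lemma time_change_inv l : time_change l -> exists m, [/\ time_change m,
  forall t, 0 <= t -> l (m t) = t & forall t, 0 <= t -> m (l t) = t].
Proof.
move=> tl; have [[lfun linj lsurj] lm] := tl.
have /choice[m mP] : forall t : R, exists s : R,
    0 <= t -> 0 <= s /\ l s = t.
  move=> t; case: (leP 0 t) => t0; last by exists 0.
  have [|s] := lsurj t; first by rewrite /= in_itv/= t0.
  by rewrite /= in_itv/= andbT => s0 <-; exists s.
have lK t : 0 <= t -> m (l t) = t.
  move=> t0; have [mlt0 lmlt] := mP _ (time_change_ge0 tl t0).
  by apply: linj => //; rewrite inE/= in_itv/= ?mlt0 ?t0.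
exists m; split=> //; last by move=> t /mP[].
split; first split.
- by move=> t; rewrite /= !in_itv/= !andbT => /mP[].
- move=> s t; rewrite !inE/= !in_itv/= !andbT => /mP[_ {2}<-] /mP[_ {2}<-].
  by move=> ->.
- move=> t; rewrite /= in_itv/= andbT => t0.
  exists (l t); last exact: lK.
  by rewrite /= in_itv/= andbT; exact: time_change_ge0.
- move=> s t; rewrite !in_itv/= !andbT => s0 t0.
  have [ms0 lms] := mP _ s0; have [mt0 lmt] := mP _ t0.
  by rewrite -{2}lms -{2}lmt lm// in_itv/= ?ms0 ?mt0.
Qed.

Let ent := @J1_entourage U.

Lemma J1_filter : Filter ent.
Proof.
split.
- by exists (0, 1); split=> /=.
- move=> A B [[T e] /= [e0 TA]] [[T' e'] /= [e'0 TB]].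
  exists (Num.max T T', Num.min e e'); split; first by rewrite lt_min e0.
  move=> xy [l tl [l1 l2]]; split; [apply: TA|apply: TB]; exists l => //; split.
  + by move=> t /l1; rewrite lt_min => /andP[].
  + move=> t /andP[t0 tT].
    by apply: le_ball (l2 t _); rewrite ?ge_min ?lexx// t0/= le_max tT.
  + by move=> t /l1; rewrite lt_min => /andP[].
  + move=> t /andP[t0 tT].
    by apply: le_ball (l2 t _); rewrite ?ge_min ?lexx ?orbT// t0/= le_max tT orbT.
- by move=> A B AB [Te [e0 TA]]; exists Te; split=> //; exact: subset_trans AB.
Qed.

Lemma J1_diagonal A : ent A -> diagonal `<=` A.
Proof.
move=> [[T e] /= [e0 TA]] [x y] xy; have <- : x = y := xy.
apply: TA; exists id.
  exact: time_change_id.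
by split=> [t _|t _] /=; [rewrite subrr normr0|exact: ballxx].
Qed.

Lemma J1_inv A : ent A -> ent (A^-1)%relation.
Proof.
move=> [[T e] /= [e0 TA]]; exists (T + e, e); split=> // -[x y] /=.
move=> [l tl [l1 l2]]; apply: TA.
have [m [tm lK mK]] := time_change_inv tl; exists m => //; split=> t.
  move=> t0; have := l1 _ (time_change_ge0 tm t0).
  by rewrite lK// distrC.
move=> /andP[t0 tT] /=; apply: ball_sym.
rewrite -{2}(lK _ t0); apply: l2.
have mt0 := time_change_ge0 tm t0; rewrite mt0/=.
have := l1 _ mt0; rewrite lK// distrC ltr_distl => /andP[_ /ltW h].
by rewrite (le_trans h)// lerD2r.
Qed.

Lemma J1_split A : ent A -> exists2 B, ent B & (B \; B `<=` A)%relation.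
Proof.
move=> [[T e] /= [e0 TA]].
have e20 : 0 < e / 2 by rewrite divr_gt0.
exists (J1_close (T + e / 2) (e / 2)); first by exists (T + e / 2, e / 2); split.
move=> [x z] /= [y [l tl [l1 l2]] [m tm [m1 m2]]]; apply: TA.
exists (m \o l); first exact: time_change_comp.
split=> t /=.
  move=> t0; rewrite -(subrKA (l t)) (splitr e).
  by rewrite (le_lt_trans (ler_normD _ _))// ltrD ?m1 ?l1//; exact: time_change_ge0.
move=> /andP[t0 tT]; rewrite (splitr e); apply: ball_triangle.
  by apply: l2; rewrite t0/= (le_trans tT)// lerDl ltW.
apply: m2; rewrite time_change_ge0//=.
have := l1 _ t0; rewrite ltr_distl => /andP[_ /ltW h].
by rewrite (le_trans h)// lerD2r.
Qed.

End J1_uniform.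

HB.instance Definition _ (U : pseudoMetricType R) := gen_eqMixin (skorokhod U).
HB.instance Definition _ (U : pseudoMetricType R) :=
  gen_choiceMixin (skorokhod U).
HB.instance Definition _ (U : pseudoMetricType R) :=
  @isUniform.Build (skorokhod U) (@J1_entourage U)
    J1_filter J1_diagonal J1_inv J1_split.

End skorokhod_space.

Section processes.
Context {R : realType}.

(* Meaningful for random elements Z N and Zoo that are Borel measurable. On
   skorokhod (R * R) with the J1 topology this amounts to the measurability of
   the values at each time t >= 0. *)
Definition cvg_in_law {T : topologicalType} {d d'}
    {Om : measurableType d} {Om' : measurableType d'}
    (Pr : probability Om R) (Pr' : probability Om' R)
    (Z : nat -> Om -> T) (Zoo : Om' -> T) :=
  forall F : T -> R, continuous F -> bounded_fun F ->
    ('E_Pr[F \o Z N])%E @[N --> \oo] --> ('E_Pr'[F \o Zoo])%E.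

Record levy_process {d} {Om : measurableType d} (Pr : probability Om R)
    (Z : Om -> skorokhod (R * R)%type) : Prop := {
  levy_measurable : forall t, 0 <= t -> measurable_fun setT (fun w => Z w t) ;
  levy_start : {ae Pr, forall w, Z w 0 = 0} ;
  levy_independent : forall n (t : nat -> R) (B : nat -> set (R * R)),
    0 <= t 0%N -> nondecreasing_seq t -> (forall k, measurable (B k)) ->
    Pr (\bigcap_(k < n) [set w | B k (Z w (t k.+1) - Z w (t k))]) =
    (\prod_(k < n) Pr [set w | B k (Z w (t k.+1) - Z w (t k))%R])%E ;
  levy_stationary : forall s h (B : set (R * R)),
    0 <= s -> 0 <= h -> measurable B ->
    Pr [set w | B (Z w (s + h) - Z w s)] = Pr [set w | B (Z w h - Z w 0)] }.

Lemma cadlag_step (U : topologicalType) (u : nat -> U) (c : R) :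
  cadlag (fun t => u (Num.truncn (c * t))).
Proof.
have [c0|c0] := leP c 0.
  have f0 t : 0 <= t -> u (Num.truncn (c * t)) = u 0%N.
    move=> t0; congr u; apply/eqP; rewrite -leqn0.
    by rewrite real_truncn_le_nat ?num_real// (le_lt_trans _ ltr01)// mulr_le0_ge0.
  split=> t t0.
    rewrite (f0 _ t0); apply: cvg_near_cst.
    by near=> s; apply: f0; rewrite (le_trans t0)// ltW//; near: s; exact: nbhs_right_gt.
  exists (u 0%N); apply: cvg_near_cst.
  by near=> s; apply/f0/ltW; near: s; exact: nbhs_left_gt.
split=> t t0.
  have /truncn_itv/andP[h1 h2] : 0 <= c * t by rewrite mulr_ge0// ltW.
  apply: cvg_near_cst; near=> s; congr u.
  apply: truncn_def; apply/andP; split.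
    rewrite (le_trans h1)// ler_pM2l// ltW//; near: s; exact: nbhs_right_gt.
  rewrite mulrC -ltr_pdivlMr//; near: s; apply: nbhs_right_lt.
  by rewrite ltr_pdivlMr// mulrC.
have ct0 : 0 < c * t by rewrite mulr_gt0.
have [m /andP[m1 m2]] : exists m : nat, m%:R < c * t <= m.+1%:R.
  have /andP[] := truncn_itv (ltW ct0).
  case: (Num.truncn (c * t)) => [|n]; rewrite le_eqVlt.
    by move=> _ /ltW h; exists 0%N; rewrite ct0.
  move=> /orP[/eqP h _|h1 h2]; last by exists n.+1; rewrite h1 ltW.
  by exists n; rewrite -h lexx andbT ltr_nat.
exists (u m); apply: cvg_near_cst; near=> s; congr u.
apply: truncn_def; apply/andP; split.
  rewrite mulrC -ler_pdivrMr//; near: s; apply: nbhs_left_ge.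
  by rewrite ltr_pdivrMr// mulrC.
rewrite (lt_le_trans _ m2)// ltr_pM2l//; near: s; exact: nbhs_left_lt.
Unshelve. all: by end_near. Qed.

Lemma cadlag_drift (f : R -> R * R) (v : R) : cadlag f ->
  cadlag (fun t => ((f t).1 - v * t, (f t).2)).
Proof.
have drift (F : set_system R) (t : R) (a : R * R) : Filter F -> F --> t ->
    f s @[s --> F] --> a ->
    ((f s).1 - v * s, (f s).2) @[s --> F] --> (a.1 - v * t, a.2).
  move=> FF Ft fa; apply: (@cvg_pair _ _ _ F (nbhs _) (nbhs _)).
    apply: cvgB; last by apply: cvgM => //; exact: cvg_cst.
    exact: (cvg_comp _ _ fa cvg_fst).
  exact: (cvg_comp _ _ fa cvg_snd).
move=> [fr fl]; split=> t t0.
  by apply: drift; [exact: cvg_at_right_filter|exact: fr].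
have [a fa] := fl t t0; exists (a.1 - v * t, a.2).
by apply: drift; [exact: cvg_at_left_filter|exact: fa].
Qed.

Definition scaled_path (k a b : R) (s t : nat -> R) (r : R) : R * R :=
  (k `^ (- b^-1) * s (Num.truncn (k * r)),
   k `^ (- a^-1) * t (Num.truncn (k * r))).

Definition centered_path (k a v : R) (s t : nat -> R) (r : R) : R * R :=
  (k^-1 * s (Num.truncn (k * r)) - v * r,
   k `^ (- a^-1) * t (Num.truncn (k * r))).

Lemma scaled_path_cadlag k a b s t : cadlag (scaled_path k a b s t).
Proof.
exact: (cadlag_step (fun n => (k `^ (- b^-1) * s n, k `^ (- a^-1) * t n)) k).
Qed.

Lemma centered_path_cadlag k a v s t : cadlag (centered_path k a v s t).
Proof.
exact: (cadlag_drift v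
  (cadlag_step (fun n => (k^-1 * s n, k `^ (- a^-1) * t n)) k)).
Qed.

Definition scaled_process k a b s t : skorokhod (R * R)%type :=
  Skorokhod (scaled_path_cadlag k a b s t).

Definition centered_process k a v s t : skorokhod (R * R)%type :=
  Skorokhod (centered_path_cadlag k a v s t).

End processes.

(* Main.v *)
(* Split the partial sums at a small level delta. Jumps above delta L_N, with
   L_N = K_N^(1/beta), are rare; by (A2) and (A4) one step of the kernel smears
   them out, in the sense that a function f supported by such jumps satisfies
   ||P f||_2 <= C \int |f| d pi, which is much smaller than ||f||_2. With the
   spectral gap, two large jumps closer than h are improbable, and the
   characteristic function of the increments over a grid is asymptotically the
   product of the one-step characteristic functions, hence converges to that of
   the Levy process by regular variation. The jumps below delta L_N have small
   variance, uniformly in N, and a maximal inequality obtained from the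
   martingale decomposition f - \int f = u - P u + (small) controls their sums.
   So, off an event of small probability, the path is up to a small error
   constant between large jumps that are h-separated; moving these jumps to the
   grid h N is a small change of time, and the J1 distance between the path and
   its discretization is small. No tightness criterion is needed: it suffices to
   test against J1-uniformly continuous F, and F of a discretized path is a
   uniformly continuous function of finitely many increments. *)
From HB Require Import structures.
From mathcomp Require Import all_boot all_order all_algebra archimedean.
From mathcomp Require Import complex.
From mathcomp Require Import all_classical all_reals all_analysis.
From mathcomp Require Import measurable_realfun.
From mathcomp Require Import ring lra.
Require Import Defs.

Set Implicit Arguments.
Unset Strict Implicit.
Unset Printing Implicit Defensive.

Import Order.TTheory GRing.Theory Num.Theory.
Import numFieldNormedType.Exports.

Local Open Scope classical_set_scope.
Local Open Scope ring_scope.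

(** * Bounded measurable functions *)

(** The obstacle is that [V] and [tau] need not be square integrable, whereas the spectral gap lives
    in L2. Every function handed to the chain is therefore bounded: a truncation, an indicator, a
    cosine or a sine. The rates then decide. Freezing the conditional characteristic function of the
    future costs, at each step, about the product of two L2 norms: that of [e^(i theta) - 1], of
    order [K^(-1/2)], and that of its image under the kernel minus the mean, which is [o(K^(-1/2))].
    Over order [K] steps the total error is [o(1)]. The joint tail bound enters only to make [K]
    times the mean of [min(1,|v1|) * min(1,|v2|)] vanish, and this is why the limit exponent is a
    sum. At [beta = 1] the centering [w] may diverge, but [w^2 / K] tends to 0, which is all that
    passing to the power limit requires. Characteristic functions are turned into expectations by
    hand: a coordinate is replaced by a sine of it, and Bernstein polynomials in that sine are
    trigonometric polynomials. Uniformly continuous functionals suffice because a bounded continuous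
    one is a limit of inf-convolutions from below, and so is its opposite. *)

Section bounded_measurable.
Context {d} {T : measurableType d} {R : realType}.
Implicit Types (f g : T -> R) (A : set T).

(** The bound holds everywhere, not almost everywhere, so that one function can be integrated
    against [pi] and against every [P x] without integrability conditions, and so that the
    transition operator preserves the class. *)
Definition bdd_meas f := measurable_fun setT f /\ exists M, forall x, `|f x| <= M.

Lemma bdd_meas_cst (c : R) : bdd_meas (fun=> c).
Proof. by split=> //; exists `|c|. Qed.

Lemma bdd_measD f g : bdd_meas f -> bdd_meas g -> bdd_meas (fun x => f x + g x).
Proof.
move=> [mf [M fM]] [mg [N gN]]; split; first exact: measurable_funD.
by exists (M + N) => x; rewrite (le_trans (ler_normD _ _))// lerD.
Qed.

Lemma bdd_measN f : bdd_meas f -> bdd_meas (fun x => - f x).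
Proof.
move=> [mf [M fM]]; split; first exact: measurableT_comp.
by exists M => x; rewrite normrN.
Qed.

Lemma bdd_measB f g : bdd_meas f -> bdd_meas g -> bdd_meas (fun x => f x - g x).
Proof. by move=> bf /bdd_measN; exact: bdd_measD. Qed.

Lemma bdd_measM f g : bdd_meas f -> bdd_meas g -> bdd_meas (fun x => f x * g x).
Proof.
move=> [mf [M fM]] [mg [N gN]]; split; first exact: measurable_funM.
by exists (M * N) => x; rewrite normrM ler_pM.
Qed.

Lemma bdd_measZ c f : bdd_meas f -> bdd_meas (fun x => c * f x).
Proof. by apply: bdd_measM; exact: bdd_meas_cst. Qed.

Lemma bdd_meas_sqr f : bdd_meas f -> bdd_meas (fun x => f x ^+ 2).
Proof. by move=> bf; under eq_fun do rewrite expr2; exact: bdd_measM. Qed.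

Lemma bdd_meas_sum I (s : seq I) (F : I -> T -> R) :
  (forall i, bdd_meas (F i)) -> bdd_meas (fun x => \sum_(i <- s) F i x).
Proof.
move=> bF; elim: s => [|i s IH].
  by under eq_fun do rewrite big_nil; exact: bdd_meas_cst.
by under eq_fun do rewrite big_cons; exact: bdd_measD.
Qed.

Lemma bdd_meas_prod I (s : seq I) (F : I -> T -> R) :
  (forall i, bdd_meas (F i)) -> bdd_meas (fun x => \prod_(i <- s) F i x).
Proof.
move=> bF; elim: s => [|i s IH].
  by under eq_fun do rewrite big_nil; exact: bdd_meas_cst.
by under eq_fun do rewrite big_cons; exact: bdd_measM.
Qed.

Lemma bdd_meas_indic A : measurable A -> bdd_meas (\1_A : T -> R).
Proof.
move=> mA; split=> //; exists 1 => x.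
by rewrite indicE; case: (x \in A); rewrite ?normr1 ?normr0.
Qed.

Lemma bdd_meas_cos f : measurable_fun setT f -> bdd_meas (fun x => cos (f x)).
Proof.
move=> mf; split.
  by apply: measurableT_comp mf; apply: continuous_measurable_fun; exact: continuous_cos.
by exists 1 => x; rewrite ler_norml cos_geN1 cos_le1.
Qed.

Lemma bdd_meas_sin f : measurable_fun setT f -> bdd_meas (fun x => sin (f x)).
Proof.
move=> mf; split.
  by apply: measurableT_comp mf; apply: continuous_measurable_fun; exact: continuous_sin.
by exists 1 => x; rewrite ler_norml sin_geN1 sin_le1.
Qed.

Lemma bdd_meas_bounded f : bdd_meas f -> exists2 M, 0 <= M & forall x, `|f x| <= M.
Proof.
move=> [_ [M fM]]; exists `|M| => // x; exact: le_trans (fM x) (ler_norm _).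
Qed.

Lemma bdd_meas_comp {d'} {U : measurableType d'} (h : U -> T) f :
  measurable_fun setT h -> bdd_meas f ->
  measurable_fun setT (fun u => f (h u)) /\ exists M, forall u, `|f (h u)| <= M.
Proof.
by move=> mh [mf [M fM]]; split; [exact: measurableT_comp|exists M].
Qed.

End bounded_measurable.

(** The number of levels [(i + 1) / n] not exceeding [y] is the integer part of [y * n], provided
    that [B] is large enough to list them all. *)
Lemma sum_layers (R : realType) (n B : nat) (y : R) : (0 < n)%N -> 0 <= y ->
  y * n%:R < B.+1%:R ->
  let s := (\sum_(i < B) (i.+1%:R / n%:R <= y)%R%:R) / n%:R in
  s <= y <= s + n%:R^-1.
Proof.
move=> n0 y0 yB /=; have n0' : (0 : R) < n%:R by rewrite ltr0n.
have yn0 : 0 <= y * n%:R by rewrite mulr_ge0// ltW.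
set k := Num.truncn (y * n%:R).
have /andP[k1 k2] := truncn_itv yn0.
have kB : (k <= B)%N.
  by rewrite -ltnS -(ltr_nat R); apply: le_lt_trans yB.
suff -> : \sum_(i < B) (i.+1%:R / n%:R <= y)%R%:R = k%:R :> R.
  by rewrite ler_pdivrMr// k1/= -{2}[n%:R^-1]mul1r -mulrDl natr1 ler_pdivlMr// ltW.
rewrite -natr_sum; congr _%:R.
under eq_bigr => i _.
  rewrite ler_pdivrMr// (_ : (_ <= _) = (i < k)%N); first over.
  by rewrite /k -truncn_ge_nat.
rewrite -(big_mkord xpredT (fun i => nat_of_bool (i < k)%N)) (big_cat_nat (n := k))//=.
rewrite [X in (X + _)%N](eq_big_nat _ _ (F2 := fun=> 1%N)); last first.
  by move=> i /andP[_ ->].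
rewrite sum_nat_const_nat subn0 muln1 big_nat_cond big1 ?addn0// => i.
by rewrite andbT => /andP[ki _]; rewrite ltnNge ki.
Qed.

Section bdd_meas_ind.
Context {d} {T : measurableType d} {R : realType}.

(** Shifted to be nonnegative, [f] lies within [1 / n] of a staircase over its superlevel sets.
    Since this approximation is uniform, the closure condition concerns uniform limits only, and
    every integral identity passes through it at once. *)
Lemma bdd_meas_ind (C : (T -> R) -> Prop) :
  (forall A, measurable A -> C \1_A) ->
  (forall f g, bdd_meas f -> bdd_meas g -> C f -> C g -> C (fun x => f x + g x)) ->
  (forall c f, bdd_meas f -> C f -> C (fun x => c * f x)) ->
  (forall f, bdd_meas f -> (forall e, 0 < e -> exists g,
    [/\ bdd_meas g, C g & forall x, `|f x - g x| <= e]) -> C f) ->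
  forall f, bdd_meas f -> C f.
Proof.
move=> C1 CD CZ Clim f bf; apply: Clim => // e e0.
have [M M0 fM] := bdd_meas_bounded bf.
pose n := (Num.truncn e^-1).+1.
have n0 : (0 : R) < n%:R by rewrite ltr0n.
have ne : n%:R^-1 <= e.
  by rewrite -[leRHS]invrK lef_pV2 ?posrE ?invr_gt0// ltW// truncnS_gt.
pose B := Num.truncn (2 * M * n%:R).
pose A i := [set x | i.+1%:R / n%:R <= f x + M].
have mA i : measurable (A i).
  rewrite (_ : A i = f @^-1` `[i.+1%:R / n%:R - M, +oo[).
    by rewrite -[X in measurable X]setTI; apply: bf.1.
  by apply/seteqP; split=> x; rewrite /A/= in_itv/= andbT lerBlDr.
pose g m x := \sum_(i < m) \1_(A i) x : R.
have Cg m : bdd_meas (g m) /\ C (g m).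
  elim: m => [|m [IH1 IH2]].
    have -> : g 0%N = (fun x => 0 * \1_setT x).
      by apply/funext => x; rewrite /g big_ord0 mul0r.
    by split; [apply: bdd_measZ; exact: bdd_meas_indic|apply: CZ;
      [exact: bdd_meas_indic|exact: C1]].
  have -> : g m.+1 = (fun x => g m x + \1_(A m) x).
    by apply/funext => x; rewrite /g big_ord_recr.
  by split; [apply: bdd_measD => //; exact: bdd_meas_indic|apply: CD => //;
      [exact: bdd_meas_indic|exact: C1]].
have bT : bdd_meas (\1_setT : T -> R) by exact: bdd_meas_indic.
(* The shift by [M] is undone with a multiple of the indicator of the whole space, so that [C] has
   to be known on indicators only. *)
exists (fun x => n%:R^-1 * g B x + (- M) * \1_setT x); split.
- by apply: bdd_measD; apply: bdd_measZ => //; case: (Cg B).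
- apply: CD; first by apply: bdd_measZ; case: (Cg B).
  + exact: bdd_measZ.
  + by apply: CZ; case: (Cg B).
  + by apply: CZ => //; apply: C1.
- move=> x; have := fM x; rewrite ler_norml => /andP[h1 h2].
  have /= := @sum_layers R n B (f x + M) isT _ _.
  rewrite (_ : \sum_(i < B) _ = g B x); last first.
    by apply: eq_bigr => i _; rewrite indicE; congr (_%:R); congr nat_of_bool;
      apply/idP/idP; rewrite inE.
  case/(_ _ _)/andP => [||a1 a2]; first lra.
    apply: (@le_lt_trans _ _ (2 * M * n%:R)); first by rewrite ler_wpM2r//; lra.
    exact: truncnS_gt.
  rewrite indicE in_setT mulr1 mulrC ler_norml; apply/andP; split; lra.
Qed.

End bdd_meas_ind.

Section expectation.
Context {d} {T : measurableType d} {R : realType} (mu : probability T R).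
Implicit Types (f g : T -> R) (A : set T).

Local Notation Ex f := (\int[mu]_x f x)%R.

Lemma bdd_meas_integrable f : bdd_meas f -> mu.-integrable setT (EFin \o f).
Proof.
move=> [mf [M fM]]; apply: measurable_bounded_integrable => //.
  by rewrite fin_num_fun_lty//; exact: fin_num_measure.
exists `|M|; split=> // N MN x _ /=; apply: ltW; apply: le_lt_trans MN.
exact: le_trans (fM x) (ler_norm _).
Qed.

Lemma ExE f : bdd_meas f -> (\int[mu]_x (f x)%:E)%E = (Ex f)%:E.
Proof.
by move=> bf; rewrite fineK//; apply: integrable_fin_num => //; exact: bdd_meas_integrable.
Qed.

Lemma ExD f g : bdd_meas f -> bdd_meas g ->
  Ex (fun x => f x + g x) = Ex f + Ex g.
Proof. by move=> bf bg; rewrite RintegralD//; exact: bdd_meas_integrable. Qed.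

Lemma ExB f g : bdd_meas f -> bdd_meas g ->
  Ex (fun x => f x - g x) = Ex f - Ex g.
Proof. by move=> bf bg; rewrite RintegralB//; exact: bdd_meas_integrable. Qed.

Lemma ExZ c f : bdd_meas f -> Ex (fun x => c * f x) = c * Ex f.
Proof. by move=> bf; rewrite RintegralZl//; exact: bdd_meas_integrable. Qed.

Lemma Ex_cst c : Ex (fun=> c) = c.
Proof. by rewrite Rintegral_cst//= probability_setT mulr1. Qed.

Lemma Ex_indic A : measurable A -> Ex \1_A = fine (mu A).
Proof. by move=> mA; rewrite /Rintegral integral_indic// setIT. Qed.

Lemma Ex_sum I (s : seq I) (F : I -> T -> R) : (forall i, bdd_meas (F i)) ->
  Ex (fun x => \sum_(i <- s) F i x) = \sum_(i <- s) Ex (F i).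
Proof.
move=> bF; elim: s => [|i s IH].
  by under eq_Rintegral do rewrite big_nil; rewrite Ex_cst big_nil.
under eq_Rintegral do rewrite big_cons.
by rewrite ExD// ?IH ?big_cons//; exact: bdd_meas_sum.
Qed.

Lemma le_Ex f g : bdd_meas f -> bdd_meas g -> (forall x, f x <= g x) -> Ex f <= Ex g.
Proof.
by move=> bf bg fg; apply: le_Rintegral => //; exact: bdd_meas_integrable.
Qed.

Lemma Ex_ge0 f : (forall x, 0 <= f x) -> 0 <= Ex f.
Proof. by move=> f0; apply: Rintegral_ge0. Qed.

Lemma norm_Ex_le f c : bdd_meas f -> (forall x, `|f x| <= c) -> `|Ex f| <= c.
Proof.
move=> bf fc; rewrite ler_norml; apply/andP; split.
  rewrite -(Ex_cst (- c)); apply: le_Ex => //; first exact: bdd_meas_cst.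
  by move=> x; have := fc x; rewrite ler_norml => /andP[].
rewrite -[leRHS](Ex_cst c); apply: le_Ex => //; first exact: bdd_meas_cst.
by move=> x; have := fc x; rewrite ler_norml => /andP[].
Qed.

Lemma norm_ExB_le f g c : bdd_meas f -> bdd_meas g -> (forall x, `|f x - g x| <= c) ->
  `|Ex f - Ex g| <= c.
Proof. by move=> bf bg fg; rewrite -ExB// norm_Ex_le//; exact: bdd_measB. Qed.

Lemma norm_ExB_le_on f g c B A : bdd_meas f -> bdd_meas g -> measurable A -> 0 <= c ->
  (forall x, ~ A x -> `|f x - g x| <= c) -> (forall x, `|f x - g x| <= B) ->
  `|Ex f - Ex g| <= c + B * fine (mu A).
Proof.
move=> bf bg mA c0 fgc fgB.
have bA : bdd_meas (\1_A : T -> R) by exact: bdd_meas_indic.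
have H x : `|f x - g x| <= c + B * \1_A x.
  rewrite indicE; have [/set_mem Ax|/negP] := boolP (x \in A).
    by rewrite mulr1 (le_trans (fgB x))// lerDr.
  by rewrite inE => nA; rewrite mulr0 addr0 fgc.
have b2 : bdd_meas (fun x => c + B * \1_A x).
  by apply: bdd_measD; [exact: bdd_meas_cst|exact: bdd_measZ].
rewrite -ExB// -(Ex_indic mA) -ExZ// -[X in _ <= X + _](Ex_cst c) -ExD//; first last.
- exact: bdd_measZ.
- exact: bdd_meas_cst.
rewrite ler_norml; apply/andP; split.
  rewrite -mulN1r -ExZ//; apply: le_Ex => //; [exact: bdd_measZ|exact: bdd_measB|].
  by move=> x; have := H x; rewrite ler_norml mulN1r => /andP[].
apply: le_Ex => //; first exact: bdd_measB.
by move=> x; have := H x; rewrite ler_norml => /andP[].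
Qed.

Lemma Ex_young f g t : bdd_meas f -> bdd_meas g -> 0 < t ->
  `|Ex (fun x => f x * g x)| <=
  2^-1 * (t * Ex (fun x => f x ^+ 2) + t^-1 * Ex (fun x => g x ^+ 2)).
Proof.
move=> bf bg t0.
have bf2 := bdd_meas_sqr bf; have bg2 := bdd_meas_sqr bg.
have b3 : bdd_meas (fun x => 2^-1 * (t * f x ^+ 2 + t^-1 * g x ^+ 2)).
  by apply: bdd_measZ; apply: bdd_measD; exact: bdd_measZ.
have H x : `|f x * g x| <= 2^-1 * (t * f x ^+ 2 + t^-1 * g x ^+ 2).
  have -> : `|f x * g x| = 2^-1 * (2 * `|f x| * `|g x|).
    by rewrite normrM; lra.
  rewrite ler_pM2l ?invr_gt0//.
  have : 0 <= t^-1 * (t * `|f x| - `|g x|) ^+ 2.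
    by rewrite mulr_ge0 ?sqr_ge0// invr_ge0 ltW.
  have -> : t^-1 * (t * `|f x| - `|g x|) ^+ 2 =
     t * `|f x| ^+ 2 - 2 * `|f x| * `|g x| + t^-1 * `|g x| ^+ 2.
    by field; rewrite gt_eqF.
  by rewrite !real_normK ?num_real//; lra.
rewrite -!ExZ// -ExD; [|exact: bdd_measZ..].
rewrite -ExZ; last by apply: bdd_measD; exact: bdd_measZ.
rewrite ler_norml; apply/andP; split.
  rewrite -mulN1r -ExZ//; apply: le_Ex => //; [exact: bdd_measZ|exact: bdd_measM|].
  by move=> x; have := H x; rewrite ler_norml mulN1r => /andP[].
apply: le_Ex => //; first exact: bdd_measM.
by move=> x; have := H x; rewrite ler_norml => /andP[].
Qed.

(** Optimizing the weight [t] in [Ex_young] gives the inequality. The second moments are first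
    enlarged by [e], so that the optimal weight [sqrt ((b + e) / (a + e))] exists and is positive
    even when one of them vanishes. *)
Lemma Ex_cauchy_schwarz f g : bdd_meas f -> bdd_meas g ->
  (Ex (fun x => f x * g x)) ^+ 2 <= Ex (fun x => f x ^+ 2) * Ex (fun x => g x ^+ 2).
Proof.
move=> bf bg; set a := Ex (fun x => f x ^+ 2); set b := Ex (fun x => g x ^+ 2).
have a0 : 0 <= a by apply: Ex_ge0 => x; exact: sqr_ge0.
have b0 : 0 <= b by apply: Ex_ge0 => x; exact: sqr_ge0.
suff H e : 0 < e -> `|Ex (fun x => f x * g x)| ^+ 2 <= (a + e) * (b + e).
  rewrite -real_normK ?num_real//; apply/ler_addgt0Pr => e e0.
  have e1 : 0 < Num.min 1 (e / (a + b + 1)).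
    by rewrite lt_min ltr01 divr_gt0//; lra.
  apply: le_trans (H _ e1) _; set s := Num.min _ _ in e1 *.
  have s1 : s <= 1 by rewrite ge_min lexx.
  have s2 : s * (a + b + 1) <= e by rewrite -ler_pdivlMr ?ge_min ?lexx ?orbT//; lra.
  have s3 : s * s <= s by rewrite -[leRHS]mulr1 ler_pM2l.
  lra.
move=> e0; set c := `|_|.
have c0 : 0 <= c by exact: normr_ge0.
have ae : 0 < a + e by lra.
have be : 0 < b + e by lra.
pose t := Num.sqrt ((b + e) / (a + e)).
have t0 : 0 < t by rewrite sqrtr_gt0 divr_gt0.
have tt : t * t = (b + e) / (a + e) by rewrite -expr2 sqr_sqrtr// divr_ge0// ltW.
have := Ex_young bf bg t0; rewrite -/a -/b -/c => h.
have h2 : c <= t * (a + e).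
  apply: le_trans h _.
  rewrite -(ler_pM2l t0) mulrCA mulrDr (mulrA t t^-1) divff ?gt_eqF// mul1r.
  rewrite (mulrA t t) (mulrA t t) tt divfK ?gt_eqF//.
  have : (b + e) / (a + e) * a <= b + e.
    by rewrite mulrAC ler_pdivrMr// ler_pM2l//; lra.
  lra.
apply: (@le_trans _ _ ((t * (a + e)) ^+ 2)).
  by rewrite lerXn2r ?nnegrE// mulr_ge0// ltW.
by rewrite expr2 mulrACA tt -!mulrA (mulrA (a+e)^-1) mulVf ?gt_eqF// mul1r mulrC.
Qed.

Lemma markov_sqr f e : bdd_meas f -> 0 < e ->
  fine (mu [set x | e <= `|f x|]) <= Ex (fun x => f x ^+ 2) / e ^+ 2.
Proof.
move=> bf e0.
have mA : measurable [set x | e <= `|f x|].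
  rewrite (_ : [set _ | _] = (fun x => `|f x|) @^-1` `[e, +oo[).
    rewrite -[X in measurable X]setTI; apply: measurableT_comp => //.
    by case: bf.
  by apply/seteqP; split=> x /=; rewrite in_itv/= andbT.
rewrite ler_pdivlMr ?exprn_gt0// mulrC -(Ex_indic mA) -ExZ; last exact: bdd_meas_indic.
apply: le_Ex => [||x].
- by apply: bdd_measZ; exact: bdd_meas_indic.
- exact: bdd_meas_sqr.
rewrite indicE; have [/set_mem/= h|_] := boolP (_ \in _); last by rewrite mulr0 sqr_ge0.
by rewrite mulr1 -[leRHS]real_normK ?num_real// lerXn2r// nnegrE ltW.
Qed.

End expectation.

(** * Integrals against regularly varying tails *)

Lemma powR_exprn (R : realType) (r p : R) j : 0 <= r -> (r ^+ j) `^ p = (r `^ p) ^+ j.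
Proof.
move=> r0; elim: j => [|j IH]; first by rewrite !expr0 powR1.
by rewrite !exprS powRM ?exprn_ge0// IH.
Qed.

Section weighted_tails.
Context {d} {T : measurableType d} {R : realType}.
Variables (mu : {measure set T -> \bar R}) (w Y : T -> R) (c b : R).
Hypothesis mw : measurable_fun setT w.
Hypothesis w0 : forall x, 0 <= w x.
Hypothesis mY : measurable_fun setT Y.
Hypothesis c0 : 0 <= c.
Hypothesis b0 : 0 < b.

(** A common frame for two situations: the rescaled law of [V], where [mu] is [pi] and [w] is the
    constant [K N], and the Levy measure, where [mu] is Lebesgue measure, [w] the density and [Y]
    plus or minus the identity. Convergence to the Levy measure then becomes convergence of one tail
    function to another. *)
Definition wtail (s : R) : \bar R := (\int[mu]_(x in [set x | (s <= Y x)%R]) (w x)%:E)%E.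

Hypothesis tail_le : forall s, 0 < s -> (wtail s <= (c * s `^ (- b))%:E)%E.

Lemma measurable_geY s : measurable [set x | s <= Y x].
Proof.
rewrite (_ : [set _ | _] = Y @^-1` `[s, +oo[).
  by rewrite -[X in measurable X]setTI; apply: mY.
by apply/seteqP; split=> x /=; rewrite in_itv/= andbT.
Qed.

Lemma measurable_gtY s : measurable [set x | s < Y x].
Proof.
rewrite (_ : [set _ | _] = Y @^-1` `]s, +oo[).
  by rewrite -[X in measurable X]setTI; apply: mY.
by apply/seteqP; split=> x /=; rewrite in_itv/= andbT.
Qed.

(** On [D] the function [f] is at most the sum over [j] of [a j] times the indicator of [s j <= Y].
    Integrating term by term with [tail_le] leaves a geometric series of ratio [rho]. *)
Lemma dyadic_bound (D : set T) (f : T -> R) (a s : nat -> R) (K rho : R) :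
  measurable D -> measurable_fun setT f -> (forall x, 0 <= f x) ->
  (forall j, 0 <= a j) -> (forall j, 0 < s j) ->
  (forall x, D x -> exists2 j, s j <= Y x & f x <= a j) ->
  (forall j, a j * (c * s j `^ (- b)) <= K * rho ^+ j) ->
  0 <= rho < 1 -> 0 <= K ->
  (\int[mu]_(x in D) (f x * w x)%:E <= (K / (1 - rho))%:E)%E.
Proof.
move=> mD mf f0 a0 s0 Df aK /andP[r0 r1] K0.
pose u j x := (a j * (\1_[set y | s j <= Y y] x * w x))%:E.
have u0 j x : (0 <= u j x)%E by rewrite lee_fin !mulr_ge0// indicE.
have m1 j : measurable_fun setT (\1_[set y | s j <= Y y] : T -> R).
  by apply: measurable_indic; exact: measurable_geY.
have mu_ j : measurable_fun setT (u j).
  apply/measurable_EFinP; apply: measurable_funM => //.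
  by apply: measurable_funM.
have intu j : (\int[mu]_x u j x = (a j)%:E * wtail (s j))%E.
  rewrite /u /wtail; under eq_integral do rewrite EFinM.
  rewrite ge0_integralZl ?lee_fin//; last 2 first.
  - by apply/measurable_EFinP; apply: measurable_funM.
  - by move=> x _; rewrite lee_fin mulr_ge0// indicE.
  rewrite [in RHS]integral_mkcond; congr (_ * _)%E; apply: eq_integral => x _.
  by rewrite patchE indicE; case: ifPn => _; rewrite ?mul1r ?mul0r.
apply: (@le_trans _ _ (\int[mu]_(x in D) \sum_(j <oo) u j x)%E).
  apply: ge0_le_integral => //.
  - by move=> x _; rewrite lee_fin mulr_ge0.
  - apply: measurable_funTS; apply/measurable_EFinP; exact: measurable_funM.
  - apply: measurable_funTS.
    by apply: ge0_emeasurable_sum.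
  move=> x /Df[j sj fa].
  have := @nneseries_lim_ge R (u ^~ x) xpredT 0%N j.+1 (fun _ _ _ => u0 _ _).
  apply: le_trans; rewrite big_nat_recr//=; apply: (@le_trans _ _ (u j x)).
    by rewrite lee_fin indicE mem_set// mul1r ler_wpM2r.
  by rewrite leeDr// sume_ge0.
rewrite integral_nneseries//; last by move=> j; exact: measurable_funTS.
apply: lime_le; first by apply: is_cvg_nneseries => j _ _; apply: integral_ge0.
apply: nearW => n.
apply: (@le_trans _ _ (\sum_(0 <= j < n) (K * rho ^+ j)%:E)%E).
  apply: lee_sum => j _.
  apply: (@le_trans _ _ (\int[mu]_x u j x)%E).
    by apply: ge0_subset_integral.
  rewrite intu; apply: (@le_trans _ _ ((a j)%:E * (c * s j `^ (- b))%:E)%E).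
    by apply: lee_wpmul2l; rewrite ?lee_fin//; exact: tail_le.
  by rewrite -EFinM lee_fin.
rewrite sumEFin lee_fin -mulr_sumr; apply: ler_wpM2l => //.
have r10 : 0 < 1 - rho by rewrite subr_gt0.
rewrite -[leRHS]mul1r ler_pdivlMr//.
have : (\sum_(0 <= j < n) rho ^+ j) * (1 - rho) = 1 - rho ^+ n.
  elim: n => [|n IH]; first by rewrite big_geq// mul0r expr0 subrr.
  by rewrite big_nat_recr//= mulrDl IH exprS; ring.
by move=> ->; rewrite lerBlDr lerDl exprn_ge0.
Qed.

Lemma halfp_lt1 (r : R) : 0 < r -> 0 <= (2 : R) `^ (- r) < 1.
Proof.
move=> r0; rewrite powR_ge0/= powRN invf_lt1 ?powR_gt0//.
have h1 : (1 : R) = 1 `^ r by rewrite powR1.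
by rewrite [ltLHS]h1; apply: gt0_ltr_powR; rewrite ?nnegrE// ltr1n.
Qed.

(** Dyadic shells shrinking to 0: the shell at height [L * 2^(-j)] contributes at most a multiple of
    [2^(-j (p - b))], which is summable because [b < p]. *)
Lemma small_moment p L : b < p -> 0 < L ->
  (\int[mu]_(x in [set x | (0 < Y x <= L)%R]) (Y x `^ p * w x)%:E <=
   (c * 2 `^ b / (1 - 2 `^ (- (p - b))) * L `^ (p - b))%:E)%E.
Proof.
move=> bp L0; have h2 : (0 : R) <= 2^-1 by rewrite invr_ge0.
have p0 : 0 < p by exact: lt_trans bp.
have hp r : 2^-1 `^ r = 2 `^ (- r) :> R.
  by rewrite -powR_inv1// -powRrM mulN1r.
rewrite mulrAC.
apply: (@dyadic_bound _ _ (fun j => (L * 2^-1 ^+ j) `^ p) (fun j => L * 2^-1 ^+ j.+1)).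
- rewrite (_ : [set _ | _] = Y @^-1` `]0, L]).
    by rewrite -[X in measurable X]setTI; apply: mY.
  by apply/seteqP; split=> x /=; rewrite in_itv/=.
- exact: (measurableT_comp (measurable_powR _) mY).
- by move=> x; exact: powR_ge0.
- by move=> j; exact: powR_ge0.
- by move=> j; rewrite mulr_gt0// exprn_gt0// invr_gt0.
- move=> x /= /andP[Y0 YL].
  have exj : exists j, L * 2^-1 ^+ j.+1 <= Y x.
    have /cvgrPdist_lt/(_ (Y x / L)) : (2^-1 : R) ^+ n @[n --> \oo] --> (0 : R).
      by apply: cvg_expr; rewrite ger0_norm// invf_lt1// ltr1n.
    rewrite divr_gt0// => /(_ isT)[j _ /(_ j.+1 (leqnSn j))/=].
    rewrite sub0r normrN ger0_norm ?exprn_ge0// => h; exists j.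
    by rewrite mulrC -ler_pdivlMr// ltW.
  (* Minimality of [j] bounds [Y x] from above by the previous level [L * 2^(-j)], which for [j = 0]
     is [L] itself. *)
  exists (ex_minn exj); case: ex_minnP => j hj jmin //.
  apply: ge0_ler_powR => //; rewrite ?nnegrE ?(ltW p0) ?(ltW Y0)//.
    by rewrite mulr_ge0 ?exprn_ge0// ltW.
  case: j hj jmin => [|j] hj jmin; first by rewrite expr0 mulr1.
  rewrite leNgt; apply/negP => h; have := jmin j; rewrite ltW// => /(_ isT).
  by rewrite ltnn.
- move=> j; rewrite !powRM ?exprn_ge0 ?(ltW L0)// !powR_exprn// !hp opprK.
  rewrite powRB ?(gt_eqF L0) ?implybT// powRN exprS.
  rewrite (_ : 2 `^ (- (p - b)) = 2 `^ (- p) * 2 `^ b :> R); last first.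
    by rewrite -powRD ?pnatr_eq0 ?implybT//; congr powR; ring.
  by rewrite exprMn !powRN le_eqVlt; apply/orP; left; apply/eqP; ring.
- by apply: halfp_lt1; rewrite subr_gt0.
- by rewrite !mulr_ge0// powR_ge0.
Qed.

(** The mirror image of [small_moment]: the shells grow like [L * 2^j], and summability now comes
    from [q < b]. *)
Lemma large_moment q L : 0 <= q -> q < b -> 0 < L ->
  (\int[mu]_(x in [set x | (L <= Y x)%R]) (Y x `^ q * w x)%:E <=
   (c * 2 `^ q / (1 - 2 `^ (- (b - q))) * L `^ (q - b))%:E)%E.
Proof.
move=> q0 qb L0.
rewrite mulrAC.
apply: (@dyadic_bound _ _ (fun j => (L * 2 ^+ j.+1) `^ q) (fun j => L * 2 ^+ j)).
- exact: measurable_geY.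
- exact: (measurableT_comp (measurable_powR _) mY).
- by move=> x; exact: powR_ge0.
- by move=> j; exact: powR_ge0.
- by move=> j; rewrite mulr_gt0// exprn_gt0.
- move=> x /= LY; have Y0 : 0 < Y x by exact: lt_le_trans LY.
  have exj : exists j, Y x < L * 2 ^+ j.+1.
    exists (Num.truncn (Y x / L)).
    rewrite mulrC -ltr_pdivrMr//; apply: lt_le_trans (truncnS_gt _) _.
    rewrite -natrX ler_nat; exact: ltnW (ltn_expl _ _).
  exists (ex_minn exj); case: ex_minnP => j hj jmin.
    case: j hj jmin => [|j] hj jmin; first by rewrite expr0 mulr1.
    rewrite leNgt; apply/negP => h; have := jmin j h.
    by rewrite ltnn.
  by apply: ge0_ler_powR => //; rewrite ?nnegrE ?(ltW Y0) ?(ltW hj)// mulr_ge0 ?exprn_ge0// ltW.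
- move=> j; rewrite !powRM ?exprn_ge0 ?(ltW L0)// !powR_exprn//.
  rewrite powRB ?(gt_eqF L0) ?implybT// powRN exprS.
  rewrite (_ : 2 `^ (- (b - q)) = 2 `^ (- b) * 2 `^ q :> R); last first.
    by rewrite -powRD ?pnatr_eq0 ?implybT//; congr powR; ring.
  by rewrite exprMn !powRN le_eqVlt; apply/orP; left; apply/eqP; ring.
- by apply: halfp_lt1; rewrite subr_gt0.
- by rewrite !mulr_ge0// powR_ge0.
Qed.

Section test_function.
Variables (p q eps M : R).
Hypothesis bp : b < p.
Hypothesis q0 : 0 <= q.
Hypothesis qb : q < b.
Hypothesis eps0 : 0 < eps.
Hypothesis M0 : 0 < M.

Definition small_const := c * 2 `^ b / (1 - 2 `^ (- (p - b))).
Definition large_const := c * 2 `^ q / (1 - 2 `^ (- (b - q))).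

Lemma integral_dominated (g : R -> R) (A1 A2 A3 : R) : measurable_fun setT g ->
  0 <= A1 -> 0 <= A2 -> 0 <= A3 ->
  (forall y, 0 < y -> `|g y| <= A1 * (y `^ p * \1_[set z | z <= eps] y) +
     A2 * (y `^ q * \1_[set z | M <= z] y) + A3 * \1_[set z | eps <= z] y) ->
  (\int[mu]_(x in [set x | (0 < Y x)%R]) `|(g (Y x) * w x)%:E| <=
   (A1 * (small_const * eps `^ (p - b)) + A2 * (large_const * M `^ (q - b)) +
    A3 * (c * eps `^ (- b)))%:E)%E.
Proof.
move=> mg A10 A20 A30 gle.
have mD : measurable [set x | 0 < Y x] by exact: measurable_gtY.
have mle : measurable [set x | 0 < Y x <= eps].
  rewrite (_ : [set _ | _] = Y @^-1` `]0, eps]).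
    by rewrite -[X in measurable X]setTI; apply: mY.
  by apply/seteqP; split=> x /=; rewrite in_itv/=.
have mge s : measurable [set x | s <= Y x] by exact: measurable_geY.
pose h1 x := (Y x `^ p * w x) * \1_[set x | 0 < Y x <= eps] x.
pose h2 x := (Y x `^ q * w x) * \1_[set x | M <= Y x] x.
pose h3 x := w x * \1_[set x | eps <= Y x] x.
have mpow r : measurable_fun setT (fun x => Y x `^ r).
  exact: (measurableT_comp (measurable_powR _) mY).
have m1 : measurable_fun setT h1 by do 2 apply: measurable_funM => //; exact: measurable_indic.
have m2 : measurable_fun setT h2 by do 2 apply: measurable_funM => //; exact: measurable_indic.
have m3 : measurable_fun setT h3 by apply: measurable_funM => //; exact: measurable_indic.
have h10 x : 0 <= h1 x by rewrite !mulr_ge0 ?powR_ge0// indicE.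
have h20 x : 0 <= h2 x by rewrite !mulr_ge0 ?powR_ge0// indicE.
have h30 x : 0 <= h3 x by rewrite !mulr_ge0// indicE.
have I (A : set T) (k : T -> R) : measurable A ->
    (\int[mu]_x (k x * \1_A x)%:E = \int[mu]_(x in A) (k x)%:E)%E.
  move=> mA; rewrite [in RHS]integral_mkcond; apply: eq_integral => x _.
  by rewrite patchE indicE; case: ifPn => _; rewrite ?mulr1 ?mulr0.
apply: (@le_trans _ _ (\int[mu]_x (A1%:E * (h1 x)%:E + A2%:E * (h2 x)%:E + A3%:E * (h3 x)%:E))%E).
  rewrite integral_mkcond; apply: ge0_le_integral => //.
  - by move=> x _; rewrite patchE; case: ifPn.
  - apply/(measurable_restrictT _ _).1 => //; apply: measurable_funTS.
    apply: measurableT_comp => //; apply/measurable_EFinP; apply: measurable_funM => //.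
    exact: measurableT_comp.
  - by apply: emeasurable_funD; [apply: emeasurable_funD|];
      apply: measurable_funeM; apply/measurable_EFinP.
  - move=> x _; rewrite patchE; case: ifPn => [/set_mem/= Yx|_]; last first.
      by rewrite !adde_ge0// mule_ge0 ?lee_fin.
    rewrite /= lee_fin normrM (ger0_norm (w0 x)).
    apply: le_trans (ler_wpM2r (w0 x) (gle _ Yx)) _.
    rewrite /h1 /h2 /h3 !indicE.
    have -> : (Y x \in [set z | z <= eps]) = (x \in [set x0 | 0 < Y x0 <= eps]).
      by apply/idP/idP; rewrite !inE/= Yx.
    have -> : (Y x \in [set z | M <= z]) = (x \in [set x0 | M <= Y x0]).
      by apply/idP/idP; rewrite !inE/=.
    have -> : (Y x \in [set z | eps <= z]) = (x \in [set x0 | eps <= Y x0]).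
      by apply/idP/idP; rewrite !inE/=.
    by rewrite le_eqVlt; apply/orP; left; apply/eqP; ring.
rewrite ge0_integralD//; first last.
- by apply: measurable_funeM; apply/measurable_EFinP.
- by move=> x _; rewrite mule_ge0 ?lee_fin.
- by apply: emeasurable_funD; apply: measurable_funeM; apply/measurable_EFinP.
- by move=> x _; rewrite adde_ge0// mule_ge0 ?lee_fin.
rewrite ge0_integralD//; first last.
- by apply: measurable_funeM; apply/measurable_EFinP.
- by move=> x _; rewrite mule_ge0 ?lee_fin.
- by apply: measurable_funeM; apply/measurable_EFinP.
- by move=> x _; rewrite mule_ge0 ?lee_fin.
rewrite !ge0_integralZl ?lee_fin//;
  try (by apply/measurable_EFinP); try (by move=> x _; rewrite lee_fin).
rewrite !EFinD !EFinM; apply: leeD; first apply: leeD.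
- by apply: lee_wpmul2l; rewrite ?lee_fin// I//; exact: small_moment.
- by apply: lee_wpmul2l; rewrite ?lee_fin// I//; exact: large_moment.
- by apply: lee_wpmul2l; rewrite ?lee_fin// I//; exact: tail_le.
Qed.

Lemma integrable_dominated (g : R -> R) (A1 A2 A3 : R) : measurable_fun setT g ->
  0 <= A1 -> 0 <= A2 -> 0 <= A3 ->
  (forall y, 0 < y -> `|g y| <= A1 * (y `^ p * \1_[set z | z <= eps] y) +
     A2 * (y `^ q * \1_[set z | M <= z] y) + A3 * \1_[set z | eps <= z] y) ->
  mu.-integrable [set x | 0 < Y x] (fun x => (g (Y x) * w x)%:E) /\
  (`| (\int[mu]_(x in [set x | (0 < Y x)%R]) (g (Y x) * w x))%R | <=
   A1 * (small_const * eps `^ (p - b)) + A2 * (large_const * M `^ (q - b)) +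
    A3 * (c * eps `^ (- b))).
Proof.
move=> mg A10 A20 A30 gle; have H := integral_dominated mg A10 A20 A30 gle.
have mD : measurable [set x | 0 < Y x] by exact: measurable_gtY.
have ig : mu.-integrable [set x | 0 < Y x] (fun x => (g (Y x) * w x)%:E).
  apply/integrableP; split; last by apply: le_lt_trans H _; rewrite ltry.
  apply: measurable_funTS; apply/measurable_EFinP; apply: measurable_funM => //.
  exact: measurableT_comp.
split=> //; rewrite -lee_fin EFin_normr_Rintegral//; apply: le_trans H.
apply: le_abse_integral => //; exact: (measurable_int mu).
Qed.

Section steps.
Variables (f : R -> R) (B Lam : R) (n : nat).
Hypothesis mf : measurable_fun setT f.
Hypothesis B0 : 0 <= B.
Hypothesis Lam0 : 0 <= Lam.
Hypothesis fp : forall y, 0 < y -> `|f y| <= B * y `^ p.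
Hypothesis fq : forall y, 0 < y -> `|f y| <= B * y `^ q.
Hypothesis fLip : forall x y, 0 < x -> 0 < y -> `|f x - f y| <= Lam * `|x - y|.
Hypothesis epsM : eps < M.
Hypothesis n0 : (0 < n)%N.

Definition step_point (i : nat) : R := eps + (M - eps) / n%:R * i%:R.

(** The integral of a staircase approximation of [f], written with the tail function [G] alone. Only
    finitely many positive levels occur, so pointwise convergence of tails is enough to pass to the
    limit. *)
Definition step_sum (G : R -> R) :=
  \sum_(i < n) f (step_point i) * (G (step_point i) - G (step_point i.+1)).

(** One term for each region: the [p]-th moment below [eps], the [q]-th moment above [M], and in
    between the mesh times the Lipschitz constant times the mass of [eps <= Y]. *)
Definition step_error := B * (small_const * eps `^ (p - b)) +
  B * (large_const * M `^ (q - b)) + Lam * ((M - eps) / n%:R) * (c * eps `^ (- b)).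

Let del0 : 0 < (M - eps) / n%:R.
Proof. by rewrite divr_gt0 ?subr_gt0 ?ltr0n. Qed.

Lemma step_point_gt0 i : 0 < step_point i.
Proof. by rewrite ltr_wpDr// mulr_ge0// ltW. Qed.

Lemma step_point_mono i j : (i <= j)%N -> step_point i <= step_point j.
Proof. by move=> ij; rewrite lerD2l ler_wpM2l ?(ltW del0)// ler_nat. Qed.

Definition step_fun (y : R) :=
  \sum_(i < n) f (step_point i) *
    (\1_[set z | step_point i <= z] y - \1_[set z | step_point i.+1 <= z] y).

Lemma step_fun_out y : y < eps \/ M <= y -> step_fun y = 0.
Proof.
move=> yo; apply: big1 => i _; rewrite !indicE.
have -> : (y \in [set z | step_point i <= z]) = (y \in [set z | step_point i.+1 <= z]).
  case: yo => yo.
    have H j : (y \in [set z | step_point j <= z]) = false.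
      apply/negbTE; rewrite notin_setE/=; apply/negP; rewrite -ltNge.
      by apply: lt_le_trans yo _; rewrite lerDl mulr_ge0// ltW.
    by rewrite !H.
  have H j : (j <= n)%N -> (y \in [set z | step_point j <= z]) = true.
    move=> jn; apply/mem_set => /=; apply: le_trans yo.
    apply: (le_trans (step_point_mono jn)).
    by rewrite /step_point divfK ?gt_eqF ?ltr0n// addrC subrK.
  by rewrite !H ?(ltnW (ltn_ord i)).
by rewrite subrr mulr0.
Qed.

Lemma step_fun_in y : eps <= y -> y < M ->
  `|f y - step_fun y| <= Lam * ((M - eps) / n%:R).
Proof.
move=> y1 y2; have y0 : 0 < y by exact: lt_le_trans y1.
have z0 : 0 <= (y - eps) / ((M - eps) / n%:R) by rewrite divr_ge0 ?subr_ge0// ltW.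
have /andP[k1 k2] := truncn_itv z0; set k := Num.truncn _ in k1 k2.
rewrite ler_pdivlMr// in k1; rewrite ltr_pdivrMr// in k2.
have sk : step_point k <= y by rewrite /step_point mulrC; lra.
have sk1 : y < step_point k.+1 by rewrite /step_point mulrC; lra.
have kn : (k < n)%N.
  rewrite ltnNge; apply/negP => nk.
  have := le_trans (step_point_mono nk) sk.
  rewrite /step_point divfK ?gt_eqF ?ltr0n// addrC subrK.
  by rewrite leNgt y2.
have -> : step_fun y = f (step_point k).
  rewrite /step_fun (bigD1 (Ordinal kn))//= big1 ?addr0.
    rewrite !indicE (_ : _ \in _); last by rewrite inE.
    rewrite (_ : _ \in _ = false) ?subr0 ?mulr1//.
    by apply/negbTE; rewrite notin_setE/=; apply/negP; rewrite -ltNge.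
  move=> i ik; rewrite !indicE.
  have ik' : i != k :> nat by apply: contra_neq ik => e; apply: val_inj.
  case: (ltngtP i k) ik' => // [ik'|ki] _.
    have H j : (j <= k)%N -> (y \in [set z | step_point j <= z]) = true.
      by move=> jk; apply/mem_set => /=; apply: le_trans sk; exact: step_point_mono.
    by rewrite !H ?subrr ?mulr0// ltnW.
  have H j : (k < j)%N -> (y \in [set z | step_point j <= z]) = false.
    move=> kj; apply/negbTE; rewrite notin_setE/=; apply/negP; rewrite -ltNge.
    exact: lt_le_trans sk1 (step_point_mono kj).
  by rewrite !H ?subrr ?mulr0// ltnW.
apply: (le_trans (fLip y0 (step_point_gt0 k))); apply: ler_wpM2l => //.
rewrite ger0_norm ?subr_ge0// lerBlDr; apply: (le_trans (ltW sk1)).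
by rewrite /step_point -natr1 mulrDr mulr1; lra.
Qed.

Let lam0 : 0 <= Lam * ((M - eps) / n%:R).
Proof. by rewrite mulr_ge0// ltW. Qed.

Lemma measurable_step_fun : measurable_fun setT step_fun.
Proof.
have mI i : measurable [set z : R | step_point i <= z].
  rewrite (_ : [set z | _] = `[step_point i, +oo[%classic) //.
  by apply/seteqP; split=> z /=; rewrite in_itv/= andbT.
apply: measurable_sum => i; apply: measurable_funM => //.
by apply: measurable_funB; exact: measurable_indic.
Qed.

Lemma integrable_test :
  mu.-integrable [set x | 0 < Y x] (fun x => (f (Y x) * w x)%:E).
Proof.
have [] := @integrable_dominated f B B (B * (M `^ p)) mf B0 B0 _ _ => //.
  by rewrite mulr_ge0// powR_ge0.
move=> y y0; have p0 : 0 <= p by exact: ltW (lt_trans b0 bp).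
have a1 : 0 <= B * (y `^ p * \1_[set z | z <= eps] y) by rewrite !mulr_ge0 ?powR_ge0 ?indicE.
have a2 : 0 <= B * (y `^ q * \1_[set z | M <= z] y) by rewrite !mulr_ge0 ?powR_ge0 ?indicE.
have a3 : 0 <= B * M `^ p * \1_[set z | eps <= z] y by rewrite !mulr_ge0 ?powR_ge0 ?indicE.
have [h|h] := leP y eps.
  apply: le_trans (fp y0) _; rewrite {1}indicE mem_set// mulr1.
  by rewrite -addrA lerDl addr_ge0.
have [h'|h'] := leP M y.
  apply: le_trans (fq y0) _; rewrite [X in B * (y `^ q * X)]indicE mem_set// mulr1.
  by rewrite addrAC lerDr addr_ge0.
apply: le_trans (fp y0) _; rewrite [X in B * M `^ p * X]indicE mem_set/=; last exact: ltW.
rewrite mulr1; apply: (@le_trans _ _ (B * M `^ p)); last by rewrite lerDr addr_ge0.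
by apply: ler_wpM2l => //; apply: ge0_ler_powR; rewrite ?nnegrE// ltW.
Qed.

(** The staircase vanishes below [eps] and from [M] on, where [f] is controlled by its powers [p]
    and [q]; in between it differs from [f] by at most [Lam] times the mesh. So the difference is
    dominated in the sense of [integrable_dominated]. *)
Lemma step_approx :
  `| (\int[mu]_(x in [set x | (0 < Y x)%R]) (f (Y x) * w x))%R
     - step_sum (fun s => fine (wtail s)) | <= step_error.
Proof.
have mD : measurable [set x | 0 < Y x] by exact: measurable_gtY.
have diff y : 0 < y -> `|f y - step_fun y| <= B * (y `^ p * \1_[set z | z <= eps] y) +
     B * (y `^ q * \1_[set z | M <= z] y) +
     Lam * ((M - eps) / n%:R) * \1_[set z | eps <= z] y.
  move=> y0.
  have a1 : 0 <= B * (y `^ p * \1_[set z | z <= eps] y) by rewrite !mulr_ge0 ?powR_ge0 ?indicE.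
  have a2 : 0 <= B * (y `^ q * \1_[set z | M <= z] y) by rewrite !mulr_ge0 ?powR_ge0 ?indicE.
  have a3 : 0 <= Lam * ((M - eps) / n%:R) * \1_[set z | eps <= z] y.
    by rewrite mulr_ge0 ?indicE.
  have [h|h] := ltP y eps.
    rewrite (step_fun_out (or_introl h)) subr0.
    apply: le_trans (fp y0) _; rewrite {1}indicE mem_set ?mulr1; last exact: ltW.
    by rewrite -addrA lerDl addr_ge0.
  have [h'|h'] := leP M y.
    rewrite (step_fun_out (or_intror h')) subr0.
    apply: le_trans (fq y0) _; rewrite [X in B * (y `^ q * X)]indicE mem_set// mulr1.
    by rewrite addrAC lerDr addr_ge0.
  apply: le_trans (step_fun_in h h') _; rewrite [X in _ + _ * X]indicE mem_set//= mulr1.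
  by rewrite lerDr addr_ge0.
have mh := measurable_step_fun.
have [i1 h1] := integrable_dominated (measurable_funB mf mh) B0 B0 lam0 diff.
have i2 := integrable_test.
have iT i : mu.-integrable [set x | 0 < Y x]
    (EFin \o (fun x => \1_[set z | step_point i <= z] (Y x) * w x)).
  have [] := @integrable_dominated (\1_[set z | step_point i <= z])
    ((step_point i) `^ (- p)) ((step_point i) `^ (- p) * M `^ (p - q) + M `^ (- q)) 1 _ _ _ _ _ => //.
  - apply: measurable_indic; rewrite (_ : [set z | _] = `[step_point i, +oo[%classic) //.
    by apply/seteqP; split=> z /=; rewrite in_itv/= andbT.
  - by rewrite powR_ge0.
  - by rewrite addr_ge0 ?mulr_ge0 ?powR_ge0.
  - move=> y y0.
    have a1 : 0 <= (step_point i) `^ (- p) * (y `^ p * \1_[set z | z <= eps] y).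
      by rewrite !mulr_ge0 ?powR_ge0 ?indicE.
    have a2 : 0 <= ((step_point i) `^ (- p) * M `^ (p - q) + M `^ (- q)) *
        (y `^ q * \1_[set z | M <= z] y).
      by rewrite mulr_ge0 ?addr_ge0 ?mulr_ge0 ?powR_ge0 ?indicE.
    rewrite ger0_norm; last by rewrite indicE.
    have [h|h] := leP eps y.
      rewrite [X in 1 * X]indicE mem_set// mulr1.
      apply: (@le_trans _ _ 1); last by rewrite lerDr addr_ge0.
      by rewrite indicE; case: (_ \in _).
    rewrite indicE (_ : _ \in _ = false) ?addr_ge0 ?indicE//.
    apply/negbTE; rewrite notin_setE/=; apply/negP; rewrite -ltNge.
    by apply: lt_le_trans h _; rewrite lerDl mulr_ge0// ltW.
have IT i : (\int[mu]_(x in [set x | (0 < Y x)%R]) (\1_[set z | step_point i <= z] (Y x) * w x))%R =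
    fine (wtail (step_point i)).
  rewrite /Rintegral /wtail [in RHS]integral_mkcond [in LHS]integral_mkcond; congr fine.
  apply: eq_integral => x _; rewrite !patchE indicE.
  have [h|h] := boolP (x \in [set x0 | step_point i <= Y x0]).
    have sY : step_point i <= Y x by exact: (set_mem h).
    rewrite (mem_set (_ : [set x0 | 0 < Y x0] x)) /=; last exact: lt_le_trans (step_point_gt0 i) sY.
    by rewrite mem_set// mul1r.
  rewrite (_ : (Y x \in _) = false); last by apply/negbTE; move: h; apply: contra; rewrite !inE.
  by case: ifPn => // _; rewrite mul0r.
rewrite (_ : step_sum _ = (\int[mu]_(x in [set x | (0 < Y x)%R]) (step_fun (Y x) * w x))%R); last first.
  rewrite /step_sum /step_fun.
  have iS m : (m <= n)%N -> mu.-integrable [set x | 0 < Y x] (EFin \o (fun x => (\sum_(i < m) f (step_point i) *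
     (\1_[set z | step_point i <= z] (Y x) - \1_[set z | step_point i.+1 <= z] (Y x))) * w x)) /\
     \sum_(i < m) f (step_point i) * (fine (wtail (step_point i)) - fine (wtail (step_point i.+1))) =
     (\int[mu]_(x in [set x | (0 < Y x)%R]) ((\sum_(i < m) f (step_point i) *
     (\1_[set z | step_point i <= z] (Y x) - \1_[set z | step_point i.+1 <= z] (Y x))) * w x))%R.
    elim: m => [_|m IH mn].
      under [X in mu.-integrable _ (EFin \o X)]eq_fun do rewrite big_ord0 mul0r.
      split; first exact: integrable0.
      under [RHS]eq_Rintegral do rewrite big_ord0 mul0r.
      by rewrite big_ord0 /Rintegral integral0.
    have [IH1 IH2] := IH (ltnW mn).
    have iB : mu.-integrable [set x | 0 < Y x] (EFin \o (fun x => f (step_point m) *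
        (\1_[set z | step_point m <= z] (Y x) * w x - \1_[set z | step_point m.+1 <= z] (Y x) * w x))).
      exact: (integrableZl mD (f (step_point m)) (integrableB mD (iT m) (iT m.+1))).
    have EE x : (\sum_(i < m.+1) f (step_point i) *
     (\1_[set z | step_point i <= z] (Y x) - \1_[set z | step_point i.+1 <= z] (Y x))) * w x =
     (\sum_(i < m) f (step_point i) *
     (\1_[set z | step_point i <= z] (Y x) - \1_[set z | step_point i.+1 <= z] (Y x))) * w x +
     f (step_point m) *
        (\1_[set z | step_point m <= z] (Y x) * w x - \1_[set z | step_point m.+1 <= z] (Y x) * w x).
      by rewrite big_ord_recr/= mulrDl; congr (_ + _); ring.
    split.
      under [X in mu.-integrable _ (EFin \o X)]eq_fun do rewrite EE.
      exact: (integrableD mD IH1 iB).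
    under [RHS]eq_Rintegral do rewrite EE.
    rewrite big_ord_recr/= IH2 RintegralD// RintegralZl//; last first.
      exact: (integrableB mD (iT m) (iT m.+1)).
    by rewrite RintegralB// !IT.
  by have [_] := iS n (leqnn n).
rewrite -RintegralB//.
  move: h1; congr (`| _ | <= _).
  by apply: eq_Rintegral => x _; rewrite mulrBl.
have -> : (EFin \o (fun x => step_fun (Y x) * w x)) =
  (fun x => (f (Y x) * w x)%:E - ((f \- step_fun) (Y x) * w x)%:E)%E.
  by apply/funext => x /=; rewrite -EFinB; congr EFin; ring.
exact: (integrableB mD i2 i1).
Qed.

End steps.

End test_function.

End weighted_tails.

(** * Elementary bounds on sine and cosine *)

Section trigonometric_bounds.
Context {R : realType}.
Implicit Types x y : R.

Lemma sin_lip x y : `|sin x - sin y| <= `|x - y|.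
Proof.
wlog xy : x y / y <= x.
  move=> H; have [/H//|/ltW/H] := leP y x.
  by rewrite distrC (distrC y).
have [c _ ->] := MVT_segment xy (fun z _ => is_derive_sin z)
  (continuous_subspaceT (@continuous_sin R)).
by rewrite normrM ler_piMl// ler_norml cos_geN1 cos_le1.
Qed.

Lemma cos_lip x y : `|cos x - cos y| <= `|x - y|.
Proof.
wlog xy : x y / y <= x.
  move=> H; have [/H//|/ltW/H] := leP y x.
  by rewrite distrC (distrC y).
have [c _ ->] := MVT_segment xy (fun z _ => is_derive_cos z)
  (continuous_subspaceT (@continuous_cos R)).
by rewrite normrM ler_piMl// normrN ler_norml sin_geN1 sin_le1.
Qed.

Lemma norm_sin_le x : `|sin x| <= `|x|.
Proof. by have := sin_lip x 0; rewrite sin0 !subr0. Qed.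

Lemma norm_sin_le1 x : `|sin x| <= 1.
Proof. by rewrite ler_norml sin_geN1 sin_le1. Qed.

Lemma norm_cos_le1 x : `|cos x| <= 1.
Proof. by rewrite ler_norml cos_geN1 cos_le1. Qed.

Lemma cosB1_le x : `|cos x - 1| <= `|x|.
Proof. by have := cos_lip x 0; rewrite cos0 subr0. Qed.

Lemma cosB1_le_sqr x : `|cos x - 1| <= x ^+ 2.
Proof.
wlog x0 : x / 0 <= x.
  move=> H; have [/H//|/ltW xlt] := leP 0 x.
  by rewrite -cosN -sqrrN; apply: H; rewrite oppr_ge0.
have [c] := MVT_segment x0 (fun z _ => is_derive_cos z)
  (continuous_subspaceT (@continuous_cos R)).
rewrite in_itv/= cos0 subr0 => /andP[c0 cx] ->.
rewrite normrM normrN (ger0_norm x0) expr2 ler_wpM2r//.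
by rewrite (le_trans (norm_sin_le c))// ger0_norm.
Qed.

Lemma sinB_le_sqr x : `|sin x - x| <= x ^+ 2.
Proof.
wlog x0 : x / 0 <= x.
  move=> H; have [/H//|/ltW xlt] := leP 0 x.
  have := H (- x); rewrite oppr_ge0 sinN sqrrN opprK => /(_ xlt).
  by rewrite -normrN opprD !opprK.
have D (z : R) : is_derive z 1 (fun z : R => sin z - z) (cos z - 1 : R).
  by apply: is_deriveB.
have cD : {within `[0, x], continuous (fun z : R => sin z - z)}.
  apply: continuous_subspaceT => z; apply: cvgB; [exact: continuous_sin|exact: cvg_id].
have [c] := MVT_segment x0 (fun z _ => D z) cD.
rewrite in_itv/= sin0 !subr0 => /andP[c0 cx] ->.
rewrite normrM (ger0_norm x0) expr2 ler_wpM2r//.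
by rewrite (le_trans (cosB1_le c))// ger0_norm.
Qed.

End trigonometric_bounds.

Lemma powR_small {R : realType} (A r e : R) : 0 <= A -> 0 < r -> 0 < e ->
  exists2 x : R, 0 < x < 1 & A * x `^ r <= e.
Proof.
move=> A0 r0 e0.
have := @powR_cvg0 R r r0; move=> /cvgrPdist_le/(_ (e / (A + 1))).
rewrite divr_gt0 ?ltr_wpDl// => /(_ isT) H.
have : \forall x \near (0 : R)^'+, [/\ 0 < x, x < 1 & `|0 - x `^ r| <= e / (A + 1)].
  by near=> x; split; near: x => //; [exact: nbhs_right_gt|exact: nbhs_right_lt].
move=> /filter_ex[x [x0 x1]]; rewrite sub0r normrN ger0_norm ?powR_ge0// => h.
exists x; first by rewrite x0.
apply: (@le_trans _ _ (A * (e / (A + 1)))); first exact: ler_wpM2l.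
rewrite mulrA ler_pdivrMr ?ltr_wpDl// mulrC ler_wpM2l ?(ltW e0)//.
by rewrite lerDl.
Unshelve. all: by end_near. Qed.

Lemma powRN_cvg0 {R : realType} (r : R) : 0 < r -> x `^ (- r) @[x --> +oo%R] --> (0 : R).
Proof.
move=> r0; apply/cvgrPdist_le => e e0.
have [y /andP[y0 _]] := powR_small ler01 r0 e0; rewrite mul1r => ye.
near=> x; have x0 : 0 < x by near: x; exact: nbhs_pinfty_gt.
rewrite sub0r normrN ger0_norm ?powR_ge0//; apply: le_trans ye.
have -> : y `^ r = y^-1 `^ (- r).
  by rewrite -(powR_inv1 (ltW y0)) -powRrM mulN1r opprK.
rewrite !powRN lef_pV2 ?posrE ?powR_gt0 ?invr_gt0//.
apply: ge0_ler_powR; rewrite ?nnegrE ?invr_ge0 ?ltW//.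
by near: x; apply: nbhs_pinfty_gt; exact: num_real.
Unshelve. all: by end_near. Qed.

Section step_error_small.
Context {R : realType}.
Variables (c b p q B Lam : R).
Hypothesis c0 : 0 <= c.
Hypothesis bp : b < p.
Hypothesis q0 : 0 <= q.
Hypothesis qb : q < b.
Hypothesis B0 : 0 <= B.
Hypothesis Lam0 : 0 <= Lam.

(** The order of choice matters: [eps] and [M] make the two moment terms small, and only then is the
    number of steps taken large enough to beat the mass [c * eps^(-b)], which may be huge. *)
Lemma step_error_small e : 0 < e -> exists eps M : R, exists n : nat,
  [/\ 0 < eps < M, (0 < n)%N & step_error c b p q eps M B Lam n <= e].
Proof.
move=> e0; have e3 : 0 < e / 3 by rewrite divr_gt0.
have half r : 0 < r -> 0 <= 1 - (2 : R) `^ (- r).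
  by move=> /halfp_lt1 /andP[_ /ltW]; rewrite subr_ge0.
have sc0 : 0 <= small_const c b p.
  by rewrite /small_const !mulr_ge0 ?powR_ge0// invr_ge0 half// subr_gt0.
have lc0 : 0 <= large_const c b q.
  by rewrite /large_const !mulr_ge0 ?powR_ge0// invr_ge0 half// subr_gt0.
have pb : 0 < p - b by rewrite subr_gt0.
have bq : 0 < b - q by rewrite subr_gt0.
have [eps /andP[eps0 eps1] heps] := powR_small (mulr_ge0 B0 sc0) pb e3.
have [x /andP[x0 x1] hx] := powR_small (mulr_ge0 B0 lc0) bq e3.
pose M := x^-1; have M1 : 1 < M by rewrite /M invf_gt1.
pose D := Lam * (M - eps) * (c * eps `^ (- b)).
exists eps, M, (Num.truncn (D / (e / 3))).+1; split=> //.
  by rewrite eps0/= (lt_trans eps1).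
rewrite /step_error [leRHS](_ : e = e / 3 + e / 3 + e / 3); last by lra.
apply: lerD; first apply: lerD.
- by rewrite mulrA.
- rewrite mulrA (_ : M `^ (q - b) = x `^ (b - q))//.
  rewrite /M -[x^-1](powR_inv1 (ltW x0)) -powRrM; congr powR; ring.
- have N0 : 0 < (Num.truncn (D / (e / 3))).+1%:R :> R by rewrite ltr0n.
  rewrite (_ : _ * _ * _ = D / (Num.truncn (D / (e / 3))).+1%:R); last first.
    by rewrite /D; ring.
  rewrite ler_pdivrMr// mulrC -ler_pdivrMr//; apply: ltW; exact: truncnS_gt.
Qed.

End step_error_small.

Section tail_limit.
Context {d d'} {T : measurableType d} {T' : measurableType d'} {R : realType}.
Variables (mu : {measure set T -> \bar R}) (mu' : {measure set T' -> \bar R}).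
Variables (w Y : nat -> T -> R) (w' Y' : T' -> R) (c b p q B Lam : R) (f : R -> R).
Hypothesis mw : forall N, measurable_fun setT (w N).
Hypothesis w0 : forall N x, 0 <= w N x.
Hypothesis mY : forall N, measurable_fun setT (Y N).
Hypothesis mw' : measurable_fun setT w'.
Hypothesis w'0 : forall x, 0 <= w' x.
Hypothesis mY' : measurable_fun setT Y'.
Hypothesis c0 : 0 <= c.
Hypothesis b0 : 0 < b.
Hypothesis tail_le : \forall N \near \oo,
  forall s, 0 < s -> (wtail mu (w N) (Y N) s <= (c * s `^ (- b))%:E)%E.
Hypothesis tail_le' : forall s, 0 < s -> (wtail mu' w' Y' s <= (c * s `^ (- b))%:E)%E.
Hypothesis tail_cvg : forall s, 0 < s ->
  fine (wtail mu (w N) (Y N) s) @[N --> \oo] --> fine (wtail mu' w' Y' s).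
Hypothesis bp : b < p.
Hypothesis q0 : 0 <= q.
Hypothesis qb : q < b.
Hypothesis mf : measurable_fun setT f.
Hypothesis B0 : 0 <= B.
Hypothesis Lam0 : 0 <= Lam.
Hypothesis fp : forall y, 0 < y -> `|f y| <= B * y `^ p.
Hypothesis fq : forall y, 0 < y -> `|f y| <= B * y `^ q.
Hypothesis fLip : forall x y, 0 < x -> 0 < y -> `|f x - f y| <= Lam * `|x - y|.

(** Both integrals are within the same [step_error] of their step sums, uniformly in [N], and the
    step sums converge because the tails do. *)
Lemma tail_limit :
  (\int[mu]_(x in [set x | (0 < Y N x)%R]) (f (Y N x) * w N x))%R @[N --> \oo] -->
  (\int[mu']_(x in [set x | (0 < Y' x)%R]) (f (Y' x) * w' x))%R.
Proof.
apply/cvgrPdist_le => e e0; have e3 : 0 < e / 3 by rewrite divr_gt0.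
have [eps [M [n [/andP[eps0 epsM] n0 hs]]]] :=
  step_error_small Lam c0 bp qb B0 e3.
have M0 : 0 < M by exact: lt_trans epsM.
have S' := step_approx mw' w'0 mY' c0 b0 tail_le' bp q0 qb eps0 M0 mf B0 Lam0 fp fq fLip epsM n0.
have Scvg : step_sum eps M f n (fun s => fine (wtail mu (w N) (Y N) s)) @[N --> \oo] -->
    step_sum eps M f n (fun s => fine (wtail mu' w' Y' s)).
  rewrite /step_sum; apply: cvg_big => [|i _]; first exact: add_continuous.
  apply: cvgM; first exact: cvg_cst.
  by apply: cvgB; apply: tail_cvg; exact: step_point_gt0.
move: Scvg => /cvgrPdist_le/(_ _ e3) Scvg.
near=> N.
have tl : forall s, 0 < s -> (wtail mu (w N) (Y N) s <= (c * s `^ (- b))%:E)%E.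
  by near: N.
have SN := step_approx (mw N) (w0 N) (mY N) c0 b0 tl bp q0 qb eps0 M0 mf B0 Lam0 fp fq fLip epsM n0.
have SS : `|step_sum eps M f n (fun s => fine (wtail mu' w' Y' s)) -
   step_sum eps M f n (fun s => fine (wtail mu (w N) (Y N) s))| <= e / 3 by near: N.
move: S' SN SS.
set I' := Rintegral _ _ _; set IN := Rintegral _ _ _.
set s' := step_sum _ _ _ _ _; set sN := step_sum _ _ _ _ _ => S' SN SS.
rewrite (_ : I' - IN = (I' - s') + (s' - sN) - (IN - sN)); last by ring.
rewrite (_ : e = e / 3 + e / 3 + e / 3); last by lra.
apply: le_trans (ler_normB _ _) _; apply: lerD; last exact: le_trans SN hs.
by apply: le_trans (ler_normD _ _) _; apply: lerD => //; exact: le_trans S' hs.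
Unshelve. all: by end_near. Qed.

End tail_limit.

Lemma powR_continuous_pos {R : realType} (r x : R) : 0 < x ->
  {for x, continuous (fun y : R => y `^ r)}.
Proof.
move=> x0; apply: differentiable_continuous; apply/derivable1_diffP.
by apply: derivable_powR; rewrite in_itv/= andbT.
Qed.

(** * Tails of the Levy measures and of the rescaled variable *)

Section levy_tails.
Context {R : realType}.
Variables (b cp cm : R).
Hypothesis b0 : 0 < b.
Hypothesis cp0 : 0 <= cp.
Hypothesis cm0 : 0 <= cm.

Lemma levy_density_ge0 x : 0 <= levy_density b cp cm x.
Proof.
by rewrite /levy_density mulr_ge0 ?powR_ge0// mulr_ge0 ?(ltW b0)//; case: ifPn.
Qed.

Lemma measurable_levy_density : measurable_fun setT (levy_density b cp cm).
Proof.
apply: measurable_funM; last first.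
  apply: (measurableT_comp (measurable_powR _)).
  exact: normr_measurable.
apply: measurable_funM => //; apply: measurable_fun_ifT => //.
by apply: (measurable_fun_ltr (measurable_cst _)).
Qed.

(** The function [- cp * x^(-b)] is a primitive of the density on the positive half-line and
    vanishes at infinity. *)
Lemma levy_tail_pos s : 0 < s ->
  wtail lebesgue_measure (levy_density b cp cm) id s = (cp * s `^ (- b))%:E.
Proof.
move=> s0; rewrite /wtail.
have -> : [set x : R | s <= x] = `[s, +oo[%classic.
  by apply/seteqP; split=> x /=; rewrite in_itv/= andbT.
pose F (x : R) := - cp * x `^ (- b).
rewrite (@ge0_continuous_FTC2y R _ F s 0); last 6 first.
- by move=> x _; exact: levy_density_ge0.
- apply: (@subspace_eq_continuous _ _ _ (fun x : R => b * cp * x `^ (- 1 - b))).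
    move=> x; rewrite inE/= in_itv/= andbT => sx.
    have x0 : 0 < x by exact: lt_le_trans sx.
    by rewrite /from_subspace/= /levy_density x0 ger0_norm// ltW.
  apply: continuous_in_subspaceT => x; rewrite inE/= in_itv/= andbT => sx.
  apply: cvgM; first exact: cvg_cst.
  by apply: powR_continuous_pos; exact: lt_le_trans sx.
- rewrite /F (_ : 0 = - cp * 0); last by rewrite mulr0.
  apply: cvgM; first exact: cvg_cst.
  exact: powRN_cvg0.
- move=> x sx; apply: derivableM => //; apply: derivable_powR.
  by rewrite in_itv/= andbT (lt_trans s0).
- apply: cvgM; first exact: cvg_cst.
  by apply: cvg_at_right_filter; exact: powR_continuous_pos.
- move=> x; rewrite in_itv/= andbT => sx; have x0 : 0 < x by exact: lt_trans sx.
  rewrite derive1E /F deriveM//; last first.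
    by apply: derivable_powR; rewrite in_itv/= andbT.
  rewrite derive_cst scaler0 addr0 -derive1E powR_derive1; last first.
    by rewrite in_itv/= andbT.
  rewrite /levy_density x0 ger0_norm ?(ltW x0)// /GRing.scale/=.
  by rewrite (_ : - 1 - b = - b - 1); ring.
by rewrite -EFinD /F; congr EFin; ring.
Qed.

End levy_tails.

Lemma levy_densityN {R : realType} (b cp cm x : R) : x != 0 ->
  levy_density b cp cm (- x) = levy_density b cm cp x.
Proof.
move=> x0; rewrite /levy_density normrN oppr_gt0.
by case: ltgtP x0 => // ->; rewrite eqxx.
Qed.

(** Reflection about 0 exchanges [cp] and [cm] and reduces the claim to the positive half-line. *)
Lemma levy_tail_neg {R : realType} (b cp cm s : R) : 0 < b -> 0 <= cp -> 0 <= cm -> 0 < s ->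
  wtail lebesgue_measure (levy_density b cp cm) -%R s = (cm * s `^ (- b))%:E.
Proof.
move=> b0 cp0 cm0 s0; rewrite -(levy_tail_pos b0 cm0 cp0 s0) /wtail.
have -> : [set x : R | s <= x] = `[s, +oo[%classic.
  by apply/seteqP; split=> x /=; rewrite in_itv/= andbT.
have -> : [set x : R | s <= - x] = `]-oo, - s]%classic.
  by apply/seteqP; split=> x /=; rewrite in_itv/= lerNr.
rewrite ge0_integration_by_substitutionNy.
- apply: eq_integral => x; rewrite inE/= in_itv/= andbT => sx.
  by rewrite levy_densityN// gt_eqF// (lt_le_trans s0).
- apply: (@subspace_eq_continuous _ _ _ (fun x : R => b * cm * (- x) `^ (- 1 - b))).
    move=> x; rewrite inE/= in_itv/= => sx.
    have x0 : x < 0 by rewrite (le_lt_trans sx)// oppr_lt0.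
    by rewrite /from_subspace/= /levy_density ltNge (ltW x0)/= ltr0_norm.
  apply: continuous_in_subspaceT => x; rewrite inE/= in_itv/= => sx.
  apply: cvgM; first exact: cvg_cst.
  apply: (@continuous_comp _ _ _ -%R (fun x : R => x `^ (- 1 - b))).
    exact: opp_continuous.
  by apply: powR_continuous_pos; rewrite oppr_gt0 (le_lt_trans sx)// oppr_lt0.
- by move=> x _; exact: levy_density_ge0.
Qed.

Lemma powR_pinfty {R : realType} (r : R) (K : nat -> R) : 0 < r ->
  K N @[N --> \oo] --> +oo%R -> K N `^ r @[N --> \oo] --> +oo%R.
Proof.
move=> r0 KN; apply/cvgryPge => A.
move: KN => /cvgryPge/(_ ((Num.max A 0) `^ (r^-1))); apply: filterS => N h.
apply: (@le_trans _ _ (Num.max A 0)); first by rewrite le_max lexx.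
have A0 : 0 <= Num.max A 0 by rewrite le_max lexx orbT.
rewrite -[leLHS](powRr1 A0) -(mulVf (lt0r_neq0 r0)) powRrM.
apply: ge0_ler_powR; rewrite ?nnegrE ?powR_ge0 ?(ltW r0)//.
exact: le_trans (powR_ge0 _ _) h.
Qed.

(** The set where [Y] vanishes may carry positive mass, as when [V] is 0 with positive probability;
    the condition on [h] removes its contribution. *)
Lemma Rintegral_split_sign {d} {T : measurableType d} {R : realType}
    (mu : {measure set T -> \bar R}) (Y h : T -> R) : measurable_fun setT Y ->
  (forall x, Y x = 0 -> h x = 0) ->
  mu.-integrable [set x | (0 < Y x)%R] (EFin \o h) ->
  mu.-integrable [set x | (0 < - Y x)%R] (EFin \o h) ->
  mu.-integrable setT (EFin \o h) /\
  (\int[mu]_x h x)%R = (\int[mu]_(x in [set x | (0 < Y x)%R]) h x)%R +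
                       (\int[mu]_(x in [set x | (0 < - Y x)%R]) h x)%R.
Proof.
move=> mY h0 i1 i2.
have m1 : measurable [set x | 0 < Y x] by exact: measurable_gtY.
have m2 : measurable [set x | 0 < - Y x].
  by apply: (@measurable_gtY _ _ _ (fun x => - Y x)); exact: measurableT_comp.
have j1 := (integrable_mkcond _ m1).1 i1; have j2 := (integrable_mkcond _ m2).1 i2.
have E x : (EFin \o h) x = ((EFin \o h) \_ [set x | (0 < Y x)%R] x +
    (EFin \o h) \_ [set x | (0 < - Y x)%R] x)%E.
  rewrite !patchE; have [Yx|Yx|Yx] := ltgtP (Y x) 0.
  - rewrite memNset/=; last by apply/negP; rewrite -leNgt ltW.
    by rewrite mem_set ?add0e//= oppr_gt0.
  - rewrite mem_set//= memNset ?adde0//=.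
    by apply/negP; rewrite -leNgt oppr_le0 ltW.
  - rewrite !memNset/= ?Yx ?oppr0 ?ltxx//; by rewrite h0 // adde0.
have -> : EFin \o h = (fun x => (EFin \o h) \_ [set x | (0 < Y x)%R] x +
    (EFin \o h) \_ [set x | (0 < - Y x)%R] x)%E by apply/funext => x; exact: E.
split; first exact: integrableD.
rewrite /Rintegral; under [X in fine X = _]eq_integral => x _ do rewrite (E x : (h x)%:E = _).
rewrite integralD// fineD.
- by rewrite -!integral_mkcond.
- exact: integrable_fin_num.
- exact: integrable_fin_num.
Qed.

Section regular_tail.
Context {d} {T : measurableType d} {R : realType} (pi : probability T R).
Variables (W : T -> R) (b c : R).
Hypothesis mW : measurable_fun setT W.
Hypothesis b0 : 0 < b.
Hypothesis c0 : 0 <= c.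
Hypothesis hW : tail_asymptotics pi (fun lam => [set x | lam <= W x]) b c.

Let mWge s : measurable [set x | s <= W x].
Proof. exact: measurable_geY. Qed.

(** The asymptotics give the bound at large levels. At the others the probability is at most 1,
    which is at most [l1^b * lam^(-b)] as long as [lam <= l1]. *)
Lemma tail_bound : exists2 C, 0 <= C &
  forall lam, 0 < lam -> fine (pi [set x | lam <= W x]) <= C * lam `^ (- b).
Proof.
have := hW; move=> /cvgrPdist_le/(_ _ ltr01)[l0 [_ H]].
pose l1 := Num.max l0 1 + 1.
have l10 : 0 < l1 by rewrite /l1 ltr_wpDl// le_max ler01 orbT.
exists (Num.max (c + 1) (l1 `^ b)); first by rewrite le_max addr_ge0.
move=> lam lam0; rewrite powRN ler_pdivlMr ?powR_gt0//.
have [h|h] := leP lam l1; rewrite le_max; apply/orP; [right|left].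
  rewrite -[leRHS]mul1r; apply: ler_pM; rewrite ?fine_ge0 ?powR_ge0//.
    by rewrite -lee_fin fineK ?fin_num_measure// probability_le1.
  by apply: ge0_ler_powR => //; rewrite ?nnegrE ltW.
have := H lam; rewrite /=; have -> : l0 < lam.
  apply: lt_trans h; rewrite /l1 ltr_pwDr// le_max lexx//.
by move=> /(_ isT); rewrite ler_distlC mulrC => /andP[].
Qed.

Variable K : nat -> R.
Hypothesis K1 : forall N, 1 <= K N.
Hypothesis KN : K N @[N --> \oo] --> +oo%R.

Let K0 N : 0 < K N.
Proof. exact: lt_le_trans (K1 N). Qed.

Let L N := K N `^ b^-1.

Let L0 N : 0 < L N.
Proof. exact: powR_gt0. Qed.

Lemma scaled_wtail N s : wtail pi (fun=> K N) (fun x => W x / L N) s =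
  (K N * fine (pi [set x | s * L N <= W x]))%:E.
Proof.
rewrite /wtail (_ : [set x | s <= W x / L N] = [set x | s * L N <= W x]).
  by rewrite integral_cst// EFinM fineK// fin_num_measure.
by apply/seteqP; split=> x /=; rewrite ler_pdivlMr.
Qed.

Lemma scale_powR N : L N `^ b = K N.
Proof. by rewrite -powRrM mulVf ?gt_eqF// powRr1// ltW. Qed.

Lemma scaled_tail_bound : exists2 C, 0 <= C & forall N s, 0 < s ->
  K N * fine (pi [set x | s * L N <= W x]) <= C * s `^ (- b).
Proof.
have [C C0 H] := tail_bound; exists C => // N s s0.
have := H (s * L N); rewrite mulr_gt0// => /(_ isT) h.
apply: le_trans (ler_wpM2l (ltW (K0 N)) h) _.
rewrite powRM ?(ltW s0) ?(ltW (L0 N))// [L N `^ _]powRN scale_powR.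
by rewrite le_eqVlt; apply/orP; left; apply/eqP; field; rewrite gt_eqF.
Qed.

Lemma scaled_tail_cvg s : 0 < s ->
  K N * fine (pi [set x | s * L N <= W x]) @[N --> \oo] --> c * s `^ (- b).
Proof.
move=> s0.
have sL : s * L N @[N --> \oo] --> +oo%R.
  have := powR_pinfty (_ : 0 < b^-1) KN; rewrite invr_gt0 => /(_ b0).
  move=> LN; apply/cvgryPge => A.
  move: LN => /cvgryPge/(_ (A / s)); apply: filterS => N.
  by rewrite ler_pdivrMr// mulrC.
have H := cvgM (cvg_comp _ _ sL hW) (cvg_cst (s `^ (- b)) : _ @[N --> \oo] --> _).
apply: cvg_trans (H _ _); apply: near_eq_cvg; near=> N => /=.
rewrite powRM ?(ltW s0) ?(ltW (L0 N))// scale_powR powRN.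
by field; rewrite powR_eq0 gt_eqF.
Unshelve. all: by end_near. Qed.

(** A strict tail at [s] lies between the weak tails at [s] and at any [u > s], and [u^(-b)] is
    continuous at [s]. Strict levels are what remains at [b = 1], where the truncation keeps
    [|V| <= K]. *)
Lemma scaled_tail_open_cvg s : 0 < s ->
  K N * fine (pi [set x | s * L N < W x]) @[N --> \oo] --> c * s `^ (- b).
Proof.
move=> s0; apply/cvgrPdist_le => e e0; have e2 : 0 < e / 2 by rewrite divr_gt0.
have mgt r : measurable [set x | r < W x] by exact: measurable_gtY.
have le1 N : K N * fine (pi [set x | s * L N < W x]) <= K N * fine (pi [set x | s * L N <= W x]).
  apply: ler_wpM2l; first exact: ltW.
  apply: fine_le; rewrite ?fin_num_measure//; apply: le_measure; rewrite ?inE//.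
  by move=> x /=; exact: ltW.
have le2 u N : s < u -> K N * fine (pi [set x | u * L N <= W x]) <= K N * fine (pi [set x | s * L N < W x]).
  move=> su; apply: ler_wpM2l; first exact: ltW.
  apply: fine_le; rewrite ?fin_num_measure//; apply: le_measure; rewrite ?inE//.
  by move=> x /=; apply: lt_le_trans; rewrite ltr_pM2r.
have := cvg_at_right_filter (@powR_continuous_pos R (- b) s s0); move=> /cvgrPdist_le/(_ (e / 2 / (c + 1))).
rewrite divr_gt0 ?ltr_wpDl// => /(_ isT) H.
have : \forall u \near s^'+, `|s `^ (- b) - u `^ (- b)| <= e / 2 / (c + 1) /\ s < u.
  near=> u; split; near: u; last exact: nbhs_right_gt.
  exact: H.
move=> /(@filter_ex _ _ (at_right_proper_filter s))[u [hu su]].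
have u0 : 0 < u by exact: lt_trans su.
move: (scaled_tail_cvg u0) (scaled_tail_cvg s0) => /cvgrPdist_le/(_ _ e2) hu' /cvgrPdist_le/(_ _ e0) hs.
near=> N; have : `|c * s `^ (- b) - K N * fine (pi [set x | s * L N <= W x])| <= e by near: N.
have : `|c * u `^ (- b) - K N * fine (pi [set x | u * L N <= W x])| <= e / 2 by near: N.
have su' : c * s `^ (- b) - c * u `^ (- b) <= e / 2.
  rewrite -mulrBr; apply: (@le_trans _ _ (c * (e / 2 / (c + 1)))).
    by apply: ler_wpM2l => //; apply: le_trans hu; exact: ler_norm.
  rewrite mulrA ler_pdivrMr ?ltr_wpDl// mulrC ler_wpM2l ?(ltW e2)//.
  by rewrite lerDl.
have := le1 N; have := le2 _ N su.
move: (K N * _) (K N * _) (K N * _) => A D B.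
move: (c * s `^ _) (c * u `^ _) su' => x y h1 h2 h3.
rewrite !ler_distl => /andP[h4 h5] /andP[h6 h7]; apply/andP; split.
  by rewrite lerBlDr; apply: le_trans h3 _; rewrite -lerBlDr.
apply: (@le_trans _ _ (y + e / 2)); first by rewrite -lerBlDl.
by rewrite [leRHS](_ : _ = D + e / 2 + e / 2) ?lerD2r -?addrA -?splitr// (le_trans h5)// lerD2r.
Unshelve. all: by end_near. Qed.

Section test.
Context {d'} {T' : measurableType d'} (mu' : {measure set T' -> \bar R}).
Variables (w' Y' : T' -> R) (p q B Lam : R) (f : R -> R).
Hypothesis mw' : measurable_fun setT w'.
Hypothesis w'0 : forall x, 0 <= w' x.
Hypothesis mY' : measurable_fun setT Y'.
Hypothesis tail' : forall s, 0 < s -> wtail mu' w' Y' s = (c * s `^ (- b))%:E.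
Hypothesis bp : b < p.
Hypothesis q0 : 0 <= q.
Hypothesis qb : q < b.
Hypothesis mf : measurable_fun setT f.
Hypothesis B0 : 0 <= B.
Hypothesis Lam0 : 0 <= Lam.
Hypothesis fp : forall y, 0 < y -> `|f y| <= B * y `^ p.
Hypothesis fq : forall y, 0 < y -> `|f y| <= B * y `^ q.
Hypothesis fLip : forall x y, 0 < x -> 0 < y -> `|f x - f y| <= Lam * `|x - y|.

Let mWL N : measurable_fun setT (fun x => W x / L N).
Proof. exact: measurable_funM. Qed.

Lemma tail_integrable N :
  pi.-integrable [set x | 0 < W x / L N] (fun x => (f (W x / L N) * K N)%:E).
Proof.
have [C C0 HC] := scaled_tail_bound.
apply: (@integrable_test _ _ _ pi (fun=> K N) (fun x => W x / L N) C b _ _ _ _ _ _ p q 1 1 _ _ _ _ _ f B) => //.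
- by move=> x; exact: ltW.
- by move=> s s0; rewrite scaled_wtail lee_fin HC.
Qed.

Lemma tail_integrable' :
  mu'.-integrable [set x | 0 < Y' x] (fun x => (f (Y' x) * w' x)%:E).
Proof.
apply: (@integrable_test _ _ _ mu' w' Y' c b _ _ _ _ _ _ p q 1 1 _ _ _ _ _ f B) => //.
by move=> s s0; rewrite tail'.
Qed.

Lemma tail_integral_cvg :
  (\int[pi]_(x in [set x | (0 < W x / L N)%R]) (f (W x / L N) * K N))%R @[N --> \oo] -->
  (\int[mu']_(x in [set x | (0 < Y' x)%R]) (f (Y' x) * w' x))%R.
Proof.
have [C C0 HC] := scaled_tail_bound.
apply: (@tail_limit _ _ _ _ _ pi mu' (fun N _ => K N) (fun N x => W x / L N) w' Y' (Num.max c C) b p q B Lam f) => //.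
- by move=> N x; exact: ltW.
- by rewrite le_max c0.
- apply: nearW => N s s0; rewrite scaled_wtail lee_fin; apply: le_trans (HC N s s0) _.
  by rewrite ler_wpM2r ?powR_ge0// le_max lexx orbT.
- by move=> s s0; rewrite tail'// lee_fin ler_wpM2r ?powR_ge0// le_max lexx.
- move=> s s0; rewrite tail'//=; under eq_fun do rewrite scaled_wtail /=.
  exact: scaled_tail_cvg.
Qed.

End test.

End regular_tail.

(** * Convergence of the one-step characteristic functions to the Levy exponent *)

Lemma levy_kernel_Re {R : realType} (b xi lam : R) :
  complex.Re (levy_kernel b xi lam) = cos (xi * lam) - 1.
Proof.
rewrite /levy_kernel /cexp; case: ifP => _ /=; last case: ifP => _ /=;
by rewrite expR0 mul1r ?subr0 mulrC.
Qed.

Definition jump_compensator {R : realType} (b y : R) : R :=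
  if b < 1 then 0 else if b == 1 then y * \1_`[-1, 1] y else y.

Lemma levy_kernel_Im {R : realType} (b xi lam : R) :
  complex.Im (levy_kernel b xi lam) = sin (xi * lam) - xi * jump_compensator b lam.
Proof.
rewrite /levy_kernel /cexp /jump_compensator; case: ifP => _ /=; last case: ifP => _ /=;
by rewrite expR0 mul1r ?oppr0 ?addr0 ?subr0 ?mulr0 ?subr0 [lam * xi]mulrC ?mulrA.
Qed.

Lemma ler0n2 {R : realType} : (0 : R) <= 2.
Proof. exact: ler0n. Qed.

Section clip.
Context {R : realType}.
Implicit Types x y : R.

(** A Lipschitz substitute for the compensator [y * 1_[-1,1](y)] of the case [b = 1], which is
    discontinuous and thus no admissible test function. By [clip_split] the two differ by indicators
    of half-lines, whose integrals are tails. *)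
Definition clip y := Num.max (- 1) (Num.min y 1) : R.

Lemma clip_id y : `|y| <= 1 -> clip y = y.
Proof. by rewrite ler_norml /clip => /andP[y1 y2]; rewrite min_l// max_r. Qed.

Lemma clip_le1 y : `|clip y| <= 1.
Proof.
rewrite ler_norml /clip le_max lexx/= ge_max ge_min lexx orbT andbT.
by rewrite (le_trans _ (@ler01 R))// oppr_le0.
Qed.

Lemma clip_lip x y : `|clip x - clip y| <= `|x - y|.
Proof.
wlog xy : x y / y <= x.
  move=> H; have [/H//|/ltW/H] := leP y x.
  by rewrite distrC (distrC y).
rewrite (@ger0_norm _ (x - y)) ?subr_ge0//.
rewrite /clip /Num.max /Num.min; repeat case: ifPn; rewrite -?leNgt ler_norml => *; lra.
Qed.

Lemma clip_split y : clip y = y * \1_`[-1, 1] y +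
  (\1_[set x | 1 < x] y - \1_[set x | x < - 1] y).
Proof.
rewrite !indicE; have [y1|y1] := boolP (y \in `[-1, 1]%classic).
  move: (y1); rewrite inE/= in_itv/= => /andP[y2 y3].
  rewrite memNset/=; last by apply/negP; rewrite -leNgt.
  rewrite memNset/=; last by apply/negP; rewrite -leNgt.
  by rewrite mulr1 subrr addr0 clip_id// ler_norml y2.
rewrite mulr0 add0r; have [y2|y2] := ltP 1 y.
  rewrite mem_set// memNset/=; last by lra.
  by rewrite subr0 /clip min_r ?max_r ?(ltW y2)//; lra.
have y3 : y < - 1.
  by rewrite ltNge; apply: contra y1 => y3; rewrite inE/= in_itv/= y3.
rewrite memNset/=; last by lra.
by rewrite mem_set// sub0r /clip min_l// max_l// ltW.
Qed.

End clip.

Lemma measurable_le_norm {d} {T : measurableType d} {R : realType} (f : T -> R) (s : R) :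
  measurable_fun setT f -> measurable [set x | `|f x| <= s].
Proof.
move=> mf; rewrite (_ : [set x | _] = (fun x => `|f x|) @^-1` `]-oo, s]).
  rewrite -[X in measurable X]setTI.
  by apply: (measurableT_comp (@normr_measurable R setT) mf).
by apply/seteqP; split=> x /=; rewrite in_itv/=.
Qed.

Section two_sided_tail.
Context {d} {T : measurableType d} {R : realType} (pi : probability T R).
Variables (V : T -> R) (b cp cm : R) (K : nat -> R).
Hypothesis mV : measurable_fun setT V.
Hypothesis b0 : 0 < b.
Hypothesis b2 : b < 2.
Hypothesis cp0 : 0 <= cp.
Hypothesis cm0 : 0 <= cm.
Hypothesis tail_right : tail_asymptotics pi (fun lam => [set x | lam <= V x]) b cp.
Hypothesis tail_left : tail_asymptotics pi (fun lam => [set x | V x <= - lam]) b cm.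
Hypothesis K1 : forall N, 1 <= K N.
Hypothesis KN : K N @[N --> \oo] --> +oo%R.

Lemma tail_leftN : tail_asymptotics pi (fun lam => [set x | lam <= - V x]) b cm.
Proof.
rewrite (_ : (fun lam => [set x | lam <= - V x]) = (fun lam => [set x | V x <= - lam]))//.
by apply/funext => lam; apply/seteqP; split=> x /=; rewrite lerNr.
Qed.

Let mVN : measurable_fun setT (fun x => - V x).
Proof. exact: measurableT_comp. Qed.

Let K0 N : 0 < K N.
Proof. exact: lt_le_trans (K1 N). Qed.

Let L N := K N `^ b^-1.

Let L0 N : 0 < L N.
Proof. exact: powR_gt0. Qed.

Let mVL N : measurable_fun setT (fun x => V x / L N).
Proof. exact: measurable_funM. Qed.

Let dens := levy_density b cp cm.

Section test.
Variables (p q B Lam : R) (f : R -> R).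
Hypothesis bp : b < p.
Hypothesis q0 : 0 <= q.
Hypothesis qb : q < b.
Hypothesis mf : measurable_fun setT f.
Hypothesis B0 : 0 <= B.
Hypothesis Lam0 : 0 <= Lam.
Hypothesis f0 : f 0 = 0.
Hypothesis fp : forall y, `|f y| <= B * `|y| `^ p.
Hypothesis fq : forall y, `|f y| <= B * `|y| `^ q.
Hypothesis fLip : forall x y, `|f x - f y| <= Lam * `|x - y|.

Let g y := f (- y).

Let mg : measurable_fun setT g.
Proof. exact: measurableT_comp. Qed.

Let fp' y : 0 < y -> `|f y| <= B * y `^ p.
Proof. by move=> y0; have := fp y; rewrite (gtr0_norm y0). Qed.

Let fq' y : 0 < y -> `|f y| <= B * y `^ q.
Proof. by move=> y0; have := fq y; rewrite (gtr0_norm y0). Qed.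

Let gp y : 0 < y -> `|g y| <= B * y `^ p.
Proof. by move=> y0; have := fp (- y); rewrite normrN (gtr0_norm y0). Qed.

Let gq y : 0 < y -> `|g y| <= B * y `^ q.
Proof. by move=> y0; have := fq (- y); rewrite normrN (gtr0_norm y0). Qed.

Let gLip x y : 0 < x -> 0 < y -> `|g x - g y| <= Lam * `|x - y|.
Proof. by move=> _ _; rewrite (le_trans (fLip _ _))// -opprD normrN. Qed.

Let fLip' x y : 0 < x -> 0 < y -> `|f x - f y| <= Lam * `|x - y|.
Proof. by move=> _ _. Qed.

Let mdens : measurable_fun setT dens := measurable_levy_density b cp cm.
Let dens0 : forall x, 0 <= dens x := levy_density_ge0 b0 cp0 cm0.

Let gE x : g (- x) = f x.
Proof. by rewrite /g opprK. Qed.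

(** The positive half-line is the one-sided result for [V] and [f]; the negative one is the same
    result for [-V] and the reflected function [g]. The powers [p] and [q] on either side of [b]
    control [f] near 0 and at infinity. *)
Lemma two_sided_test :
  [/\ forall N, pi.-integrable setT (EFin \o (fun x => f (V x / L N) * K N)),
      lebesgue_measure.-integrable setT (EFin \o (fun y => f y * dens y)) &
      (\int[pi]_x (f (V x / L N) * K N))%R @[N --> \oo] -->
      (\int[lebesgue_measure]_(y in [set: R]) (f y * dens y))%R].
Proof.
have t1 s : 0 < s -> wtail lebesgue_measure dens id s = (cp * s `^ (- b))%:E.
  exact: levy_tail_pos.
have t2 s : 0 < s -> wtail lebesgue_measure dens -%R s = (cm * s `^ (- b))%:E.
  exact: levy_tail_neg.
have mN : measurable_fun [set: R] (-%R : R -> R) by exact: oppr_measurable.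
have i1 N := tail_integrable mV b0 cp0 tail_right K1 bp q0 qb mf B0 fp' fq' N.
have i2 N := tail_integrable mVN b0 cm0 tail_leftN K1 bp q0 qb mg B0 gp gq N.
have j1 : lebesgue_measure.-integrable [set x : R | 0 < x] (fun x => (f x * dens x)%:E).
  by apply: (@tail_integrable' _ b cp b0 cp0 _ _ lebesgue_measure dens id p q B f) => //; exact: measurable_levy_density.
have j2 : lebesgue_measure.-integrable [set x : R | 0 < - x] (fun x => (g (- x) * dens x)%:E).
  by apply: (@tail_integrable' _ b cm b0 cm0 _ _ lebesgue_measure dens -%R p q B g) => //; exact: measurable_levy_density.
have c1 : (\int[pi]_(x in [set x | (0 < V x / L N)%R]) (f (V x / L N) * K N))%R @[N --> \oo] -->
  (\int[lebesgue_measure]_(x in [set x : R | (0 < x)%R]) (f x * dens x))%R.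
  by apply: (@tail_integral_cvg _ _ _ pi V b cp mV b0 cp0 tail_right K K1 KN _ _ lebesgue_measure dens id p q B Lam f) => //; exact: measurable_levy_density.
have c2 : (\int[pi]_(x in [set x | (0 < - V x / L N)%R]) (g (- V x / L N) * K N))%R @[N --> \oo] -->
  (\int[lebesgue_measure]_(x in [set x : R | (0 < - x)%R]) (g (- x) * dens x))%R.
  by apply: (@tail_integral_cvg _ _ _ pi (fun x => - V x) b cm mVN b0 cm0 tail_leftN K K1 KN _ _ lebesgue_measure dens -%R p q B Lam g) => //; exact: measurable_levy_density.
have i2' N : pi.-integrable [set x | (0 < - (V x / L N))%R] (EFin \o (fun x => f (V x / L N) * K N)).
  have := i2 N; rewrite (_ : [set x | 0 < - V x / L N] = [set x | 0 < - (V x / L N)]).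
    by congr (_.-integrable _ _); apply/funext => x /=; rewrite mulNr gE.
  by apply/seteqP; split=> x /=; rewrite mulNr.
have j2' : lebesgue_measure.-integrable [set x : R | 0 < - x] (EFin \o (fun y => f y * dens y)).
  by have := j2; congr (_.-integrable _ _); apply/funext => x /=; rewrite gE.
have h0 N x : V x / L N = 0 -> f (V x / L N) * K N = 0 by move=> ->; rewrite f0 mul0r.
have S1 N := @Rintegral_split_sign _ _ _ pi _ (fun x => f (V x / L N) * K N) (mVL N) (@h0 N) (i1 N) (i2' N).
have S2 := @Rintegral_split_sign _ _ _ lebesgue_measure id (fun y : R => f y * dens y)
   (@measurable_id _ _ setT) (fun x (e : x = 0) => ltac:(by rewrite e f0 mul0r)) j1 j2'.
split.
- by move=> N; case: (S1 N).
- by case: S2.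
case: S2 => _ ->.
rewrite (_ : (fun N => _) = (fun N =>
  (\int[pi]_(x in [set x | (0 < V x / L N)%R]) (f (V x / L N) * K N))%R +
  (\int[pi]_(x in [set x | (0 < - V x / L N)%R]) (g (- V x / L N) * K N))%R)).
  apply: cvgD; first exact: c1.
  rewrite (_ : (\int[lebesgue_measure]_(x in [set x : R | (0 < - x)%R]) (f x * dens x))%R =
    (\int[lebesgue_measure]_(x in [set x : R | (0 < - x)%R]) (g (- x) * dens x))%R)//.
  by apply: eq_Rintegral => x _; rewrite gE.
apply/funext => N; case: (S1 N) => _ ->; congr (_ + _).
rewrite (_ : [set x | 0 < - V x / L N] = [set x | 0 < - (V x / L N)]).
  by apply: eq_Rintegral => x _; rewrite mulNr gE.
by apply/seteqP; split=> x /=; rewrite mulNr.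
Qed.

End test.

(** The test function [cos (xi y) - 1] is quadratic at 0 and bounded at infinity, so the powers 2
    and 0 cover every [b] in [(0,2)]. *)
Lemma levy_cos xi :
  K N * ((\int[pi]_x cos (xi * (V x / L N)))%R - 1) @[N --> \oo] -->
  complex.Re (levy_exponent b cp cm xi).
Proof.
pose f y := cos (xi * y) - 1 : R.
have mf : measurable_fun setT f.
  apply: measurable_funB => //; apply: measurableT_comp; last exact: measurable_funM.
  exact: continuous_measurable_fun (@continuous_cos R).
have B0 : 0 <= 2 + xi ^+ 2 by rewrite addr_ge0 ?sqr_ge0.
have fp y : `|f y| <= (2 + xi ^+ 2) * `|y| `^ 2.
  apply: le_trans (cosB1_le_sqr _) _; rewrite powR_mulrn// real_normK ?num_real// exprMn.
  by rewrite ler_wpM2r ?sqr_ge0// lerDr.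
have fq y : `|f y| <= (2 + xi ^+ 2) * `|y| `^ 0.
  rewrite powRr0 mulr1; apply: (@le_trans _ _ 2); last by rewrite lerDl sqr_ge0.
  by rewrite (le_trans (ler_normB _ _))// normr1 -[2]/(1 + 1) lerD2r norm_cos_le1.
have fl x y : `|f x - f y| <= `|xi| * `|x - y|.
  by rewrite /f opprB addrA subrK (le_trans (cos_lip _ _))// -mulrBr normrM.
have [i1 _] := two_sided_test b2 (lexx 0) b0 mf B0 (normr_ge0 xi)
  (ltac:(by rewrite /f mulr0 cos0 subrr)) fp fq fl.
rewrite /levy_exponent/=; under [in X in _ -> _ --> X]eq_Rintegral do rewrite levy_kernel_Re.
apply: cvg_trans; apply: near_eq_cvg; apply: nearW => N.
have bc : bdd_meas (fun x => cos (xi * (V x / L N))).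
  by apply: bdd_meas_cos; exact: measurable_funM.
have b1 : bdd_meas (fun _ : T => (1 : R)) by exact: bdd_meas_cst.
rewrite -[1](Ex_cst pi) -ExB// -ExZ; last exact: bdd_measB.
by apply: eq_Rintegral => x _; rewrite mulrC.
Qed.

(** The sine is linear at 0 and bounded at infinity: powers 1 and 0, admissible without compensation
    precisely because [b < 1]. *)
Lemma levy_sin_lt1 xi : b < 1 ->
  K N * (\int[pi]_x sin (xi * (V x / L N)))%R @[N --> \oo] -->
  complex.Im (levy_exponent b cp cm xi).
Proof.
move=> b1; pose f y := sin (xi * y) : R.
have mf : measurable_fun setT f.
  apply: measurableT_comp; last exact: measurable_funM.
  exact: continuous_measurable_fun (@continuous_sin R).
have B0 : 0 <= 1 + `|xi| by rewrite addr_ge0.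
have fp y : `|f y| <= (1 + `|xi|) * `|y| `^ 1.
  apply: le_trans (norm_sin_le _) _; rewrite powRr1// normrM.
  by rewrite ler_wpM2r// lerDr.
have fq y : `|f y| <= (1 + `|xi|) * `|y| `^ 0.
  by rewrite powRr0 mulr1; apply: le_trans (norm_sin_le1 _) _; rewrite lerDl.
have fl x y : `|f x - f y| <= `|xi| * `|x - y|.
  by rewrite /f (le_trans (sin_lip _ _))// -mulrBr normrM.
have [i1 _] := two_sided_test b1 (lexx 0) b0 mf B0 (normr_ge0 xi)
  (ltac:(by rewrite /f mulr0 sin0)) fp fq fl.
rewrite /levy_exponent/=; under [in X in _ -> _ --> X]eq_Rintegral do
  rewrite levy_kernel_Im /jump_compensator b1 mulr0 subr0.
apply: cvg_trans; apply: near_eq_cvg; apply: nearW => N.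
have bc : bdd_meas (fun x => sin (xi * (V x / L N))).
  by apply: bdd_meas_sin; exact: measurable_funM.
by rewrite -ExZ//; apply: eq_Rintegral => x _; rewrite mulrC.
Qed.

(** With the powers 2 and 1 the function [sin y - y] is an integrable test function of [V / L 0].
    The sine being bounded, the linear term is integrable as well. *)
Lemma integrable_scaled : 1 < b -> pi.-integrable setT (EFin \o V).
Proof.
move=> b1; pose f y := sin y - y : R.
have mf : measurable_fun setT f.
  apply: measurable_funB; last exact: measurable_id.
  exact: continuous_measurable_fun (@continuous_sin R).
have fp y : `|f y| <= 2 * `|y| `^ 2.
  apply: le_trans (sinB_le_sqr _) _; rewrite powR_mulrn// real_normK ?num_real//.
  by rewrite ler_peMl ?sqr_ge0// ler1n.
have fq y : `|f y| <= 2 * `|y| `^ 1.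
  rewrite powRr1// /f (le_trans (ler_normB _ _))// mulr2n mulrDl mul1r lerD2r.
  exact: norm_sin_le.
have fl x y : `|f x - f y| <= 2 * `|x - y|.
  rewrite /f (_ : _ - _ = (sin x - sin y) - (x - y)); last by ring.
  by rewrite (le_trans (ler_normB _ _))// mulr2n mulrDl mul1r lerD2r sin_lip.
have [i1 _ _] := two_sided_test b2 ler01 b1 mf ler0n2 ler0n2
  (ltac:(by rewrite /f sin0 subrr)) fp fq fl.
have bs : bdd_meas (fun x => sin (V x / L 0)).
  by apply: bdd_meas_sin; exact: mVL.
have H := integrableB measurableT (integrableZl measurableT (K 0) (bdd_meas_integrable pi bs)) (i1 0%N).
have := integrableZl measurableT (L 0 / K 0) H.
rewrite (_ : (fun x => _) = EFin \o V)//.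
apply/funext => x.
have -> : (EFin \o V) x = (L 0%N / K 0%N * (K 0%N * sin (V x / L 0%N) - f (V x / L 0%N) * K 0%N))%:E.
  by rewrite /=; congr EFin; rewrite /f; field; rewrite !gt_eqF.
by [].
Qed.

(** Here the sine needs its linear part removed, with the powers 2 and 1. This changes nothing on
    the side of [pi], since [V] has mean 0. *)
Lemma levy_sin_gt1 xi : 1 < b -> (\int[pi]_x (V x)%:E)%E = 0%E ->
  K N * (\int[pi]_x sin (xi * (V x / L N)))%R @[N --> \oo] -->
  complex.Im (levy_exponent b cp cm xi).
Proof.
move=> b1 V0; pose f y := sin (xi * y) - xi * y : R.
have mf : measurable_fun setT f.
  apply: measurable_funB; last exact: measurable_funM.
  apply: measurableT_comp; last exact: measurable_funM.
  exact: continuous_measurable_fun (@continuous_sin R).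
have B0 : 0 <= 2 * `|xi| + xi ^+ 2 by apply: addr_ge0; [apply: mulr_ge0|exact: sqr_ge0].
have fp y : `|f y| <= (2 * `|xi| + xi ^+ 2) * `|y| `^ 2.
  apply: le_trans (sinB_le_sqr _) _; rewrite powR_mulrn// real_normK ?num_real// exprMn.
  by rewrite ler_wpM2r ?sqr_ge0// lerDr mulr_ge0.
have fq y : `|f y| <= (2 * `|xi| + xi ^+ 2) * `|y| `^ 1.
  rewrite powRr1// /f; apply: (@le_trans _ _ (2 * `|xi| * `|y|)).
    rewrite (le_trans (ler_normB _ _))// -mulrA -normrM mulr2n mulrDl mul1r lerD2r.
    exact: norm_sin_le.
  by rewrite ler_wpM2r// lerDl sqr_ge0.
have fl x y : `|f x - f y| <= 2 * `|xi| * `|x - y|.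
  rewrite /f (_ : _ - _ = (sin (xi * x) - sin (xi * y)) - (xi * x - xi * y)); last by ring.
  rewrite (le_trans (ler_normB _ _))// -mulrA -normrM mulrBr mulr2n mulrDl mul1r lerD2r.
  exact: sin_lip.
have [i1 _] := two_sided_test b2 ler01 b1 mf B0 (mulr_ge0 ler0n2 (normr_ge0 xi))
  (ltac:(by rewrite /f !mulr0 sin0 subrr)) fp fq fl.
rewrite /levy_exponent/=; under [in X in _ -> _ --> X]eq_Rintegral do
  rewrite levy_kernel_Im /jump_compensator ltNge (ltW b1)/= (gt_eqF b1).
apply: cvg_trans; apply: near_eq_cvg; apply: nearW => N.
have bc : bdd_meas (fun x => sin (xi * (V x / L N))).
  by apply: bdd_meas_sin; exact: measurable_funM.
have iV := integrable_scaled b1.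
rewrite -ExZ// (_ : (\int[pi]_x (f (V x / L N) * K N))%R =
  (\int[pi]_x (K N * sin (xi * (V x / L N)) - (K N * xi / L N) * V x))%R); last first.
  by apply: eq_Rintegral => x _; rewrite /f; field; rewrite gt_eqF.
rewrite RintegralB//; last 2 first.
- by apply: bdd_meas_integrable; exact: bdd_measZ.
- exact: (integrableZl measurableT (K N * xi / L N) iV).
by rewrite [X in _ - X]RintegralZl// [X in _ * X]/Rintegral V0 mulr0 subr0.
Qed.

Lemma levy_jump_pos : b = 1 ->
  lebesgue_measure.-integrable [set x : R | 1 < x] (EFin \o dens) /\
  (\int[lebesgue_measure]_(x in [set x : R | (1 < x)%R]) dens x)%R = cp.
Proof.
move=> b1; have t1 := levy_tail_pos b0 cp0 cm0 ltr01.
have E : (\int[lebesgue_measure]_(x in [set x : R | (1 < x)%R]) (dens x)%:E = cp%:E)%E.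
  move: t1; rewrite /wtail powR1 mulr1 => <-.
  have -> : [set x : R | 1 < x] = `]1, +oo[%classic.
    by apply/seteqP; split=> x /=; rewrite in_itv/= andbT.
  have -> : [set x : R | 1 <= x] = `[1, +oo[%classic.
    by apply/seteqP; split=> x /=; rewrite in_itv/= andbT.
  rewrite integral_itv_obnd_cbnd//.
  by apply: measurable_funTS; apply/measurable_EFinP; exact: measurable_levy_density.
split; last by rewrite /Rintegral E.
apply/integrableP; split.
  by apply: measurable_funTS; apply/measurable_EFinP; exact: measurable_levy_density.
under eq_integral do rewrite /= ger0_norm ?levy_density_ge0//.
by rewrite E ltry.
Qed.

Lemma levy_jump_neg : b = 1 ->
  lebesgue_measure.-integrable [set x : R | x < - 1] (EFin \o dens) /\
  (\int[lebesgue_measure]_(x in [set x : R | (x < - 1)%R]) dens x)%R = cm.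
Proof.
move=> b1; have t1 := levy_tail_neg b0 cp0 cm0 ltr01.
have E : (\int[lebesgue_measure]_(x in [set x : R | (x < - 1)%R]) (dens x)%:E = cm%:E)%E.
  move: t1; rewrite /wtail powR1 mulr1 => <-.
  have -> : [set x : R | x < - 1] = `]-oo, (- 1)[%classic.
    by apply/seteqP; split=> x /=; rewrite in_itv/=.
  have -> : [set x : R | 1 <= - x] = `]-oo, (- 1)]%classic.
    by apply/seteqP; split=> x /=; rewrite in_itv/= lerNr.
  rewrite integral_itv_bndo_bndc//.
  by apply: measurable_funTS; apply/measurable_EFinP; exact: measurable_levy_density.
split; last by rewrite /Rintegral E.
apply/integrableP; split.
  by apply: measurable_funTS; apply/measurable_EFinP; exact: measurable_levy_density.
under eq_integral do rewrite /= ger0_norm ?levy_density_ge0//.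
by rewrite E ltry.
Qed.

(** The test function is [sin (xi y) - xi * clip y]. Replacing [clip] by the sharp truncation costs
    [xi] times the difference of the rescaled strict tails at level 1, which tends to
    [xi * (cp - cm)]; the same replacement under the Levy measure costs exactly this amount. *)
Lemma levy_sin_eq1 xi : b = 1 ->
  K N * (\int[pi]_x sin (xi * (V x / L N)))%R -
    xi * (\int[pi]_x truncation V (K N) x)%R @[N --> \oo] -->
  complex.Im (levy_exponent b cp cm xi).
Proof.
move=> b1; pose f y := sin (xi * y) - xi * clip y : R.
have LE N : L N = K N by rewrite /L b1 invr1 powRr1// ltW.
have mclip : measurable_fun setT (@clip R).
  by apply: measurable_maxr => //; exact: measurable_minr.
have mf : measurable_fun setT f.
  apply: measurable_funB; last exact: measurable_funM.
  apply: measurableT_comp; last exact: measurable_funM.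
  exact: continuous_measurable_fun (@continuous_sin R).
have B0 : 0 <= 1 + `|xi| + xi ^+ 2 by rewrite !addr_ge0 ?sqr_ge0.
have fle y : (`|y| <= 1 -> `|f y| <= xi ^+ 2 * y ^+ 2) /\ (1 <= `|y| -> `|f y| <= 1 + `|xi|).
  split=> y1; rewrite /f.
    by rewrite clip_id// -exprMn; exact: sinB_le_sqr.
  rewrite (le_trans (ler_normB _ _))// lerD ?norm_sin_le1// normrM ler_piMr//.
  exact: clip_le1.
have fp y : `|f y| <= (1 + `|xi| + xi ^+ 2) * `|y| `^ 2.
  rewrite powR_mulrn//; have [y1|y1] := leP `|y| 1.
    apply: (le_trans ((fle y).1 y1)); rewrite real_normK ?num_real//.
    by rewrite ler_wpM2r ?sqr_ge0// lerDr addr_ge0.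
  apply: (le_trans ((fle y).2 (ltW y1))).
  apply: (@le_trans _ _ (1 + `|xi| + xi ^+ 2)); first by rewrite lerDl sqr_ge0.
  by rewrite ler_peMr// exprn_ege1// ltW.
have fq y : `|f y| <= (1 + `|xi| + xi ^+ 2) * `|y| `^ 0.
  rewrite powRr0 mulr1; have [y1|y1] := leP `|y| 1.
    apply: (le_trans ((fle y).1 y1)); apply: (@le_trans _ _ (xi ^+ 2)).
      by rewrite ler_piMr ?sqr_ge0// -real_normK ?num_real// exprn_ile1.
    by rewrite lerDr addr_ge0.
  by apply: (le_trans ((fle y).2 (ltW y1))); rewrite lerDl sqr_ge0.
have fl x y : `|f x - f y| <= 2 * `|xi| * `|x - y|.
  rewrite /f (_ : _ - _ = (sin (xi * x) - sin (xi * y)) - xi * (clip x - clip y)); last by ring.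
  rewrite (le_trans (ler_normB _ _))// mulr2n !mulrDl !mul1r lerD//.
    by rewrite (le_trans (sin_lip _ _))// -mulrBr normrM.
  by rewrite normrM ler_wpM2l// clip_lip.
have [_ i2 c1] := two_sided_test b2 (lexx 0) b0 mf B0 (mulr_ge0 ler0n2 (normr_ge0 xi))
  (ltac:(by rewrite /f mulr0 sin0 clip_id ?normr0// mulr0 subrr)) fp fq fl.
have [j1 J1] := levy_jump_pos b1; have [j2 J2] := levy_jump_neg b1.
have m1 : measurable [set x : R | 1 < x] by exact: (@measurable_gtY _ _ _ id).
have m2 : measurable [set x : R | x < - 1].
  by rewrite (_ : [set x : R | _] = `]-oo, (-1)[%classic).
have Im : complex.Im (levy_exponent b cp cm xi) =
    (\int[lebesgue_measure]_(y in [set: R]) (f y * dens y))%R + xi * (cp - cm).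
  have k1 : lebesgue_measure.-integrable setT (EFin \o (fun y : R => \1_[set x : R | 1 < x] y * dens y)).
    have := (integrable_mkcond (mu:=lebesgue_measure) (EFin \o dens) m1).1 j1.
    congr (_.-integrable _ _); apply/funext => x.
    by rewrite patchE/= indicE; case: ifPn => _; rewrite ?mul1r ?mul0r.
  have k2 : lebesgue_measure.-integrable setT (EFin \o (fun y : R => \1_[set x : R | x < - 1] y * dens y)).
    have := (integrable_mkcond (mu:=lebesgue_measure) (EFin \o dens) m2).1 j2.
    congr (_.-integrable _ _); apply/funext => x.
    by rewrite patchE/= indicE; case: ifPn => _; rewrite ?mul1r ?mul0r.
  have e1 : (\int[lebesgue_measure]_(y in [set: R]) (\1_[set x : R | (1 < x)%R] y * dens y))%R = cp.
    rewrite -[RHS]J1 [in RHS]Rintegral_mkcond; apply: eq_Rintegral => x _.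
    by rewrite patchE/= indicE; case: ifPn => _; rewrite ?mul1r ?mul0r.
  have e2 : (\int[lebesgue_measure]_(y in [set: R]) (\1_[set x : R | (x < - 1)%R] y * dens y))%R = cm.
    rewrite -[RHS]J2 [in RHS]Rintegral_mkcond; apply: eq_Rintegral => x _.
    by rewrite patchE/= indicE; case: ifPn => _; rewrite ?mul1r ?mul0r.
  have k12 : lebesgue_measure.-integrable setT (EFin \o (fun y : R =>
      \1_[set x | 1 < x] y * dens y - \1_[set x | x < -1] y * dens y)).
    exact: (integrableB measurableT k1 k2).
  have E12 := RintegralB measurableT k1 k2; rewrite e1 e2 in E12.
  have E3 := RintegralZl xi measurableT k12; rewrite E12 in E3; rewrite -E3.
  rewrite -RintegralD//; last exact: (integrableZl measurableT xi k12).
  rewrite /levy_exponent/=; apply: eq_Rintegral => y _.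
  rewrite levy_kernel_Im /jump_compensator b1 ltxx eqxx /f.
  by rewrite /dens b1 (clip_split y); ring.
have mgt s : measurable [set x | s < V x] by exact: measurable_gtY.
have mgt' s : measurable [set x | s < - V x] by exact: (@measurable_gtY _ _ _ (fun x => - V x)).
have IE N : K N * (\int[pi]_x sin (xi * (V x / L N)))%R - xi * (\int[pi]_x truncation V (K N) x)%R =
   (\int[pi]_x (f (V x / L N) * K N))%R + xi * (K N * fine (pi [set x | 1 * L N < V x]) -
     K N * fine (pi [set x | 1 * L N < - V x])).
  have bs : bdd_meas (fun x => sin (xi * (V x / L N))).
    by apply: bdd_meas_sin; exact: measurable_funM.
  have bt : bdd_meas (truncation V (K N)).
    split; first by apply: measurable_funM => //; apply: measurable_indic; exact: measurable_le_norm.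
    exists (K N) => x; rewrite /truncation indicE.
    have [/set_mem/= h|_] := boolP (x \in _); first by rewrite mulr1.
    by rewrite mulr0 normr0 ltW.
  have bi1 : bdd_meas (\1_[set x | 1 * L N < V x] : T -> R) by exact: bdd_meas_indic.
  have bi2 : bdd_meas (\1_[set x | 1 * L N < - V x] : T -> R) by exact: bdd_meas_indic.
  rewrite -!Ex_indic// -!mulrBr -ExB// -!ExZ; do ?[exact: bdd_measB|by apply: bdd_measZ; exact: bdd_measB|exact: bt|exact: bs].
  have b3 : bdd_meas (fun x => K N * sin (xi * (V x / L N))) by exact: bdd_measZ.
  have b4 : bdd_meas (fun x => xi * truncation V (K N) x) by exact: bdd_measZ.
  have b5 : bdd_meas (fun x => xi * (K N * (\1_[set x0 | 1 * L N < V x0] x - \1_[set x0 | 1 * L N < - V x0] x))).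
    by do 2 apply: bdd_measZ; exact: bdd_measB.
  have FE x : f (V x / L N) * K N = K N * sin (xi * (V x / L N)) - xi * truncation V (K N) x -
     xi * (K N * (\1_[set x0 | 1 * L N < V x0] x - \1_[set x0 | 1 * L N < - V x0] x)).
    rewrite /f (clip_split (V x / L N)) /truncation !indicE.
    have -> : (V x / L N \in `[-1, 1]%classic) = (x \in [set y | `|V y| <= K N]).
      apply/idP/idP; rewrite !inE/= in_itv/= ler_norml LE;
      by rewrite ler_pdivrMr// ler_pdivlMr// mulN1r mul1r.
    have -> : (V x / L N \in [set x0 | 1 < x0]) = (x \in [set x0 | 1 * L N < V x0]).
      by apply/idP/idP; rewrite !inE/= ltr_pdivlMr.
    have -> : (V x / L N \in [set x0 | x0 < - 1]) = (x \in [set x0 | 1 * L N < - V x0]).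
      by apply/idP/idP; rewrite !inE/= ltr_pdivrMr// mulN1r mul1r ltrNr.
    by rewrite -(LE N); field; rewrite gt_eqF.
  under [in RHS]eq_Rintegral do rewrite FE.
  by rewrite !ExB//; [ring|exact: bdd_measB].
rewrite Im (_ : (fun N => _) = (fun N => (\int[pi]_x (f (V x / L N) * K N))%R +
   xi * (K N * fine (pi [set x | 1 * L N < V x]) -
     K N * fine (pi [set x | 1 * L N < - V x])))); last by apply/funext.
apply: cvgD; first exact: c1.
apply: cvgM; first exact: cvg_cst.
have := scaled_tail_open_cvg mV b0 cp0 tail_right K1 KN ltr01.
have := scaled_tail_open_cvg mVN b0 cm0 tail_leftN K1 KN ltr01.
rewrite powR1 !mulr1 => h2 h1; exact: cvgB.
Qed.

End two_sided_tail.

(** * Discretization of paths in the J1 topology *)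

Section time_changes.
Context {R : realType}.

Lemma time_changeP (l : R -> R) : l 0 = 0 ->
  (forall x y, 0 <= x -> x < y -> l x < l y) ->
  (forall y, 0 <= y -> exists2 x, 0 <= x & l x = y) -> time_change l.
Proof.
move=> l0 lmono lsurj.
have lm x y : 0 <= x -> 0 <= y -> (l x <= l y) = (x <= y).
  move=> x0 y0; have [xy|yx|->] := ltgtP x y; last by rewrite lexx.
    by rewrite ltW// lmono.
  by apply/negbTE; rewrite -ltNge lmono.
split; last by move=> x y; rewrite !in_itv/= !andbT; exact: lm.
split.
- move=> x; rewrite /= !in_itv/= !andbT => x0.
  by rewrite -[leLHS]l0 lm.
- move=> x y; rewrite !inE/= !in_itv/= !andbT => x0 y0 xy.
  by apply/eqP; rewrite eq_le -(lm x)// -(lm y)// xy lexx.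
- by move=> y; rewrite /= in_itv/= andbT => /lsurj[x x0 <-]; exists x => //; rewrite /= in_itv/= x0.
Qed.

Lemma time_change0 (l : R -> R) : time_change l -> l 0 = 0.
Proof.
move=> tl; have [m [tm lK mK]] := time_change_inv tl.
have l00 := time_change_ge0 tl (lexx 0).
have m00 := time_change_ge0 tm (lexx 0).
apply/eqP; rewrite eq_le l00 andbT.
rewrite -[leRHS](lK 0)//; case: tl => _ ->; rewrite ?in_itv/= ?lexx//.
by rewrite m00.
Qed.

Lemma time_change_lt (l : R -> R) x y : time_change l -> 0 <= x -> 0 <= y ->
  (l x < l y) = (x < y).
Proof.
by move=> [_ lm] x0 y0; rewrite !ltNge lm// in_itv/= ?x0 ?y0.
Qed.

(** Piecewise linear interpolation sending [t i] to [u i], continued by a translation after the last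
    node. Its displacement is a convex combination of the displacements at two neighbouring nodes.
    Measuring time from [t 0] and [u 0] makes the induction on the number of nodes possible. *)
Lemma time_change_nodes m (t u : nat -> R) h :
  (forall i, (i < m)%N -> t i < t i.+1) -> (forall i, (i < m)%N -> u i < u i.+1) ->
  (forall i, (i <= m)%N -> `|u i - t i| <= h) ->
  exists l, [/\ time_change l,
    forall x, 0 <= x -> `|u 0%N + l x - (t 0%N + x)| <= h &
    forall i, (i <= m)%N -> u 0%N + l (t i - t 0%N) = u i].
Proof.
elim: m t u => [|m IH] t u tm um uth.
  exists id; split; first exact: time_change_id.
    by move=> x x0; rewrite opprD addrACA subrr addr0 uth.
  by move=> [|//] _; rewrite subrr addr0.
have [l [tl lh lt]] := IH (t \o S) (u \o S) (fun i im => tm i.+1 im)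
  (fun i im => um i.+1 im) (fun i im => uth i.+1 im).
pose a := t 1%N - t 0%N; pose b := u 1%N - u 0%N.
have a0 : 0 < a by rewrite subr_gt0 tm.
have b0 : 0 < b by rewrite subr_gt0 um.
have l0 := time_change0 tl.
(* Slope [b / a] up to the second node, then the time change obtained for the remaining nodes. *)
exists (fun x => if x < a then x * (b / a) else b + l (x - a)); split.
- apply: time_changeP => [|x y x0 xy|y y0].
  + by rewrite a0 mul0r.
  + have [ya|ay] := ltP y a.
      by rewrite (lt_trans xy ya) ltr_pM2r// divr_gt0.
    have ly : b <= b + l (y - a) by rewrite lerDl time_change_ge0// subr_ge0.
    have [xa|ax] := ltP x a.
      apply: lt_le_trans ly; rewrite mulrA ltr_pdivrMr// mulrC ltr_pM2l//.
    by rewrite ltrD2l time_change_lt// ?subr_ge0// ltrD2r.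
  + have [yb|bY] := ltP y b.
      exists (y * (a / b)); first by rewrite mulr_ge0// divr_ge0// ltW.
      by rewrite mulrA ltr_pdivrMr// mulrC ltr_pM2l// yb mulrCA -mulrA; field; rewrite !gt_eqF.
    have [k [tk lK kK]] := time_change_inv tl.
    have yb0 : 0 <= y - b by rewrite subr_ge0.
    have k0 := time_change_ge0 tk yb0.
    exists (k (y - b) + a); first by rewrite addr_ge0// ltW.
    by rewrite ltNge lerDr k0/= addrK lK// addrC subrK.
- move=> x x0; case: ifPn => xa.
    have -> : u 0%N + x * (b / a) - (t 0%N + x) =
      (1 - x / a) * (u 0%N - t 0%N) + (x / a) * (u 1%N - t 1%N).
      by rewrite /a /b in a0 *; field; rewrite gt_eqF.
    have xa0 : 0 <= x / a by rewrite divr_ge0// ltW.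
    have xa1 : 0 <= 1 - x / a by rewrite subr_ge0 ler_pdivrMr// mul1r ltW.
    apply: le_trans (ler_normD _ _) _; rewrite (normrM (1 - x / a)) (normrM (x / a)) (ger0_norm xa0) (ger0_norm xa1).
    have h0 := uth 0%N isT; have h1 := uth 1%N isT.
    have := ler_wpM2l xa0 h1; have := ler_wpM2l xa1 h0; lra.
  rewrite -leNgt in xa; have := lh (x - a); rewrite subr_ge0 => /(_ xa)/=.
  by rewrite (_ : u 0%N + _ - _ = u 1%N + l (x - a) - (t 1%N + (x - a)))// /a /b; ring.
- move=> [|i] im; first by rewrite subrr a0 mul0r addr0.
  rewrite ltNge (_ : a <= _) /=; last first.
    rewrite /a lerD2r; elim: i im => // i IHi im.
    by rewrite (le_trans (IHi (ltnW im)))// ltW// tm.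
  have := lt i im; rewrite /= => <-.
  rewrite (_ : t i.+1 - t 0%N - a = t i.+1 - t 1%N); last by rewrite /a; ring.
  by rewrite /b; ring.
Qed.

Definition ceiln (y : R) : nat :=
  if (Num.truncn y)%:R == y then Num.truncn y else (Num.truncn y).+1.

Lemma ceilnP y : 0 <= y -> y <= (ceiln y)%:R < y + 1.
Proof.
move=> y0; have /andP[h1 h2] := truncn_itv y0; rewrite /ceiln; case: ifPn => [/eqP ->|ne].
  by rewrite lexx ltrDl ltr01.
by rewrite (ltW h2)/= -natr1 ltrD2r lt_neqAle ne.
Qed.

End time_changes.

Section discretization.
Context {R : realType} {U : pseudoMetricType R}.
Implicit Types (x : R -> U) (h e T : R).

(* The J1 analogue of the modulus of continuity. *)
Definition good_partition x e h T := exists m (t : nat -> R),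
  [/\ t 0%N = 0, forall i, (i < m)%N -> t i + h <= t i.+1, T < t m &
    forall i a b, (i < m)%N -> t i <= a < t i.+1 -> t i <= b < t i.+1 ->
      ball (x a) e (x b)].

Definition step_path (u : nat -> U) h : skorokhod U := Skorokhod (cadlag_step u h^-1).

(** Freezing the path from time [h * m] on makes it a function of finitely many values, hence of the
    starting point and [m] increments. *)
Definition discretize x h m := step_path (fun k => x (h * (minn k m)%:R)) h.

(** Each node [t i] is moved up to the next grid point [h * c i]; nodes at least [h] apart stay
    distinct. If [l s] lies between the images of [t i] and [t (i + 1)], the grid point just before
    [l s] still lies in the cell from [t i] to [t (i + 1)], where the path oscillates by less than
    [e]. The room [T + h] keeps [l s] before the freezing time. *)
Lemma discretize_close (x : skorokhod U) e h T m : 0 < h -> h < e -> T + h <= h * m%:R ->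
  good_partition x e h T -> J1_close T e (x, discretize x h m).
Proof.
move=> h0 he Tm [n [t [t0 th Tt xt]]].
have tS i : (i < n)%N -> t i < t i.+1.
  by move=> /th; apply: lt_le_trans; rewrite ltrDl.
have t_ge0 i : (i <= n)%N -> 0 <= t i.
  elim: i => [|i IH] i_n; first by rewrite t0.
  by rewrite (le_trans (IH (ltnW i_n)))// ltW// tS.
pose c i := ceiln (t i / h).
have cP i : (i <= n)%N -> t i <= h * (c i)%:R < t i + h.
  move=> i_n; have /ceilnP : 0 <= t i / h by rewrite divr_ge0 ?t_ge0// ltW.
  rewrite -/(c i) ler_pdivrMr// => /andP[h1 h2]; rewrite mulrC h1/=.
  by move: h2; rewrite -(ltr_pM2r h0) mulrDl mul1r divfK ?gt_eqF.
have c0 : c 0%N = 0%N.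
  have /andP[_] := cP 0%N isT; rewrite t0 add0r -[X in _ < X]mulr1 ltr_pM2l//.
  by rewrite -[1]/(1%:R) ltr_nat ltnS leqn0 => /eqP.
have cS i : (i < n)%N -> h * (c i)%:R < h * (c i.+1)%:R.
  move=> i_n; have /andP[_ h1] := cP i (ltnW i_n).
  have /andP[h2 _] := cP i.+1 i_n; apply: lt_le_trans h2.
  exact: lt_le_trans h1 (th i i_n).
have ch i : (i <= n)%N -> `|h * (c i)%:R - t i| <= h.
  by move=> /cP/andP[? ?]; rewrite ler_norml; apply/andP; split; lra.
have [l [tl]] := time_change_nodes tS cS ch.
rewrite c0 t0 mulr0 => lh lt.
exists l => //; split.
  by move=> s s0; have := lh s s0; rewrite !add0r => /le_lt_trans; exact.
move=> s /andP[s0 sT].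
have [i i_n /andP[si1 si2]] : exists2 i, (i < n)%N & t i <= s < t i.+1.
  have sn : s < t n by exact: le_lt_trans Tt.
  elim: n sn {th Tt xt tS t_ge0 cP cS ch tl lh lt} => [|n IH] sn.
    by move: sn; rewrite t0 ltNge s0.
  have [|/IH[i i_n H]] := leP (t n) s; last by exists i => //; exact: ltnW.
  by move=> ns; exists n => //; rewrite ns.
have lti := lt i (ltnW i_n); have lti1 := lt i.+1 i_n.
rewrite subr0 add0r in lti; rewrite subr0 add0r in lti1.
have ti0 := t_ge0 i (ltnW i_n); have ti10 := t_ge0 i.+1 i_n.
have ls1 : h * (c i)%:R <= l s.
  by rewrite -lti; case: tl => _ ->; rewrite ?in_itv/= ?ti0 ?s0.
have ls2 : l s < h * (c i.+1)%:R by rewrite -lti1 time_change_lt.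
have ls0 := time_change_ge0 tl s0.
rewrite /=; set k := Num.truncn (h^-1 * l s).
have /truncn_itv/andP[k1 k2] : 0 <= h^-1 * l s by rewrite mulr_ge0// invr_ge0 ltW.
have {k1}k1 : h * k%:R <= l s by rewrite -ler_pdivlMl.
have {k2}k2 : l s < h * k.+1%:R by rewrite -ltr_pdivrMl.
have ik : (c i <= k)%N by have := le_lt_trans ls1 k2; rewrite ltr_pM2l// ltr_nat ltnS.
have ki : (k < c i.+1)%N by have := le_lt_trans k1 ls2; rewrite ltr_pM2l// ltr_nat.
have km : (k <= m)%N.
  have : h * k%:R <= h * m%:R.
    apply: le_trans k1 (le_trans _ Tm); have := lh s s0; rewrite !add0r ler_norml.
    by move=> /andP[_]; lra.
  by rewrite ler_pM2l// ler_nat.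
rewrite (minn_idPl km); apply: (xt i) => //; first by rewrite si1.
have /andP[ci _] := cP i (ltnW i_n); have /andP[_ ci1] := cP i.+1 i_n.
apply/andP; split; first by apply: (le_trans ci); rewrite ler_pM2l// ler_nat.
have : h * k.+1%:R <= h * (c i.+1)%:R by rewrite ler_pM2l// ler_nat.
by rewrite -natr1 mulrDr mulr1; lra.
Qed.

(** A supremum argument on the set of [S] such that the interval from 0 to [S] can be partitioned.
    The left limit at the supremum shows that it is attained, and right continuity pushes past it,
    so the set is not bounded by [T]. *)
Lemma cadlag_good_partition x e T : cadlag x -> 0 < e ->
  exists2 h, 0 < h & good_partition x e h T.
Proof.
move=> [xr xl] e0.
pose exact_part S h := exists m (t : nat -> R),
  [/\ t 0%N = 0, forall i, (i < m)%N -> t i + h <= t i.+1, t m = S &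
    forall i a b, (i < m)%N -> t i <= a < t i.+1 -> t i <= b < t i.+1 ->
      ball (x a) e (x b)].
have e20 : 0 < e / 2 by rewrite divr_gt0.
pose A := [set S | 0 <= S /\ exists2 h, 0 < h & exact_part S h].
have extend S S' : A S -> S < S' ->
    (forall a b, S <= a < S' -> S <= b < S' -> ball (x a) e (x b)) -> A S'.
  move=> [S0 [h h0 [m [t [t0 th tm tx]]]]] SS' xS; split; first by rewrite (le_trans S0)// ltW.
  exists (Num.min h (S' - S)); first by rewrite lt_min h0 subr_gt0.
  exists m.+1, (fun i => if (i <= m)%N then t i else S'); split => //.
  - move=> i; rewrite ltnS => im; rewrite im; case: ifPn => [im'|].
      by apply: le_trans (th i im'); rewrite lerD2l ge_min lexx.
    rewrite -ltnNge ltnS => mi; have -> : i = m by apply/eqP; rewrite eqn_leq im.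
    by rewrite tm -lerBrDl ge_min lexx orbT.
  - by rewrite ltnn.
  - move=> i a b; rewrite ltnS => im; rewrite im; case: ifPn => [im'|]; first exact: tx.
    rewrite -ltnNge ltnS => mi; have -> : i = m by apply/eqP; rewrite eqn_leq im.
    by rewrite tm; exact: xS.
have A0 : A 0.
  by split=> //; exists 1 => //; exists 0%N, (fun=> 0); split.
have right S : 0 <= S -> A S -> exists2 S', S < S' & A S'.
  move=> S0 AS; have /cvg_ballP/(_ _ e20) := xr S S0.
  move=> [r /= r0 xr']; exists (S + r); first by rewrite ltrDl.
  apply: extend AS _ _; first by rewrite ltrDl.
  have H a : S <= a < S + r -> ball (x S) (e / 2) (x a).
    move=> /andP[Sa ar]; move: Sa; rewrite le_eqVlt => /orP[/eqP <-|Sa].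
      exact: ballxx.
    by apply: xr' => //; rewrite /ball/= ltr_norml; apply/andP; split; lra.
  by move=> a b /H ha /H hb; rewrite (splitr e); apply: ball_triangle hb; exact: ball_sym.
suff [S AS TS] : exists2 S, A S & T < S.
  case: AS => _ [h h0 [m [t [t0 th tm tx]]]]; exists h => //; exists m, t; split => //.
  by rewrite tm.
apply: contrapT => nA.
have ubA : ubound A T by move=> S AS; rewrite leNgt; apply/negP => TS; apply: nA; exists S.
have hsA : has_sup A by split; [exists 0|exists T].
pose s := sup A.
have s0 : 0 <= s by apply: sup_upper_bound.
have As : A s.
  move: s0; rewrite le_eqVlt => /orP[/eqP <- //|s0].
  have [l /cvg_ballP/(_ _ e20)] := xl s s0.
  move=> [r /= r0 xr'].
  have [S AS Sr] := sup_adherent r0 hsA.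
  have Ss : S <= s by apply: sup_upper_bound.
  move: Ss; rewrite le_eqVlt => /orP[/eqP <- //|Ss].
  apply: extend AS Ss _.
  have H a : S <= a < s -> ball l (e / 2) (x a).
    move=> /andP[Sa ar]; apply: xr' => //; rewrite /ball/= ltr_norml.
    by rewrite -/s in Sr; apply/andP; split; lra.
  by move=> a b /H ha /H hb; rewrite (splitr e); apply: ball_triangle hb; exact: ball_sym.
have [S' sS' AS'] := right s s0 As.
have : S' <= s by apply: sup_upper_bound.
by rewrite leNgt sS'.
Qed.

Lemma J1_nbhs (x : skorokhod U) (A : set (skorokhod U)) :
  nbhs x A <-> exists T e, 0 < e /\ forall y, J1_close T e (x, y) -> A y.
Proof.
rewrite -nbhs_entourageE; split.
  move=> [B [[T e] /= [e0 TB]] BA]; exists T, e; split=> // y xy.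
  by apply: BA; rewrite /xsection/= inE; apply: TB.
move=> [T [e [e0 H]]]; exists [set xy | J1_close T e xy].
  by exists (T, e); split.
by move=> y; rewrite /xsection/= inE => /H.
Qed.

Lemma good_partition_mono x e h h' T T' : h' <= h -> T' <= T ->
  good_partition x e h T -> good_partition x e h' T'.
Proof.
move=> hh TT [m [t [t0 th tm tx]]]; exists m, t; split => //.
  by move=> i /th; apply: le_trans; rewrite lerD2l.
exact: le_lt_trans tm.
Qed.

(** With mesh [1 / (n + 1)] and [(n + 1)^2] cells the horizon is [n + 1], so that mesh and horizon
    pass to their limits together. *)
Lemma discretize_cvg (x : skorokhod U) :
  discretize x n.+1%:R^-1 (n.+1 ^ 2) @[n --> \oo] --> x.
Proof.
move=> A /J1_nbhs[T [e [e0 H]]].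
have [h h0 xh] := cadlag_good_partition T (skorokhod_cadlag x) e0.
suff : \forall n \near \oo, A (discretize x n.+1%:R^-1 (n.+1 ^ 2)) by [].
near=> n; apply: H.
have n0 : (0 : R) < n.+1%:R by [].
have n1 : n.+1%:R^-1 < e /\ n.+1%:R^-1 <= h /\ T + 1 <= n.+1%:R.
  have nn (y : R) : y < n%:R -> y < n.+1%:R by move=> yn; apply: lt_le_trans yn _; rewrite ler_nat.
  split; [|split].
  - rewrite -[X in _ < X]invrK ltf_pV2 ?posrE ?invr_gt0//; apply: nn.
    near: n; exact: nbhs_infty_gtr.
  - rewrite -[leRHS]invrK lef_pV2 ?posrE ?invr_gt0//; apply/ltW/nn.
    near: n; exact: nbhs_infty_gtr.
  - apply/ltW/nn; near: n; exact: nbhs_infty_gtr.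
case: n1 => n1 [n2 n3].
apply: discretize_close => //.
- rewrite natrX expr2 mulrA mulVf ?gt_eqF// mul1r.
  apply: le_trans n3; rewrite lerD2l -[leRHS]invr1 lef_pV2 ?posrE// ler1n//.
- exact: good_partition_mono n2 (lexx _) xh.
Unshelve. all: by end_near. Qed.

Lemma step_path_close (u v : nat -> U) h e T : 0 < e ->
  (forall k, ball (u k) e (v k)) -> J1_close T e (step_path u h, step_path v h).
Proof.
move=> e0 uv; exists id; first exact: time_change_id.
by split=> [t _|t _] /=; rewrite ?subrr ?normr0.
Qed.

End discretization.

(** * Continuous functionals on Skorokhod space *)

Section bounded_convergence.
Context {d} {T : measurableType d} {R : realType} (mu : probability T R).

Lemma Ex_bounded_cvg (f : nat -> T -> R) (g : T -> R) (M : R) :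
  (forall n, measurable_fun setT (f n)) -> (forall n x, `|f n x| <= M) ->
  (forall x, f n x @[n --> \oo] --> g x) ->
  (\int[mu]_x f n x)%R @[n --> \oo] --> (\int[mu]_x g x)%R.
Proof.
move=> mf fM fg.
have mg : measurable_fun setT g by apply: (measurable_fun_cvg mf) => x _; exact: fg.
have gM x : `|g x| <= M.
  have h : `|f n x| @[n --> \oo] --> `|g x| by apply: cvg_norm; exact: fg.
  have := limr_le (cvgP _ h); rewrite (cvg_lim _ h)//; apply.
  by apply: nearW => n.
have bg : bdd_meas g by split=> //; exists M.
have bf n : bdd_meas (f n) by split=> //; exists M.
have H : (\int[mu]_x (f n x)%:E)%E @[n --> \oo] --> (\int[mu]_x (g x)%:E)%E.
  apply: (@dominated_cvg _ _ _ _ _ measurableT _ _ (fun=> M%:E)) => //.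
  - by move=> n; apply/measurable_EFinP.
  - by move=> x _; apply: cvg_EFin; [exact: nearW|exact: fg].
  - exact: (bdd_meas_integrable mu (bdd_meas_cst M)).
  - by move=> n x _; rewrite lee_fin.
have -> : (fun n => \int[mu]_x f n x)%R = fine \o (fun n => \int[mu]_x (f n x)%:E)%E by [].
by apply: fine_cvg; rewrite fineK -?ExE// ExE.
Qed.

End bounded_convergence.

Section functionals.
Context {R : realType}.
Local Notation D := (skorokhod (R * R)%type).

Lemma measurable_countable_comp {d} {Om : measurableType d} {C : countType}
    (c : Om -> C) (g : C -> R) :
  (forall v, measurable (c @^-1` [set v])) -> measurable_fun setT (g \o c).
Proof.
move=> mc _ B mB; rewrite setTI.
rewrite (_ : _ @^-1` _ = \bigcup_(v : C) (if g v \in B then c @^-1` [set v] else set0)).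
  apply: countable_bigcupT_measurable => // v; case: ifPn => // _; exact: measurable0.
apply/seteqP; split=> w /=.
  by move=> Bw; exists (c w) => //; rewrite mem_set.
by move=> [v _]; case: ifPn => // /set_mem gv /= ->.
Qed.

Definition round_to (j : nat) (y : R) : R := (Num.floor (y * j.+1%:R))%:~R / j.+1%:R.

Lemma round_to_close j y : `|y - round_to j y| <= j.+1%:R^-1.
Proof.
have j0 : (0 : R) < j.+1%:R by [].
have /andP[h1 h2] := floor_itv (y * j.+1%:R).
have -> : y - round_to j y = (y * j.+1%:R - (Num.floor (y * j.+1%:R))%:~R) / j.+1%:R.
  by rewrite mulrBl mulfK ?gt_eqF.
rewrite normrM (ger0_norm (_ : 0 <= j.+1%:R^-1)) ?invr_ge0// ler_piMl ?invr_ge0//.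
rewrite intrD in h2; rewrite ger0_norm; lra.
Qed.

Lemma measurable_floor_fiber {d} {Om : measurableType d} (Y : Om -> R) (z : int) :
  measurable_fun setT Y -> measurable [set w | Num.floor (Y w) = z].
Proof.
move=> mY; rewrite (_ : [set w | _] = Y @^-1` `[z%:~R, (z + 1)%:~R[).
  by rewrite -[X in measurable X]setTI; apply: mY.
apply/seteqP; split=> w /=; rewrite in_itv/=.
  by move=> <-; exact: floor_itv.
exact: floor_def.
Qed.

(** Only continuity of [F] for the J1 topology is known. Rounding the values to multiples of
    [1 / (j + 1)] leaves countably many possible paths, on which measurability is trivial; as [j]
    grows the rounded paths converge uniformly and continuity gives the limit. *)
Lemma measurable_step_path {d} {Om : measurableType d} (F : D -> R) m h
    (Y : nat -> Om -> R * R) : continuous F ->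
  (forall k, measurable_fun setT (Y k)) ->
  measurable_fun setT (fun w => F (step_path (fun k => Y (minn k m) w) h)).
Proof.
move=> cF mY.
pose rnd j (y : R * R) := (round_to j y.1, round_to j y.2).
apply: (@measurable_fun_cvg _ _ _ setT
  (fun j w => F (step_path (fun k => rnd j (Y (minn k m) w)) h))); last first.
  move=> w _.
  suff h' : step_path (fun k => rnd j (Y (minn k m) w)) h @[j --> \oo] -->
      step_path (fun k => Y (minn k m) w) h by exact: (cvg_comp _ _ h' (cF _)).
  move=> A /J1_nbhs[T [e [e0 H]]].
  suff : \forall j \near \oo, A (step_path (fun k => rnd j (Y (minn k m) w)) h) by [].
  near=> j; apply: H; apply: step_path_close => // k.
  have je : j.+1%:R^-1 < e.
    rewrite -[X in _ < X]invrK ltf_pV2 ?posrE ?invr_gt0//.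
    apply: (@lt_le_trans _ _ j%:R); last by rewrite ler_nat.
    near: j; exact: nbhs_infty_gtr.
  by split; rewrite /ball/=; apply: le_lt_trans je; exact: round_to_close.
move=> j.
pose c w : m.+1.-tuple (int * int) := [tuple
  (Num.floor ((Y k w).1 * j.+1%:R), Num.floor ((Y k w).2 * j.+1%:R)) | k < m.+1].
pose g (v : m.+1.-tuple (int * int)) := F (step_path (fun k =>
  let z := tnth v (inord (minn k m)) in (z.1%:~R / j.+1%:R, z.2%:~R / j.+1%:R) : (R * R)%type) h).
rewrite (_ : (fun w => _) = g \o c); last first.
  apply/funext => w /=; rewrite /g; congr F; congr step_path; apply/funext => k.
  by rewrite tnth_mktuple inordK// ltnS geq_minr.
apply: measurable_countable_comp => v.
rewrite (_ : _ @^-1` _ = \bigcap_(k in [set: 'I_m.+1])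
   ([set w | Num.floor ((Y k w).1 * j.+1%:R) = (tnth v k).1] `&`
    [set w | Num.floor ((Y k w).2 * j.+1%:R) = (tnth v k).2])).
  apply: fin_bigcap_measurable => // k _.
  apply: measurableI; apply: measurable_floor_fiber; apply: measurable_funM => //.
    exact: (measurableT_comp measurable_fst).
  exact: (measurableT_comp measurable_snd).
apply/seteqP; split=> w /=.
  by move=> <- k _; rewrite tnth_mktuple.
move=> H; apply: eq_from_tnth => k; rewrite tnth_mktuple.
by have [-> ->] := H k I; case: (tnth v k).
Unshelve. all: by end_near. Qed.

(** A pointwise limit along [discretize_cvg] of functions of finitely many values of the path. *)
Lemma measurable_functional {d} {Om : measurableType d} (F : D -> R) (W : Om -> D) :
  continuous F -> (forall t, 0 <= t -> measurable_fun setT (fun w => W w t)) ->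
  measurable_fun setT (F \o W).
Proof.
move=> cF mW.
apply: (@measurable_fun_cvg _ _ _ setT
  (fun n w => F (discretize (W w) n.+1%:R^-1 (n.+1 ^ 2)))); last first.
  by move=> w _; exact: (cvg_comp _ _ (@discretize_cvg _ _ (W w)) (cF _)).
move=> n.
apply: (@measurable_step_path _ Om F (n.+1 ^ 2) n.+1%:R^-1
  (fun k w => W w (n.+1%:R^-1 * k%:R)) cF) => k.
by apply: mW; rewrite mulr_ge0// invr_ge0.
Qed.

Definition unif_continuous (F : D -> R) := forall eta, 0 < eta ->
  exists T e, [/\ 0 <= T, 0 < e & forall x y, J1_close T e (x, y) -> `|F x - F y| <= eta].

Lemma unif_continuousW F : unif_continuous F -> continuous F.
Proof.
move=> uF x A [eta /= eta0 HA]; have eta2 : 0 < eta / 2 by rewrite divr_gt0.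
have [T [e [_ e0 H]]] := uF _ eta2.
suff : nbhs x (F @^-1` A) by [].
apply/J1_nbhs; exists T, e; split=> // y /H xy; apply: HA.
by rewrite /ball_/=; apply: le_lt_trans xy _; lra.
Qed.

(** * Inf-convolution of a bounded functional *)

Section regularization.
Variables (F : D -> R) (M : R).
Hypothesis FM : forall x, `|F x| <= M.

(** The inf-convolution of [F] with [k] times a gauge of J1 closeness, the gauge of a pair being the
    infimum of the [e] that make it [e]-close up to the horizon [1 / e]. One parameter governs both
    closeness and horizon. *)
Definition J1_reg (k : R) (x : D) : R :=
  inf [set v | exists y e, [/\ 0 < e, J1_close e^-1 e (x, y) & v = F y + k * e]].

Local Notation S k x :=
  [set v | exists y e, [/\ 0 < e, J1_close e^-1 e (x, y) & v = F y + k * e]].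

Let FMl y : - M <= F y. Proof. by have := FM y; rewrite ler_norml => /andP[]. Qed.
Let FMr y : F y <= M. Proof. by have := FM y; rewrite ler_norml => /andP[]. Qed.

Lemma J1_close_refl T e (x : D) : 0 < e -> J1_close T e (x, x).
Proof.
move=> e0; exists id; first exact: time_change_id.
by split=> [t _|t _] /=; [rewrite subrr normr0|exact: ballxx].
Qed.

Lemma J1_reg_lb k x : 0 <= k -> lbound (S k x) (- M).
Proof.
move=> k0 v [y [e [e0 _ ->]]]; rewrite (le_trans (FMl y))// lerDl mulr_ge0//.
exact: ltW.
Qed.

Lemma J1_reg_ne k x : S k x !=set0.
Proof. by exists (F x + k * 1), x, 1; split=> //; exact: J1_close_refl. Qed.

Lemma J1_reg_le k x y e : 0 <= k -> 0 < e -> J1_close e^-1 e (x, y) ->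
  J1_reg k x <= F y + k * e.
Proof.
move=> k0 e0 xy; apply: ge_inf; first by exists (- M); exact: J1_reg_lb.
by exists y, e.
Qed.

Lemma J1_reg_leF k x : 0 <= k -> J1_reg k x <= F x.
Proof.
move=> k0; apply/ler_addgt0Pr => e e0.
have e1 : 0 < e / (k + 1) by rewrite divr_gt0//; lra.
apply: le_trans (J1_reg_le k0 e1 (J1_close_refl _ x e1)) _.
rewrite lerD2l mulrA ler_pdivrMr; last by lra.
by rewrite mulrC ler_pM2l//; lra.
Qed.

Lemma J1_reg_ge k x : 0 <= k -> - M <= J1_reg k x.
Proof. by move=> k0; apply: lb_le_inf; [exact: J1_reg_ne|exact: J1_reg_lb]. Qed.

Lemma J1_reg_bounded k x : 0 <= k -> `|J1_reg k x| <= M.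
Proof.
by move=> k0; rewrite ler_norml J1_reg_ge//= (le_trans (J1_reg_leF x k0)).
Qed.

(** A triangle inequality for the gauge. When [e + e' < 1], time changes can be composed because
    [1 / (e + e') + e <= 1 / e']. Otherwise the penalty [k * (e + e')] already exceeds [2 * M], the
    largest possible oscillation of [F]. *)
Lemma J1_reg_shift k x x' e : 2 * M <= k -> 0 <= k -> 0 < e ->
  J1_close e^-1 e (x, x') -> J1_reg k x <= J1_reg k x' + k * e.
Proof.
move=> kM k0 e0 [l tl [l1 l2]]; rewrite -lerBlDr.
apply: lb_le_inf; first exact: J1_reg_ne.
move=> v [y [e' [e'0 [l' tl' [l1' l2']] ->]]].
rewrite lerBlDr -addrA -mulrDr [e' + e]addrC.
have ee : 0 < e + e' by lra.
have [ee1|ee1] := leP 1 (e + e').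
  apply: le_trans (J1_reg_leF x k0) _; apply: (le_trans (FMr x)).
  have := FMl y; have : k <= k * (e + e') by rewrite ler_peMr.
  lra.
apply: J1_reg_le => //.
exists (l' \o l); first exact: time_change_comp.
split=> t /=.
  move=> t0; rewrite -(subrKA (l t)) addrC.
  rewrite (le_lt_trans (ler_normD _ _))// ltrD//; last exact: l1.
  exact/l1'/(time_change_ge0 tl).
move=> /andP[t0 tT]; apply: ball_triangle.
  apply: l2; rewrite t0/= (le_trans tT)// lef_pV2 ?posrE//; lra.
apply: l2'; rewrite time_change_ge0//=.
have := l1 t t0; rewrite ltr_distl => /andP[_ /ltW hl].
suff hE : (e + e')^-1 + e <= e'^-1 by rewrite (le_trans hl)// (le_trans _ hE)// lerD2r.
have : (e + e')^-1 + e <= e'^-1.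
  rewrite -lerBrDl.
  have -> : e'^-1 - (e + e')^-1 = e / (e' * (e + e')) by field; rewrite !gt_eqF.
  rewrite ler_peMr ?(ltW e0)// -[leLHS]invr1 lef_pV2 ?posrE ?mulr_gt0//.
  by rewrite mulr_ile1//; lra.
by [].
Qed.

(** [J1_reg_shift] must be used in both directions, and inverting a time change costs [e] of
    horizon; hence the horizon [1 / e + e]. *)
Lemma J1_reg_unif k : 2 * M <= k -> 0 < k -> unif_continuous (J1_reg k).
Proof.
move=> kM k0 eta eta0; pose e := eta / k.
have e0 : 0 < e by rewrite divr_gt0.
have ei : 0 < e^-1 by rewrite invr_gt0.
exists (e^-1 + e), e; split=> //; first lra.
move=> x y xy.
have ke : k * e = eta by rewrite mulrC divfK ?gt_eqF.
have H1 : J1_reg k x <= J1_reg k y + k * e.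
  apply: (J1_reg_shift _ (ltW k0) e0) => //.
  case: xy => l tl [l1 l2]; exists l => //; split=> // t /andP[t0 tT].
  by apply: l2; rewrite t0/=; lra.
have H2 : J1_reg k y <= J1_reg k x + k * e.
  apply: (J1_reg_shift _ (ltW k0) e0) => //.
  case: xy => l tl [l1 l2]; have [m [tm lK mK]] := time_change_inv tl.
  exists m => //; split=> t.
    by move=> t0; have := l1 _ (time_change_ge0 tm t0); rewrite lK// distrC.
  move=> /andP[t0 tT] /=; apply: ball_sym; rewrite -{2}(lK _ t0); apply: l2.
  have mt0 := time_change_ge0 tm t0; rewrite mt0/=.
  have := l1 _ mt0; rewrite lK// distrC ltr_distl => /andP[_ /ltW hm].
  by rewrite (le_trans hm)// lerD2r.
by rewrite ke in H1 H2; rewrite ler_distl H1 andbT lerBlDr H2.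
Qed.

(** A competitor at gauge below [e1] has a value of [F] close to [F x]; one at gauge above [e1] pays
    at least [2 * M] once [n] is large. *)
Lemma J1_reg_cvg x : {for x, continuous F} ->
  J1_reg n.+1%:R x @[n --> \oo] --> F x.
Proof.
move=> cF; apply/cvgrPdist_le => /= eta eta0.
have M0 : 0 <= M by exact: le_trans (FM x).
have : nbhs x [set y | `|F x - F y| <= eta].
  have : nbhs (F x) [set v | `|F x - v| <= eta].
    by exists eta => // v /ltW.
  by move/cF.
move=> /J1_nbhs[T [e0 [e00 H]]].
pose e1 := Num.min e0 (`|T| + 1)^-1.
have T1 : 0 < `|T| + 1 by rewrite ltr_wpDl.
have e10 : 0 < e1 by rewrite lt_min e00 invr_gt0.
near=> n.
have n0 : (0 : R) <= n.+1%:R by [].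
have nM : 2 * M / e1 <= n.+1%:R.
  apply: (@le_trans _ _ n%:R); last by rewrite ler_nat.
  near: n; exact: nbhs_infty_ger.
rewrite ger0_norm; last by rewrite subr_ge0 J1_reg_leF.
rewrite lerBlDr -lerBlDl; apply: lb_le_inf; first exact: J1_reg_ne.
move=> v [y [e [e_0 xy ->]]].
have [ee|ee] := ltP e e1.
  have : `|F x - F y| <= eta.
    apply: H; case: xy => l tl [l1 l2]; exists l => //; split.
      by move=> t t0; apply: lt_le_trans (l1 t t0) (ltW (lt_le_trans ee _)); rewrite ge_min lexx.
    move=> t /andP[t0 tT]; apply: le_ball (l2 t _).
      by apply: ltW; apply: lt_le_trans ee _; rewrite ge_min lexx.
    rewrite t0/= (le_trans tT)// (le_trans (ler_norm T))//.
    apply: (@le_trans _ _ (`|T| + 1)); first by rewrite lerDl.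
    rewrite -[leLHS]invrK lef_pV2 ?posrE ?invr_gt0//.
    by apply: ltW; apply: lt_le_trans ee _; rewrite ge_min lexx orbT.
  have : 0 <= n.+1%:R * e by rewrite mulr_ge0// ltW.
  by rewrite ler_norml => ? /andP[]; lra.
have : 2 * M <= n.+1%:R * e.
  apply: (@le_trans _ _ (n.+1%:R * e1)); first by rewrite -ler_pdivrMr.
  by rewrite ler_wpM2l.
have := FMl y; have := FMr x; lra.
Unshelve. all: by end_near. Qed.

End regularization.

(** Since [J1_reg] lies below [F], convergence for regularized functionals gives an asymptotic lower
    bound for the mean of [F]. The same bound for [- F] is the upper bound. *)
Lemma cvg_in_law_unif {d d'} {Om : measurableType d} {Om' : measurableType d'}
    (Pr : probability Om R) (Pr' : probability Om' R) (Z : nat -> Om -> D) (Zoo : Om' -> D) :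
  (forall N t, 0 <= t -> measurable_fun setT (fun w => Z N w t)) ->
  (forall t, 0 <= t -> measurable_fun setT (fun w => Zoo w t)) ->
  (forall F M, unif_continuous F -> (forall x, `|F x| <= M) ->
    (\int[Pr]_w F (Z N w))%R @[N --> \oo] --> (\int[Pr']_w F (Zoo w))%R) ->
  cvg_in_law Pr Pr' Z Zoo.
Proof.
move=> mZ mZoo H.
have lower (F : D -> R) M eta : continuous F -> (forall x, `|F x| <= M) -> 0 < eta ->
    \forall N \near \oo, (\int[Pr']_w F (Zoo w))%R - eta <= (\int[Pr]_w F (Z N w))%R.
  move=> cF FM eta0; have e2 : 0 < eta / 2 by rewrite divr_gt0.
  have M0 : 0 <= M by exact: le_trans (FM (Zoo point)).
  (* Adding [2 * M] makes every term of the sequence uniformly continuous; [J1_reg] increases with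
     its parameter, so convergence along [n + 1] is inherited. *)
  pose k n : R := n.+1%:R + 2 * M.
  have k0 n : 0 < k n by rewrite /k ltr_pwDl// mulr_ge0.
  have kM n : 2 * M <= k n by rewrite lerDr.
  have cR n := unif_continuousW (J1_reg_unif FM (kM n) (k0 n)).
  have mR n : measurable_fun setT (J1_reg F (k n) \o Zoo) by exact: measurable_functional.
  have : \forall n \near \oo, `|(\int[Pr']_w F (Zoo w))%R - (\int[Pr']_w (J1_reg F (k n) (Zoo w)))%R| <= eta / 2.
    have := @Ex_bounded_cvg _ _ _ Pr' (fun n w => J1_reg F (k n) (Zoo w)) (F \o Zoo) M mR.
    move=> /(_ _ _)/cvgrPdist_le; apply => //.
    - by move=> n w; apply: J1_reg_bounded => //; exact: ltW.
    - move=> w.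
      have /cvgrPdist_le h := @J1_reg_cvg F M FM (Zoo w) (cF (Zoo w)).
      apply/cvgrPdist_le => e e0; have := h e e0; apply: filterS => n /=.
      have F1 := J1_reg_leF FM (Zoo w) (ltW (k0 n)).
      have F2 := J1_reg_leF FM (Zoo w) (ler0n R n.+1).
      rewrite !ger0_norm ?subr_ge0// => h1; apply: le_trans h1; rewrite lerD2l lerN2.
      apply: lb_le_inf; first exact: J1_reg_ne.
      move=> v [y [e' [e'0 xy ->]]].
      apply: le_trans (J1_reg_le FM (ler0n R n.+1) e'0 xy) _.
      by rewrite lerD2l ler_pM2r// lerDl mulr_ge0.
  case=> n _ /(_ n (leqnn n))/= hn.
  have /cvgrPdist_le/(_ _ e2) := H _ M (J1_reg_unif FM (kM n) (k0 n)) (fun x => J1_reg_bounded FM x (ltW (k0 n))).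
  apply: filterS => N.
  have : (\int[Pr]_w J1_reg F (k n) (Z N w))%R <= (\int[Pr]_w F (Z N w))%R.
    apply: le_Ex.
    - split; first exact: (measurable_functional (cR n) (mZ N)).
      by exists M => w; apply: J1_reg_bounded => //; exact: ltW.
    - by split; [exact: (measurable_functional cF (mZ N))|exists M].
    - by move=> w; apply: J1_reg_leF => //; exact: ltW.
  move: hn; rewrite !ler_norml => /andP[_ h1] h2 /andP[_ h3]; lra.
move=> F cF [M0 [_ FM']].
have [M FM] : exists M, forall x, `|F x| <= M.
  by exists (M0 + 1) => x; apply: FM' => //; rewrite ltrDl.
have bZ N : bdd_meas (F \o Z N).
  by split; [exact: (measurable_functional cF (mZ N))|exists M => w; exact: FM].
have bZoo : bdd_meas (F \o Zoo).
  by split; [exact: (measurable_functional cF mZoo)|exists M => w; exact: FM].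
rewrite unlock (ExE Pr' bZoo).
under eq_fun do rewrite (ExE Pr (bZ _)).
apply: cvg_EFin; first exact: nearW.
apply/cvgrPdist_le => /= eta eta0.
have cNF : continuous (fun x => - F x) by move=> x; apply: continuousN; exact: cF.
have FMN x : `|- F x| <= M by rewrite normrN.
have h1 := lower F M eta cF FM eta0.
have h2 := lower _ M eta cNF FMN eta0.
near=> N.
have : (\int[Pr']_w F (Zoo w))%R - eta <= (\int[Pr]_w F (Z N w))%R by near: N.
have : (\int[Pr']_w - F (Zoo w))%R - eta <= (\int[Pr]_w - F (Z N w))%R by near: N.
under eq_Rintegral do rewrite -mulN1r.
under [X in _ <= X -> _]eq_Rintegral do rewrite -mulN1r.
rewrite (ExZ Pr' (-1) bZoo) (ExZ Pr (-1) (bZ N)) ler_norml => a1 a2.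
by rewrite /comp/= in a1 a2 *; apply/andP; split; lra.
Unshelve. all: by end_near. Qed.

End functionals.

(** * The transition operator and the Markov property *)

Section prob_sums.
Context {d} {T : measurableType d} {R : realType} (mu : probability T R).

Lemma prob_le_sum (N : nat) (F : nat -> set T) (A : set T) :
  measurable A -> (forall k, measurable (F k)) ->
  (forall x, A x -> exists2 k, (k < N)%N & F k x) ->
  fine (mu A) <= \sum_(k < N) fine (mu (F k)).
Proof.
move=> mA mF AF; rewrite -Ex_indic//.
rewrite (eq_bigr (fun k : 'I_N => \int[mu]_x (\1_(F k) x)%R)); last first.
  by move=> k _; rewrite Ex_indic.
have bF k : bdd_meas (\1_(F k) : T -> R) by exact: bdd_meas_indic.
rewrite -(@Ex_sum _ _ _ mu _ _ (fun k : 'I_N => \1_(F k) : T -> R))//.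
apply: le_Ex; [exact: bdd_meas_indic|exact: bdd_meas_sum|move=> x].
rewrite indicE; have [/set_mem/AF[k kN Fk]|_] := boolP (x \in A); last first.
  by apply: sumr_ge0 => i _; rewrite indicE.
rewrite (bigD1 (Ordinal kN))//= {1}indicE mem_set//= lerDl.
by apply: sumr_ge0 => i _; rewrite indicE.
Qed.

End prob_sums.

Section kernel_probability.
Context {R : realType} {d : measure_display} {E : measurableType d}.
Variables (P : R.-pker E ~> E) (x : E).

(** Registers [P x] as a probability, so that all the facts on expectations apply to each transition
    law. *)
Definition kernel_fun : set E -> \bar R := P x.

HB.instance Definition _ := Measure.copy kernel_fun (P x).

HB.instance Definition _ :=
  Measure_isProbability.Build _ _ _ kernel_fun (prob_kernel x).

Definition kernel_prob : probability E R := kernel_fun.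

End kernel_probability.

Section transition.
Context {R : realType} {d : measure_display} {E : measurableType d}.
Variables (P : R.-pker E ~> E) (pi : probability E R).
Hypothesis hinv : invariant_law P pi.
Implicit Types f g : E -> R.

Definition Pop f (x : E) : R := (\int[P x]_y f y)%R.

Lemma Pop_kernel_prob f x : Pop f x = (\int[kernel_prob P x]_y f y)%R.
Proof. by []. Qed.

Lemma PopE f x : bdd_meas f -> transition_op P f x = (Pop f x)%:E.
Proof. exact: (@ExE _ _ _ (kernel_prob P x)). Qed.

Lemma Pop_cst c : Pop (fun=> c) = fun=> c.
Proof. by apply/funext => x; exact: (@Ex_cst _ _ _ (kernel_prob P x)). Qed.

Lemma PopD f g : bdd_meas f -> bdd_meas g ->
  Pop (fun x => f x + g x) = fun x => Pop f x + Pop g x.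
Proof. by move=> bf bg; apply/funext => x; exact: (@ExD _ _ _ (kernel_prob P x)). Qed.

Lemma PopB f g : bdd_meas f -> bdd_meas g ->
  Pop (fun x => f x - g x) = fun x => Pop f x - Pop g x.
Proof. by move=> bf bg; apply/funext => x; exact: (@ExB _ _ _ (kernel_prob P x)). Qed.

Lemma PopZ c f : bdd_meas f -> Pop (fun x => c * f x) = fun x => c * Pop f x.
Proof. by move=> bf; apply/funext => x; exact: (@ExZ _ _ _ (kernel_prob P x)). Qed.

Lemma Pop_indic A x : measurable A -> Pop \1_A x = fine (P x A).
Proof. exact: (@Ex_indic _ _ _ (kernel_prob P x)). Qed.

Lemma le_Pop f g x : bdd_meas f -> bdd_meas g -> (forall y, f y <= g y) ->
  Pop f x <= Pop g x.
Proof. exact: (@le_Ex _ _ _ (kernel_prob P x)). Qed.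

Lemma bdd_meas_Pop f : bdd_meas f -> bdd_meas (Pop f).
Proof.
move=> bf; have [M M0 fM] := bdd_meas_bounded bf; split; last first.
  exists M => x; exact: (@norm_Ex_le _ _ _ (kernel_prob P x)).
have bM : bdd_meas (fun x => f x + M) by apply: bdd_measD => //; exact: bdd_meas_cst.
(* The integral of a nonnegative function against a finite kernel is measurable; [f] is shifted by
   its bound to become nonnegative. *)
have -> : Pop f = fun x => fine (\int[P x]_y (f y + M)%:E)%E - M.
  apply/funext => x; rewrite -[X in X - M]/(Pop (fun y => f y + M) x).
  by rewrite PopD ?Pop_cst ?addrK//; exact: bdd_meas_cst.
apply: measurable_funB => //.
apply: measurableT_comp => //.
apply: (@measurable_fun_integral_finite_kernel _ _ _ _ _ (fun z : E * E => (f z.2 + M)%:E) P).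
  by move=> z; rewrite lee_fin; have := fM z.2; rewrite ler_norml => /andP[]; lra.
apply/measurable_EFinP; apply: (measurableT_comp bM.1); exact: measurable_snd.
Qed.

Lemma Ex_Pop f : bdd_meas f -> (\int[pi]_x Pop f x = \int[pi]_x f x)%R.
Proof.
move: f; apply: bdd_meas_ind => [A mA|f g bf bg|c f bf|f bf H].
- rewrite Ex_indic// -hinv// /Rintegral; congr fine.
  by apply: eq_integral => x _; rewrite Pop_indic// fineK// (@fin_num_measure _ _ _ (kernel_prob P x)).
- by move=> h1 h2; rewrite PopD// !ExD//; [rewrite h1 h2|exact: bdd_meas_Pop..].
- by move=> h1; rewrite PopZ// !ExZ//; [rewrite h1|exact: bdd_meas_Pop].
- apply/eqP; rewrite -subr_eq0 -normr_eq0 eq_le normr_ge0 andbT.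
  apply/ler_addgt0Pr => e e0; rewrite add0r.
  have e20 : 0 < e / 2 by rewrite divr_gt0.
  have [g [bg gE fg]] := H _ e20.
  have h1 := @norm_ExB_le _ _ _ pi f g (e / 2) bf bg fg.
  have h2 : `|\int[pi]_x Pop f x - \int[pi]_x Pop g x| <= e / 2.
    apply: norm_ExB_le; [exact: bdd_meas_Pop..|move=> x].
    exact: (@norm_ExB_le _ _ _ (kernel_prob P x)).
  rewrite (splitr e); apply: le_trans (lerD h2 h1).
  rewrite gE [X in _ <= _ + X]distrC; apply: le_trans (ler_normD _ _).
  by rewrite addrA subrK.
Qed.

Local Notation q f := (\int[pi]_x (f x ^+ 2))%R.

Lemma sqr_Pop_le f x : bdd_meas f -> Pop f x ^+ 2 <= Pop (fun y => f y ^+ 2) x.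
Proof.
move=> bf.
have := @Ex_cauchy_schwarz _ _ _ (kernel_prob P x) f (fun=> 1) bf (bdd_meas_cst 1).
under eq_Rintegral do rewrite mulr1.
by rewrite expr1n Ex_cst mulr1.
Qed.

Lemma q_Pop_le f : bdd_meas f -> q (Pop f) <= q f.
Proof.
move=> bf; rewrite -(Ex_Pop (bdd_meas_sqr bf)); apply: le_Ex.
- exact/bdd_meas_sqr/bdd_meas_Pop.
- exact/bdd_meas_Pop/bdd_meas_sqr.
- by move=> x; exact: sqr_Pop_le.
Qed.

Lemma q_ge0 f : 0 <= q f.
Proof. by apply: Ex_ge0 => x; exact: sqr_ge0. Qed.

Lemma Lnorm2 f : bdd_meas f -> 'N[pi]_2%:E[EFin \o f]%E = (Num.sqrt (q f))%:E.
Proof.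
move=> bf; rewrite unlock -powR12_sqrt ?q_ge0//.
rewrite (_ : (\int[pi]_x _)%E = (q f)%:E) ?poweR_EFin//.
rewrite -ExE; last exact: bdd_meas_sqr.
apply: eq_integral => x _ /=.
by rewrite powR_mulrn// -normrX ger0_norm// sqr_ge0.
Qed.

(** The gap is stated for normalized functions, so [f] is rescaled; [f] of zero norm is handled by
    the contraction property. The maximum of [a^2] with [1 / 2] keeps [k] positive, which allows
    divisions by [k] later on. *)
Lemma spectral_gap_sqr : spectral_gap P pi -> exists2 k : R, 0 < k < 1 &
  forall f, bdd_meas f -> (\int[pi]_x f x = 0)%R -> q (Pop f) <= k * q f.
Proof.
rewrite /spectral_gap; set S := [set _ | _ in _] => S1.
(* When no centered function has norm 1 the supremum is minus infinity; the maximum with 0 is finite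
   in all cases. *)
pose a := fine (maxe 0%E (ereal_sup S)).
have aE : maxe 0%E (ereal_sup S) = a%:E.
  rewrite fineK// ge0_fin_numE ?le_max ?lexx//.
  by rewrite gt_max lt0y/= (lt_trans S1)// ltry.
have a0 : 0 <= a by rewrite -lee_fin -aE le_max lexx.
have a1 : a < 1 by rewrite -lte_fin -aE gt_max S1 lte01.
exists (Num.max (1 / 2) (a ^+ 2)).
  rewrite gt_max lt_max; apply/andP; split; first by rewrite divr_gt0.
  by rewrite expr_lt1// a1 andbT ltr_pdivrMr// mul1r ltr1n.
move=> f bf f0.
have [qf0|qf0] := eqVneq (q f) 0.
  by rewrite {1}qf0 mulr0 -{1}qf0; exact: q_Pop_le.
have qf : 0 < q f by rewrite lt_neqAle eq_sym qf0 q_ge0.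
pose c := (Num.sqrt (q f))^-1.
have c0 : 0 < c by rewrite invr_gt0 sqrtr_gt0.
have cq : c ^+ 2 * q f = 1 by rewrite exprVn sqr_sqrtr ?q_ge0// mulVf.
have bcf : bdd_meas (fun x => c * f x) by exact: bdd_measZ.
have qc g : bdd_meas g -> q (fun x => c * g x) = c ^+ 2 * q g.
  move=> bg; rewrite -ExZ; last exact: bdd_meas_sqr.
  by apply: eq_Rintegral => x _; rewrite exprMn.
have H : ((Num.sqrt (q (Pop (fun x => c * f x))))%:E <= a%:E)%E.
  rewrite -aE le_max; apply/orP; right.
  apply: ereal_sup_ubound; exists (fun x => c * f x).
    split; [exact: bcf.1| |].
      by rewrite ExE// ExZ// f0 mulr0.
    by rewrite Lnorm2// qc// cq sqrtr1.
  rewrite -Lnorm2; last exact: bdd_meas_Pop.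
  by congr Lnorm; apply/funext => x; rewrite PopE.
move: H; rewrite lee_fin PopZ// qc; last exact: bdd_meas_Pop.
move=> H; have {}H : c ^+ 2 * q (Pop f) <= a ^+ 2.
  have h0 : 0 <= c ^+ 2 * q (Pop f) by apply: mulr_ge0; [exact: sqr_ge0|exact: q_ge0].
  rewrite -[leLHS](sqr_sqrtr h0).
  by rewrite lerXn2r ?nnegrE ?sqrtr_ge0.
have c20 : 0 < c ^+ 2 by rewrite exprn_gt0.
rewrite -(ler_pM2l c20) mulrCA cq mulr1.
by rewrite (le_trans H)// le_max lexx orbT.
Qed.

End transition.

Section markov.
Context {R : realType} {d : measure_display} {E : measurableType d}
  {d1 : measure_display} {Om : measurableType d1} (Pr : probability Om R).
Variables (P : R.-pker E ~> E) (pi : probability E R) (X : nat -> {RV Pr >-> E}).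
Hypothesis hchain : markov_chain P X.
Hypothesis hlaw : forall B, measurable B -> distribution Pr (X 0%N) B = pi B.
Hypothesis hinv : invariant_law P pi.
Implicit Types f g : E -> R.

Definition past_gen (n : nat) : set (set Om) :=
  [set A | exists2 k, (k <= n)%N & exists2 B, measurable B & A = X k @^-1` B].

Local Notation pastT n := (g_sigma_algebraType (past_gen n)).

(** The past sigma-algebra is made into a measurable space of its own, so that the calculus of
    [bdd_meas] and its induction principle apply to functions of [X 0], ..., [X n]. *)
Definition past_bdd (n : nat) (H : Om -> R) := @bdd_meas _ (pastT n) R H.

Lemma past_sub_measurable n (A : set Om) :
  @measurable _ (pastT n) A -> measurable A.
Proof.
move: A; apply: smallest_sub; first exact: sigma_algebra_measurable.
by move=> A [k _ [B mB ->]]; rewrite -[X in measurable X]setTI; exact: measurable_funP.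
Qed.

Lemma measurable_past n k : (k <= n)%N ->
  @measurable_fun _ _ (pastT n) E setT (X k).
Proof.
move=> kn _ B mB; rewrite setTI; apply: sub_sigma_algebra.
by exists k => //; exists B.
Qed.

Lemma past_bdd_meas n H : past_bdd n H -> bdd_meas H.
Proof.
move=> [mH bH]; split=> // mT B mB; apply: (@past_sub_measurable n).
exact: mH.
Qed.

Lemma past_meas_mono n m (H : Om -> R) : (n <= m)%N ->
  measurable_fun (setT : set (pastT n)) H -> measurable_fun (setT : set (pastT m)) H.
Proof.
move=> nm mH mT B mB.
have : @measurable _ (pastT n) (setT `&` H @^-1` B) by exact: mH.
apply: smallest_sub; first exact: sigma_algebra_measurable.
move=> A [k kn [C mC ->]]; apply: sub_sigma_algebra.
by exists k; [exact: leq_trans nm|exists C].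
Qed.

Lemma past_bdd_comp n k f : (k <= n)%N -> bdd_meas f -> past_bdd n (fun w => f (X k w)).
Proof. by move=> kn bf; apply: bdd_meas_comp bf; exact: measurable_past. Qed.

Lemma bdd_meas_X k f : bdd_meas f -> bdd_meas (fun w => f (X k w)).
Proof. by move=> bf; apply: (@past_bdd_meas k); exact: past_bdd_comp. Qed.

Lemma Ex_markov_indic n (A : set Om) f : @measurable _ (pastT n) A -> bdd_meas f ->
  (\int[Pr]_w (\1_A w * f (X n.+1 w)) = \int[Pr]_w (\1_A w * Pop P f (X n w)))%R.
Proof.
move=> mA bf.
have mA' : @measurable _ Om A by exact: past_sub_measurable mA.
have bA : bdd_meas (\1_A : Om -> R) by exact: bdd_meas_indic.
have bM k g : bdd_meas g -> bdd_meas (fun w => \1_A w * g (X k w)).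
  by move=> bg; apply: bdd_measM => //; exact: bdd_meas_X.
move: f bf; apply: bdd_meas_ind => [B mB|f g bf bg|c f bf|f bf hf].
- transitivity (fine (Pr (A `&` X n.+1 @^-1` B))).
    rewrite -Ex_indic; last first.
      by apply: measurableI => //; rewrite -[X in measurable X]setTI; exact: measurable_funP.
    by apply: eq_Rintegral => w _; rewrite indicI.
  rewrite (hchain mA mB) /Rintegral [in LHS]integral_mkcond; congr fine.
  apply: eq_integral => w _; rewrite Pop_indic// patchE indicE; case: ifPn => _.
    by rewrite mul1r fineK// (@fin_num_measure _ _ _ (kernel_prob P (X n w))).
  by rewrite mul0r.
- move=> h1 h2; rewrite PopD//.
  under eq_Rintegral do rewrite mulrDr.
  under [RHS]eq_Rintegral do rewrite mulrDr.
  by rewrite !ExD ?h1 ?h2//; (apply: bM => //; exact: bdd_meas_Pop).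
- move=> h1; rewrite PopZ//.
  under eq_Rintegral do rewrite mulrCA.
  under [RHS]eq_Rintegral do rewrite mulrCA.
  by rewrite !ExZ ?h1//; (apply: bM => //; exact: bdd_meas_Pop).
- apply/eqP; rewrite -subr_eq0 -normr_eq0 eq_le normr_ge0 andbT.
  apply/ler_addgt0Pr => e e0; rewrite add0r.
  have e20 : 0 < e / 2 by rewrite divr_gt0.
  have [g [bg gE fg]] := hf _ e20.
  have A1 x (y z : R) : `|y - z| <= e / 2 -> `|\1_A x * y - \1_A x * z| <= e / 2.
    rewrite -mulrBr normrM indicE; case: (x \in A) => h; first by rewrite normr1 mul1r.
    by rewrite normr0 mul0r ltW.
  have h1 := norm_ExB_le Pr (bM n.+1 f bf) (bM n.+1 g bg) (fun w => A1 w _ _ (fg _)).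
  have h2 := norm_ExB_le Pr (bM n _ (bdd_meas_Pop P bf)) (bM n _ (bdd_meas_Pop P bg))
    (fun w => A1 w _ _ (@norm_ExB_le _ _ _ (kernel_prob P (X n w)) _ _ _ bf bg fg)).
  rewrite (splitr e); apply: le_trans (lerD h1 h2).
  rewrite gE [X in _ <= _ + X]distrC; apply: le_trans (ler_normD _ _).
  by rewrite addrA subrK.
Qed.

(** The chain is Markov on events by hypothesis. The previous lemma extends the identity to bounded
    [f] over a fixed past event; here a second induction, over the past sigma-algebra, replaces the
    event by [H]. *)
Lemma Ex_markov n H f : past_bdd n H -> bdd_meas f ->
  (\int[Pr]_w (H w * f (X n.+1 w)) = \int[Pr]_w (H w * Pop P f (X n w)))%R.
Proof.
move=> bH bf; move: H bH; apply: (@bdd_meas_ind _ (pastT n) R (fun H =>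
  \int[Pr]_w (H w * f (X n.+1 w)) = \int[Pr]_w (H w * Pop P f (X n w)))%R)
  => [A mA|H G bH bG|c H bH|H bH hH].
- exact: Ex_markov_indic.
- have bHo := past_bdd_meas bH; have bGo := past_bdd_meas bG.
  have b1 := bdd_meas_X n.+1 bf; have b2 := bdd_meas_X n (bdd_meas_Pop P bf).
  move=> h1 h2; under eq_Rintegral do rewrite mulrDl.
  under [RHS]eq_Rintegral do rewrite mulrDl.
  by rewrite !ExD ?h1 ?h2//; exact: bdd_measM.
- have bHo := past_bdd_meas bH.
  have b1 := bdd_meas_X n.+1 bf; have b2 := bdd_meas_X n (bdd_meas_Pop P bf).
  move=> h1; under eq_Rintegral do rewrite -mulrA.
  under [RHS]eq_Rintegral do rewrite -mulrA.
  by rewrite !ExZ ?h1//; exact: bdd_measM.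
- have bHo := past_bdd_meas bH.
  have b1 := bdd_meas_X n.+1 bf; have b2 := bdd_meas_X n (bdd_meas_Pop P bf).
  have [M M0 fM] := bdd_meas_bounded bf.
  apply/eqP; rewrite -subr_eq0 -normr_eq0 eq_le normr_ge0 andbT.
  apply/ler_addgt0Pr => e e0; rewrite add0r.
  have e20 : 0 < e / (2 * (M + 1)) by rewrite divr_gt0// mulr_gt0//; lra.
  have [G [bG GE HG]] := hH _ e20.
  have bGo := past_bdd_meas bG.
  have A1 x (y : R) : `|y| <= M -> `|H x * y - G x * y| <= e / 2.
    move=> yM; rewrite -mulrBl normrM.
    apply: (@le_trans _ _ (e / (2 * (M + 1)) * (M + 1))).
      by apply: ler_pM => //; lra.
    by rewrite invfM mulrA mulfVK//; lra.
  have h1 := norm_ExB_le Pr (bdd_measM bHo b1) (bdd_measM bGo b1) (fun w => A1 w _ (fM _)).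
  have h2 := norm_ExB_le Pr (bdd_measM bHo b2) (bdd_measM bGo b2)
    (fun w => A1 w _ (@norm_Ex_le _ _ _ (kernel_prob P (X n w)) _ _ bf fM)).
  rewrite (splitr e); apply: le_trans (lerD h1 h2).
  rewrite GE [X in _ <= _ + X]distrC; apply: le_trans (ler_normD _ _).
  by rewrite addrA subrK.
Qed.

Lemma Ex_X n f : bdd_meas f -> (\int[Pr]_w f (X n w) = \int[pi]_x f x)%R.
Proof.
elim: n f => [|n IH] f bf.
  have h : (\int[distribution Pr (X 0%N)]_x (f x)%:E = \int[pi]_x (f x)%:E)%E.
    by apply: eq_measure_integral => B mB _; exact: hlaw.
  rewrite /Rintegral -h integral_distribution//; first exact/measurable_EFinP/bf.1.
  exact: (bdd_meas_integrable Pr (bdd_meas_X 0%N bf)).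
have b1 : past_bdd n (fun=> 1) by exact: bdd_meas_cst.
have := Ex_markov b1 bf.
under eq_Rintegral do rewrite mul1r.
under [RHS]eq_Rintegral do rewrite mul1r.
by move=> ->; rewrite IH ?Ex_Pop//; exact: bdd_meas_Pop.
Qed.

Lemma prob_X n A : measurable A -> Pr (X n @^-1` A) = pi A.
Proof.
move=> mA; have := Ex_X n (bdd_meas_indic mA : bdd_meas (\1_A : E -> R)).
rewrite (Ex_indic pi mA) => h.
have mX : measurable (X n @^-1` A).
  by rewrite -[X in measurable X]setTI; exact: measurable_funP.
rewrite -[LHS]fineK ?fin_num_measure// -[RHS]fineK ?fin_num_measure// -h.
by rewrite -Ex_indic.
Qed.

End markov.

(** * Mixing and fluctuations of Birkhoff sums *)

Lemma sqrD_young (R : realType) (s x y : R) : 0 < s ->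
  (x + y) ^+ 2 <= (1 + s^-1) * x ^+ 2 + (1 + s) * y ^+ 2.
Proof.
move=> s0; rewrite -subr_ge0.
rewrite (_ : _ - _ = s^-1 * (x - s * y) ^+ 2).
  by rewrite mulr_ge0 ?sqr_ge0// invr_ge0 ltW.
by field; rewrite gt_eqF.
Qed.

(** The fixed point [C] of [C = (1 + k) / (1 - k) + (1 + k) / 2 * C]. *)
Definition gap_const {R : realType} (k : R) := 2 * (1 + k) / (1 - k) ^+ 2.

(* Iterating [Q' <= (1 + 1/s) e + (1 + s) k Q] with [(1 + s) k = (1 + k) / 2]. *)
Lemma gap_step (R : realType) (k e Q Q' : R) : 0 < k < 1 ->
  (forall s, 0 < s -> Q' <= (1 + s^-1) * e + (1 + s) * (k * Q)) ->
  Q <= gap_const k * e -> Q' <= gap_const k * e.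
Proof.
move=> /andP[k0 k1] QS IH.
have k10 : 1 - k != 0 by rewrite subr_eq0 eq_sym lt_eqF.
have s0 : 0 < (1 - k) / (2 * k) by rewrite divr_gt0//; lra.
apply: le_trans (QS _ s0) _.
have -> : (1 + (1 - k) / (2 * k)) * (k * Q) = (1 + k) / 2 * Q.
  by field; rewrite gt_eqF.
have -> : (1 + ((1 - k) / (2 * k))^-1) * e = (1 + k) / (1 - k) * e.
  by field; rewrite k10 gt_eqF.
apply: (@le_trans _ _ ((1 + k) / (1 - k) * e + (1 + k) / 2 * (gap_const k * e))).
  by rewrite lerD2l ler_wpM2l// divr_ge0//; lra.
rewrite /gap_const le_eqVlt; apply/orP; left; apply/eqP; field; exact: k10.
Qed.

Lemma gap_const_ge0 (R : realType) (k : R) : 0 < k < 1 -> 0 <= gap_const k.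
Proof.
by case/andP=> *; rewrite /gap_const divr_ge0 ?exprn_ge0 ?mulr_ge0//; lra.
Qed.

Section mixing.
Context {R : realType} {d : measure_display} {E : measurableType d}.
Variables (P : R.-pker E ~> E) (pi : probability E R) (k : R).
Hypothesis hinv : invariant_law P pi.
Hypothesis k01 : 0 < k < 1.
Local Notation q f := (\int[pi]_x (f x ^+ 2))%R.
Hypothesis hgap : forall f : E -> R, bdd_meas f -> (\int[pi]_x f x = 0)%R ->
  q (Pop P f) <= k * q f.
Implicit Types f g : E -> R.

Lemma q_add_young f g s : bdd_meas f -> bdd_meas g -> 0 < s ->
  q (fun x => f x + g x) <= (1 + s^-1) * q f + (1 + s) * q g.
Proof.
move=> bf bg s0; have bf2 := bdd_meas_sqr bf; have bg2 := bdd_meas_sqr bg.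
rewrite -!ExZ// -ExD; [|exact: bdd_measZ..].
apply: le_Ex => [||x].
- by apply: bdd_meas_sqr; exact: bdd_measD.
- by apply: bdd_measD; exact: bdd_measZ.
- exact: sqrD_young.
Qed.

Lemma q_center f : bdd_meas f -> q (fun x => f x - \int[pi]_y f y)%R <= q f.
Proof.
move=> bf; set m := (\int[pi]_y f y)%R.
have -> : q (fun x => f x - m) = q f - m ^+ 2.
  have -> : q (fun x => f x - m) = (\int[pi]_x (f x ^+ 2 + ((- 2 * m) * f x + m ^+ 2)))%R.
    by apply: eq_Rintegral => x _; ring.
  rewrite ExD ?ExD ?ExZ ?Ex_cst -/m//; first ring.
  - exact: bdd_meas_cst.
  - exact: bdd_measZ.
  - exact: bdd_meas_cst.
  - exact: bdd_meas_sqr.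
  - by apply: bdd_measD; [exact: bdd_measZ|exact: bdd_meas_cst].
by rewrite lerBlDr lerDl sqr_ge0.
Qed.

Lemma q_Pop_center f : bdd_meas f ->
  q (fun x => Pop P f x - \int[pi]_y f y)%R <= k * q f.
Proof.
move=> bf; set m := (\int[pi]_y f y)%R.
have bm : bdd_meas (fun x => f x - m) by apply: bdd_measB => //; exact: bdd_meas_cst.
have PE x : Pop P f x - m = Pop P (fun x => f x - m) x.
  by rewrite PopB ?Pop_cst//; exact: bdd_meas_cst.
under eq_Rintegral do rewrite PE.
apply: (@le_trans _ _ (k * q (fun x => f x - m))).
  by apply: hgap => //; rewrite ExB ?Ex_cst ?subrr//; exact: bdd_meas_cst.
by rewrite ler_pM2l ?q_center//; case/andP: k01.
Qed.

Definition Piter m g := iter m (Pop P) g.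

Lemma bdd_meas_Piter m g : bdd_meas g -> bdd_meas (Piter m g).
Proof. by move=> bg; elim: m => //= m; exact: bdd_meas_Pop. Qed.

Lemma Ex_Piter m g : bdd_meas g -> (\int[pi]_x Piter m g x = \int[pi]_x g x)%R.
Proof.
by move=> bg; elim: m => //= m <-; rewrite Ex_Pop//; exact: bdd_meas_Piter.
Qed.

Lemma q_Piter m g : bdd_meas g -> (\int[pi]_x g x = 0)%R ->
  q (Piter m g) <= k ^+ m * q g.
Proof.
move=> bg g0; elim: m => [|m IH]; first by rewrite expr0 mul1r.
rewrite exprS -mulrA; apply: le_trans (hgap (bdd_meas_Piter m bg) _) _.
  by rewrite Ex_Piter.
by rewrite ler_pM2l//; case/andP: k01.
Qed.

(** The partial sum of [P^j g] over [j < m], a truncated resolvent. A finite sum stays bounded and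
    defined at every point, unlike the L2 sum of the whole series. *)
Fixpoint potential m g : E -> R :=
  if m is m'.+1 then fun x => g x + Pop P (potential m' g) x else fun=> 0.

Lemma bdd_meas_potential m g : bdd_meas g -> bdd_meas (potential m g).
Proof.
move=> bg; elim: m => [|m IH]; first exact: bdd_meas_cst.
by apply: bdd_measD => //; exact: bdd_meas_Pop.
Qed.

Lemma Ex_potential m g : bdd_meas g -> (\int[pi]_x g x = 0)%R ->
  (\int[pi]_x potential m g x = 0)%R.
Proof.
move=> bg g0; elim: m => [|m IH]; first exact: Ex_cst.
have bp := bdd_meas_potential m bg.
by rewrite ExD ?Ex_Pop ?IH ?g0 ?addr0//; exact: bdd_meas_Pop.
Qed.

Lemma potentialS m g : bdd_meas g ->
  potential m.+1 g = fun x => potential m g x + Piter m g x.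
Proof.
move=> bg; elim: m => [|m IH].
  by apply/funext => x /=; rewrite Pop_cst addr0 add0r.
have bp := bdd_meas_potential m bg; have bi := bdd_meas_Piter m bg.
rewrite [LHS]/= -/(potential m.+1 g) IH; apply/funext => x.
rewrite PopD//= addrA.
by rewrite -[potential m g x + Piter m g x]/((fun x => potential m g x + Piter m g x) x) -IH.
Qed.

(** Comparing the two recursions of the partial sums gives the Poisson equation up to the remainder
    [P^m g], which is exponentially small in L2 when [g] is centered. *)
Lemma poisson_eq m g x : bdd_meas g ->
  g x = potential m g x - Pop P (potential m g) x + Piter m g x.
Proof.
move=> bg; have := congr1 (fun f => f x) (potentialS m bg); rewrite /= => h; lra.
Qed.

(** The recursion for [potential] adds [g] to a function contracted by [k], so [gap_step] gives a
    bound that does not depend on [m]. *)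
Lemma q_potential m g : bdd_meas g -> (\int[pi]_x g x = 0)%R ->
  q (potential m g) <= gap_const k * q g.
Proof.
move=> bg g0; elim: m => [|n IH].
  by rewrite /= expr0n/= Ex_cst mulr_ge0 ?gap_const_ge0// q_ge0.
apply: gap_step k01 _ IH => s s0; have bp := bdd_meas_potential n bg.
apply: le_trans (q_add_young bg (bdd_meas_Pop P bp) s0) _.
by rewrite lerD2l ler_pM2l ?addr_gt0// hgap// Ex_potential.
Qed.

(** After its mean is removed, the sum of [P^(n+1) g] is a potential of the centered function [P g],
    and Cauchy-Schwarz applies. Starting from [P g] rather than [g] is essential: for indicators of
    large jumps the norm of [P g] is far smaller. *)
Lemma correlation_sum f g N : bdd_meas f -> bdd_meas g ->
  (forall x, 0 <= f x <= 1) -> (forall x, 0 <= g x) ->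
  \sum_(n < N) (\int[pi]_x (f x * Piter n.+1 g x))%R <=
  N%:R * ((\int[pi]_x f x) * (\int[pi]_x g x))%R +
  2 * Num.sqrt (gap_const k * (\int[pi]_x f x)%R * q (Pop P g)).
Proof.
move=> bf bg f01 g0.
set mf := (\int[pi]_x f x)%R; set mg := (\int[pi]_x g x)%R.
pose g1 x := Pop P g x - mg.
have bP := bdd_meas_Pop P bg.
have bg1 : bdd_meas g1 by apply: bdd_measB => //; exact: bdd_meas_cst.
have g10 : (\int[pi]_x g1 x = 0)%R.
  by rewrite ExB ?Ex_cst ?Ex_Pop ?subrr//; exact: bdd_meas_cst.
have PiE n x : Piter n.+1 g x = Piter n g1 x + mg.
  rewrite /Piter iterSr; elim: n x => [|n IH] x; first by rewrite /= /g1 subrK.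
  rewrite [LHS]/= -/(Piter n (Pop P g)) (_ : Piter n _ = fun x => Piter n g1 x + mg).
    by rewrite PopD ?Pop_cst//; [exact: bdd_meas_Piter|exact: bdd_meas_cst].
  by apply/funext => y; exact: IH.
have b n : bdd_meas (fun x => f x * Piter n g1 x).
  by apply: bdd_measM => //; exact: bdd_meas_Piter.
have -> : \sum_(n < N) (\int[pi]_x (f x * Piter n.+1 g x))%R =
   N%:R * (mf * mg) + (\int[pi]_x (f x * potential N g1 x))%R.
  have pE m x : potential m g1 x = \sum_(n < m) Piter n g1 x.
    elim: m => [|m IH]; first by rewrite big_ord0.
    by rewrite potentialS// big_ord_recr/= -IH.
  under [X in _ = _ + X]eq_Rintegral do rewrite pE mulr_sumr.
  rewrite (@Ex_sum _ _ _ pi _ _ (fun n : 'I_N => fun x => f x * Piter n g1 x))//.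
  rewrite -[N in N%:R]card_ord -sumr_const mulr_suml -big_split/=.
  apply: eq_bigr => n _; rewrite mul1r.
  have PiE' y : Pop P (Piter n g) y = Piter n g1 y + mg := PiE n y.
  under eq_Rintegral do rewrite PiE' mulrDr addrC [f _ * mg]mulrC.
  by rewrite ExD ?ExZ ?[mg * _]mulrC//; exact: bdd_measZ.
rewrite lerD2l; apply: le_trans (ler_norm _) _.
have h := Ex_cauchy_schwarz pi bf (bdd_meas_potential N bg1).
have h2 : (\int[pi]_x (f x ^+ 2))%R <= mf.
  apply: le_Ex => //; first exact: bdd_meas_sqr.
  by move=> x; have /andP[x0 x1] := f01 x; rewrite expr2 ler_piMl.
have mf0 : 0 <= mf by apply: Ex_ge0 => x; case/andP: (f01 x).
have C0 : 0 <= gap_const k.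
  exact: gap_const_ge0.
have h3 : q (potential N g1) <= gap_const k * q (Pop P g).
  apply: le_trans (q_potential N bg1 g10) _.
  rewrite ler_wpM2l// /g1 /mg -(Ex_Pop hinv bg); exact: q_center.
set A := gap_const k * mf * q (Pop P g).
have A0 : 0 <= A by apply: mulr_ge0; [exact: mulr_ge0|exact: q_ge0].
have h4 : (\int[pi]_x (f x * potential N g1 x))%R ^+ 2 <= A.
  apply: le_trans h _; rewrite /A -mulrA mulrCA.
  by apply: ler_pM => //; exact: q_ge0.
have := sqrtr_ge0 A => sA.
rewrite -sqrtr_sqr; apply: (@le_trans _ _ (Num.sqrt A)); last by lra.
by rewrite ler_wsqrtr.
Qed.

End mixing.

(** * Maximal inequalities along the chain *)

Section maximal.
Context {R : realType} {d : measure_display} {E : measurableType d}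
  {d1 : measure_display} {Om : measurableType d1} (Pr : probability Om R).
Variables (P : R.-pker E ~> E) (pi : probability E R) (X : nat -> {RV Pr >-> E}).

Lemma measurable_norm_ge {d'} {T : measurableType d'} (f : T -> R) e :
  measurable_fun setT f -> measurable [set x | e <= `|f x|].
Proof.
move=> mf; rewrite (_ : [set _ | _] = (fun x => `|f x|) @^-1` `[e, +oo[).
  by rewrite -[X in measurable X]setTI; apply: measurableT_comp.
by apply/seteqP; split=> x /=; rewrite in_itv/= andbT.
Qed.

(** Kolmogorov's inequality for martingale differences, proved with a functional instead of a
    stopping time: [Phi] equals [e^2] once the level has been reached and the squared sum before.
    One step raises it by at most the square of the difference plus a term orthogonal to the
    past. *)
Lemma kolmogorov_ineq (D : nat -> Om -> R) (e : R) N : 0 < e ->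
  (forall n, past_bdd X n.+1 (D n)) ->
  (forall n H, past_bdd X n H -> (\int[Pr]_w (H w * D n w) = 0)%R) ->
  exists2 A : set Om, measurable A /\
      fine (Pr A) <= (\sum_(n < N) (\int[Pr]_w (D n w ^+ 2))%R) / e ^+ 2 &
    forall w, ~ A w -> forall n, (n <= N)%N -> `|\sum_(k < n) D k w| < e.
Proof.
move=> e0 pD oD.
pose M n w := \sum_(k < n) D k w.
have pM n : past_bdd X n (M n).
  apply: bdd_meas_sum => i; have [mD bD] := pD i; split=> //.
  by apply: past_meas_mono mD; exact: ltn_ord.
(* The event that the level [e] has been reached by time [n]. *)
pose B := fix B n : set Om := if n is m.+1 then B m `|` [set w | e <= `|M m.+1 w|]
  else set0.
have mB n : @measurable _ (g_sigma_algebraType (past_gen X n)) (B n).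
  elim: n => [|n IH]; first exact: measurable0.
  apply: measurableU; last exact: (measurable_norm_ge _ (pM n.+1).1).
  have : @measurable_fun _ _ (g_sigma_algebraType (past_gen X n.+1)) _ setT (\1_(B n) : _ -> R).
    by apply: (@past_meas_mono _ _ _ _ _ _ _ n) => //; apply/measurable_indicP.
  by move/measurable_indicP.
have mB' n : measurable (B n) by exact: past_sub_measurable (mB n).
have pB n : past_bdd X n (\1_(B n) : Om -> R) by apply: bdd_meas_indic.
have bB n := past_bdd_meas (pB n); have bM n := past_bdd_meas (pM n).
have bD n := past_bdd_meas (pD n).
pose Phi n w := e ^+ 2 * \1_(B n) w + (1 - \1_(B n) w) * M n w ^+ 2.
have pH n : past_bdd X n (fun w => 2 * ((1 - \1_(B n) w) * M n w)).
  exact: (bdd_measZ 2 (bdd_measM (bdd_measB (bdd_meas_cst 1) (pB n)) (pM n))).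
have bPhi n : bdd_meas (Phi n).
  apply: bdd_measD; first exact: bdd_measZ.
  by apply: bdd_measM; [apply: bdd_measB => //; exact: bdd_meas_cst|exact: bdd_meas_sqr].
have step n w : Phi n.+1 w <= Phi n w + (2 * ((1 - \1_(B n) w) * M n w) * D n w + D n w ^+ 2).
  have MS : M n.+1 w = M n w + D n w by rewrite /M big_ord_recr.
  rewrite /Phi !indicE; have [Bn|nBn] := boolP (w \in B n).
    have -> : w \in B n.+1 by rewrite inE; left; exact/set_mem.
    by rewrite !subrr !mul0r mulr0 !mul0r add0r addr0 lerDl sqr_ge0.
  have [Bn1|nBn1] := boolP (w \in B n.+1).
    have : e ^+ 2 <= M n.+1 w ^+ 2.
      rewrite -[leRHS]real_normK ?num_real// lerXn2r// ?nnegrE ?(ltW e0)//.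
      by have := set_mem Bn1 => -[/mem_set|//]; rewrite (negbTE nBn).
    by rewrite MS mulr1 subrr mul0r mulr0 subr0; lra.
  by rewrite mulr0 subr0 MS; lra.
have bound n : (\int[Pr]_w Phi n w)%R <= \sum_(i < n) (\int[Pr]_w (D i w ^+ 2))%R.
  elim: n => [|n IH].
    rewrite big_ord0 (_ : Phi 0%N = fun=> 0) ?Ex_cst//.
    by apply/funext => w; rewrite /Phi/= /M indic0 big_ord0 expr0n/= !mulr0 addr0.
  rewrite big_ord_recr/=; apply: le_trans (lerD IH (lexx _)).
  have bHD : bdd_meas (fun w => 2 * ((1 - \1_(B n) w) * M n w) * D n w).
    by apply: bdd_measM => //; exact: (past_bdd_meas (pH n)).
  have b2 := bdd_meas_sqr (bD n).
  apply: le_trans (le_Ex Pr (bPhi _) _ (step n)) _.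
    by apply: bdd_measD => //; exact: bdd_measD.
  have b3 := bdd_measD bHD b2.
  by rewrite (ExD Pr (bPhi n) b3) (ExD Pr bHD b2) oD ?add0r.
exists (B N).
  split=> //; rewrite ler_pdivlMr ?exprn_gt0// mulrC.
  rewrite -Ex_indic// -ExZ//; apply: le_trans (bound N); apply: le_Ex => //.
    exact: bdd_measZ.
  move=> w; rewrite /Phi lerDl mulr_ge0 ?sqr_ge0// subr_ge0 indicE; by case: (w \in B N).
move=> w; elim: N {bound} => [|N IH] /=.
  by move=> _ [|//] _; rewrite big_ord0 normr0.
move=> /not_orP[nB /negP]; rewrite -ltNge => h n.
by rewrite leq_eqVlt => /orP[/eqP -> //|]; rewrite ltnS; exact: IH.
Qed.

Hypothesis hchain : markov_chain P X.
Hypothesis hlaw : forall B, measurable B -> distribution Pr (X 0%N) B = pi B.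
Hypothesis hinv : invariant_law P pi.
Variable k : R.
Hypothesis k01 : 0 < k < 1.
Local Notation q f := (\int[pi]_x (f x ^+ 2))%R.
Hypothesis hgap : forall f : E -> R, bdd_meas f -> (\int[pi]_x f x = 0)%R ->
  q (Pop P f) <= k * q f.

Lemma prob_exists_le (g : E -> R) e N : bdd_meas g -> 0 < e ->
  exists2 A : set Om, measurable A /\ fine (Pr A) <= N%:R * (q g / e ^+ 2) &
    forall w, ~ A w -> forall n, (n < N)%N -> `|g (X n w)| < e.
Proof.
move=> bg e0; pose F n := [set w | e <= `|g (X n w)|].
have mF n : measurable (F n).
  by apply: measurable_norm_ge; case: (bdd_meas_X X n bg).
exists (\bigcup_(n < N) F n).
  have mA : measurable (\bigcup_(n < N) F n) by apply: bigcup_measurable.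
  split=> //; apply: le_trans (@prob_le_sum _ _ _ Pr N F _ mA mF _) _.
    by move=> w [n nN Fn]; exists n.
  rewrite -[N in N%:R]card_ord -sumr_const mulr_suml.
  apply: ler_sum => n _; rewrite mul1r.
  apply: le_trans (markov_sqr Pr (bdd_meas_X X n bg) e0) _.
  by rewrite (Ex_X hchain hlaw hinv n (bdd_meas_sqr bg)).
by move=> w nA n nN; rewrite ltNge; apply/negP => h; apply: nA; exists n.
Qed.

(** By the approximate Poisson equation the centered sum is a martingale, plus the boundary term
    [u (X 0) - u (X n)], plus a sum of remainders. The martingale, the two boundary values and the
    remainders receive [e / 4] each; hence the factor 16 after Chebyshev. *)
Lemma birkhoff_fluctuation (f : E -> R) e N : bdd_meas f -> 0 < e ->
  exists2 A : set Om, measurable A /\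
      fine (Pr A) <= 16 * (N.+1%:R) * (3 * gap_const k + 1) * q f / e ^+ 2 &
    forall w, ~ A w -> forall n, (n <= N)%N ->
      `|\sum_(i < n) (f (X i w) - (\int[pi]_x f x)%R)| < e.
Proof.
move=> bf e0; set v := (\int[pi]_x f x)%R.
pose g x := f x - v.
have bg : bdd_meas g by apply: bdd_measB => //; exact: bdd_meas_cst.
have g0 : (\int[pi]_x g x = 0)%R.
  by rewrite ExB ?Ex_cst ?subrr//; exact: bdd_meas_cst.
have qg : q g <= q f by exact: (q_center pi bf).
have qf0 : 0 <= q f by exact: q_ge0.
have [/andP[k0 k1]] := k01.
have C0 : 0 <= gap_const k by exact: gap_const_ge0.
(* Each of the remainders must stay below [e / (4 (N + 1))]: a union over [N + 1] times, with a
   squared level, produces the cube. The order [m] depends on [N], but the final bound does not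
   involve it. *)
have [m hm] : exists m, N.+1%:R ^+ 3 * k ^+ m < 1.
  have /cvgrPdist_lt/(_ (N.+1%:R ^- 3)) : (k ^+ n @[n --> \oo] --> 0)%R.
    by apply: cvg_expr; rewrite ger0_norm// ltW.
  case=> [|m _ /(_ m (leqnn m))]; first by rewrite invr_gt0 exprn_gt0.
  rewrite /= sub0r normrN ger0_norm ?exprn_ge0 1?ltW// => h; exists m.
  by rewrite mulrC -ltr_pdivlMr ?exprn_gt0// mul1r.
pose u := potential P m g; have bu : bdd_meas u by exact: bdd_meas_potential.
have qu : q u <= gap_const k * q f.
  apply: le_trans (q_potential hinv k01 hgap m bg g0) _; exact: ler_wpM2l.
pose r := Piter P m g; have br : bdd_meas r by exact: bdd_meas_Piter.
have qr : q r <= k ^+ m * q f.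
  apply: le_trans (q_Piter hinv k01 hgap m bg g0) _.
  by rewrite ler_wpM2l// exprn_ge0// ltW.
pose D n w := u (X n.+1 w) - Pop P u (X n w).
have bPu := bdd_meas_Pop P bu.
have pD n : past_bdd X n.+1 (D n).
  by apply: bdd_measB; apply: past_bdd_comp.
have oD n H : past_bdd X n H -> (\int[Pr]_w (H w * D n w) = 0)%R.
  move=> pH; have bH := past_bdd_meas pH.
  under eq_Rintegral do rewrite mulrBr.
  rewrite ExB ?(Ex_markov hchain pH bu) ?subrr//; apply: bdd_measM => //; exact: bdd_meas_X.
have e4 : 0 < e / 4 by rewrite divr_gt0.
have [A1 [mA1 PA1] hA1] := kolmogorov_ineq N e4 pD oD.
have [A2 [mA2 PA2] hA2] := prob_exists_le N.+1 bu e4.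
have eN : 0 < e / (4 * N.+1%:R) by rewrite divr_gt0// mulr_gt0.
have [A3 [mA3 PA3] hA3] := prob_exists_le N.+1 br eN.
(* The Markov property turns the cross term into twice the mean square of [P u], so the variance of
   a difference is [q u - q (P u)]. *)
have qD n : (\int[Pr]_w (D n w ^+ 2))%R <= q u.
  have pP : past_bdd X n (fun w => Pop P u (X n w)) by apply: past_bdd_comp.
  have bP := past_bdd_meas pP.
  have bX := bdd_meas_X X n.+1 bu.
  have -> : (\int[Pr]_w (D n w ^+ 2))%R = (\int[Pr]_w (u (X n.+1 w) ^+ 2))%R
     - (\int[Pr]_w (Pop P u (X n w) ^+ 2))%R.
    have -> : (\int[Pr]_w (D n w ^+ 2))%R = (\int[Pr]_w (u (X n.+1 w) ^+ 2 +
      ((- 2) * (Pop P u (X n w) * u (X n.+1 w)) + Pop P u (X n w) ^+ 2)))%R.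
      by apply: eq_Rintegral => w _; rewrite /D; ring.
    have b1 := bdd_meas_sqr bX; have b2 := bdd_meas_sqr bP; have b3 := bdd_measM bP bX.
    have b4 := bdd_measZ (-2) b3.
    rewrite ExD//; last exact: bdd_measD.
    rewrite ExD// ExZ// (Ex_markov hchain pP bu).
    under [X in _ + (_ * X + _)]eq_Rintegral do rewrite -expr2.
    by rewrite /=; lra.
  rewrite (Ex_X hchain hlaw hinv n.+1 (bdd_meas_sqr bu)) lerBlDr lerDl.
  by apply: Ex_ge0 => w; exact: sqr_ge0.
exists (A1 `|` A2 `|` A3).
  split; first by apply: measurableU => //; exact: measurableU.
  have U (B C : set Om) : measurable B -> measurable C ->
      fine (Pr (B `|` C)) <= fine (Pr B) + fine (Pr C).
    move=> mB mC; rewrite -fineD ?fin_num_measure// fine_le ?fin_num_measure//.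
      exact: measurableU.
      by rewrite fin_numD !fin_num_measure.
    exact: measureU2.
  apply: le_trans (U _ _ (measurableU _ _ mA1 mA2) mA3) _.
  apply: (@le_trans _ _ (fine (Pr A1) + fine (Pr A2) + fine (Pr A3))).
    by rewrite lerD2r; exact: U.
  have N1 : (1 : R) <= N.+1%:R by rewrite ler1n.
  have ie : 0 < (e ^+ 2)^-1 by rewrite invr_gt0 exprn_gt0.
  have P1 : fine (Pr A1) <= 16 * N.+1%:R * (gap_const k * q f) * (e ^+ 2)^-1.
    apply: le_trans PA1 _.
    rewrite ler_pdivrMr ?exprn_gt0//.
    have -> : 16 * N.+1%:R * (gap_const k * q f) / e ^+ 2 * (e / 4) ^+ 2 =
      N.+1%:R * (gap_const k * q f) by field; rewrite gt_eqF.
    apply: (@le_trans _ _ (\sum_(n < N) q u)); first by apply: ler_sum => n _; exact: qD.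
    by rewrite sumr_const card_ord -[leLHS]mulr_natl ler_pM// ?ler_nat ?q_ge0.
  have P2 : fine (Pr A2) <= 16 * N.+1%:R * (gap_const k * q f) * (e ^+ 2)^-1.
    apply: le_trans PA2 _.
    have -> : 16 * N.+1%:R * (gap_const k * q f) / e ^+ 2 =
      N.+1%:R * ((gap_const k * q f) / (e / 4) ^+ 2) by field; rewrite gt_eqF.
    by rewrite ler_pM2l// ler_pM2r// invr_gt0 exprn_gt0.
  have P3 : fine (Pr A3) <= 16 * N.+1%:R * q f * (e ^+ 2)^-1.
    apply: le_trans PA3 _.
    have -> : N.+1%:R * (q r / (e / (4 * N.+1%:R)) ^+ 2) =
      16 * (N.+1%:R ^+ 3 * q r) * (e ^+ 2)^-1.
      have H (a y : R) : 0 < a -> a * (y / (e / (4 * a)) ^+ 2) = 16 * (a ^+ 3 * y) / e ^+ 2.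
        by move=> a0; field; rewrite !gt_eqF.
      exact: H.
    rewrite ler_pM2r// -mulrA ler_pM2l//.
    apply: (@le_trans _ _ (N.+1%:R ^+ 3 * k ^+ m * q f)).
      by rewrite -mulrA ler_pM2l ?exprn_gt0.
    by rewrite ler_wpM2r// (le_trans (ltW hm)).
  have := mulr_ge0 (mulr_ge0 (ler0n R N.+1) (mulr_ge0 C0 qf0)) (ltW ie); lra.
move=> w /not_orP[/not_orP[nA1 nA2] nA3] n nN.
have h1 := hA1 w nA1 n nN.
have h2 := hA2 w nA2 0%N isT.
have h3 := hA2 w nA2 n nN.
have h4 : `|\sum_(i < n) r (X i w)| < e / 4.
  have [->|n0] := posnP n; first by rewrite big_ord0 normr0.
  apply: le_lt_trans (ler_norm_sum _ _ _) _.
  apply: (@lt_le_trans _ _ (\sum_(i < n) e / (4 * N.+1%:R))).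
    have n0' : (0 < n)%N by [].
    case: n n0' nN {h1 h3 n0} => // n _ nN.
    apply: (@ltr_sum _ _ _ _ _ _ _); first by apply/hasP; exists ord0 => //; rewrite mem_index_enum.
    by move=> i _; apply: hA3 => //; rewrite (leq_trans (ltn_ord i))// ltnW.
  have H (a b : R) : a * (e / (4 * b)) = a / b * (e / 4) by rewrite invfM; ring.
  rewrite sumr_const card_ord -[leLHS]mulr_natl H ler_piMl ?(ltW e4)//.
  by rewrite ler_pdivrMr// mul1r ler_nat leqW.
have -> : \sum_(i < n) (f (X i w) - v) = \sum_(i < n) D i w + (u (X 0%N w) - u (X n w))
   + \sum_(i < n) r (X i w).
  elim: n {nN h1 h3 h4} => [|n IH]; first by rewrite !big_ord0 subrr !addr0.
  rewrite !big_ord_recr/= IH -[f (X n w) - v]/(g (X n w)) (poisson_eq P m _ bg).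
  by rewrite /D -/u -/r; ring.
have := ler_normD (\sum_(i < n) D i w + (u (X 0%N w) - u (X n w))) (\sum_(i < n) r (X i w)).
have := ler_normD (\sum_(i < n) D i w) (u (X 0%N w) - u (X n w)).
have := ler_normB (u (X 0%N w)) (u (X n w)).
lra.
Qed.

End maximal.

(** * Factorization of characteristic functions along the chain *)

Import ComplexField.Normc.

Ltac bdd := repeat first [ done | exact: bdd_meas_cst | apply: bdd_measD
  | apply: bdd_measN | apply: bdd_measM | apply: bdd_meas_sqr
  | apply: bdd_meas_Pop | apply: bdd_meas_cos | apply: bdd_meas_sin ].

Definition expi {R : realType} (t : R) : R[i] := (cos t +i* sin t)%C.

Definition Exi {d} {T : measurableType d} {R : realType} (mu : probability T R)
  (f : T -> R) : R[i] :=
  ((\int[mu]_x cos (f x))%R +i* (\int[mu]_x sin (f x))%R)%C.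

Section normc_facts.
Context {R : realType}.
Implicit Types z : R[i].

Lemma normc_ge0 z : 0 <= normc z.
Proof. by case: z => a b; exact: sqrtr_ge0. Qed.

Lemma normc_le (a b e : R) : 0 <= e -> a ^+ 2 + b ^+ 2 <= e ^+ 2 -> normc (a +i* b)%C <= e.
Proof.
move=> e0 h; rewrite /normc -[leRHS](ger0_norm e0) -sqrtr_sqr.
by rewrite ler_wsqrtr.
Qed.

Lemma normc_expi (t : R) : normc (expi t) = 1.
Proof. by rewrite /normc/= cos2Dsin2 sqrtr1. Qed.

Lemma expiD (s t : R) : expi (s + t) = expi s * expi t.
Proof. by rewrite /expi cosD sinD; congr (_ +i* _)%C; rewrite addrC. Qed.

Lemma expi0 : expi (0 : R) = 1.
Proof. by rewrite /expi cos0 sin0. Qed.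

End normc_facts.

Lemma normc_Exi_le1 {d} {T : measurableType d} {R : realType} (mu : probability T R)
  (f : T -> R) : measurable_fun setT f -> normc (Exi mu f) <= 1.
Proof.
move=> mf; apply: normc_le => //; rewrite expr1n.
have bc := bdd_meas_cos mf; have bs := bdd_meas_sin mf.
have h1 := Ex_cauchy_schwarz mu bc (bdd_meas_cst 1).
have h2 := Ex_cauchy_schwarz mu bs (bdd_meas_cst 1).
move: h1 h2; rewrite expr1n Ex_cst !mulr1.
under [X in X ^+ 2 <= _ -> _]eq_Rintegral do rewrite mulr1.
under [X in _ -> X ^+ 2 <= _ -> _]eq_Rintegral do rewrite mulr1.
move=> h1 h2; apply: le_trans (lerD h1 h2) _.
rewrite -ExD; [|exact: bdd_meas_sqr..].
by under eq_Rintegral do rewrite cos2Dsin2; rewrite Ex_cst.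
Qed.

(** Cauchy-Schwarz for a product of complex functions, in components: [A + B] and [C + D] are the
    two squared norms, and the four integrals are those of the products of real and imaginary
    parts. *)
Lemma sqr_sum4_le (R : realType) (x1 x2 x3 x4 A B C D M : R) : 0 <= M ->
  x1 ^+ 2 <= A * C -> x2 ^+ 2 <= B * D -> x3 ^+ 2 <= B * C -> x4 ^+ 2 <= A * D ->
  (A + B) * (C + D) <= M -> (x1 - x2) ^+ 2 + (x3 + x4) ^+ 2 <= 4 * M.
Proof.
move=> M0 h1 h2 h3 h4 hM.
have S2 (a b : R) : (a - b) ^+ 2 <= 2 * (a ^+ 2 + b ^+ 2).
  rewrite -subr_ge0 (_ : _ - _ = (a + b) ^+ 2); [exact: sqr_ge0|ring].
have S3 (a b : R) : (a + b) ^+ 2 <= 2 * (a ^+ 2 + b ^+ 2).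
  rewrite -subr_ge0 (_ : _ - _ = (a - b) ^+ 2); [exact: sqr_ge0|ring].
have F1 := S2 x1 x2; have F2 := S3 x3 x4.
apply: le_trans (lerD F1 F2) _.
rewrite -mulrDr; apply: (@le_trans _ _ (2 * ((A + B) * (C + D)))).
  rewrite ler_pM2l//; apply: le_trans (lerD (lerD h1 h2) (lerD h3 h4)) _.
  rewrite le_eqVlt; apply/orP; left; apply/eqP; ring.
apply: (@le_trans _ _ (2 * M)); first by rewrite ler_pM2l.
by rewrite ler_wpM2r// ler_nat.
Qed.

Section charfun.
Context {R : realType} {d : measure_display} {E : measurableType d}
  {d1 : measure_display} {Om : measurableType d1} (Pr : probability Om R).
Variables (P : R.-pker E ~> E) (pi : probability E R) (X : nat -> {RV Pr >-> E}).
Hypothesis hinv : invariant_law P pi.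
Variable k : R.
Hypothesis k01 : 0 < k < 1.
Local Notation q f := (\int[pi]_x (f x ^+ 2))%R.
Hypothesis hgap : forall f : E -> R, bdd_meas f -> (\int[pi]_x f x = 0)%R ->
  q (Pop P f) <= k * q f.
Implicit Types th : nat -> E -> R.

(* Real and imaginary parts of [x |-> E_x exp (i \sum_(j < n) th j (X j))]. *)
Fixpoint phase_re_im n th : (E -> R) * (E -> R) :=
  if n is n'.+1 then
    let h := phase_re_im n' (fun j => th j.+1) in
    (fun x => cos (th 0%N x) * Pop P h.1 x - sin (th 0%N x) * Pop P h.2 x,
     fun x => sin (th 0%N x) * Pop P h.1 x + cos (th 0%N x) * Pop P h.2 x)
  else (fun=> 1, fun=> 0).

Lemma bdd_meas_phase n th : (forall j, measurable_fun setT (th j)) ->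
  bdd_meas (phase_re_im n th).1 /\ bdd_meas (phase_re_im n th).2.
Proof.
elim: n th => [|n IH] th mth /=; first by split; exact: bdd_meas_cst.
by have [b1 b2] := IH (fun j => th j.+1) (fun j => mth j.+1); split; bdd.
Qed.

Lemma phase_norm_le1 n th : (forall j, measurable_fun setT (th j)) -> forall x,
  (phase_re_im n th).1 x ^+ 2 + (phase_re_im n th).2 x ^+ 2 <= 1.
Proof.
elim: n th => [|n IH] th mth x /=; first by rewrite expr1n expr0n addr0.
have [b1 b2] := bdd_meas_phase n (fun j => mth j.+1).
set c := cos _; set s := sin _; set u := Pop _ _ x; set v := Pop _ _ x.
have -> : (c * u - s * v) ^+ 2 + (s * u + c * v) ^+ 2 =
  (c ^+ 2 + s ^+ 2) * (u ^+ 2 + v ^+ 2) by ring.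
rewrite cos2Dsin2 mul1r.
apply: le_trans (lerD (sqr_Pop_le P x b1) (sqr_Pop_le P x b2)) _.
have b12 := bdd_meas_sqr b1; have b22 := bdd_meas_sqr b2.
have := PopD P b12 b22 => /(congr1 (fun f => f x)) <-.
have <- : Pop P (fun=> 1) x = 1 by rewrite Pop_cst.
by apply: le_Pop => [||y]; [bdd|bdd|exact: IH].
Qed.

Lemma phase_Exi_le1 n th : (forall j, measurable_fun setT (th j)) ->
  (\int[pi]_x (phase_re_im n th).1 x)%R ^+ 2 +
  (\int[pi]_x (phase_re_im n th).2 x)%R ^+ 2 <= 1.
Proof.
move=> mth; have [b1 b2] := bdd_meas_phase n mth.
have h1 := Ex_cauchy_schwarz pi b1 (bdd_meas_cst 1).
have h2 := Ex_cauchy_schwarz pi b2 (bdd_meas_cst 1).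
move: h1 h2; rewrite expr1n Ex_cst !mulr1.
under [X in X ^+ 2 <= _ -> _]eq_Rintegral do rewrite mulr1.
under [X in _ -> X ^+ 2 <= _ -> _]eq_Rintegral do rewrite mulr1.
move=> h1 h2; apply: le_trans (lerD h1 h2) _.
rewrite -ExD; [|exact: bdd_meas_sqr..].
rewrite -(Ex_cst pi 1); apply: le_Ex; [bdd|bdd|exact: phase_norm_le1].
Qed.

Section deviation.
Variables (eps rho : R).
Hypothesis eps0 : 0 <= eps.
Hypothesis rho0 : 0 <= rho.

(** Two different scales: [rho] bounds the size of [e^(i f) - 1], while [eps] bounds the fluctuation
    of its image under [P]. In the application [rho] is of order [1 / K] and [eps] is [o(1 / K)]. *)
Definition small_phase (f : E -> R) :=
  [/\ measurable_fun setT f,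
    q (fun x => Pop P (fun y => cos (f y)) x - (\int[pi]_y cos (f y))%R) +
    q (fun x => Pop P (fun y => sin (f y)) x - (\int[pi]_y sin (f y))%R) <= eps &
    q (fun x => cos (f x) - 1) + q (fun x => sin (f x)) <= rho].

(** Let [h] be the conditional characteristic function of the remaining steps and [P h = z + w] with
    [z] its mean. Then [e^(i theta) P h] is [z e^(i theta)], whose image fluctuates by at most [eps]
    since [|z| <= 1], plus [e^(i theta) w], which the gap contracts since the factor has modulus 1.
    [gap_step] makes the bound uniform in [n]. *)
Lemma phase_oscillation n th : (forall j, small_phase (th j)) ->
  q (fun x => Pop P (phase_re_im n th).1 x - (\int[pi]_y (phase_re_im n th).1 y)%R) +
  q (fun x => Pop P (phase_re_im n th).2 x - (\int[pi]_y (phase_re_im n th).2 y)%R)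
  <= gap_const k * eps.
Proof.
have C0 := gap_const_ge0 k01.
elim: n th => [|n IH] th sth.
  have q0 c : q (fun x => Pop P (fun=> c) x - (\int[pi]_y c)%R) = 0.
    under eq_Rintegral do rewrite Pop_cst Ex_cst subrr expr0n/=.
    exact: Ex_cst.
  by rewrite /= !q0 addr0 mulr_ge0.
have mth j : measurable_fun setT (th j.+1) by case: (sth j.+1).
have [b1 b2] := bdd_meas_phase n mth.
have zz1 := phase_Exi_le1 n mth.
have := IH _ (fun j => sth j.+1); move: b1 b2 zz1 => /=.
set h := phase_re_im n _ => b1 b2; set zr := (\int[pi]_y h.1 y)%R.
set zi := (\int[pi]_y h.2 y)%R => zz1.
have [mt cs _] := sth 0%N.
set c := fun x => cos (th 0%N x); set s := fun x => sin (th 0%N x).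
have bc : bdd_meas c by exact: bdd_meas_cos.
have bs : bdd_meas s by exact: bdd_meas_sin.
pose cr := (\int[pi]_x c x)%R; pose ci := (\int[pi]_x s x)%R.
pose wr x := Pop P h.1 x - zr; pose wi x := Pop P h.2 x - zi.
have bwr : bdd_meas wr by rewrite /wr; bdd.
have bwi : bdd_meas wi by rewrite /wi; bdd.
(* [A1] and [A2] are the components of [z] times the centered [P e^(i theta)]; [B1] and [B2] below
   are those of the centered image of [e^(i theta) w]. *)
pose A1 x := zr * (Pop P c x - cr) - zi * (Pop P s x - ci).
pose A2 x := zr * (Pop P s x - ci) + zi * (Pop P c x - cr).
have bA1 : bdd_meas A1 by rewrite /A1; bdd.
have bA2 : bdd_meas A2 by rewrite /A2; bdd.
pose v1 x := c x * wr x - s x * wi x; pose v2 x := s x * wr x + c x * wi x.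
have bv1 : bdd_meas v1 by rewrite /v1; bdd.
have bv2 : bdd_meas v2 by rewrite /v2; bdd.
pose B1 x := Pop P v1 x - (\int[pi]_y v1 y)%R.
pose B2 x := Pop P v2 x - (\int[pi]_y v2 y)%R.
have bB1 : bdd_meas B1 by rewrite /B1; bdd.
have bB2 : bdd_meas B2 by rewrite /B2; bdd.
have lin1 (f g u v : E -> R) a b : bdd_meas f -> bdd_meas g -> bdd_meas u ->
   bdd_meas v -> forall x, Pop P (fun x => (a * f x + b * g x) + (u x * v x)) x -
   (\int[pi]_y ((a * f y + b * g y) + (u y * v y)))%R =
   a * (Pop P f x - (\int[pi]_y f y)%R) + b * (Pop P g x - (\int[pi]_y g y)%R) +
   (Pop P (fun y => u y * v y) x - (\int[pi]_y (u y * v y))%R).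
  move=> bf bg bu bv x.
  have ba : bdd_meas (fun x => a * f x) by bdd.
  have bb : bdd_meas (fun x => b * g x) by bdd.
  have bab : bdd_meas (fun x => a * f x + b * g x) by bdd.
  have buv : bdd_meas (fun x => u x * v x) by bdd.
  by rewrite !PopD// !PopZ// !ExD// !ExZ//; ring.
have bone : bdd_meas (fun _ : E => (1 : R)) by bdd.
have E1 x : Pop P (fun x => c x * Pop P h.1 x - s x * Pop P h.2 x) x -
    (\int[pi]_y (c y * Pop P h.1 y - s y * Pop P h.2 y))%R = A1 x + B1 x.
  have := lin1 c s v1 (fun=> 1) zr (- zi) bc bs bv1 bone x.
  have F : (fun x => (zr * c x + (- zi) * s x) + v1 x * 1) =
    (fun x => c x * Pop P h.1 x - s x * Pop P h.2 x).
    by apply/funext => y; rewrite /v1 /wr /wi; ring.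
  have F2 : (fun y => v1 y * 1) = v1 by apply/funext => y; rewrite mulr1.
  by rewrite F F2 => ->; rewrite /A1 /B1 mulNr.
have E2 x : Pop P (fun x => s x * Pop P h.1 x + c x * Pop P h.2 x) x -
    (\int[pi]_y (s y * Pop P h.1 y + c y * Pop P h.2 y))%R = A2 x + B2 x.
  have := lin1 s c v2 (fun=> 1) zr zi bs bc bv2 bone x.
  have F : (fun x => (zr * s x + zi * c x) + v2 x * 1) =
    (fun x => s x * Pop P h.1 x + c x * Pop P h.2 x).
    by apply/funext => y; rewrite /v2 /wr /wi; ring.
  have F2 : (fun y => v2 y * 1) = v2 by apply/funext => y; rewrite mulr1.
  by rewrite F F2 => ->; rewrite /A2 /B2.
move=> IHn.
have -> : (q (fun x => Pop P (fun x => c x * Pop P h.1 x - s x * Pop P h.2 x) x -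
    (\int[pi]_y (c y * Pop P h.1 y - s y * Pop P h.2 y))%R)) = q (fun x => A1 x + B1 x).
  by under eq_Rintegral do rewrite E1.
have -> : (q (fun x => Pop P (fun x => s x * Pop P h.1 x + c x * Pop P h.2 x) x -
    (\int[pi]_y (s y * Pop P h.1 y + c y * Pop P h.2 y))%R)) = q (fun x => A2 x + B2 x).
  by under eq_Rintegral do rewrite E2.
apply: gap_step k01 _ IHn => t t0.
apply: le_trans (lerD (q_add_young pi bA1 bB1 t0) (q_add_young pi bA2 bB2 t0)) _.
have qA : q A1 + q A2 <= eps.
  rewrite -ExD; [|bdd|bdd].
  apply: le_trans cs.
  rewrite -ExD; [|bdd|bdd].
  apply: le_Ex; [bdd|bdd|move=> x].
  rewrite -/c -/s -/cr -/ci.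
  have -> : A1 x ^+ 2 + A2 x ^+ 2 = (zr ^+ 2 + zi ^+ 2) *
    ((Pop P c x - cr) ^+ 2 + (Pop P s x - ci) ^+ 2) by rewrite /A1 /A2; ring.
  by rewrite ler_piMl// addr_ge0 ?sqr_ge0.
have qB : q B1 + q B2 <= k * (q wr + q wi).
  apply: le_trans (lerD (q_Pop_center k01 hgap bv1) (q_Pop_center k01 hgap bv2)) _.
  rewrite -mulrDr ler_pM2l; last by case/andP: k01.
  rewrite -ExD; [|bdd|bdd]; rewrite -ExD; [|bdd|bdd].
  apply: le_Ex; [bdd|bdd|move=> x].
  have -> : v1 x ^+ 2 + v2 x ^+ 2 = (c x ^+ 2 + s x ^+ 2) * (wr x ^+ 2 + wi x ^+ 2).
    by rewrite /v1 /v2; ring.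
  by rewrite cos2Dsin2 mul1r.
have t10 : 0 <= 1 + t^-1 by rewrite addr_ge0// invr_ge0 ltW.
have t20 : 0 <= 1 + t by rewrite addr_ge0// ltW.
apply: (@le_trans _ _ ((1 + t^-1) * (q A1 + q A2) + (1 + t) * (q B1 + q B2))).
  by rewrite !mulrDr addrACA.
by apply: lerD; exact: ler_wpM2l.
Qed.

(** Since [w] has mean 0, replacing [P h] by its mean [z] costs only the integral of
    [(e^(i theta) - 1) w], at most the product of the norms given by [rho] and [phase_oscillation].
    Earlier errors are multiplied by a number of modulus at most 1, so they just add up. *)
Lemma phase_product n th : (forall j, small_phase (th j)) ->
  normc ((\int[pi]_x (phase_re_im n th).1 x)%R +i* (\int[pi]_x (phase_re_im n th).2 x)%R
     - \prod_(j < n) Exi pi (th j))%C <= n%:R * (2 * Num.sqrt (rho * (gap_const k * eps))).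
Proof.
have C0 := gap_const_ge0 k01.
elim: n th => [|n IH] th sth.
  rewrite big_ord0 !Ex_cst mul0r (_ : _ - _ = (0 +i* 0)%C); last first.
    by apply/eqP; rewrite eq_complex/= subrr subr0 !eqxx.
  by rewrite /normc expr0n addr0 sqrtr0.
have mth j : measurable_fun setT (th j.+1) by case: (sth j.+1).
have [b1 b2] := bdd_meas_phase n mth.
have := phase_oscillation n (fun j => sth j.+1).
have := IH _ (fun j => sth j.+1); move: b1 b2 => /=.
set h := phase_re_im n _ => b1 b2; set zr := (\int[pi]_y h.1 y)%R.
set zi := (\int[pi]_y h.2 y)%R => IHn osc.
have [mt _ rh] := sth 0%N; have n1 := normc_Exi_le1 pi mt.
rewrite big_ord_recl/=.
rewrite (eq_bigr (fun j : 'I_n => Exi pi (th j.+1))); last by move=> j _; rewrite /bump.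
set c := fun x => cos (th 0%N x); set s := fun x => sin (th 0%N x).
have bc : bdd_meas c by exact: bdd_meas_cos.
have bs : bdd_meas s by exact: bdd_meas_sin.
pose wr x := Pop P h.1 x - zr; pose wi x := Pop P h.2 x - zi.
have bwr : bdd_meas wr by rewrite /wr; bdd.
have bwi : bdd_meas wi by rewrite /wi; bdd.
have wr0 : (\int[pi]_x wr x)%R = 0 by rewrite ExB ?Ex_cst ?Ex_Pop ?subrr//; bdd.
have wi0 : (\int[pi]_x wi x)%R = 0 by rewrite ExB ?Ex_cst ?Ex_Pop ?subrr//; bdd.
pose cr := (\int[pi]_x c x)%R; pose ci := (\int[pi]_x s x)%R.
pose x1 := (\int[pi]_x ((c x - 1) * wr x))%R; pose x2 := (\int[pi]_x (s x * wi x))%R.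
pose x3 := (\int[pi]_x (s x * wr x))%R; pose x4 := (\int[pi]_x ((c x - 1) * wi x))%R.
have lin (f g : E -> R) : bdd_meas f -> bdd_meas g ->
   (\int[pi]_x (f x * g x))%R = (\int[pi]_x ((f x - 1) * g x))%R + (\int[pi]_x g x)%R.
  move=> bf bg; rewrite -ExD; [|bdd|bdd].
  by apply: eq_Rintegral => x _; ring.
have E1 : (\int[pi]_x (c x * Pop P h.1 x - s x * Pop P h.2 x))%R =
   (cr * zr - ci * zi) + (x1 - x2).
  transitivity (\int[pi]_x ((zr * c x + (- zi) * s x) + (c x * wr x + (-1) * (s x * wi x))))%R.
    by apply: eq_Rintegral => x _; rewrite /wr /wi; ring.
  rewrite ExD; [|bdd|bdd]; rewrite ExD; [|bdd|bdd]; rewrite ExD; [|bdd|bdd].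
  rewrite !ExZ; [|bdd..]; rewrite (lin c wr)// wr0 /x1 /x2 -/cr -/ci; ring.
have E2 : (\int[pi]_x (s x * Pop P h.1 x + c x * Pop P h.2 x))%R =
   (ci * zr + cr * zi) + (x3 + x4).
  transitivity (\int[pi]_x ((zr * s x + zi * c x) + (s x * wr x + c x * wi x)))%R.
    by apply: eq_Rintegral => x _; rewrite /wr /wi; ring.
  rewrite ExD; [|bdd|bdd]; rewrite ExD; [|bdd|bdd]; rewrite ExD; [|bdd|bdd].
  rewrite !ExZ; [|bdd..]; rewrite (lin c wi)// wi0 /x3 /x4 -/cr -/ci; ring.
rewrite E1 E2 /Exi -/c -/s -/cr -/ci.
set p := \prod_(_ < _) _ in IHn *.
have -> : ((cr * zr - ci * zi + (x1 - x2)) +i* (ci * zr + cr * zi + (x3 + x4)) -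
   (cr +i* ci) * p = (cr +i* ci) * ((zr +i* zi) - p) + ((x1 - x2) +i* (x3 + x4)))%C.
  by case: p {IHn} => a b; simpc; congr (_ +i* _)%C; ring.
apply: le_trans (le_normcD _ _) _.
rewrite -natr1 mulrDl mul1r; apply: lerD.
  rewrite normcM; apply: le_trans IHn.
  by rewrite ler_piMl ?normc_ge0.
apply: normc_le; first by rewrite mulr_ge0// sqrtr_ge0.
set Q := q wr + q wi in osc.
have osc' : Q <= gap_const k * eps by [].
have M0 : 0 <= rho * (gap_const k * eps) by apply: mulr_ge0 => //; exact: mulr_ge0.
rewrite exprMn (sqr_sqrtr M0) (_ : 2 ^+ 2 = 4 :> R); last by ring.
have CS (f g : E -> R) (F G : R) : bdd_meas f -> bdd_meas g -> q f <= F -> q g <= G ->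
    0 <= F -> (\int[pi]_x (f x * g x))%R ^+ 2 <= F * G.
  move=> bf bg qf qg F0; apply: le_trans (Ex_cauchy_schwarz pi bf bg) _.
  by apply: ler_pM => //; exact: q_ge0.
have qc0 := q_ge0 pi (fun x => c x - 1); have qs0 := q_ge0 pi s.
have qr0 := q_ge0 pi wr; have qi0 := q_ge0 pi wi.
have rho1 : q (fun x => c x - 1) + q s <= rho by [].
have bc1 : bdd_meas (fun x => c x - 1) by bdd.
have H1 := CS _ _ _ _ bc1 bwr (lexx _) (lexx _) qc0.
have H2 := CS _ _ _ _ bs bwi (lexx _) (lexx _) qs0.
have H3 := CS _ _ _ _ bs bwr (lexx _) (lexx _) qs0.
have H4 := CS _ _ _ _ bc1 bwi (lexx _) (lexx _) qc0.
rewrite -/x1 in H1; rewrite -/x2 in H2; rewrite -/x3 in H3; rewrite -/x4 in H4.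
apply: sqr_sum4_le M0 H1 H2 H3 H4 _.
by apply: ler_pM => //; rewrite addr_ge0.
Qed.

Hypothesis hchain : markov_chain P X.
Hypothesis hlaw : forall B, measurable B -> distribution Pr (X 0%N) B = pi B.

Definition phase_sum th n w := \sum_(j < n) th j (X j w).

Lemma past_phase th n : (forall j, measurable_fun setT (th j)) ->
  past_bdd X n (fun w => cos (phase_sum th n.+1 w)) /\
  past_bdd X n (fun w => sin (phase_sum th n.+1 w)).
Proof.
move=> mth.
have mS : @measurable_fun _ _ (g_sigma_algebraType (past_gen X n)) _ setT (phase_sum th n.+1).
  rewrite /phase_sum; apply: measurable_sum => j.
  apply: (measurableT_comp (mth j)); apply: measurable_past.
  by rewrite -ltnS.
by split; [exact: bdd_meas_cos|exact: bdd_meas_sin].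
Qed.

Lemma phase_markov n th m : (forall j, measurable_fun setT (th j)) ->
  let h := phase_re_im n (fun j => th (m + j)%N) in
  (\int[Pr]_w (cos (phase_sum th m w) * h.1 (X m w) - sin (phase_sum th m w) * h.2 (X m w))
     = \int[Pr]_w cos (phase_sum th (m + n) w))%R /\
  (\int[Pr]_w (sin (phase_sum th m w) * h.1 (X m w) + cos (phase_sum th m w) * h.2 (X m w))
     = \int[Pr]_w sin (phase_sum th (m + n) w))%R.
Proof.
move=> mth; elim: n m => [|n IH] m /=.
  by rewrite addn0; split; apply: eq_Rintegral => w _; rewrite mulr1 mulr0 ?subr0 ?addr0.
have := IH m.+1; rewrite /= addSnnS.
have -> : (fun j => th (m.+1 + j)%N) = (fun j => th (m + j.+1)%N).
  by apply/funext => j; rewrite addSnnS.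
set h := phase_re_im n _ => -[<- <-].
have [b1 b2] : bdd_meas h.1 /\ bdd_meas h.2 by apply: bdd_meas_phase.
have [pc ps] := past_phase m mth.
have bc := past_bdd_meas pc; have bs := past_bdd_meas ps.
have c1 := bdd_meas_X X m.+1 b1; have c2 := bdd_meas_X X m.+1 b2.
have d1' := bdd_meas_X X m (bdd_meas_Pop P b1); have d2' := bdd_meas_X X m (bdd_meas_Pop P b2).
have SE w : phase_sum th m.+1 w = phase_sum th m w + th (m + 0)%N (X m w).
  by rewrite /phase_sum big_ord_recr/= addn0.
split.
- rewrite [RHS]ExB; [|by apply: bdd_measM|by apply: bdd_measM].
  rewrite (Ex_markov hchain pc b1) (Ex_markov hchain ps b2).
  rewrite -ExB; [|by apply: bdd_measM|by apply: bdd_measM].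
  by apply: eq_Rintegral => w _; rewrite SE cosD sinD; ring.
- rewrite [RHS]ExD; [|by apply: bdd_measM|by apply: bdd_measM].
  rewrite (Ex_markov hchain ps b1) (Ex_markov hchain pc b2).
  rewrite -ExD; [|by apply: bdd_measM|by apply: bdd_measM].
  by apply: eq_Rintegral => w _; rewrite SE cosD sinD; ring.
Qed.

Lemma charfun_product n th : (forall j, small_phase (th j)) ->
  normc (Exi Pr (phase_sum th n) - \prod_(j < n) Exi pi (th j)) <=
  n%:R * (2 * Num.sqrt (rho * (gap_const k * eps))).
Proof.
move=> sth; have mth j : measurable_fun setT (th j) by case: (sth j).
have [b1 b2] := bdd_meas_phase n mth.
have := phase_product n sth; rewrite -!(Ex_X hchain hlaw hinv 0%N)//.
have [h1 h2] := phase_markov n 0 mth.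
rewrite /Exi -h1 -h2.
rewrite [X in normc (X +i* _ - _)%C <= _ -> _](_ : _ = (\int[Pr]_w
  (cos (phase_sum th 0 w) * (phase_re_im n th).1 (X 0%N w) -
   sin (phase_sum th 0 w) * (phase_re_im n th).2 (X 0%N w)))%R); last first.
  by apply: eq_Rintegral => w _; rewrite /phase_sum big_ord0 cos0 sin0; ring.
rewrite [X in normc (_ +i* X - _)%C <= _ -> _](_ : _ = (\int[Pr]_w
  (sin (phase_sum th 0 w) * (phase_re_im n th).1 (X 0%N w) +
   cos (phase_sum th 0 w) * (phase_re_im n th).2 (X 0%N w)))%R) //.
by apply: eq_Rintegral => w _; rewrite /phase_sum big_ord0 cos0 sin0; ring.
Qed.

End deviation.

End charfun.

(** * Regularizing effect of the kernel *)

Section density.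
Context {R : realType} {d : measure_display} {E : measurableType d}.
Variables (P : R.-pker E ~> E) (pi : probability E R) (Q : R.-ker E ~> E) (p : E -> E -> R).
Hypothesis hinv : invariant_law P pi.
Hypothesis hsplit : kernel_splitting P pi Q p.
Local Notation q f := (\int[pi]_x (f x ^+ 2))%R.

Lemma measurable_density x : measurable_fun setT (p x).
Proof.
case: hsplit => mp _ _ _.
exact: (@measurable_fun_pair2 _ _ _ _ _ _ (fun z : E * E => p z.1 z.2) x mp).
Qed.

Lemma ac_part_indic x A : measurable A ->
  ac_part pi p x A = (\int[pi]_y (p x y * \1_A y)%:E)%E.
Proof.
move=> mA; rewrite /ac_part integral_mkcond; apply: eq_integral => y _.
by rewrite patchE indicE; case: ifPn => _; rewrite ?mulr1 ?mulr0.
Qed.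

(** The kernel [Q] is compared with the absolutely continuous part on superlevel sets only. Writing
    [f] as a layer sum of such sets transfers the comparison to [P f]; the factor [1 + C] accounts
    for both parts of the kernel. *)
Lemma Pop_le_ac (C : R) (f : E -> R) : 0 <= C -> bdd_meas f ->
  (forall x, 0 <= f x <= 1) ->
  (forall s x, 0 < s -> (Q x [set y | (s <= f y)%R] <=
     C%:E * ac_part pi p x [set y | (s <= f y)%R])%E) ->
  forall x, ((Pop P f x)%:E <= (1 + C)%:E * \int[pi]_y (p x y * f y)%:E)%E.
Proof.
case: (hsplit) => mp p0 PE _ C0 bf f01 hQ x.
pose A s := [set y | (s <= f y)%R].
have mA s : measurable (A s).
  rewrite (_ : A s = f @^-1` `[s, +oo[); last first.
    by apply/seteqP; split=> y; rewrite /A/= in_itv/= andbT.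
  by rewrite -[X in measurable X]setTI; apply: bf.1.
have PA s : 0 < s -> (P x (A s) <= (1 + C)%:E * ac_part pi p x (A s))%E.
  move=> s0; rewrite PE// EFinD ge0_muleDl ?mul1e//; apply: leeD => //.
  exact: hQ.
apply/lee_addgt0Pr => e e0.
pose n := (Num.truncn e^-1).+1.
have n0 : (0 : R) < n%:R by rewrite ltr0n.
have ne : n%:R^-1 <= e.
  by rewrite -[leRHS]invrK lef_pV2 ?posrE ?invr_gt0// ltW// truncnS_gt.
pose a (i : 'I_n) : R := i.+1%:R / n%:R.
have a0 i : 0 < a i by rewrite divr_gt0.
have lay y : (\sum_(i < n) \1_(A (a i)) y) / n%:R <= f y <= (\sum_(i < n) \1_(A (a i)) y) / n%:R + n%:R^-1.
  have /andP[fy0 fy1] := f01 y.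
  have /= := @sum_layers R n n (f y) isT fy0 _.
  rewrite (_ : \sum_(i < n) _ = \sum_(i < n) \1_(A (a i)) y); last first.
    by apply: eq_bigr => i _; rewrite indicE; congr (_%:R); congr nat_of_bool;
      apply/idP/idP; rewrite inE.
  apply; apply: (@le_lt_trans _ _ n%:R); first by rewrite ler_piMl// ltW.
  by rewrite ltr_nat.
have b1 i : bdd_meas (\1_(A (a i)) : E -> R) by apply: bdd_meas_indic.
have bS : bdd_meas (fun y => \sum_(i < n) \1_(A (a i)) y : R) by exact: bdd_meas_sum.
have h1 : Pop P f x <= n%:R^-1 + n%:R^-1 * \sum_(i < n) fine (P x (A (a i))).
  apply: le_trans (le_Pop P x bf _ (fun y => (andP (lay y)).2)) _; first by bdd.
  rewrite (_ : (fun y => _) = (fun y => n%:R^-1 * (\sum_(i < n) \1_(A (a i)) y) + n%:R^-1)); last first.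
    by apply/funext => y; rewrite mulrC.
  rewrite PopD; [|by bdd|by bdd]; rewrite PopZ// Pop_cst addrC lerD2l ler_wpM2l ?invr_ge0 ?(ltW n0)//.
  rewrite Pop_kernel_prob (@Ex_sum _ _ _ (kernel_prob P x) _ _ (fun i => \1_(A (a i)) : E -> R))//.
  by apply: ler_sum => i _; rewrite Ex_indic.
have pf0 g y : (0 <= g y)%R -> (0 <= (p x y * g y)%:E)%E by move=> g0; rewrite lee_fin mulr_ge0.
have mpf g : measurable_fun setT g -> measurable_fun setT (fun y => (p x y * g y)%:E).
  by move=> mg; apply/measurable_EFinP; apply: measurable_funM => //; exact: measurable_density.
apply: (@le_trans _ _ (n%:R^-1%:E + n%:R^-1%:E * \sum_(i < n) P x (A (a i)))%E).
  rewrite -[X in (_ <= _ + _ * X)%E](_ : (\sum_(i < n) fine (P x (A (a i))))%:E = _)%E.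
    by rewrite -EFinM -EFinD lee_fin.
  rewrite -sumEFin; apply: eq_bigr => i _.
  by rewrite fineK// (@fin_num_measure _ _ _ (kernel_prob P x)).
rewrite addeC; apply: leeD; last by rewrite lee_fin.
apply: (@le_trans _ _ ((1 + C)%:E * \int[pi]_y (p x y * (n%:R^-1 * \sum_(i < n) \1_(A (a i)) y))%:E)%E).
  under eq_integral do rewrite mulrCA EFinM.
  rewrite ge0_integralZl//; last 2 first.
  - exact: (mpf _ bS.1).
  - by move=> y _; apply: (pf0 (fun y => \sum_(i < n) \1_(A (a i)) y)); apply: sumr_ge0 => i _; rewrite indicE.
  rewrite muleCA lee_wpmul2l ?lee_fin ?invr_ge0 ?(ltW n0)//.
  under eq_integral do rewrite mulr_sumr -sumEFin.
  rewrite ge0_integral_sum//; last 2 first.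
  - by move=> i; apply: (mpf _ (b1 i).1).
  - by move=> i y _; apply: (pf0 (\1_(A (a i)))); rewrite indicE.
  rewrite ge0_sume_distrr; last first.
    by move=> i _; apply: integral_ge0 => y _; apply: (pf0 (\1_(A (a i)))); rewrite indicE.
  apply: lee_sum => i _; rewrite -ac_part_indic//.
  exact: PA.
rewrite lee_wpmul2l ?lee_fin ?addr_ge0//; apply: ge0_le_integral => //.
- move=> y _; apply: (pf0 (fun y => n%:R^-1 * \sum_(i < n) \1_(A (a i)) y)).
  by rewrite mulr_ge0 ?invr_ge0 ?(ltW n0)//; apply: sumr_ge0 => i _; rewrite indicE.
- by apply: mpf; apply: (bdd_measZ _ bS).1.
- by apply: mpf; case: bf.
- move=> y _; rewrite lee_fin ler_wpM2l// mulrC; by case/andP: (lay y).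
Qed.

(** Hoelder bounds the squared integral of [p(x,y) f(y)] over [y] by that of [p(x,y)^2 f(y)] times
    the mean of [f]. Integrating over [x] and exchanging the integrals leaves the uniform bound on
    [p(.,y)^2] and a second factor equal to the mean. Superlevel sets of [f] must be tails of [W],
    because domination is known there. *)
Lemma density_q_Pop (W : E -> R) : tail_domination pi Q p W ->
  exists2 C : R, 0 <= C & forall f : E -> R, bdd_meas f -> (forall x, 0 <= f x <= 1) ->
    (forall s, 0 < s <= 1 -> exists2 lam, 0 <= lam &
       [set y | (s <= f y)%R] = [set y | (lam <= W y)%R]) ->
    q (Pop P f) <= C * (\int[pi]_x f x)%R ^+ 2.
Proof.
move=> [C1 hC1]; case: (hsplit) => mp p0 PE Bfin.
set S := ereal_sup _ in Bfin.
have Sle y : (\int[pi]_x (p x y ^+ 2)%:E <= S)%E.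
  by apply: ereal_sup_ubound; exists y.
have S0 : (0 <= S)%E.
  apply: le_trans (Sle point); apply: integral_ge0 => x _.
  by rewrite lee_fin sqr_ge0.
pose B := fine S.
have SB : S = B%:E by rewrite fineK// ge0_fin_numE.
have B0 : 0 <= B by rewrite -lee_fin -SB.
pose C := Num.max C1 0.
have C0 : 0 <= C by rewrite le_max lexx orbT.
exists ((1 + C) ^+ 2 * B); first by rewrite mulr_ge0 ?sqr_ge0.
move=> f bf f01 hlev; set m := (\int[pi]_x f x)%R.
have m0 : 0 <= m by apply: Ex_ge0 => x; case/andP: (f01 x).
have f0 x : 0 <= f x by case/andP: (f01 x).
have hQ s x : 0 < s -> (Q x [set y | (s <= f y)%R] <=
     C%:E * ac_part pi p x [set y | (s <= f y)%R])%E.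
  move=> s0; have [s1|s1] := leP s 1; last first.
    rewrite (_ : [set y | (s <= f y)%R] = set0); last first.
      apply/seteqP; split=> // y /= sf.
      by have /andP[_ /(le_trans sf)] := f01 y; rewrite leNgt s1.
    by rewrite /ac_part measure0 integral_set0 mule0.
  have [|lam lam0 ->] := hlev s; first by rewrite s0.
  apply: le_trans (hC1 lam x lam0) _; rewrite lee_wpmul2r//.
    by apply: integral_ge0 => y _; rewrite lee_fin.
  by rewrite lee_fin le_max lexx.
have hP := Pop_le_ac C0 bf f01 hQ.
have CS x : ((\int[pi]_y (p x y * f y)%:E) `^ 2 <=
    (\int[pi]_y (p x y ^+ 2 * f y)%:E) * m%:E)%E.
  (* The factor [f] is shared between the two sides of the inequality by its square root. *)
  pose g y := p x y * f y `^ 2^-1; pose h y := f y `^ 2^-1.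
  have mh : measurable_fun setT h.
    by apply: (measurableT_comp (measurable_powR _)); case: bf.
  have mg : measurable_fun setT g by apply: measurable_funM => //; exact: measurable_density.
  have hh y : h y * h y = f y.
    rewrite /h -powRD; last by rewrite implybE gt_eqF//; apply/orP; left; rewrite -mulr2n -(mulr_natl 2^-1) divff ?oner_eq0.
    by rewrite -mulr2n -(mulr_natl 2^-1) divff// powRr1.
  have h0 y : 0 <= h y by exact: powR_ge0.
  have /= := @hoelder _ _ _ pi g h 2 2 mg mh (ltr0Sn _ _) (ltr0Sn _ _) _.
  rewrite -mulr2n -(mulr_natl 2^-1) divff// => /(_ erefl) H0.
  have {}H0 : (\int[pi]_y (p x y * f y)%:E <= 'N[pi]_2%:E[EFin \o g] * 'N[pi]_2%:E[EFin \o h])%E.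
    apply: le_trans H0; rewrite Lnorm1 le_eqVlt; apply/orP; left; apply/eqP.
    apply: eq_integral => y _ /=; rewrite -mulrA hh ger0_norm//; exact: mulr_ge0.
  have I0 : (0 <= \int[pi]_y (p x y * f y)%:E)%E.
    by apply: integral_ge0 => y _; rewrite lee_fin mulr_ge0.
  have N0 (k : E -> \bar R) : (0 <= 'N[pi]_2%:E[k])%E by exact: Lnorm_ge0.
  have := @gt0_ler_poweR R 2 (ler0n _ _) _ _ _ _ H0.
  rewrite !in_itv/= !leey !andbT => /(_ I0 (mule_ge0 (N0 _) (N0 _))).
  rewrite poweRM// !poweR_Lnorm//; congr (_ <= _ * _)%E.
  - apply: eq_integral => y _ /=; rewrite powR_mulrn// real_normK ?num_real//.
    by rewrite /g -/(h y) exprMn (expr2 (h y)) hh.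
  - rewrite -ExE//; apply: eq_integral => y _ /=; rewrite powR_mulrn// real_normK ?num_real//.
    by rewrite expr2 hh.
rewrite -lee_fin -ExE; last by apply: bdd_meas_sqr; exact: bdd_meas_Pop.
have mpp : measurable_fun setT (fun z : E * E => (p z.1 z.2 ^+ 2 * f z.2)%:E).
  apply/measurable_EFinP; apply: measurable_funM; first exact: measurable_funX.
  by apply: measurableT_comp => //; case: bf.
have pp0 (z : E * E) : (0 <= (p z.1 z.2 ^+ 2 * f z.2)%:E)%E.
  by rewrite lee_fin mulr_ge0 ?sqr_ge0.
have mF := measurable_fun_fubini_tonelli_F (m2 := pi) _ mpp pp0.
apply: (@le_trans _ _ (\int[pi]_x (((1 + C) ^+ 2 * m)%:E * \int[pi]_y (p x y ^+ 2 * f y)%:E))%E).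
  apply: ge0_le_integral => //.
  - by move=> x _; rewrite lee_fin sqr_ge0.
  - by apply/measurable_EFinP; case: (bdd_meas_sqr (bdd_meas_Pop P bf)).
  - exact: measurable_funeM.
  move=> x _.
  have I0 : (0 <= \int[pi]_y (p x y * f y)%:E)%E.
    by apply: integral_ge0 => y _; rewrite lee_fin mulr_ge0.
  have P0 : 0 <= Pop P f x by rewrite Pop_kernel_prob; exact: Ex_ge0.
  apply: (@le_trans _ _ (((1 + C)%:E * \int[pi]_y (p x y * f y)%:E) `^ 2)%E).
    rewrite -powR_mulrn// -poweR_EFin; apply: gt0_ler_poweR => //.
      by rewrite in_itv/= lee_fin P0 leey.
    by rewrite in_itv/= leey andbT mule_ge0// lee_fin addr_ge0.
  rewrite poweRM ?lee_fin ?addr_ge0// poweR_EFin powR_mulrn ?addr_ge0//.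
  rewrite [((1 + C) ^+ 2 * m)%:E]EFinM -muleA lee_wpmul2l ?lee_fin ?sqr_ge0//.
  by rewrite [leRHS]muleC.
rewrite ge0_integralZl//; last 2 first.
  - by move=> x _; apply: integral_ge0 => y _; exact: (pp0 (x, y)).
  - by rewrite lee_fin mulr_ge0 ?sqr_ge0.
rewrite (fubini_tonelli (m1 := pi) (m2 := pi) _ mpp pp0)/=.
apply: (@le_trans _ _ (((1 + C) ^+ 2 * m)%:E * \int[pi]_y (B%:E * (f y)%:E))%E).
  apply: lee_wpmul2l; first by rewrite lee_fin mulr_ge0 ?sqr_ge0.
  apply: ge0_le_integral => //.
  - by move=> y _; apply: integral_ge0 => x _; exact: (pp0 (x, y)).
  - exact: (measurable_fun_fubini_tonelli_G (m1 := pi) _ mpp pp0).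
  - by apply/measurable_EFinP; apply: measurable_funM => //; case: bf.
  move=> y _.
  under eq_integral do rewrite mulrC EFinM.
  rewrite ge0_integralZl ?lee_fin//; last 2 first.
  - apply/measurable_EFinP; apply: measurable_funX.
    exact: (@measurable_fun_pair1 _ _ _ _ _ _ (fun z : E * E => p z.1 z.2) y mp).
  - by move=> x _; rewrite lee_fin sqr_ge0.
  by rewrite muleC lee_wpmul2r ?lee_fin// -SB.
rewrite ge0_integralZl ?lee_fin//; last 2 first.
  - by apply/measurable_EFinP; case: bf.
  - by move=> y _; rewrite lee_fin.
rewrite ExE// -/m -!EFinM lee_fin le_eqVlt; apply/orP; left; apply/eqP; ring.
Qed.

End density.

(** * Heavy-tailed components *)

Section heavy.
Context {R : realType} {d : measure_display} {E : measurableType d}.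
Variables (P : R.-pker E ~> E) (pi : probability E R).

Definition small_jump (v : E -> R) (del : R) (x : E) := v x * \1_[set y | `|v y| <= del] x.

(** Up to constants it dominates both [|cos (xi v) - 1|] and [|sin (xi v)|], and its superlevel sets
    at levels in [(0,1]] are tails of [|v|], so that [density_q_Pop] applies to it. *)
Definition unit_jump (v : E -> R) (x : E) := Num.min 1 `|v x|.

(** Everything that the limit theorem needs from one coordinate: [v N] is the rescaled variable,
    [K N] the number of steps per unit of time, [w N] the centering and [psi] the limit exponent.
    Together, [heavy_min] and [heavy_dom] make the one-step image of the phase fluctuate by
    [o(1 / K)] in squared norm. *)
Record heavy (v : nat -> E -> R) (K w : nat -> R) (psi : R -> R[i]) : Prop := Heavy {
  heavy_meas : forall N, measurable_fun setT (v N) ;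
  heavy_tail : forall del, 0 < del ->
    exists C, forall N, K N * fine (pi [set x | del <= `|v N x|]) <= C ;
  heavy_decay : forall e, 0 < e -> exists2 del, 0 < del &
    forall N, K N * fine (pi [set x | del <= `|v N x|]) <= e ;
  heavy_small : forall e, 0 < e -> exists2 del, 0 < del &
    forall N, K N * (\int[pi]_x (small_jump (v N) del x ^+ 2))%R <= e ;
  heavy_drift : forall del, 0 < del ->
    exists C, forall N, `|K N * (\int[pi]_x small_jump (v N) del x)%R - w N| <= C ;
  heavy_min : K N * (\int[pi]_x unit_jump (v N) x)%R ^+ 2 @[N --> \oo] --> (0 : R) ;
  heavy_cos : forall xi, K N * ((\int[pi]_x cos (xi * v N x))%R - 1) @[N --> \oo] -->
    complex.Re (psi xi) ;
  heavy_sin : forall xi, K N * (\int[pi]_x sin (xi * v N x))%R - xi * w N @[N --> \oo] -->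
    complex.Im (psi xi) ;
  heavy_dom : exists2 C, 0 <= C & forall N,
    (\int[pi]_x (Pop P (unit_jump (v N)) x ^+ 2))%R <= C * (\int[pi]_x unit_jump (v N) x)%R ^+ 2 /\
    forall del, 0 < del -> (\int[pi]_x (Pop P \1_[set y | del <= `|v N y|] x ^+ 2))%R <=
      C * fine (pi [set y | del <= `|v N y|]) ^+ 2
}.

Lemma bdd_small_jump v del : measurable_fun setT v -> bdd_meas (small_jump v del).
Proof.
move=> mv; split.
  by apply: measurable_funM => //; apply: measurable_indic; exact: measurable_le_norm.
exists `|del| => x; rewrite /small_jump indicE.
have [/set_mem/= h|_] := boolP (x \in _); first by rewrite mulr1 (le_trans h)// ler_norm.
by rewrite mulr0 normr0.
Qed.

Lemma bdd_unit_jump v : measurable_fun setT v -> bdd_meas (unit_jump v).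
Proof.
move=> mv; split.
  by apply: measurable_minr => //; exact: (measurableT_comp (@normr_measurable R setT) mv).
by exists 1 => x; rewrite /unit_jump ger0_norm ?ge_min ?lexx// le_min ler01 normr_ge0.
Qed.

Lemma unit_jump_ge0 v x : 0 <= unit_jump v x.
Proof. by rewrite /unit_jump le_min ler01 normr_ge0. Qed.

Lemma unit_jump_le1 v x : unit_jump v x <= 1.
Proof. by rewrite /unit_jump ge_min lexx. Qed.

End heavy.

Section domination.
Context {R : realType} {d : measure_display} {E : measurableType d}.
Variables (P : R.-pker E ~> E) (pi : probability E R) (Q : R.-ker E ~> E) (p : E -> E -> R).
Hypothesis hA2 : kernel_splitting P pi Q p.
Variables (V : E -> R) (L : nat -> R).
Hypothesis mV : measurable_fun setT V.
Hypothesis L0 : forall N, 0 < L N.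
Hypothesis hdom : tail_domination pi Q p (fun x => `|V x|).

Lemma scaled_domination : exists2 C, 0 <= C & forall N,
  let v x := V x / L N in
  (\int[pi]_x (Pop P (unit_jump v) x ^+ 2))%R <= C * (\int[pi]_x unit_jump v x)%R ^+ 2 /\
  forall del, 0 < del -> (\int[pi]_x (Pop P \1_[set y | (del <= `|v y|)%R] x ^+ 2))%R <=
    C * fine (pi [set y | (del <= `|v y|)%R]) ^+ 2.
Proof.
have [C C0 H] := density_q_Pop hA2 hdom; exists C => // N v.
have mv : measurable_fun setT v by exact: measurable_funM.
have vE x : `|v x| = `|V x| / L N by rewrite /v normrM normfV (gtr0_norm (L0 N)).
have ne x : 0 <= `|V x| by [].
split=> [|del del0].
  apply: H; first exact: bdd_unit_jump.
    by move=> x; rewrite unit_jump_ge0 unit_jump_le1.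
  move=> s /andP[s0 s1]; exists (s * L N); first by rewrite mulr_ge0 ?ltW.
  by apply/seteqP; split=> x /=; rewrite /unit_jump le_min s1/= vE ler_pdivlMr.
have mA : measurable [set y | del <= `|v y|].
  exact: measurable_norm_ge.
rewrite -Ex_indic//; apply: H; first exact: bdd_meas_indic.
  by move=> x; rewrite indicE; case: (_ \in _); rewrite lexx ler01.
move=> s /andP[s0 s1]; exists (del * L N); first by rewrite mulr_ge0 ?ltW.
apply/seteqP; split=> x /=; rewrite indicE -ler_pdivlMr// -vE.
  have [/set_mem//|_] := boolP (x \in _).
  by rewrite leNgt s0.
by move=> h; rewrite mem_set.
Qed.

End domination.

Section scaled.
Context {R : realType} {d : measure_display} {E : measurableType d}.
Variables (P : R.-pker E ~> E) (pi : probability E R) (Q : R.-ker E ~> E) (p : E -> E -> R).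
Hypothesis hA2 : kernel_splitting P pi Q p.
Variables (V : E -> R) (b cp cm : R) (K : nat -> R).
Hypothesis mV : measurable_fun setT V.
Hypothesis b0 : 0 < b.
Hypothesis b2 : b < 2.
Hypothesis cp0 : 0 <= cp.
Hypothesis cm0 : 0 <= cm.
Hypothesis tail_right : tail_asymptotics pi (fun lam => [set x | lam <= V x]) b cp.
Hypothesis tail_left : tail_asymptotics pi (fun lam => [set x | V x <= - lam]) b cm.
Hypothesis V_centered : 1 < b -> (\int[pi]_x (V x)%:E)%E = 0%E.
Hypothesis hdom : tail_domination pi Q p (fun x => `|V x|).
Hypothesis K1 : forall N, 1 <= K N.
Hypothesis KN : K N @[N --> \oo] --> +oo%R.

Let K0 N : 0 < K N.
Proof. exact: lt_le_trans (K1 N). Qed.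

Let L N := K N `^ b^-1.

Let L0 N : 0 < L N.
Proof. exact: powR_gt0. Qed.

Definition jump N x := V x / K N `^ b^-1.

(** Below 1 the small jumps have a finite rescaled mean, and above 1 the variable is centered; only
    at 1 does a possibly divergent drift have to be subtracted. *)
Definition centering N := if b == 1 then (\int[pi]_x truncation V (K N) x)%R else 0.

Let mv N : measurable_fun setT (jump N).
Proof. exact: measurable_funM. Qed.

Let mav N : measurable_fun setT (fun x => `|jump N x|).
Proof. exact: (measurableT_comp (@normr_measurable R setT) (mv N)). Qed.

Let maV : measurable_fun setT (fun x => `|V x|).
Proof. exact: (measurableT_comp (@normr_measurable R setT) mV). Qed.

Lemma abs_tail : exists2 C, 0 <= C & forall lam, 0 < lam ->
  fine (pi [set x | lam <= `|V x|]) <= C * lam `^ (- b).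
Proof.
have [C1 C10 H1] := tail_bound mV b0 cp0 tail_right.
have mVN : measurable_fun setT (fun x => - V x) by exact: measurableT_comp.
have [C2 C20 H2] := tail_bound mVN b0 cm0 (tail_leftN tail_left).
exists (C1 + C2); first exact: addr_ge0.
move=> lam lam0; rewrite mulrDl; apply: le_trans (lerD (H1 _ lam0) (H2 _ lam0)).
have m1 : measurable [set x | lam <= V x] by exact: measurable_geY.
have m2 : measurable [set x | lam <= - V x] by exact: (@measurable_geY _ _ _ (fun x => - V x)).
have m3 : measurable [set x | lam <= `|V x|] by exact: (@measurable_geY _ _ _ (fun x => `|V x|)).
rewrite -fineD ?fin_num_measure//; apply: fine_le; rewrite ?fin_numD ?fin_num_measure//.
apply: (@le_trans _ _ (pi ([set x | lam <= V x] `|` [set x | lam <= - V x]))); last exact: measureU2.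
apply: le_measure; rewrite ?inE//; first exact: measurableU.
by move=> x /=; rewrite ler_normr => /orP.
Qed.

Lemma abs_wtail : exists2 C, 0 <= C & forall N s, 0 < s ->
  (wtail pi (fun=> K N) (fun x => `|jump N x|%R) s <= (C * s `^ (- b))%:E)%E.
Proof.
have [C C0 H] := abs_tail; exists C => // N s s0.
rewrite /wtail (_ : [set x | s <= `|jump N x|] = [set x | s * L N <= `|V x|]); last first.
  by apply/seteqP; split=> x /=; rewrite /jump normrM normfV (gtr0_norm (L0 N)) ler_pdivlMr.
have m3 : measurable [set x | s * L N <= `|V x|] by exact: (@measurable_geY _ _ _ (fun x => `|V x|)).
rewrite integral_cst// -[X in (_ * X <= _)%E]fineK ?fin_num_measure// -EFinM lee_fin.
have h := H (s * L N) (mulr_gt0 s0 (L0 N)).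
apply: le_trans (ler_wpM2l (ltW (K0 N)) h) _.
rewrite powRM ?(ltW s0) ?(ltW (L0 N))// [L N `^ _]powRN scale_powR//.
by rewrite le_eqVlt; apply/orP; left; apply/eqP; field; rewrite gt_eqF.
Qed.

Let restrict_small (r : R) N del (g : E -> R) : measurable_fun setT g ->
  (forall x, `|g x| <= `|jump N x| `^ r * \1_[set y | `|jump N y| <= del] x) ->
  (forall x, jump N x = 0 -> g x = 0) ->
  (\int[pi]_x (`|g x| * K N)%R%:E <=
   \int[pi]_(x in [set x | (0 < `|jump N x| <= del)%R]) (`|jump N x| `^ r * K N)%R%:E)%E.
Proof.
move=> mg gle g0; rewrite [leRHS]integral_mkcond; apply: ge0_le_integral => //.
- by move=> x _; rewrite lee_fin mulr_ge0// ltW.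
- apply/measurable_EFinP; apply: measurable_funM => //.
  exact: (measurableT_comp (@normr_measurable R setT) mg).
- apply/(measurable_restrictT _ _).1.
    rewrite (_ : [set x | _] = (fun x => `|jump N x|) @^-1` `]0, del]).
      by rewrite -[X in measurable X]setTI; apply: mav.
    by apply/seteqP; split=> x /=; rewrite in_itv/=.
  apply: measurable_funTS; apply/measurable_EFinP; apply: measurable_funM => //.
  exact: (measurableT_comp (measurable_powR _) (mav N)).
- move=> x _; rewrite patchE; have [/set_mem/= h|h] := boolP (x \in _).
    rewrite lee_fin ler_wpM2r ?(ltW (K0 N))//; apply: le_trans (gle x) _.
    by rewrite ler_piMr ?powR_ge0// indicE; case: (_ \in _).
  have [e|e] := eqVneq (jump N x) 0; first by rewrite g0// normr0 mul0r.
  suff -> : `|g x| = 0 by rewrite mul0r.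
  apply/eqP; rewrite eq_le normr_ge0 andbT; apply: le_trans (gle x) _.
  rewrite indicE memNset ?mulr0//= => h2; move: h; rewrite notin_setE/= => -[].
  by rewrite normr_gt0 e.
Qed.

Lemma scaled_small e : 0 < e -> exists2 del, 0 < del &
  forall N, K N * (\int[pi]_x (small_jump (jump N) del x ^+ 2))%R <= e.
Proof.
move=> e0; have [C C0 HC] := abs_wtail.
have half r : 0 < r -> 0 <= 1 - (2 : R) `^ (- r).
  by move=> /halfp_lt1 /andP[_ /ltW]; rewrite subr_ge0.
have r0 : 0 < 2 - b by rewrite subr_gt0.
have A0 : 0 <= C * 2 `^ b / (1 - 2 `^ (- (2 - b))).
  by rewrite !mulr_ge0 ?powR_ge0// invr_ge0 half.
have [del /andP[del0 _] hdel] := powR_small A0 r0 e0.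
exists del => // N; rewrite -lee_fin.
have bs := bdd_meas_sqr (bdd_small_jump del (mv N)).
rewrite -ExZ// -ExE; last exact: bdd_measZ.
have K0' (x : E) : 0 <= K N by exact: ltW.
have := small_moment (measurable_cst (K N)) K0' (mav N) C0 b0 (HC N) b2 del0.
move=> h; apply: le_trans _ (le_trans h _); last by rewrite lee_fin.
have := @restrict_small 2 N del (fun x => small_jump (jump N) del x ^+ 2) bs.1.
move=> h2; apply: le_trans (h2 _ _).
- rewrite le_eqVlt; apply/orP; left; apply/eqP; apply: eq_integral => x _.
  by rewrite mulrC ger0_norm// sqr_ge0.
- move=> x; rewrite ger0_norm ?sqr_ge0// /small_jump exprMn powR_mulrn// real_normK ?num_real//.
  by rewrite indicE; case: (_ \in _); rewrite ?mulr1 ?mulr0 ?expr1n ?expr0n ?mulr1 ?mulr0.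
- by move=> x e'; rewrite /small_jump e' mul0r expr0n.
Qed.

(** For [b < 1] this is the first moment of the small jumps. For [b > 1] the variable is centered,
    so the mean of the small jumps is minus that of the large ones. For [b = 1] the centering is [K]
    times the mean of the jumps up to size 1, and only jumps between [del] and 1 make a
    difference. *)
Lemma scaled_drift del : 0 < del ->
  exists C, forall N, `|K N * (\int[pi]_x small_jump (jump N) del x)%R - centering N| <= C.
Proof.
move=> del0; have [C C0 HC] := abs_wtail.
have bs N := bdd_small_jump del (mv N).
have [b1|b1|b1] := ltgtP b 1.
- eexists=> N; rewrite /centering lt_eqF// subr0 -ExZ// -lee_fin.
  have bKs := bdd_measZ (K N) (bs N).
  apply: (@le_trans _ _ (\int[pi]_x (`|small_jump (jump N) del x| * K N)%R%:E)%E).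
    rewrite EFin_normr_Rintegral//; last exact: bdd_meas_integrable.
    apply: le_trans (le_abse_integral _ _ _) _ => //; first by apply/measurable_EFinP; case: bKs.
    rewrite le_eqVlt; apply/orP; left; apply/eqP; apply: eq_integral => x _.
    by rewrite /= normrM (gtr0_norm (K0 N)) mulrC.
  have K0' (x : E) : 0 <= K N by exact: ltW.
  apply: le_trans (small_moment (measurable_cst (K N)) K0' (mav N) C0 b0 (HC N) b1 del0).
  apply: restrict_small; first by case: (bs N).
    by move=> x; rewrite powRr1// normrM ler_wpM2l// ger0_norm// indicE.
  by move=> x e'; rewrite /small_jump e' mul0r.
- eexists=> N; rewrite /centering gt_eqF// subr0.
  have iV := integrable_scaled mV b0 b2 cp0 cm0 tail_right tail_left K1 KN b1.
  pose g x := jump N x - small_jump (jump N) del x.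
  have ij : pi.-integrable setT (EFin \o jump N).
    have := integrableZl measurableT (L N)^-1 iV; congr (_.-integrable _ _).
    by apply/funext => x; rewrite /= -EFinM mulrC.
  have is_ := bdd_meas_integrable pi (bs N).
  have ig : pi.-integrable setT (EFin \o g) by exact: (integrableB measurableT ij is_).
  have Ij : (\int[pi]_x jump N x)%R = 0.
    rewrite (_ : (\int[pi]_x jump N x)%R = (\int[pi]_x ((L N)^-1 * V x))%R); last first.
      by apply: eq_Rintegral => x _; rewrite mulrC.
    by rewrite RintegralZl// [X in _ * X]/Rintegral V_centered// mulr0.
  have Ig : (\int[pi]_x small_jump (jump N) del x)%R = - (\int[pi]_x g x)%R.
    by rewrite /g RintegralB// Ij sub0r opprK.
  have iKg := integrableZl measurableT (K N) ig.
  rewrite Ig mulrN normrN -RintegralZl// -lee_fin.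
  apply: (@le_trans _ _ (\int[pi]_x (`|g x| * K N)%R%:E)%E).
    rewrite EFin_normr_Rintegral//.
    apply: le_trans (le_abse_integral _ _ _) _ => //; first exact: (measurable_int pi).
    rewrite le_eqVlt; apply/orP; left; apply/eqP; apply: eq_integral => x _.
    by rewrite /= normrM (gtr0_norm (K0 N)) mulrC.
  have K0' (x : E) : 0 <= K N by exact: ltW.
  apply: le_trans (large_moment (measurable_cst (K N)) K0' (mav N) C0 (HC N) ler01 b1 del0).
  have mD : measurable [set x | del <= `|jump N x|].
    exact: (@measurable_geY _ _ _ (fun x => `|jump N x|)).
  rewrite [leRHS]integral_mkcond; apply: ge0_le_integral => //.
  + by move=> x _; rewrite lee_fin mulr_ge0// ltW.
  + apply/measurable_EFinP; apply: measurable_funM => //.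
    by apply: (measurableT_comp (@normr_measurable R setT)); exact/measurable_EFinP/(measurable_int pi).
  + apply/(measurable_restrictT _ _).1 => //.
    apply: measurable_funTS; apply/measurable_EFinP; apply: measurable_funM => //.
    exact: (measurableT_comp (measurable_powR _) (mav N)).
  + move=> x _; rewrite patchE /g /small_jump indicE; have [h|h] := leP `|jump N x| del.
      rewrite (mem_set (h : [set y | `|jump N y| <= del] x)) mulr1 subrr normr0 mul0r.
      by case: ifPn => // _; rewrite lee_fin mulr_ge0 ?powR_ge0//= ltW.
    rewrite memNset/=; last by apply/negP; rewrite -ltNge.
    by rewrite mulr0 subr0 mem_set/= ?powRr1// ltW.
- exists (Num.max del 1 * (C * (Num.min del 1) `^ (- b))) => N.
  have LE : L N = K N by rewrite /L b1 invr1 powRr1// ltW.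
  have b1s := bdd_small_jump 1 (mv N).
  have -> : centering N = K N * (\int[pi]_x small_jump (jump N) 1 x)%R.
    rewrite /centering b1 eqxx -ExZ//; apply: eq_Rintegral => x _.
    rewrite /small_jump /truncation /jump -/(L N) mulrCA.
    rewrite (_ : [set y | `|V y| <= K N] = [set y | `|V y / L N| <= 1]).
      by rewrite LE -mulrA mulKf// gt_eqF.
    by apply/seteqP; split=> y /=; rewrite LE normrM normfV (gtr0_norm (K0 N)) ler_pdivrMr// mul1r.
  have m0 : 0 < Num.min del 1 by rewrite lt_min del0 ltr01.
  have mA : measurable [set x | Num.min del 1 <= `|jump N x|].
    exact: (@measurable_geY _ _ _ (fun x => `|jump N x|)).
  rewrite -mulrBr -ExB// normrM (gtr0_norm (K0 N)).
  apply: (@le_trans _ _ (K N * (Num.max del 1 * fine (pi [set x | Num.min del 1 <= `|jump N x|])))).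
    apply: ler_wpM2l; first exact: ltW.
    rewrite -Ex_indic// -ExZ; last exact: bdd_meas_indic.
    have bd := bdd_measB (bs N) b1s.
    have bi := bdd_measZ (Num.max del 1) (bdd_meas_indic mA (R := R)).
    have pw x : `|small_jump (jump N) del x - small_jump (jump N) 1 x| <=
        Num.max del 1 * \1_[set x0 | Num.min del 1 <= `|jump N x0|] x.
      rewrite /small_jump !indicE.
      have M0 : 0 <= Num.max del 1 by rewrite le_max ler01 orbT.
      have [h1|h1] := leP `|jump N x| del; have [h2|h2] := leP `|jump N x| 1.
      + rewrite (mem_set (h1 : [set y | `|jump N y| <= del] x)) (mem_set (h2 : [set y | `|jump N y| <= 1] x)).
        by rewrite subrr normr0 mulr_ge0.
      + rewrite (mem_set (h1 : [set y | `|jump N y| <= del] x)) (memNset (_ : ~ [set y | `|jump N y| <= 1] x)); last first.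
          by apply/negP; rewrite -ltNge.
        rewrite mulr1 mulr0 subr0 mem_set/=; last by rewrite ge_min (ltW h2) orbT.
        by rewrite mulr1 le_max h1.
      + rewrite (memNset (_ : ~ [set y | `|jump N y| <= del] x)); last first.
          by apply/negP; rewrite -ltNge.
        rewrite (mem_set (h2 : [set y | `|jump N y| <= 1] x)) mulr0 mulr1 sub0r normrN.
        rewrite mem_set/=; last by rewrite ge_min (ltW h1).
        by rewrite mulr1 le_max h2 orbT.
      + rewrite (memNset (_ : ~ [set y | `|jump N y| <= del] x)); last first.
          by apply/negP; rewrite -ltNge.
        rewrite (memNset (_ : ~ [set y | `|jump N y| <= 1] x)); last first.
          by apply/negP; rewrite -ltNge.
        by rewrite !mulr0 subrr normr0 mulr_ge0.
    rewrite ler_norml; apply/andP; split.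
      rewrite -[leLHS]mulN1r -ExZ//; apply: le_Ex => //; first exact: bdd_measZ.
      by move=> x; rewrite mulN1r; have := pw x; rewrite ler_norml => /andP[].
    by apply: le_Ex => // x; have := pw x; rewrite ler_norml => /andP[].
  rewrite mulrCA ler_wpM2l//; first by rewrite le_max ler01 orbT.
  have := HC N _ m0; rewrite /wtail integral_cst//.
  by rewrite -[X in (_ * X <= _)%E]fineK ?fin_num_measure// -EFinM lee_fin.
Qed.

(** With [s <= 1] one has [min(1,|v|) <= |v|^s], so the mean is of order [L^(-s)] when [s < b].
    Multiplying its square by [K = L^b] leaves a negative power when [s > b / 2]. *)
Lemma scaled_min :
  K N * (\int[pi]_x unit_jump (jump N) x)%R ^+ 2 @[N --> \oo] --> (0 : R).
Proof.
have [C C0 HC] := abs_tail.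
(* An exponent in [(b / 2, b)] that does not exceed 1; it exists since [b < 2]. *)
pose s := Num.min 1 (3 / 4 * b).
have s0 : 0 < s by rewrite lt_min ltr01 mulr_gt0// divr_gt0.
have sb : s < b by rewrite gt_min; apply/orP; right; rewrite -[ltRHS]mul1r ltr_pM2r//; lra.
have s1 : s <= 1 by rewrite ge_min lexx.
have sb2 : 0 < 2 * s / b - 1.
  rewrite subr_gt0 ltr_pdivlMr// mul1r /s /Num.min; case: ifPn => _; first by rewrite mulr1.
  by rewrite mulrA -[ltLHS]mul1r ltr_pM2r//; lra.
have HC1 r : 0 < r -> (wtail pi (fun=> 1%R) (fun x => `|V x|%R) r <= (C * r `^ (- b))%:E)%E.
  move=> r0; have m3 : measurable [set x | r <= `|V x|] by exact: (@measurable_geY _ _ _ (fun x => `|V x|)).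
  rewrite /wtail integral_cst// mul1e -[leLHS]fineK ?fin_num_measure// lee_fin; exact: HC.
have := large_moment (measurable_cst (1 : R)) (fun _ : E => ler01) maV C0 HC1 (ltW s0) sb ltr01.
rewrite powR1 mulr1; set M := _ / _ => HM.
have M0 : 0 <= M.
  rewrite -lee_fin; apply: le_trans HM; apply: integral_ge0 => x _.
  by rewrite lee_fin mulr1 powR_ge0.
have bu N := bdd_unit_jump (mv N).
have e1 : (1 : R) = 1 `^ s by rewrite powR1.
have mD : measurable [set x | 1 <= `|V x|] by exact: (@measurable_geY _ _ _ (fun x => `|V x|)).
have H N : (\int[pi]_x unit_jump (jump N) x)%R <= L N `^ (- s) * (1 + M).
  rewrite -lee_fin -ExE//.
  have pw x : unit_jump (jump N) x <= L N `^ (- s) * (1 + `|V x| `^ s * 1 * \1_[set y | 1 <= `|V y|] x).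
    have h0 : 0 <= `|V x| `^ s * 1 * \1_[set y | 1 <= `|V y|] x.
      by rewrite mulr1 mulr_ge0 ?powR_ge0// indicE.
    apply: (@le_trans _ _ (`|jump N x| `^ s)).
      rewrite /unit_jump; have [h|h] := leP 1 `|jump N x|.
        by rewrite [leLHS]e1; apply: ge0_ler_powR; rewrite ?nnegrE// ltW.
      have [->|e] := eqVneq (jump N x) 0; first by rewrite normr0 powR_ge0.
      by apply: ger1_powR => //; rewrite normr_gt0 e ltW.
    rewrite /jump normrM normfV (gtr0_norm (L0 N)) powRM ?invr_ge0 ?(ltW (L0 N))//.
    rewrite -[(K N `^ _)^-1](powR_inv1 (ltW (L0 N))) -powRrM mulN1r mulrC.
    apply: ler_wpM2l; first exact: powR_ge0.
    have [h|h] := leP 1 `|V x|.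
      by rewrite indicE mem_set// !mulr1 lerDr.
    apply: (@le_trans _ _ 1); last by rewrite lerDl.
    by rewrite [leRHS]e1; apply: ge0_ler_powR; rewrite ?nnegrE// ltW.
  have mI : measurable_fun setT (fun x => `|V x| `^ s * 1 * \1_[set y | 1 <= `|V y|] x).
    apply: measurable_funM; last exact: measurable_indic.
    by apply: measurable_funM => //; exact: (measurableT_comp (measurable_powR _) maV).
  apply: (@le_trans _ _ (\int[pi]_x ((L N `^ (- s))%:E * (1%:E + (`|V x| `^ s * 1 * \1_[set y | (1 <= `|V y|)%R] x)%:E)))%E).
    apply: ge0_le_integral => //.
    - by move=> x _; rewrite lee_fin unit_jump_ge0.
    - by apply/measurable_EFinP; case: (bu N).
    - by apply: measurable_funeM; apply: emeasurable_funD => //; exact/measurable_EFinP.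
    - by move=> x _; rewrite -EFinD -EFinM lee_fin; exact: pw.
  have I0 x : (0 <= (`|V x| `^ s * 1 * \1_[set y | (1 <= `|V y|)%R] x)%:E)%E.
    by rewrite lee_fin mulr1 mulr_ge0 ?powR_ge0// indicE.
  rewrite ge0_integralZl ?lee_fin ?powR_ge0//; last 2 first.
  - by apply: emeasurable_funD => //; exact/measurable_EFinP.
  - by move=> x _; rewrite adde_ge0.
  rewrite [leRHS]EFinM lee_wpmul2l ?lee_fin ?powR_ge0//.
  rewrite ge0_integralD//; last exact/measurable_EFinP.
  rewrite EFinD; apply: leeD.
    by rewrite integral_cst// mul1e; exact: probability_le1.
  move: HM; rewrite integral_mkcond; apply: le_trans.
  rewrite le_eqVlt; apply/orP; left; apply/eqP; apply: eq_integral => x _.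
  by rewrite patchE indicE; case: ifPn => _; rewrite ?mulr1 ?mulr0.
have up : (1 + M) ^+ 2 * K N `^ (- (2 * s / b - 1)) @[N --> \oo] --> (0 : R).
  rewrite -[0](mulr0 ((1 + M) ^+ 2)); apply: cvgM; first exact: cvg_cst.
  exact: (cvg_comp _ _ KN (powRN_cvg0 sb2)).
apply: (squeeze_cvgr _ (cvg_cst 0) up); apply: nearW => N.
have u0 : 0 <= (\int[pi]_x unit_jump (jump N) x)%R by apply: Ex_ge0 => x; exact: unit_jump_ge0.
rewrite mulr_ge0 ?sqr_ge0 ?(ltW (K0 N))//=.
apply: (@le_trans _ _ (K N * (L N `^ (- s) * (1 + M)) ^+ 2)).
  apply: ler_wpM2l; first exact: ltW.
  by apply: lerXn2r; rewrite ?nnegrE//; exact: le_trans (H N).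
rewrite exprMn mulrA mulrC ler_wpM2l ?sqr_ge0//.
rewrite -powR_mulrn ?powR_ge0// -!powRrM -[X in X * _](powRr1 (ltW (K0 N))) -powRD; last first.
  by rewrite (gt_eqF (K0 N)) implybT.
rewrite le_eqVlt; apply/orP; left; apply/eqP; congr powR.
by field; rewrite gt_eqF.
Qed.

Lemma heavy_scaled : heavy P pi jump K centering (levy_exponent b cp cm).
Proof.
split.
- exact: mv.
- move=> del del0; have [C C0 HC] := abs_wtail; exists (C * del `^ (- b)) => N.
  have mA : measurable [set x | del <= `|jump N x|].
    exact: (@measurable_geY _ _ _ (fun x => `|jump N x|)).
  have := HC N _ del0; rewrite /wtail integral_cst//.
  by rewrite -[X in (_ * X <= _)%E]fineK ?fin_num_measure// -EFinM lee_fin.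
- move=> e e0; have [C C0 HC] := abs_wtail.
  have [y /andP[y0 _] hy] := powR_small C0 b0 e0.
  exists y^-1; first by rewrite invr_gt0.
  move=> N; have mA : measurable [set x | y^-1 <= `|jump N x|].
    exact: (@measurable_geY _ _ _ (fun x => `|jump N x|)).
  have yi : 0 < y^-1 by rewrite invr_gt0.
  have := HC N _ yi; rewrite /wtail integral_cst//.
  rewrite -[X in (_ * X <= _)%E]fineK ?fin_num_measure// -EFinM lee_fin => h.
  by rewrite (le_trans h)// -(powR_inv1 (ltW y0)) -powRrM mulN1r opprK.
- exact: scaled_small.
- exact: scaled_drift.
- exact: scaled_min.
- by move=> xi; exact: (levy_cos mV b0 b2 cp0 cm0 tail_right tail_left K1 KN).
- move=> xi; rewrite /centering; have [b1|b1|b1] := ltgtP b 1.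
  + under eq_fun do rewrite mulr0 subr0.
    exact: (levy_sin_lt1 mV b0 cp0 cm0 tail_right tail_left K1 KN).
  + under eq_fun do rewrite mulr0 subr0.
    by apply: (levy_sin_gt1 mV b0 b2 cp0 cm0 tail_right tail_left K1 KN) => //; exact: V_centered.
  + exact: (levy_sin_eq1 mV b0 b2 cp0 cm0 tail_right tail_left K1 KN).
- by have [C C0 H] := scaled_domination hA2 mV L0 hdom; exists C.
Qed.

End scaled.

(** * Convergence of expectations from characteristic functions *)

Section bernstein.
Context {R : realType}.
Implicit Types (u : R) (f g : nat -> R).

(* [bern u n f] is the expectation of [f] under the binomial law of parameters
   [n] and [u], computed by conditioning on the first trial. *)
Fixpoint bern u n f : R :=
  if n is m.+1 then u * bern u m (fun k => f k.+1) + (1 - u) * bern u m f else f 0%N.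

Lemma bern_le u n f g : 0 <= u <= 1 -> (forall k, (k <= n)%N -> f k <= g k) ->
  bern u n f <= bern u n g.
Proof.
move=> /andP[u0 u1]; have u10 : 0 <= 1 - u by rewrite subr_ge0.
elim: n f g => [|n IH] f g fg /=; first exact: fg.
apply: lerD; apply: ler_wpM2l => //; apply: IH => k kn; first exact: fg.
by apply: fg; exact: leqW.
Qed.

Lemma bernD u n f g : bern u n (fun k => f k + g k) = bern u n f + bern u n g.
Proof. by elim: n f g => [|n IH] f g //=; rewrite !IH; ring. Qed.

Lemma bernZ u n c f : bern u n (fun k => c * f k) = c * bern u n f.
Proof. by elim: n f => [|n IH] f //=; rewrite !IH; ring. Qed.

Lemma bern_cst u n c : bern u n (fun=> c) = c.
Proof. by elim: n => [|n IH] //=; rewrite !IH; ring. Qed.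

(** The shift [s] absorbs the outcome of the first trial in the induction. *)
Lemma bern_variance u n s :
  bern u n (fun k => (k%:R + s - n%:R * u) ^+ 2) = n%:R * (u * (1 - u)) + s ^+ 2.
Proof.
elim: n s => [|n IH] s /=; first by rewrite /=; ring.
have -> : (fun k : nat => (k.+1%:R + s - n.+1%:R * u) ^+ 2) =
    (fun k : nat => (k%:R + (s + 1 - u) - n%:R * u) ^+ 2).
  by apply/funext => k; rewrite -!natr1; congr (_ ^+ 2); ring.
have -> : (fun k : nat => (k%:R + s - n.+1%:R * u) ^+ 2) =
    (fun k : nat => (k%:R + (s - u) - n%:R * u) ^+ 2).
  by apply/funext => k; rewrite -!natr1; congr (_ ^+ 2); ring.
by rewrite !IH -!natr1; ring.
Qed.

Lemma bern_norm_le u n f g c : 0 <= u <= 1 ->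
  (forall k, (k <= n)%N -> `|f k - c| <= g k) -> `|bern u n f - c| <= bern u n g.
Proof.
move=> u01 fg.
have -> : bern u n f - c = bern u n (fun k => f k + - c).
  by rewrite bernD bern_cst.
rewrite ler_norml; apply/andP; split.
  rewrite -mulN1r -bernZ; apply: bern_le => // k kn.
  by have := fg k kn; rewrite ler_norml mulN1r => /andP[].
by apply: bern_le => // k kn; have := fg k kn; rewrite ler_norml => /andP[].
Qed.

(** Bernstein's argument: near [u] the values are within [eta] of [c], and Chebyshev's inequality
    bounds the rest, with [u * (1 - u) <= 1]. *)
Lemma bern_approx u n f c B eta del : 0 <= u <= 1 -> (0 < n)%N -> 0 < del -> 0 <= B ->
  0 <= eta ->
  (forall k, (k <= n)%N -> `|f k - c| <= B) ->
  (forall k, (k <= n)%N -> `|k%:R / n%:R - u| < del -> `|f k - c| <= eta) ->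
  `|bern u n f - c| <= eta + B / (n%:R * del ^+ 2).
Proof.
move=> u01 n0 d0 B0 eta0 fB fe; have n0' : (0 : R) < n%:R by rewrite ltr0n.
pose g k := eta + B / (n%:R * del) ^+ 2 * (k%:R + 0 - n%:R * u) ^+ 2.
have fg k : (k <= n)%N -> `|f k - c| <= g k.
  move=> kn; have [h|h] := ltP `|k%:R / n%:R - u| del.
    apply: (le_trans (fe k kn h)); rewrite lerDl mulr_ge0 ?sqr_ge0//.
    by rewrite divr_ge0// sqr_ge0.
  apply: (le_trans (fB k kn)); rewrite /g.
  have -> : k%:R + 0 - n%:R * u = n%:R * (k%:R / n%:R - u) by field; rewrite gt_eqF.
  rewrite !exprMn invfM.
  have -> : B * (n%:R ^- 2 * del ^- 2) * (n%:R ^+ 2 * (k%:R / n%:R - u) ^+ 2) =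
     B * ((k%:R / n%:R - u) ^+ 2 / del ^+ 2).
    by field; rewrite !gt_eqF.
  apply: (@le_trans _ _ (B * ((k%:R / n%:R - u) ^+ 2 / del ^+ 2))); last by rewrite lerDr.
  rewrite ler_peMr// ler_pdivlMr ?exprn_gt0// mul1r -[leRHS]real_normK ?num_real//.
  by rewrite lerXn2r// nnegrE ltW.
have Eg : bern u n g <= eta + B / (n%:R * del ^+ 2).
  rewrite /g bernD bern_cst bernZ bern_variance expr0n/= addr0 lerD2l.
  rewrite exprMn (_ : B / (n%:R ^+ 2 * del ^+ 2) * (n%:R * (u * (1 - u))) =
    B / (n%:R * del ^+ 2) * (u * (1 - u))); last by field; rewrite !gt_eqF.
  apply: ler_piMr.
    by apply: divr_ge0 => //; apply: mulr_ge0; [exact: ltW|exact: sqr_ge0].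
  by case/andP: u01 => u0 u1; rewrite mulr_ile1 ?subr_ge0// lerBlDr lerDl.
exact: le_trans (bern_norm_le u01 fg) Eg.
Qed.

Lemma cos_le_pi (x y : R) : 0 <= x -> x <= y -> y <= pi -> cos y <= cos x.
Proof.
move=> x0; rewrite le_eqVlt => /orP[/eqP ->//|xy] yp.
by rewrite ltW// ltr_cos// in_itv/= ?x0 ?yp ?andbT/= ?(le_trans x0) ?(le_trans (ltW xy))// ltW.
Qed.

(** With half-sum [m] and half-difference [r] the two sides are [2 (sin r)^2] and [2 cos m sin r],
    and [sin r <= cos m] because [|m| + r <= pi / 2]. *)
Lemma sinB_ge (a b : R) : - (pi / 2) <= b -> b <= a -> a <= pi / 2 ->
  1 - cos (a - b) <= sin a - sin b.
Proof.
move=> b1 ab a1; pose m := (a + b) / 2; pose r := (a - b) / 2.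
have -> : a - b = r + r by rewrite /r; lra.
have -> : sin a = sin (m + r) by congr sin; rewrite /m /r; lra.
have -> : sin b = sin (m - r) by congr sin; rewrite /m /r; lra.
rewrite cosD sinD sinB.
have pi0 := pi_gt0 R.
have r0 : 0 <= r by rewrite /r; lra.
have rp : r <= pi / 2 by rewrite /r; lra.
have s0 : 0 <= sin r by apply: sin_ge0_pi; rewrite r0/=; lra.
have H : sin r <= cos m.
  rewrite -cosBpihalf -(cosN (r - pi / 2)) opprB.
  have [m0|m0] := leP 0 m; last rewrite -(cosN m).
    by apply: cos_le_pi => //; rewrite /m /r in m0 *; lra.
  by apply: cos_le_pi; rewrite /m /r in m0 *; lra.
have -> : 1 - (cos r * cos r - sin r * sin r) = 2 * (sin r * sin r).
  by have := cos2Dsin2 r; lra.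
have -> : sin m * cos r + cos m * sin r - (sin m * cos r - cos m * sin r) =
  2 * (cos m * sin r) by lra.
by rewrite ler_pM2l// ler_wpM2r.
Qed.

(** An explicit modulus of uniform continuity for the arcsine, up to and including the ends of its
    domain. *)
Lemma asin_close (a b d : R) : - (pi / 2) <= a <= pi / 2 -> - (pi / 2) <= b <= pi / 2 ->
  0 < d < 1 -> `|sin a - sin b| < 1 - cos d -> `|a - b| < d.
Proof.
move=> /andP[a1 a2] /andP[b1 b2] /andP[d0 d1] h.
have pi2 : (2 : R) <= pi by exact: pi_ge2.
rewrite ltNge; apply/negP => abd.
suff : 1 - cos d <= `|sin a - sin b| by rewrite leNgt h.
have cd x : d <= x -> x <= pi -> 1 - cos d <= 1 - cos x.
  by move=> dx xp; rewrite lerD2l lerN2; apply: cos_le_pi => //; exact: ltW.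
have [ab|/ltW ab] := leP b a.
  move: abd; rewrite (ger0_norm (_ : 0 <= a - b)) ?subr_ge0// => /cd h1.
  apply: (le_trans (h1 _)); first by lra.
  by apply: le_trans (sinB_ge b1 ab a2) _; exact: ler_norm.
move: abd; rewrite distrC (ger0_norm (_ : 0 <= b - a)) ?subr_ge0// => /cd h1.
apply: (le_trans (h1 _)); first by lra.
by apply: le_trans (sinB_ge a1 ab b2) _; rewrite distrC; exact: ler_norm.
Qed.

End bernstein.

Lemma eps_collect (R : realType) (m g e : R) : 0 <= m -> 0 <= g -> 0 <= e ->
  e + (m * (e + e) + m * (2 * g) * e) + (m * (e + e) + m * (2 * g) * e) <=
  e * (4 * (2 * m * g + m + 1)).
Proof.
by move=> m0 g0 e0; have := mulr_ge0 (mulr_ge0 m0 g0) e0; have := mulr_ge0 m0 e0; lra.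
Qed.

Section charfun_convergence.
Context {R : realType} {d d'} {Om : measurableType d} {Om' : measurableType d'}.
Variables (Pr : probability Om R) (Pr' : probability Om' R) (n : nat).
Variables (Y : nat -> Om -> nat -> R) (Yoo : Om' -> nat -> R).
Hypothesis mY : forall N i, measurable_fun setT (fun w => Y N w i).
Hypothesis mYoo : forall i, measurable_fun setT (fun w => Yoo w i).
Implicit Types (G H : (nat -> R) -> R) (xi : nat -> R).

(** Contains that [G] depends on its first [j] coordinates only, since sequences that agree there
    satisfy the premise for every [del]. *)
Definition unif_cont_coord j G := forall eta, 0 < eta -> exists2 del, 0 < del &
  forall y y', (forall i, (i < j)%N -> `|y i - y' i| < del) -> `|G y - G y'| <= eta.

Lemma measurable_unif_cont_coord {e} {S : measurableType e} (W : S -> nat -> R) j G :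
  (forall i, measurable_fun setT (fun w => W w i)) -> unif_cont_coord j G ->
  measurable_fun setT (fun w => G (W w)).
Proof.
move=> mW uG.
apply: (@measurable_fun_cvg _ _ _ setT (fun m w => G (fun i => round_to m (W w i)))); last first.
  move=> w _; apply/cvgrPdist_le => eta eta0.
  have [del del0 H] := uG _ eta0; near=> m; apply: H => i _.
  apply: le_lt_trans (round_to_close m _) _.
  rewrite -[X in _ < X]invrK ltf_pV2 ?posrE ?invr_gt0//.
  apply: (@lt_le_trans _ _ m%:R); last by rewrite ler_nat.
  near: m; exact: nbhs_infty_gtr.
move=> m.
pose c w : j.-tuple int := [tuple Num.floor (W w k * m.+1%:R) | k < j].
pose g (v : j.-tuple int) := G (fun i => (nth 0 v i)%:~R / m.+1%:R).
have GE y y' : (forall i, (i < j)%N -> y i = y' i) -> G y = G y'.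
  move=> yy; apply/eqP; rewrite -subr_eq0 -normr_eq0 eq_le normr_ge0 andbT.
  apply/ler_addgt0Pr => eta eta0; rewrite add0r; have [del del0] := uG _ eta0; apply => i ij.
  by rewrite yy// subrr normr0.
rewrite (_ : (fun w => _) = g \o c); last first.
  apply/funext => w /=; apply: GE => i ij.
  by rewrite -(tnth_nth 0 (c w) (Ordinal ij)) tnth_mktuple.
apply: measurable_countable_comp => v.
rewrite (_ : _ @^-1` _ = \bigcap_(k in [set: 'I_j])
   [set w | Num.floor (W w k * m.+1%:R) = tnth v k]).
  apply: fin_bigcap_measurable => // k _.
  by apply: measurable_floor_fiber; apply: measurable_funM.
apply/seteqP; split=> w /=.
  by move=> <- k _; rewrite tnth_mktuple.
by move=> H; apply: eq_from_tnth => k; rewrite tnth_mktuple; exact: H.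
Unshelve. all: by end_near. Qed.

Definition Ex_cvg H :=
  (\int[Pr]_w H (Y N w))%R @[N --> \oo] --> (\int[Pr']_w H (Yoo w))%R.

Definition bdd_meas_Y H :=
  (forall N, bdd_meas (fun w => H (Y N w))) /\ bdd_meas (fun w => H (Yoo w)).

Lemma bdd_meas_YM H G : bdd_meas_Y H -> bdd_meas_Y G -> bdd_meas_Y (fun y => H y * G y).
Proof. by move=> [a b] [a' b']; split=> [N|]; exact: bdd_measM. Qed.

Lemma bdd_meas_YD H G : bdd_meas_Y H -> bdd_meas_Y G -> bdd_meas_Y (fun y => H y + G y).
Proof. by move=> [a b] [a' b']; split=> [N|]; exact: bdd_measD. Qed.

Lemma bdd_meas_YZ c H : bdd_meas_Y H -> bdd_meas_Y (fun y => c * H y).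
Proof. by move=> [a b]; split=> [N|]; exact: bdd_measZ. Qed.

Lemma Ex_cvgD H G : bdd_meas_Y H -> bdd_meas_Y G -> Ex_cvg H -> Ex_cvg G ->
  Ex_cvg (fun y => H y + G y).
Proof.
move=> [a b] [a' b'] cH cG; rewrite /Ex_cvg ExD//.
by under eq_fun do rewrite ExD//; exact: cvgD.
Qed.

Lemma Ex_cvgZ c H : bdd_meas_Y H -> Ex_cvg H -> Ex_cvg (fun y => c * H y).
Proof.
move=> [a b] cH; rewrite /Ex_cvg ExZ//.
by under eq_fun do rewrite ExZ//; apply: cvgMr.
Qed.

Definition lin xi (y : nat -> R) := \sum_(i < n) xi i * y i.

Lemma bdd_meas_Ycos xi : bdd_meas_Y (fun y => cos (lin xi y)).
Proof.
by split=> [N|]; apply: bdd_meas_cos; apply: measurable_sum => i;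
  apply: measurable_funM.
Qed.

Lemma bdd_meas_Ysin xi : bdd_meas_Y (fun y => sin (lin xi y)).
Proof.
by split=> [N|]; apply: bdd_meas_sin; apply: measurable_sum => i;
  apply: measurable_funM.
Qed.

Lemma linD xi zeta y : lin (fun i => xi i + zeta i) y = lin xi y + lin zeta y.
Proof. by rewrite /lin -big_split; apply: eq_bigr => i _; rewrite mulrDl. Qed.

Lemma linB xi zeta y : lin (fun i => xi i - zeta i) y = lin xi y - lin zeta y.
Proof. by rewrite /lin -sumrB; apply: eq_bigr => i _; rewrite mulrBl. Qed.

(** The bounded multipliers that keep convergence of characteristic functions. The class contains 1
    and, by [trig_cvg_mono], is stable under multiplication by [a + b sin], hence contains the
    products that arise in Bernstein polynomials. *)
Definition trig_cvg H := [/\ bdd_meas_Y H, exists2 M, 0 <= M & forall y, `|H y| <= M,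
  forall xi, Ex_cvg (fun y => H y * cos (lin xi y)) &
  forall xi, Ex_cvg (fun y => H y * sin (lin xi y))].

(** Products of two sines, or of a sine and a cosine, are combinations of sines and cosines of sums
    and differences. *)
Lemma trig_cvg_mono H xi a b :
  trig_cvg H -> trig_cvg (fun y => H y * (a + b * sin (lin xi y))).
Proof.
move=> [bH [M M0 HM] cH sH].
have bC := bdd_meas_Ycos; have bS := bdd_meas_Ysin.
have bHC zeta := bdd_meas_YM bH (bC zeta).
have bHS zeta := bdd_meas_YM bH (bS zeta).
split.
- apply: bdd_meas_YM => //; apply: bdd_meas_YD; last exact: bdd_meas_YZ.
  by split=> [N|]; exact: bdd_meas_cst.
- exists (M * (`|a| + `|b|)); first by rewrite mulr_ge0// addr_ge0.
  move=> y; rewrite normrM ler_pM//; apply: le_trans (ler_normD _ _) _.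
  rewrite lerD2l normrM ler_piMr//; rewrite ler_norml sin_geN1 sin_le1//.
- move=> zeta.
  have -> : (fun y => H y * (a + b * sin (lin xi y)) * cos (lin zeta y)) =
    (fun y => a * (H y * cos (lin zeta y)) +
      (b / 2 * (H y * sin (lin (fun i => xi i + zeta i) y)) +
       b / 2 * (H y * sin (lin (fun i => xi i - zeta i) y)))).
    by apply/funext => y; rewrite linB linD sinD sinB; lra.
  by apply: Ex_cvgD; [exact: bdd_meas_YZ|apply: bdd_meas_YD; exact: bdd_meas_YZ|
    exact: Ex_cvgZ|apply: Ex_cvgD; [exact: bdd_meas_YZ..|exact: Ex_cvgZ|exact: Ex_cvgZ]].
- move=> zeta.
  have -> : (fun y => H y * (a + b * sin (lin xi y)) * sin (lin zeta y)) =
    (fun y => a * (H y * sin (lin zeta y)) +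
      (b / 2 * (H y * cos (lin (fun i => xi i - zeta i) y)) +
       (- (b / 2)) * (H y * cos (lin (fun i => xi i + zeta i) y)))).
    by apply/funext => y; rewrite linB linD cosB cosD; lra.
  by apply: Ex_cvgD; [exact: bdd_meas_YZ|apply: bdd_meas_YD; exact: bdd_meas_YZ|
    exact: Ex_cvgZ|apply: Ex_cvgD; [exact: bdd_meas_YZ..|exact: Ex_cvgZ|exact: Ex_cvgZ]].
Qed.

(** A variable with values in [[0,1]], affine in a sine of [y j] and injective on [|y j| < L]. *)
Definition sin_coord (L : R) (j : nat) (y : nat -> R) := 2^-1 + 2^-1 * sin (y j / L).

Lemma sin_coord01 L j y : 0 <= sin_coord L j y <= 1.
Proof.
by rewrite /sin_coord; have := sin_geN1 (y j / L); have := sin_le1 (y j / L) => *;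
  apply/andP; split; lra.
Qed.

Lemma sin_coordE L j y : (j < n)%N ->
  sin_coord L j y = 2^-1 + 2^-1 * sin (lin (fun i => if i == j then L^-1 else 0) y).
Proof.
move=> jn; rewrite /sin_coord /lin (bigD1 (Ordinal jn))//= eqxx big1 ?addr0 1?[L^-1 * _]mulrC//.
move=> i /negbTE ij; have -> : (i == j :> nat) = false by exact: ij.
by rewrite mul0r.
Qed.

(** Each level of the recursion of [bern] multiplies [H] by [u] or [1 - u], both of the form allowed
    by [trig_cvg_mono]. *)
Lemma bern_trig L j m (f : nat -> (nat -> R) -> R) H : (j < n)%N ->
  (forall k, bdd_meas_Y (f k)) ->
  (forall k H, trig_cvg H -> Ex_cvg (fun y => H y * f k y)) -> trig_cvg H ->
  bdd_meas_Y (fun y => bern (sin_coord L j y) m (fun k => f k y)) /\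
  Ex_cvg (fun y => H y * bern (sin_coord L j y) m (fun k => f k y)).
Proof.
move=> jn; elim: m f H => [|m IH] f H bf cf tH /=; first by split; [exact: bf|exact: cf].
set xi := fun i : nat => if i == j then L^-1 else 0.
have uE y : sin_coord L j y = 2^-1 + 2^-1 * sin (lin xi y) by exact: sin_coordE.
have vE y : 1 - sin_coord L j y = 2^-1 + (- 2^-1) * sin (lin xi y).
  by rewrite uE; lra.
have tH1 := trig_cvg_mono xi 2^-1 2^-1 tH.
have tH2 := trig_cvg_mono xi 2^-1 (- 2^-1) tH.
have [b1 c1] := IH (fun k => f k.+1) _ (fun k => bf k.+1) (fun k => cf k.+1) tH1.
have [b2 c2] := IH f _ bf cf tH2.
have [bH1 _ _ _] := tH1; have [bH2 _ _ _] := tH2.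
have bcst c : bdd_meas_Y (fun _ => c : R) by split=> [N|]; exact: bdd_meas_cst.
split.
  under eq_fun do rewrite vE [X in X * _]uE.
  apply: bdd_meas_YD; apply: bdd_meas_YM => //; apply: bdd_meas_YD => //;
    apply: bdd_meas_YZ; exact: bdd_meas_Ysin.
rewrite (_ : (fun y => _) = (fun y =>
  H y * (2^-1 + 2^-1 * sin (lin xi y)) * bern (sin_coord L j y) m (fun k => f k.+1 y) +
  H y * (2^-1 + (- 2^-1) * sin (lin xi y)) * bern (sin_coord L j y) m (fun k => f k y))).
  by apply: Ex_cvgD => //; exact: bdd_meas_YM.
by apply/funext => y; rewrite vE [X in X * _ + _]uE; ring.
Qed.

Hypothesis cos_cvg : forall xi, Ex_cvg (fun y => cos (lin xi y)).
Hypothesis sin_cvg : forall xi, Ex_cvg (fun y => sin (lin xi y)).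
Hypothesis tight : forall i eps, (i < n)%N -> 0 < eps -> exists2 L, 0 < L &
  \forall N \near \oo, fine (Pr [set w | L <= `|Y N w i|]) <= eps.

Lemma trig_cvg1 : trig_cvg (fun=> 1).
Proof.
split.
- by split=> [N|]; exact: bdd_meas_cst.
- by exists 1 => // y; rewrite normr1.
- by move=> xi; under eq_fun do rewrite mul1r; exact: cos_cvg.
- by move=> xi; under eq_fun do rewrite mul1r; exact: sin_cvg.
Qed.

Lemma prob_tail_small {e} {S : measurableType e} (mu : probability S R) (W : S -> R) eps :
  measurable_fun setT W -> 0 < eps ->
  exists2 L, 0 < L & fine (mu [set w | L <= `|W w|]) <= eps.
Proof.
move=> mW eps0.
have mA L := measurable_norm_ge L mW.
have : (\int[mu]_w \1_[set w | m.+1%:R <= `|W w|] w)%R @[m --> \oo] --> (\int[mu]_w (0 : R))%R.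
  apply: (@Ex_bounded_cvg _ _ _ mu _ _ 1).
  - by move=> m; case: (bdd_meas_indic (mA m.+1%:R) : bdd_meas (\1__ : S -> R)).
  - by move=> m w; rewrite indicE; case: (_ \in _); rewrite ?normr1 ?normr0.
  - move=> w; apply: cvg_near_cst; near=> m; rewrite indicE.
    rewrite (_ : w \in _ = false)//; apply/negbTE; rewrite notin_setE/=; apply/negP; rewrite -ltNge.
    apply: (@lt_le_trans _ _ m%:R); last by rewrite ler_nat.
    near: m; exact: nbhs_infty_gtr.
rewrite Ex_cst => /cvgrPdist_le/(_ _ eps0)[m _ /(_ m (leqnn m))/=].
rewrite Ex_indic// sub0r normrN => h; exists m.+1%:R => //.
by apply: le_trans h; exact: ler_norm.
Unshelve. all: by end_near. Qed.

(** Induction on the number of coordinates that [G] uses. The last one is replaced by a Bernstein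
    polynomial in [sin_coord], whose coefficients use one coordinate less. The approximation is good
    for [|y j| < L], and tightness controls the complement. *)
Lemma charfun_cvg_aux j G H : (j <= n)%N -> unif_cont_coord j G ->
  (exists M, forall y, `|G y| <= M) -> trig_cvg H -> Ex_cvg (fun y => H y * G y).
Proof.
elim: j G H => [|j IH] G H jn uG [MG0 GMG0] tH.
  have GE y : G y = G (fun=> 0).
    apply/eqP; rewrite -subr_eq0 -normr_eq0 eq_le normr_ge0 andbT.
    by apply/ler_addgt0Pr => eta eta0; rewrite add0r; have [del del0] := uG _ eta0; apply.
  under eq_fun do rewrite GE mulrC.
  have [bH _ cH _] := tH; apply: Ex_cvgZ => //.
  have := cH (fun=> 0); congr Ex_cvg; apply/funext => y.
  by rewrite /lin big1 ?cos0 ?mulr1// => i _; rewrite mul0r.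
pose MG := `|MG0|; have MG_ge0 : 0 <= MG by exact: normr_ge0.
have GMG y : `|G y| <= MG by apply: le_trans (GMG0 y) (ler_norm _).
have [bH [MH MH0 HMH] _ _] := tH.
have bG : bdd_meas_Y G.
  split=> [N|]; (split; [exact: (measurable_unif_cont_coord _ uG)|by exists MG => w]).
have bHG := bdd_meas_YM bH bG.
apply/cvgrPdist_le => /= eta eta0.
pose C := 2 * MH * MG + MH + 1.
have C0 : 0 < C by rewrite /C; have := mulr_ge0 MH0 MG_ge0; lra.
pose eps := eta / (4 * C).
have eps0 : 0 < eps by rewrite divr_gt0// mulr_gt0.
have [L1 L10 hL1] := tight jn eps0.
have [L2 L20 hL2] := prob_tail_small Pr' (mYoo j) eps0.
pose L := Num.max L1 L2.
have L0 : 0 < L by rewrite lt_max L10.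
have tailL e (S : measurableType e) (mu : probability S R) (W : S -> R) K :
    measurable_fun setT W -> K <= L ->
    fine (mu [set w | L <= `|W w|]) <= fine (mu [set w | K <= `|W w|]).
  move=> mW KL; have m1 := measurable_norm_ge L mW; have m2 := measurable_norm_ge K mW.
  rewrite fine_le ?fin_num_measure//; apply: le_measure; rewrite ?inE//.
  by move=> w /=; exact: le_trans.
have [del del0 hdel] := uG _ eps0.
(* Precision required on [y j / L]; the bound [1 / 2] keeps it in the range of [asin_close]. *)
pose d0 := Num.min (del / L) 2^-1.
have d00 : 0 < d0 by rewrite lt_min divr_gt0//= invr_gt0.
have d01 : d0 < 1.
  by apply: (@le_lt_trans _ _ 2^-1); [rewrite ge_min lexx orbT|rewrite invf_lt1// ltr1n].
have cd0 : 0 < 1 - cos d0.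
  rewrite subr_gt0 -cos0 ltr_cos// in_itv/=; rewrite ?lexx ?pi_ge0//.
  by rewrite (ltW d00) (le_trans (ltW d01))// (le_trans _ (pi_ge2 R))// ler1n.
(* The corresponding precision on [sin_coord]; the sine is twice that variable minus 1, whence the
   half. *)
pose q := (1 - cos d0) / 2.
have q0 : 0 < q by rewrite divr_gt0.
have [m0 hm0] : exists m, 2 * MG / q ^+ 2 / eps < m%:R :> R.
  by have [m _ /(_ m (leqnn m))] := nbhs_infty_gtr (2 * MG / q ^+ 2 / eps); exists m.
pose m := m0.+1.
have hm : 2 * MG / (m%:R * q ^+ 2) <= eps.
  have mm : (0 : R) < m%:R by [].
  have -> : 2 * MG / (m%:R * q ^+ 2) = 2 * MG / q ^+ 2 / m%:R by rewrite invfM mulrA mulrAC.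
  rewrite ler_pdivrMr// [leRHS]mulrC -ler_pdivrMr//.
  by rewrite (le_trans (ltW hm0))// ler_nat.
(* The value of the coordinate in [[- L * pi / 2, L * pi / 2]] at which [sin_coord] equals
   [k / m]. *)
pose node (k : nat) : R := L * asin (2 * (k%:R / m%:R) - 1).
pose upd (y : nat -> R) v i := if i == j then v else y i.
pose f k y := G (upd y (node k)).
have uf k : unif_cont_coord j (f k).
  move=> e0 /uG[dl dl0 h]; exists dl => // y y' yy; apply: h => i.
  rewrite ltnS leq_eqVlt /upd => /orP[/eqP ->|ij]; first by rewrite eqxx subrr normr0.
  by case: eqP => [|_]; [rewrite subrr normr0|exact: yy].
have bf k : bdd_meas_Y (f k).
  split=> [N|]; (split; [exact: (measurable_unif_cont_coord _ (uf k))|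
    by exists MG => w; exact: GMG]).
have cf k H' : trig_cvg H' -> Ex_cvg (fun y => H' y * f k y).
  by apply: IH => //; [exact: ltnW|exists MG => y; exact: GMG].
have [bB cB] := bern_trig L m jn bf cf tH.
set B := fun y => bern _ _ _ in bB cB.
have fMG y k : `|f k y - G y| <= 2 * MG.
  by apply: le_trans (ler_normB _ _) _; have := GMG (upd y (node k)); have := GMG y; rewrite /f; lra.
have Bapprox y : `|y j| < L -> `|B y - G y| <= eps + eps.
  move=> yL; apply: le_trans (@bern_approx _ _ m _ (G y) (2 * MG) eps q _ _ q0 _ (ltW eps0) _ _) _ => //.
  - exact: sin_coord01.
  - by rewrite mulr_ge0.
  - move=> k km uk; rewrite /f; apply: hdel => i.
    rewrite ltnS leq_eqVlt /upd => /orP[/eqP ->|ij]; last first.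
      by rewrite (ltn_eqF ij) subrr normr0.
    rewrite eqxx; pose a := y j / L; pose b : R := asin (2 * (k%:R / m%:R) - 1).
    have km1 : 0 <= (k%:R / m%:R : R) <= 1.
      by rewrite divr_ge0//= ler_pdivrMr// mul1r ler_nat.
    have bI : -1 <= (2 * (k%:R / m%:R) - 1 : R) <= 1.
      by case/andP: km1 => ? ?; apply/andP; split; lra.
    have pi2 := pi_ge2 R.
    have aI : - (pi / 2) <= a <= pi / 2.
      have : `|a| < 1 by rewrite normrM [`|L^-1|]gtr0_norm ?invr_gt0// ltr_pdivrMr// mul1r.
      by rewrite ltr_norml => /andP[? ?]; apply/andP; split; lra.
    have bI2 : - (pi / 2) <= b <= pi / 2 by rewrite asin_geNpi2// asin_lepi2.
    have ab : `|a - b| < d0.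
      apply: asin_close => //; first by rewrite d00.
      rewrite (asin_def bI).2.
      have -> : sin a - (2 * (k%:R / m%:R) - 1) = - (2 * (k%:R / m%:R - sin_coord L j y)).
        by rewrite /sin_coord -/a; lra.
      by rewrite normrN normrM ger0_norm// mulrC -ltr_pdivlMr.
    rewrite /node distrC -/b (_ : y j = L * a); last by rewrite /a mulrC divfK ?gt_eqF.
    rewrite -mulrBr normrM (gtr0_norm L0) mulrC -ltr_pdivlMr//.
    by apply: lt_le_trans ab _; rewrite ge_min lexx.
  - by rewrite lerD2l.
have HB y : `|H y * B y - H y * G y| <= MH * (2 * MG).
  rewrite -mulrBr normrM; apply: ler_pM => //.
  rewrite -(bern_cst (sin_coord L j y) m (2 * MG)).
  by apply: bern_norm_le => [|k km]; [exact: sin_coord01|exact: fMG].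
have HBL y : `|y j| < L -> `|H y * B y - H y * G y| <= MH * (eps + eps).
  by move=> yL; rewrite -mulrBr normrM; apply: ler_pM => //; exact: Bapprox.
have bHB := bdd_meas_YM bH bB.
have c0 : 0 <= MH * (eps + eps) by rewrite mulr_ge0// addr_ge0// ltW.
have D0 : 0 <= MH * (2 * MG) by rewrite mulr_ge0// mulr_ge0.
have gen e (S : measurableType e) (mu : probability S R) (W : S -> nat -> R) :
    measurable_fun setT (fun w => W w j) ->
    bdd_meas (fun w => H (W w) * B (W w)) -> bdd_meas (fun w => H (W w) * G (W w)) ->
    fine (mu [set w | L <= `|W w j|]) <= eps ->
    `|(\int[mu]_w (H (W w) * B (W w)))%R - (\int[mu]_w (H (W w) * G (W w)))%R| <=
    MH * (eps + eps) + MH * (2 * MG) * eps.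
  move=> mW b1 b2 h.
  have mA := measurable_norm_ge L mW.
  apply: le_trans (norm_ExB_le_on mu b1 b2 mA c0 _ (fun w => HB (W w))) _.
    by move=> w /negP; rewrite -ltNge; exact: HBL.
  by rewrite lerD2l ler_wpM2l.
have LL1 : L1 <= L by rewrite le_max lexx.
have LL2 : L2 <= L by rewrite le_max lexx orbT.
have near1 := gen _ _ Pr' Yoo (mYoo j) bHB.2 bHG.2
  (le_trans (tailL _ _ Pr' _ _ (mYoo j) LL2) hL2).
move/cvgrPdist_le : cB => /(_ _ eps0) cB.
near=> N.
have h1 : fine (Pr [set w | L1 <= `|Y N w j|]) <= eps by near: N.
have near2 := gen _ _ Pr (Y N) (mY N j) (bHB.1 N) (bHG.1 N)
  (le_trans (tailL _ _ Pr _ _ (mY N j) LL1) h1).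
have near3 : `|(\int[Pr']_w (H (Yoo w) * B (Yoo w)))%R -
  (\int[Pr]_w (H (Y N w) * B (Y N w)))%R| <= eps by near: N.
move: near1 near2 near3.
set a1 := (\int[Pr']_w (H (Yoo w) * B (Yoo w)))%R.
set a2 := (\int[Pr']_w (H (Yoo w) * G (Yoo w)))%R.
set a3 := (\int[Pr]_w (H (Y N w) * B (Y N w)))%R.
set a4 := (\int[Pr]_w (H (Y N w) * G (Y N w)))%R => n1 n2 n3.
have E4 : eps * (4 * C) = eta by rewrite divfK// gt_eqF// mulr_gt0.
have -> : a2 - a4 = (a1 - a3) + (a3 - a4) - (a1 - a2) by ring.
apply: le_trans (ler_normB _ _) _; apply: le_trans (lerD (ler_normD _ _) (lexx _)) _.
apply: le_trans (lerD (lerD n3 n2) n1) _.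
by rewrite -E4; apply: eps_collect => //; exact: ltW.
Unshelve. all: by end_near. Qed.

Lemma charfun_cvg G : unif_cont_coord n G -> (exists M, forall y, `|G y| <= M) -> Ex_cvg G.
Proof.
move=> uG bG; have := charfun_cvg_aux (leqnn n) uG bG trig_cvg1.
by congr Ex_cvg; apply/funext => y; rewrite mul1r.
Qed.

End charfun_convergence.

(** * Oscillations of the rescaled sums *)

Section jump_partition.
Context {R : realType}.
Variables (jump_at : R -> Prop) (h : R).
Hypothesis h0 : 0 < h.
Hypothesis jump_late : forall s, jump_at s -> h < s.
Hypothesis jump_apart : forall s s', jump_at s -> jump_at s' -> s < s' -> s + h < s'.

Lemma jump_partition T : 0 <= T -> exists m (t : nat -> R),
  [/\ t 0%N = 0, forall i, t i + h <= t i.+1, forall i, t i.+1 <= t i + 2 * h,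
      T < t m & forall i, (i < m)%N -> t i <= T /\ forall s, t i < s < t i.+1 -> ~ jump_at s].
Proof.
move=> T0; pose inv t := forall s, jump_at s -> t < s -> t + h < s.
have step t : exists t', inv t -> [/\ inv t', t + h <= t', t' <= t + 2 * h &
    forall s, t < s < t' -> ~ jump_at s].
  have [[s [js /andP[s1 s2]]]|noj] := pselect (exists s, jump_at s /\ t + h < s <= t + 2 * h).
    exists s => it; split=> //; first by move=> s' js' ss'; exact: jump_apart.
      exact: ltW.
    move=> s' /andP[ts' s's] js'; have h1 := it _ js' ts'.
    by have := jump_apart js' js s's; lra.
  exists (t + h) => it; split=> //; last by move=> s /andP[s1 s2] js; have := it _ js s1; lra.
    move=> s js ts; rewrite ltNge; apply/negP => st; apply: noj; exists s; split=> //.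
    by rewrite ts/=; lra.
  by rewrite lerD2l mulr2n mulrDl mul1r lerDl ltW.
have {step}[g hg] := choice step.
pose t i := iter i g 0.
have it i : inv (t i).
  elim: i => [|i IH]; first by move=> s js _; rewrite /t /= add0r; exact: jump_late.
  by rewrite /t iterS; case: (hg _ IH).
have tE i : [/\ t i + h <= t i.+1, t i.+1 <= t i + 2 * h & forall s, t i < s < t i.+1 -> ~ jump_at s].
  by have [] := hg _ (it i); split.
have tge i : i%:R * h <= t i.
  elim: i => [|i IH]; first by rewrite mul0r.
  by rewrite -natr1 mulrDl mul1r; have [h1 _ _] := tE i; apply: le_trans h1; rewrite lerD2r.
have ex : exists m, T < t m.
  exists (Num.truncn (T / h)).+1; apply: lt_le_trans (tge _).
  by rewrite -ltr_pdivrMr//; exact: truncnS_gt.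
exists (ex_minn ex), t; case: ex_minnP => m Tm mmin; split=> //.
- by move=> i; case: (tE i).
- by move=> i; case: (tE i).
move=> i im; split; last by case: (tE i).
by rewrite leNgt; apply/negP => /mmin; rewrite leqNgt im.
Qed.

End jump_partition.

Lemma fluct_arith {R : realType} (g K T q Q n : R) : 0 <= g -> 1 <= K -> 0 <= T ->
  0 <= q -> K * q <= Q -> n <= K * T ->
  16 * (n + 1) * (3 * g + 1) * q <= 16 * (3 * g + 1) * (T + 2) * Q.
Proof.
move=> g0 K1 T0 q0 KQ nK.
have G0 : 0 <= 16 * (3 * g + 1) by rewrite mulr_ge0// addr_ge0// mulr_ge0.
rewrite (_ : 16 * (n + 1) * (3 * g + 1) * q = 16 * (3 * g + 1) * ((n + 1) * q)); last by ring.
rewrite -[leRHS]mulrA; apply: ler_wpM2l => //.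
apply: (@le_trans _ _ ((T + 2) * (K * q))); last by rewrite ler_wpM2l// addr_ge0.
by rewrite mulrA ler_wpM2r// mulrDl; lra.
Qed.

Section increments.
Context {R : realType} {d : measure_display} {E : measurableType d}
  {d'} {Om : measurableType d'} {Pr : probability Om R}.
Variables (P : R.-pker E ~> E) (pi : probability E R) (X : nat -> {RV Pr >-> E}).
Hypothesis hchain : markov_chain P X.
Hypothesis hlaw : forall B, measurable B -> distribution Pr (X 0%N) B = pi B.
Hypothesis hinv : invariant_law P pi.
Variable k : R.
Hypothesis k01 : 0 < k < 1.
Local Notation q f := (\int[pi]_x (f x ^+ 2))%R.
Hypothesis hgap : forall f : E -> R, bdd_meas f -> (\int[pi]_x f x = 0)%R ->
  q (Pop P f) <= k * q f.

Definition steps (K r : R) := Num.truncn (K * r).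

Definition centered_sum (v : E -> R) (K w : R) (om : Om) (r : R) :=
  \sum_(i < steps K r) v (X i om) - w * r.

Lemma stepsP K r : 0 <= K -> 0 <= r -> (steps K r)%:R <= K * r < (steps K r)%:R + 1.
Proof. by move=> K0 r0; rewrite natr1; apply: truncn_itv; rewrite mulr_ge0. Qed.

Lemma steps_mono K r s : 0 <= K -> 0 <= r -> r <= s -> (steps K r <= steps K s)%N.
Proof.
move=> K0 r0 rs; have /andP[h1 _] := stepsP K0 r0.
have /andP[_ h2] := stepsP K0 (le_trans r0 rs).
rewrite -ltnS -(ltr_nat R) -natr1; apply: le_lt_trans h1 _; apply: le_lt_trans h2.
exact: ler_wpM2l.
Qed.

Definition fluct_const := 16 * (3 * gap_const k + 1).

(** Without a jump above [del] the sum agrees with that of the truncated variable. Its fluctuation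
    gives [2 * e0]; the number of steps differs from [K (b - a)] by at most one, and the truncated
    mean is at most [sqrt Q]; the remaining drift is at most [C] per unit of time. *)
Lemma increment_bound (v : E -> R) (K w del T C Q e0 : R) :
  measurable_fun setT v -> 1 <= K -> 0 <= T -> 0 < e0 ->
  K * q (small_jump v del) <= Q ->
  `|K * (\int[pi]_x small_jump v del x)%R - w| <= C ->
  exists2 A : set Om, measurable A /\ fine (Pr A) <= fluct_const * (T + 2) * Q / e0 ^+ 2 &
    forall om, ~ A om -> forall a b, 0 <= a -> a <= b -> b <= T ->
    (forall i, (steps K a <= i < steps K b)%N -> `|v (X i om)| <= del) ->
    `|centered_sum v K w om b - centered_sum v K w om a| < 2 * e0 + Num.sqrt Q + (b - a) * C.
Proof.
move=> mv K1 T0 e00 hQ hC; have K0 : 0 < K by exact: lt_le_trans K1.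
have bf := bdd_small_jump del mv; set f := small_jump v del in bf hQ hC.
set mu := (\int[pi]_x f x)%R in hC.
have [A [mA PA] HA] := birkhoff_fluctuation hchain hlaw hinv k01 hgap (steps K T) bf e00.
have g0 := gap_const_ge0 k01.
have q0 : 0 <= q f by exact: q_ge0.
exists A.
  split=> //; apply: le_trans PA _.
  rewrite ler_wpM2r ?invr_ge0 ?sqr_ge0// /fluct_const.
  rewrite -[(steps K T).+1%:R]natr1; apply: (fluct_arith g0 K1 T0 q0 hQ).
  by have /andP[] := stepsP (ltW K0) T0.
move=> om nA a b a0 ab bT small.
have b0 : 0 <= b by exact: le_trans ab.
have sab := steps_mono (ltW K0) a0 ab.
have sbT := steps_mono (ltW K0) b0 bT.
have Ha := HA om nA _ (leq_trans sab sbT); have Hb := HA om nA _ sbT.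
have muQ : `|mu| <= Num.sqrt Q.
  rewrite -(sqrtr_sqr mu); apply: ler_wsqrtr.
  apply: le_trans hQ; apply: (@le_trans _ _ (q f)); last by rewrite ler_peMl.
  have := q_ge0 pi (fun x => f x - mu).
  have bsq := bdd_meas_sqr bf; have bmf := bdd_measZ (2 * mu) bf.
  have bc : bdd_meas (fun _ : E => mu ^+ 2) by exact: bdd_meas_cst.
  rewrite (_ : q (fun x => f x - mu) = q f - mu ^+ 2) ?subr_ge0//.
  have FE x : (f x - mu) ^+ 2 = f x ^+ 2 - 2 * mu * f x + mu ^+ 2 by ring.
  under [LHS]eq_Rintegral do rewrite FE.
  rewrite ExD//; last exact: bdd_measB.
  by rewrite ExB// Ex_cst ExZ// -/mu; ring.
pose D := \sum_(i < steps K b) (f (X i om) - mu) - \sum_(i < steps K a) (f (X i om) - mu).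
have SE (g : E -> R) : \sum_(i < steps K b) g (X i om) - \sum_(i < steps K a) g (X i om) =
    \sum_(steps K a <= i < steps K b) g (X i om).
  rewrite -!(big_mkord xpredT (fun i => g (X i om))) (@big_cat_nat _ _ _ (steps K a) 0%N)//=.
  by rewrite addrAC subrr add0r.
(* Fluctuation, rounding of the number of steps, and compensated drift. *)
have -> : centered_sum v K w om b - centered_sum v K w om a =
   D + (((steps K b)%:R - (steps K a)%:R - K * (b - a)) * mu + (b - a) * (K * mu - w)).
  rewrite /centered_sum /D (SE (fun x => f x - mu)).
  rewrite (_ : _ - _ - _ = \sum_(i < steps K b) v (X i om) - \sum_(i < steps K a) v (X i om) - w * (b - a)); last by ring.
  rewrite (SE v) (_ : \sum_(steps K a <= i < steps K b) v (X i om) =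
    \sum_(steps K a <= i < steps K b) f (X i om)); last first.
    apply: eq_big_nat => i hi; rewrite /f /small_jump indicE mem_set ?mulr1//=.
    exact: small.
  rewrite sumrB -(natrB _ sab) big_const_nat iter_addr addr0 -mulr_natl; ring.
have D2 : `|D| < 2 * e0.
  by rewrite (le_lt_trans (ler_normB _ _))// mulr2n mulrDl mul1r ltrD.
clearbody D; rewrite -[ltRHS]addrA; apply: le_lt_trans (ler_normD _ _) _; apply: ltr_leD => //.
apply: le_trans (ler_normD _ _) _; apply: lerD; rewrite normrM.
  apply: le_trans muQ; rewrite ler_piMl//.
  have /andP[h1 h2] := stepsP (ltW K0) a0; have /andP[h3 h4] := stepsP (ltW K0) b0.
  by rewrite mulrBr ler_norml; apply/andP; split; lra.
by rewrite (ger0_norm (_ : 0 <= b - a)) ?subr_ge0// ler_wpM2l ?subr_ge0.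
Qed.

Lemma Ex_markov_iter n H g l : past_bdd X n H -> bdd_meas g ->
  (\int[Pr]_w (H w * g (X (n + l)%N w)) = \int[Pr]_w (H w * Piter P l g (X n w)))%R.
Proof.
move=> bH; elim: l g => [|l IH] g bg; first by rewrite addn0.
have bH' : past_bdd X (n + l) H.
  by split; [apply: (past_meas_mono (leq_addr l n) bH.1)|case: bH].
rewrite addnS (Ex_markov hchain bH' bg) IH; last exact: bdd_meas_Pop.
by rewrite /Piter iterSr.
Qed.

(** A union bound over pairs of times at lag at least 1 and at most [D]. By stationarity and
    [correlation_sum] the cost is what independence would give plus a correlation term involving [P]
    applied to the indicator. *)
Lemma close_pairs (A : set E) (n D : nat) : measurable A ->
  exists2 B : set Om, measurable B /\ fine (Pr B) <= n%:R * (D%:R * fine (pi A) ^+ 2 +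
      2 * Num.sqrt (gap_const k * fine (pi A) * q (Pop P \1_A))) &
    forall om, ~ B om -> forall i l, (i < n)%N -> (l < D)%N ->
      ~ (A (X i om) /\ A (X (i + l.+1)%N om)).
Proof.
move=> mA; have bA : bdd_meas (\1_A : E -> R) by exact: bdd_meas_indic.
pose F i l := X i @^-1` A `&` X (i + l.+1)%N @^-1` A.
have mX i : measurable (X i @^-1` A) by rewrite -[X in measurable X]setTI; exact: measurable_funP.
have mF i l : measurable (F i l) by exact: measurableI.
pose G i := \bigcup_(l < D) F i l.
have mG i : measurable (G i) by apply: bigcup_measurable.
have mB : measurable (\bigcup_(i < n) G i) by apply: bigcup_measurable.
exists (\bigcup_(i < n) G i); last first.
  by move=> om nB i l iN lD [h1 h2]; apply: nB; exists i => //; exists l.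
split=> //; apply: le_trans (@prob_le_sum _ _ _ Pr n G _ mB mG _) _.
  by move=> w [i iN Gi]; exists i.
rewrite -[n in n%:R]card_ord -sumr_const mulr_suml; apply: ler_sum => i _; rewrite mul1r.
apply: le_trans (@prob_le_sum _ _ _ Pr D (F i) _ (mG i) (mF i) _) _.
  by move=> w [l lD Fl]; exists l.
have c01 x : 0 <= (\1_A x : R) <= 1 by rewrite indicE; case: (_ \in _); rewrite lexx ler01.
have c0 x : 0 <= (\1_A x : R) by case/andP: (c01 x).
have := correlation_sum hinv k01 hgap D bA bA c01 c0; rewrite Ex_indic// -expr2.
apply: le_trans; rewrite le_eqVlt; apply/orP; left; apply/eqP; apply: eq_bigr => l _.
have bAi : past_bdd X i (fun w => \1_A (X i w) : R) by exact: past_bdd_comp.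
have bQ := bdd_measM bA (bdd_meas_Piter P l.+1 bA).
rewrite -(Ex_X hchain hlaw hinv i bQ) -(Ex_markov_iter l.+1 bAi bA) -Ex_indic//.
apply: eq_Rintegral => w _; rewrite !indicE /F -natrM mulnb; congr (_%:R).
congr nat_of_bool; apply/idP/andP => [/set_mem[h1 h2]|[/set_mem h1 /set_mem h2]].
  by split; apply/mem_set.
by apply/mem_set.
Qed.

Lemma early_visit (A : set E) (D : nat) : measurable A ->
  exists2 B : set Om, measurable B /\ fine (Pr B) <= D%:R * fine (pi A) &
    forall om, ~ B om -> forall i, (i < D)%N -> ~ A (X i om).
Proof.
move=> mA; have mX i : measurable (X i @^-1` A).
  by rewrite -[X in measurable X]setTI; exact: measurable_funP.
have mB : measurable (\bigcup_(i < D) (X i @^-1` A)) by apply: bigcup_measurable.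
exists (\bigcup_(i < D) (X i @^-1` A)); last first.
  by move=> om nB i iD Ai; apply: nB; exists i.
split=> //; apply: le_trans (@prob_le_sum _ _ _ Pr D (fun i => X i @^-1` A) _ mB mX _) _.
  by move=> w [i iD Ai]; exists i.
rewrite -[D in D%:R]card_ord -sumr_const mulr_suml; apply: ler_sum => i _.
by rewrite mul1r (prob_X hchain hlaw hinv).
Qed.

End increments.

Lemma prob_setU_le {d} {T : measurableType d} {R : realType} (mu : probability T R) (A B : set T) :
  measurable A -> measurable B -> fine (mu (A `|` B)) <= fine (mu A) + fine (mu B).
Proof.
move=> mA mB; rewrite -fineD ?fin_num_measure//.
apply: fine_le; rewrite ?fin_numD ?fin_num_measure//; first exact: measurableU.
exact: measureU2.
Qed.

Lemma pair_arith {R : realType} (K n D T h p q g C C2 : R) : 1 <= K -> 0 <= n -> n <= K * T ->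
  0 <= D -> D <= K * h -> 0 <= p -> K * p <= C -> 0 <= q -> K ^+ 2 * q <= C2 -> 0 <= g ->
  n * (D * p ^+ 2 + 2 * Num.sqrt (g * p * q)) <= T * h * C ^+ 2 + T * 2 * Num.sqrt (g * C * C2 / K).
Proof.
move=> K1 n0 nT D0 Dh p0 pC q0 qC g0; have K0 : 0 < K by exact: lt_le_trans K1.
have C0 : 0 <= C by apply: le_trans pC; rewrite mulr_ge0// ltW.
have T0 : 0 <= T by rewrite -(pmulr_rge0 _ K0) (le_trans n0).
have h0 : 0 <= h by rewrite -(pmulr_rge0 _ K0) (le_trans D0).
rewrite mulrDr; apply: lerD.
  apply: (@le_trans _ _ (K * T * (K * h * p ^+ 2))).
    by apply: ler_pM => //; rewrite ?mulr_ge0 ?sqr_ge0// ler_wpM2r ?sqr_ge0.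
  rewrite (_ : K * T * (K * h * p ^+ 2) = T * h * (K * p) ^+ 2); last by ring.
  apply: ler_wpM2l; first exact: mulr_ge0.
  by apply: lerXn2r; rewrite ?nnegrE ?mulr_ge0// ltW.
apply: (@le_trans _ _ (K * T * (2 * Num.sqrt (g * p * q)))).
  by apply: ler_wpM2r => //; rewrite mulr_ge0 ?sqrtr_ge0.
rewrite (_ : K * T * (2 * Num.sqrt (g * p * q)) = T * 2 * (K * Num.sqrt (g * p * q))); last by ring.
apply: ler_wpM2l; first by rewrite mulr_ge0.
rewrite -[X in X * _](ger0_norm (ltW K0)) -sqrtr_sqr -sqrtrM ?sqr_ge0//.
apply: ler_wsqrtr; rewrite ler_pdivlMr//.
rewrite (_ : K ^+ 2 * (g * p * q) * K = g * (K * p) * (K ^+ 2 * q)); last by ring.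
have p0' : 0 <= K * p by rewrite mulr_ge0// ltW.
apply: ler_pM => //; rewrite ?mulr_ge0 ?sqr_ge0 ?(ltW K0)//.
exact: ler_wpM2l.
Qed.

Lemma sqrD_le2 {R : realType} (a b : R) : (a + b) ^+ 2 <= 2 * a ^+ 2 + 2 * b ^+ 2.
Proof. by have := sqr_ge0 (a - b); rewrite sqrrB sqrrD; lra. Qed.

Section oscillation.
Context {R : realType} {d : measure_display} {E : measurableType d}
  {d'} {Om : measurableType d'} {Pr : probability Om R}.
Variables (P : R.-pker E ~> E) (pi : probability E R) (X : nat -> {RV Pr >-> E}).
Hypothesis hchain : markov_chain P X.
Hypothesis hlaw : forall B, measurable B -> distribution Pr (X 0%N) B = pi B.
Hypothesis hinv : invariant_law P pi.
Variable k : R.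
Hypothesis k01 : 0 < k < 1.
Local Notation q f := (\int[pi]_x (f x ^+ 2))%R.
Hypothesis hgap : forall f : E -> R, bdd_meas f -> (\int[pi]_x f x = 0)%R ->
  q (Pop P f) <= k * q f.
Variables (K : nat -> R) (v1 v2 : nat -> E -> R) (w1 w2 : nat -> R) (psi1 psi2 : R -> R[i]).
Hypothesis K1 : forall N, 1 <= K N.
Hypothesis KN : K N @[N --> \oo] --> +oo%R.
Hypothesis H1 : heavy P pi v1 K w1 psi1.
Hypothesis H2 : heavy P pi v2 K w2 psi2.
Variable Z : nat -> Om -> skorokhod (R * R)%type.
Hypothesis ZE : forall N om r, 0 <= r -> Z N om r =
  (centered_sum X (v1 N) (K N) (w1 N) om r, centered_sum X (v2 N) (K N) (w2 N) om r).

Let K0 N : 0 < K N.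
Proof. exact: lt_le_trans (K1 N). Qed.

Definition big_jump del1 del2 N := [set x | del1 <= `|v1 N x|] `|` [set x | del2 <= `|v2 N x|].

Let m1 N del : measurable [set x | del <= `|v1 N x|].
Proof. by apply: measurable_norm_ge; exact: (heavy_meas H1). Qed.

Let m2 N del : measurable [set x | del <= `|v2 N x|].
Proof. by apply: measurable_norm_ge; exact: (heavy_meas H2). Qed.

Lemma measurable_big_jump del1 del2 N : measurable (big_jump del1 del2 N).
Proof. exact: measurableU. Qed.

(** The second bound is where the kernel helps: an indicator has squared norm of order [1 / K], but
    its image under [P] has squared norm of order [1 / K^2]. *)
Lemma big_jump_bounds del1 del2 : 0 < del1 -> 0 < del2 -> exists C C2, forall N,
  K N * fine (pi (big_jump del1 del2 N)) <= C /\
  K N ^+ 2 * q (Pop P \1_(big_jump del1 del2 N)) <= C2.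
Proof.
move=> d1 d2; have [C1 HC1] := heavy_tail H1 d1; have [C2 HC2] := heavy_tail H2 d2.
have [D1 D10 HD1] := heavy_dom H1; have [D2 D20 HD2] := heavy_dom H2.
exists (C1 + C2), (2 * D1 * C1 ^+ 2 + 2 * D2 * C2 ^+ 2) => N; split.
  apply: le_trans (lerD (HC1 N) (HC2 N)); rewrite -mulrDr.
  by apply: ler_wpM2l; [exact: ltW|exact: prob_setU_le].
have b1 : bdd_meas (\1_[set x | del1 <= `|v1 N x|] : E -> R) by exact: bdd_meas_indic.
have b2 : bdd_meas (\1_[set x | del2 <= `|v2 N x|] : E -> R) by exact: bdd_meas_indic.
have bb : bdd_meas (\1_(big_jump del1 del2 N) : E -> R).
  by apply: bdd_meas_indic; exact: measurable_big_jump.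
have p1 := bdd_meas_sqr (bdd_meas_Pop P b1); have p2 := bdd_meas_sqr (bdd_meas_Pop P b2).
have pb := bdd_meas_sqr (bdd_meas_Pop P bb).
have ind (A : set E) x : 0 <= (\1_A x : R) by rewrite indicE.
have Pind A x : measurable A -> 0 <= Pop P \1_A x.
  by move=> mA; rewrite Pop_indic// fine_ge0.
have : q (Pop P \1_(big_jump del1 del2 N)) <= 2 * q (Pop P \1_[set x | del1 <= `|v1 N x|]) +
    2 * q (Pop P \1_[set x | del2 <= `|v2 N x|]).
  have z1 := bdd_measZ 2 p1; have z2 := bdd_measZ 2 p2.
  have E12 := ExD pi z1 z2; rewrite (ExZ pi 2 p1) (ExZ pi 2 p2) in E12; rewrite -E12.
  apply: (le_Ex pi pb (bdd_measD z1 z2)).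
  move=> x; apply: (@le_trans _ _ ((Pop P \1_[set x | del1 <= `|v1 N x|] x + Pop P \1_[set x | del2 <= `|v2 N x|] x) ^+ 2)).
    apply: lerXn2r; rewrite ?nnegrE ?addr_ge0 ?Pind//; first exact: measurable_big_jump.
    have := PopD P b1 b2; move=> /(congr1 (fun f => f x)) <-.
    apply: le_Pop => //; first exact: bdd_measD.
    move=> y; rewrite !indicE /big_jump; have [/set_mem[h|h]|_] := boolP (y \in _ `|` _).
    - by rewrite (mem_set h) lerDl.
    - by rewrite (mem_set h) lerDr.
    - by rewrite addr_ge0.
  exact: sqrD_le2.
have tl1 : 0 <= K N * fine (pi [set x | del1 <= `|v1 N x|]) by rewrite mulr_ge0 ?fine_ge0// ltW.
have tl2 : 0 <= K N * fine (pi [set x | del2 <= `|v2 N x|]) by rewrite mulr_ge0 ?fine_ge0// ltW.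
move=> /(ler_wpM2l (sqr_ge0 (K N))); move/le_trans; apply.
rewrite mulrDr; apply: lerD.
  apply: (@le_trans _ _ (2 * D1 * (K N * fine (pi [set x | del1 <= `|v1 N x|])) ^+ 2)).
    rewrite (_ : 2 * D1 * _ = K N ^+ 2 * (2 * (D1 * fine (pi [set x | del1 <= `|v1 N x|]) ^+ 2))); last by ring.
    apply: ler_wpM2l; first exact: sqr_ge0.
    by apply: ler_wpM2l => //; have [_ /(_ _ d1)] := HD1 N.
  apply: ler_wpM2l; first by rewrite mulr_ge0.
  by apply: lerXn2r; rewrite ?nnegrE// (le_trans tl1).
apply: (@le_trans _ _ (2 * D2 * (K N * fine (pi [set x | del2 <= `|v2 N x|])) ^+ 2)).
  rewrite (_ : 2 * D2 * _ = K N ^+ 2 * (2 * (D2 * fine (pi [set x | del2 <= `|v2 N x|]) ^+ 2))); last by ring.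
  apply: ler_wpM2l; first exact: sqr_ge0.
  by apply: ler_wpM2l => //; have [_ /(_ _ d2)] := HD2 N.
apply: ler_wpM2l; first by rewrite mulr_ge0.
by apply: lerXn2r; rewrite ?nnegrE// (le_trans tl2).
Qed.

Lemma sqrt_over_cvg0 (T c : R) : T * 2 * Num.sqrt (c / K N) @[N --> \oo] --> (0 : R).
Proof.
rewrite -[0](mulr0 (T * 2)); apply: cvgM; first exact: cvg_cst.
rewrite -(sqrtr0 R); apply: (cvg_comp (fun N => c / K N) Num.sqrt); last exact: sqrt_continuous.
rewrite -[0](mulr0 c); apply: cvgM; first exact: cvg_cst.
have := cvg_comp _ _ KN (@powRN_cvg0 R 1 ltr01); apply: cvg_trans; apply: near_eq_cvg.
by apply: nearW => N; rewrite /= powR_inv1// ltW.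
Qed.

(** The choices are made in this order: a variance budget [Q], the levels [d1] and [d2] that respect
    it, the resulting drift and jump constants, then [h], and finally [N]. The bad event combines
    two fluctuation events, a pair of big jumps closer than [h], and a big jump before time [h]. *)
Lemma oscillation T e eta : 0 <= T -> 0 < e -> 0 < eta -> exists2 h, 0 < h &
  \forall N \near \oo, exists2 A : set Om, measurable A /\ fine (Pr A) <= eta &
    forall om, ~ A om -> good_partition (Z N om) e h T.
Proof.
move=> T0 e0 eta0; have g0 := gap_const_ge0 k01.
pose e4 := e / 4; have e40 : 0 < e4 by rewrite divr_gt0.
pose F := fluct_const k * (T + 2 + 2).
have fc0 : 0 <= fluct_const k by apply: mulr_ge0 => //; apply: addr_ge0 => //; exact: mulr_ge0.
have F0 : 0 <= F by apply: mulr_ge0 => //; do 2 apply: addr_ge0 => //.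
(* The first bound makes [sqrt Q] at most [e / 4], the second makes each fluctuation event at most
   [eta / 4] likely. *)
pose Q := Num.min (e4 ^+ 2) (eta / 4 * e4 ^+ 2 / (F + 1)).
have Q0 : 0 < Q.
  by rewrite lt_min exprn_gt0//= !mulr_gt0 ?divr_gt0 ?exprn_gt0 ?invr_gt0 ?ltr_wpDl.
have FQ : F * Q / e4 ^+ 2 <= eta / 4.
  rewrite ler_pdivrMr ?exprn_gt0//; apply: (@le_trans _ _ (F * (eta / 4 * e4 ^+ 2 / (F + 1)))).
    by apply: ler_wpM2l => //; rewrite ge_min lexx orbT.
  have p0 : 0 <= eta / 4 * e4 ^+ 2 by rewrite mulr_ge0 ?sqr_ge0// divr_ge0// ltW.
  by rewrite mulrCA ler_piMr// ler_pdivrMr ?ltr_wpDl// mul1r lerDl.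
have sQ : Num.sqrt Q <= e4.
  rewrite -(ger0_norm (ltW e40)) -sqrtr_sqr; apply: ler_wsqrtr.
  by rewrite ge_min lexx.
have [d1 d10 Hd1] := heavy_small H1 Q0; have [d2 d20 Hd2] := heavy_small H2 Q0.
have [C1 HC1] := heavy_drift H1 d10; have [C2 HC2] := heavy_drift H2 d20.
have C10 : 0 <= C1 by apply: le_trans (HC1 0%N).
have C20 : 0 <= C2 by apply: le_trans (HC2 0%N).
have [C [B HCB]] := big_jump_bounds d10 d20.
have C0 : 0 <= C by apply: le_trans (HCB 0%N).1; rewrite mulr_ge0 ?fine_ge0// ltW.
(* With [h = 1 / M], each summand enforces one condition on [h]: drift over a cell of length at most
   [2 h], early big jumps, close pairs of big jumps, and [h <= 1]. *)
pose M := 2 * (C1 + C2) / e4 + C / (eta / 4) + (T + 2) * C ^+ 2 / (eta / 8) + 1.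
have a1 : 0 <= 2 * (C1 + C2) / e4.
  by apply: divr_ge0; [apply: mulr_ge0 => //; exact: addr_ge0|exact: ltW].
have a2 : 0 <= C / (eta / 4) by apply: divr_ge0 => //; apply: divr_ge0 => //; exact: ltW.
have a3 : 0 <= (T + 2) * C ^+ 2 / (eta / 8).
  apply: divr_ge0; last by apply: divr_ge0 => //; exact: ltW.
  by apply: mulr_ge0; [exact: addr_ge0|exact: sqr_ge0].
have M1 : 1 <= M by rewrite lerDr; do 2 apply: addr_ge0 => //.
pose h := M^-1; have M0 : 0 < M by exact: lt_le_trans M1.
have h0 : 0 < h by rewrite invr_gt0.
have h1 : h <= 1 by rewrite invf_le1.
have hM a b : 0 < b -> a / b <= M -> a * h <= b.
  by move=> b0 ab; rewrite ler_pdivrMr// mulrC -ler_pdivrMr.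
have hC : 2 * (C1 + C2) * h <= e4 by apply: hM => //; rewrite /M; lra.
have hC' : C * h <= eta / 4 by apply: hM; [rewrite divr_gt0|rewrite /M; lra].
have hC2 : (T + 2) * C ^+ 2 * h <= eta / 8 by apply: hM; [rewrite divr_gt0|rewrite /M; lra].
have eta8 : 0 < eta / 8 by rewrite divr_gt0.
have /cvgrPdist_le/(_ _ eta8) sm := sqrt_over_cvg0 (T + 2) (gap_const k * C * B).
exists h => //; near=> N.
have sm' : (T + 2) * 2 * Num.sqrt (gap_const k * C * B / K N) <= eta / 8.
  have : `|0 - (T + 2) * 2 * Num.sqrt (gap_const k * C * B / K N)| <= eta / 8 by near: N.
  by rewrite sub0r normrN; apply: le_trans; exact: ler_norm.
have T20 : 0 <= T + 2 by rewrite addr_ge0.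
have [A1 [mA1 PA1] HA1] := increment_bound hchain hlaw hinv k01 hgap
  (heavy_meas H1 N) (K1 N) T20 e40 (Hd1 N) (HC1 N).
have [A2 [mA2 PA2] HA2] := increment_bound hchain hlaw hinv k01 hgap
  (heavy_meas H2 N) (K1 N) T20 e40 (Hd2 N) (HC2 N).
pose n := steps (K N) (T + 2); pose D := steps (K N) h.
have mJ := measurable_big_jump d1 d2 N.
have [A3 [mA3 PA3] HA3] := close_pairs hchain hlaw hinv k01 hgap n D mJ.
have [A4 [mA4 PA4] HA4] := early_visit hchain hlaw hinv D mJ.
have KN0 := ltW (K0 N).
have /andP[n1 _] := stepsP KN0 T20; rewrite -/n in n1.
have /andP[D1 _] := stepsP KN0 (ltW h0); rewrite -/D in D1.
have [pC qB] := HCB N.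
have p0 : 0 <= fine (pi (big_jump d1 d2 N)) by exact: fine_ge0.
exists (A1 `|` A2 `|` (A3 `|` A4)).
  split; first by do !apply: measurableU.
  have mA12 : measurable (A1 `|` A2) by exact: measurableU.
  have mA34 : measurable (A3 `|` A4) by exact: measurableU.
  apply: le_trans (prob_setU_le Pr mA12 mA34) _.
  rewrite (_ : eta = eta / 4 + eta / 4 + (eta / 8 + eta / 8 + eta / 4)); last by lra.
  apply: lerD.
    apply: le_trans (prob_setU_le Pr mA1 mA2) _; apply: lerD.
      exact: le_trans PA1 FQ.
    exact: le_trans PA2 FQ.
  apply: le_trans (prob_setU_le Pr mA3 mA4) _; apply: lerD.
    apply: le_trans PA3 _.
    have := pair_arith (K1 N) (ler0n R n) n1 (ler0n R D) D1 p0 pC (q_ge0 _ _) qB g0.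
    move/le_trans; apply; apply: lerD => //.
    by rewrite mulrAC.
  apply: le_trans PA4 _; apply: le_trans hC'.
  apply: (@le_trans _ _ (K N * h * fine (pi (big_jump d1 d2 N)))); first exact: ler_wpM2r.
  by rewrite mulrAC ler_wpM2r// ltW.
move=> om nA.
have nA1 : ~ A1 om by move=> ?; apply: nA; left; left.
have nA2 : ~ A2 om by move=> ?; apply: nA; left; right.
have nA3 : ~ A3 om by move=> ?; apply: nA; right; left.
have nA4 : ~ A4 om by move=> ?; apply: nA; right; right.
(* The value at [X i] enters the sum when [K r] reaches [i + 1], so this is the time at which the
   path jumps. *)
pose jump_at s := exists2 i, (i < n)%N & big_jump d1 d2 N (X i om) /\ s = i.+1%:R / K N.
have late s : jump_at s -> h < s.
  move=> [i iN [bi ->]]; rewrite ltr_pdivlMr// ltNge; apply/negP => ih.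
  apply: (HA4 om nA4 i) bi; rewrite /D /steps truncn_gt_nat -?ltr_nat//.
  by rewrite mulrC.
have apart s s' : jump_at s -> jump_at s' -> s < s' -> s + h < s'.
  move=> [i iN [bi ->]] [j jN [bj ->]]; rewrite ltr_pM2r ?invr_gt0// ltr_nat ltnS => ij.
  rewrite ltNge; apply/negP => hh.
  have jE : (j = i + (j - i.+1).+1)%N by rewrite -subSn// subSS subnKC// ltnW.
  apply: (HA3 om nA3 i (j - i.+1)%N iN); last by rewrite -jE.
  have : (j - i.+1).+1%:R <= K N * h.
    have : j.+1%:R <= i.+1%:R + h * K N.
      by move: hh; rewrite ler_pdivrMr// mulrDl divfK ?gt_eqF.
    rewrite {1}jE -addSn natrD lerD2l mulrC; exact.
  by move=> H; rewrite /D /steps truncn_gt_nat.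
have [m [t [t00 th1 th2 Ttm tj]]] := jump_partition h0 late apart T0.
exists m, t; split=> // i a b im.
have tge0 j : 0 <= t j.
  elim: j => [|j IH]; first by rewrite t00.
  by apply: le_trans (th1 j); rewrite addr_ge0// ltW.
have [tT tn] := tj _ im.
have main a' b' : t i <= a' -> a' <= b' -> b' < t i.+1 ->
    `|centered_sum X (v1 N) (K N) (w1 N) om b' - centered_sum X (v1 N) (K N) (w1 N) om a'| < e /\
    `|centered_sum X (v2 N) (K N) (w2 N) om b' - centered_sum X (v2 N) (K N) (w2 N) om a'| < e.
  move=> ta ab bt; have a'0 := le_trans (tge0 i) ta; have b'0 := le_trans a'0 ab.
  (* The cell starts by time [T] and has length at most [2 h <= 2]; this is why the fluctuation
     bounds were taken up to [T + 2]. *)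
  have bT : b' <= T + 2.
    apply: (le_trans (ltW bt)); apply: (le_trans (th2 i)); apply: lerD => //.
    by rewrite ler_piMr.
  have ba : b' - a' <= 2 * h.
    rewrite lerBlDr addrC; apply: (le_trans (ltW bt)); apply: (le_trans (th2 i)).
    by rewrite lerD2r.
  have nobig j : (steps (K N) a' <= j < steps (K N) b')%N -> ~ big_jump d1 d2 N (X j om).
    move=> /andP[aj jb] bj; apply: (tn (j.+1%:R / K N)).
      apply/andP; split.
        apply: (le_lt_trans ta); rewrite ltr_pdivlMr// mulrC.
        have /andP[_] := stepsP KN0 a'0; move/lt_le_trans; apply.
        by rewrite natr1 ler_nat ltnS.
      apply: le_lt_trans bt; rewrite ler_pdivrMr// mulrC.
      have /andP[+ _] := stepsP KN0 b'0; apply: le_trans.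
      by rewrite ler_nat.
    exists j => //; apply: (leq_trans jb); exact: steps_mono.
  have fin (S : R) (Cc : R) : 0 <= Cc -> Cc <= C1 + C2 -> S < 2 * e4 + Num.sqrt Q + (b' - a') * Cc -> S < e.
    move=> Cc0 CcC; move/lt_le_trans; apply.
    rewrite (_ : e = 2 * e4 + e4 + e4); last by rewrite /e4; lra.
    apply: lerD; first by rewrite lerD2l.
    apply: le_trans hC; rewrite mulrAC; apply: ler_pM => //; by rewrite subr_ge0.
  split.
    apply: (fin _ C1) => //; first by rewrite lerDl.
    apply: HA1 => // j /nobig; rewrite leNgt => nb; apply/negP => h'; apply: nb; left.
    exact: ltW.
  apply: (fin _ C2) => //; first by rewrite lerDr.
  apply: HA2 => // j /nobig; rewrite leNgt => nb; apply/negP => h'; apply: nb; right.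
  exact: ltW.
wlog ab : a b / a <= b.
  move=> H ha hb; have [ab|/ltW ab] := leP a b; first exact: H.
  by apply: ball_sym; exact: H.
move=> /andP[ta _] /andP[_ bt]; have a0 := le_trans (tge0 i) ta.
have [h3 h4] := main _ _ ta ab bt.
by rewrite !ZE ?(le_trans a0)//; split; rewrite /ball/= distrC.
Unshelve. all: by end_near. Qed.

End oscillation.

(** * Characteristic functions of the increments *)

Section complex_limits.
Context {R : realType}.
Implicit Types (z : R[i]) (u v c : nat -> R[i]).

Lemma squeeze0 (f g : nat -> R) : (forall N, 0 <= f N <= g N) ->
  g N @[N --> \oo] --> (0 : R) -> f N @[N --> \oo] --> (0 : R).
Proof.
move=> fg g0; have fg' : \forall N \near \oo, 0 <= f N <= g N by exact: nearW.
exact: (squeeze_cvgr fg' (cvg_cst 0) g0).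
Qed.

Lemma cvg0D (f g : nat -> R) : f N @[N --> \oo] --> (0 : R) -> g N @[N --> \oo] --> (0 : R) ->
  f N + g N @[N --> \oo] --> (0 : R).
Proof. by move=> f0 g0; rewrite -[X in _ --> X](addr0 (0 : R)); exact: cvgD. Qed.

Lemma cvg0Ml (a : R) (f : nat -> R) : f N @[N --> \oo] --> (0 : R) ->
  a * f N @[N --> \oo] --> (0 : R).
Proof. by move=> f0; rewrite -[X in _ --> X](mulr0 a); apply: cvgM => //; exact: cvg_cst. Qed.

Lemma cvg0M (f g : nat -> R) (a : R) : f N @[N --> \oo] --> a -> g N @[N --> \oo] --> (0 : R) ->
  f N * g N @[N --> \oo] --> (0 : R).
Proof. by move=> f0 g0; rewrite -[X in _ --> X](mulr0 a); exact: cvgM. Qed.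

Lemma cvg_normB (f : nat -> R) (a : R) : f N @[N --> \oo] --> a ->
  `|f N - a| @[N --> \oo] --> (0 : R).
Proof.
move=> fa; rewrite -[X in _ --> X](normr0 R) -[X in `|X|](subrr a).
by apply: cvg_norm; apply: cvgB => //; exact: cvg_cst.
Qed.

Definition ccvg u (l : R[i]) := complex.Re (u N) @[N --> \oo] --> complex.Re l /\
  complex.Im (u N) @[N --> \oo] --> complex.Im l.

Lemma ReImE z : z = (complex.Re z +i* complex.Im z)%C.
Proof. by case: z. Qed.

Lemma normc_ReIm z : `|complex.Re z| <= normc z /\ `|complex.Im z| <= normc z.
Proof.
case: z => a b /=; split; rewrite -sqrtr_sqr; apply: ler_wsqrtr.
  by rewrite lerDl sqr_ge0.
by rewrite lerDr sqr_ge0.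
Qed.

Lemma normc_le_sum z : normc z <= `|complex.Re z| + `|complex.Im z|.
Proof.
case: z => a b; apply: normc_le; first by rewrite addr_ge0.
by rewrite sqrrD !real_normK ?num_real// [leRHS]addrAC lerDl mulrn_wge0// mulr_ge0.
Qed.

Lemma ReB (x y : R[i]) : complex.Re (x - y) = complex.Re x - complex.Re y.
Proof. by case: x y => a b [a' b']. Qed.

Lemma ImB (x y : R[i]) : complex.Im (x - y) = complex.Im x - complex.Im y.
Proof. by case: x y => a b [a' b']. Qed.

Lemma ccvg_normc u l : normc (u N - l) @[N --> \oo] --> (0 : R) -> ccvg u l.
Proof.
move=> /cvgrPdist_le H; split; apply/cvgrPdist_le => e /H; apply: filterS => N.
  rewrite sub0r normrN ger0_norm ?normc_ge0//; apply: le_trans.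
  by rewrite distrC -ReB; exact: (normc_ReIm _).1.
rewrite sub0r normrN ger0_norm ?normc_ge0//; apply: le_trans.
by rewrite distrC -ImB; exact: (normc_ReIm _).2.
Qed.

Lemma normc_ccvg u l : ccvg u l -> normc (u N - l) @[N --> \oo] --> (0 : R).
Proof.
move=> [h1 h2].
apply: (squeeze0 _ (cvg0D (cvg_normB h1) (cvg_normB h2))) => N.
rewrite normc_ge0/= -ReB -ImB; exact: normc_le_sum.
Qed.

Lemma ccvg_close u v l : normc (u N - v N) @[N --> \oo] --> (0 : R) -> ccvg v l -> ccvg u l.
Proof.
move=> uv /normc_ccvg vl; apply: ccvg_normc.
apply: (squeeze0 _ (cvg0D uv vl)) => N.
rewrite normc_ge0/= (_ : u N - l = (u N - v N) + (v N - l)); last by rewrite addrA subrK.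
exact: le_normcD.
Qed.

Lemma ccvg_cst l : ccvg (fun=> l) l.
Proof. by split; exact: cvg_cst. Qed.

Lemma ccvgM u v l l' : ccvg u l -> ccvg v l' -> ccvg (fun N => u N * v N) (l * l').
Proof.
move=> [h1 h2] [h3 h4].
have E (x y : R[i]) : (complex.Re (x * y) = complex.Re x * complex.Re y - complex.Im x * complex.Im y) *
    (complex.Im (x * y) = complex.Re x * complex.Im y + complex.Im x * complex.Re y).
  by case: x y => a b [a' b'].
rewrite /ccvg; split; rewrite E; under eq_fun do rewrite E.
  by apply: cvgB; apply: cvgM.
by apply: cvgD; apply: cvgM.
Qed.

Lemma ccvg_prod n (U : nat -> nat -> R[i]) (l : nat -> R[i]) :
  (forall j, (j < n)%N -> ccvg (fun N => U N j) (l j)) ->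
  ccvg (fun N => \prod_(j < n) U N j) (\prod_(j < n) l j).
Proof.
elim: n => [|n IH] H.
  rewrite big_ord0; under eq_fun do rewrite big_ord0; exact: ccvg_cst.
rewrite big_ord_recr/=; under eq_fun do rewrite big_ord_recr/=.
by apply: ccvgM; [apply: IH => j jn; apply: H; exact: ltnW|exact: H].
Qed.

Lemma cexpD (x y : R[i]) : cexp (x + y) = cexp x * cexp y.
Proof.
case: x y => a b [a' b']; rewrite /cexp/=; apply/eqP; rewrite eq_complex/= expRD cosD sinD.
by apply/andP; split; apply/eqP; ring.
Qed.

Lemma cexp_nat (z : R[i]) n : cexp (n%:R * z) = cexp z ^+ n.
Proof.
elim: n => [|n IH]; last by rewrite -natr1 mulrDl mul1r cexpD IH exprSr.
by rewrite mul0r expr0 /cexp/= expR0 sin0 cos0 mulr1 mulr0.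
Qed.

Lemma normc_cexp (z : R[i]) : normc (cexp z) = expR (complex.Re z).
Proof.
rewrite /cexp /normc !exprMn -mulrDr cos2Dsin2 mulr1 sqrtr_sqr ger0_norm// expR_ge0.
Qed.

Lemma expR_taylor (x : R) : x <= 0 -> `|expR x - 1| <= `|x| /\ `|expR x - 1 - x| <= x ^+ 2.
Proof.
move=> x0; have h1 := expR_ge1Dx x; have h2 := expR_ge1Dx (- x).
have e1 : expR x <= 1 by rewrite -expR0 ler_expR.
have e0 : 0 < expR x by exact: expR_gt0.
split; first by rewrite (ler0_norm x0) ler0_norm ?subr_le0//; lra.
rewrite ger0_norm; last by lra.
have : expR x * (1 - x) <= 1.
  apply: (@le_trans _ _ (expR x * expR (- x))); first by apply: ler_wpM2l => //; exact: ltW.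
  by rewrite -expRD subrr expR0.
move=> h3; have : (expR x - 1 - x) * (1 - x) <= x ^+ 2 by rewrite mulrBl mulrBl; lra.
apply: le_trans; rewrite ler_peMr ?lerBrDr//; lra.
Qed.

(** On the half-plane of nonpositive real parts the exponential has modulus at most 1, so the
    quadratic remainder needs no bound on [z]. *)
Lemma cexp_taylor (z : R[i]) : complex.Re z <= 0 -> normc (cexp z - 1 - z) <= 4 * normc z ^+ 2.
Proof.
case: z => x y x0; have {}x0 : x <= 0 := x0; have [h1 h2] := expR_taylor x0.
have e1 : expR x <= 1 by rewrite -expR0 ler_expR.
have e0 : 0 <= expR x by exact: expR_ge0.
rewrite [in leRHS]/normc sqr_sqrtr ?addr_ge0 ?sqr_ge0//.
rewrite (_ : cexp _ - 1 - _ = ((expR x * (cos y - 1) + (expR x - 1 - x)) +i*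
  (expR x * (sin y - y) + (expR x - 1) * y))%C); last first.
  by apply/eqP; rewrite eq_complex/=; apply/andP; split; apply/eqP; ring.
apply: le_trans (normc_le_sum _) _ => /=.
have g1 : `|expR x * (cos y - 1) + (expR x - 1 - x)| <= y ^+ 2 + x ^+ 2.
  apply: le_trans (ler_normD _ _) _; apply: lerD => //; rewrite normrM (ger0_norm e0).
  apply: le_trans (cosB1_le_sqr y); exact: ler_piMl.
have g2 : `|expR x * (sin y - y) + (expR x - 1) * y| <= y ^+ 2 + `|x| * `|y|.
  apply: le_trans (ler_normD _ _) _; apply: lerD.
    rewrite normrM (ger0_norm e0); apply: le_trans (sinB_le_sqr y); exact: ler_piMl.
  by rewrite normrM ler_wpM2r.
apply: le_trans (lerD g1 g2) _.
have := sqr_ge0 (`|x| - `|y|); rewrite sqrrB !real_normK ?num_real//.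
have := sqr_ge0 x; have := sqr_ge0 y; lra.
Qed.

(** Telescoping: one factor is exchanged at a time, and all the others have modulus at most 1. *)
Lemma normc_subX (a b : R[i]) n : normc a <= 1 -> normc b <= 1 ->
  normc (a ^+ n - b ^+ n) <= n%:R * normc (a - b).
Proof.
move=> a1 b1; have b1n m : normc (b ^+ m) <= 1.
  elim: m => [|m IH]; first by rewrite expr0 normc1.
  by rewrite exprS normcM mulr_ile1// normc_ge0.
elim: n => [|n IH]; first by rewrite subrr mul0r normc0.
rewrite (_ : _ - _ = a * (a ^+ n - b ^+ n) + (a - b) * b ^+ n); last by rewrite !exprS; ring.
rewrite [leRHS](_ : _ = n%:R * normc (a - b) + normc (a - b)); last by rewrite -natr1 mulrDl mul1r.
apply: le_trans (le_normcD _ _) _; rewrite !normcM; apply: lerD.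
  by apply: le_trans IH; rewrite ler_piMl// normc_ge0.
by rewrite ler_piMr// normc_ge0.
Qed.

Lemma normc_real (x : R) : normc x%:C%C = `|x|.
Proof. by rewrite /normc/= expr0n addr0 sqrtr_sqr. Qed.

Lemma normc_imag (x : R) : normc (0 +i* x)%C = `|x|.
Proof. by rewrite /normc/= expr0n add0r sqrtr_sqr. Qed.

Lemma expi_taylor (a : R) : normc (expi (- a) - 1 + (0 +i* a)%C) <= 2 * a ^+ 2.
Proof.
apply: le_trans (normc_le_sum _) _; rewrite /= cosN sinN oppr0 !addr0.
rewrite mulr2n mulrDl mul1r; apply: lerD; first exact: cosB1_le_sqr.
by rewrite addrC -opprB normrN; exact: sinB_le_sqr.
Qed.

Section power_limit.
Variables (c : nat -> R[i]) (K w : nat -> R) (n : nat -> nat) (h : R) (psi : R[i]).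
Hypothesis c1 : forall N, normc (c N) <= 1.
Hypothesis K1 : forall N, 1 <= K N.
Hypothesis KN : K N @[N --> \oo] --> +oo%R.
Hypothesis wK : w N ^+ 2 / K N @[N --> \oo] --> (0 : R).
Hypothesis cK : ccvg (fun N => (K N)%:C%C * (c N - 1) - (0 +i* w N)%C) psi.
Hypothesis h0 : 0 <= h.
Hypothesis nK : forall N, `|(n N)%:R - h * K N| <= 1.

Let K0 N : 0 < K N.
Proof. exact: lt_le_trans (K1 N). Qed.

Let Kinv : (K N)^-1 @[N --> \oo] --> (0 : R).
Proof.
have := cvg_comp _ _ KN (@powRN_cvg0 R 1 ltr01); apply: cvg_trans; apply: near_eq_cvg.
by apply: nearW => N; rewrite /= powR_inv1// ltW.
Qed.

Let w_le N : `|w N| / K N <= (K N)^-1 + w N ^+ 2 / K N.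
Proof.
rewrite -[X in X + _]mul1r -mulrDl ler_wpM2r ?invr_ge0 ?(ltW (K0 N))//.
have := sqr_ge0 (`|w N| - 1); rewrite sqrrB1 real_normK ?num_real//.
have := normr_ge0 (w N); lra.
Qed.

(** The modulus of [c N] is at most 1 and the centering is imaginary, so the real part is
    nonpositive before the limit. *)
Lemma Re_psi_le0 : complex.Re psi <= 0.
Proof.
case: cK => h1 _; apply: (ler_cvg_to h1 (cvg_cst 0)); apply: nearW => N.
have [hc _] := normc_ReIm (c N).
have : complex.Re (c N) <= 1 by apply: le_trans (c1 N); apply: le_trans hc; exact: ler_norm.
case: (c N) => a b /= a1; rewrite mul0r !subr0.
by apply: mulr_ge0_le0; [exact: ltW|rewrite subr_le0].
Qed.

Let e N := normc ((K N)%:C%C * (c N - 1) - (0 +i* w N)%C - psi).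

Let ecvg : e N @[N --> \oo] --> (0 : R).
Proof. exact: normc_ccvg. Qed.

(** The factor [c N] with the drift of one step removed; [K (dd - 1)] tends to [psi] even if [w]
    diverges, with the explicit error [B]. *)
Let dd N := c N * expi (- (w N / K N)).

Let B N := e N + 3 * (w N ^+ 2 / K N) +
  (normc psi + e N) * ((K N)^-1 + w N ^+ 2 / K N).

Let Bcvg : B N @[N --> \oo] --> (0 : R).
Proof.
have K0w := cvg0D Kinv wK.
have pe : normc psi + e N @[N --> \oo] --> normc psi.
  by rewrite -[X in _ --> X](addr0 (normc psi)); apply: cvgD => //; exact: cvg_cst.
exact: cvg0D (cvg0D ecvg (cvg0Ml 3 wK)) (cvg0M pe K0w).
Qed.

Let c1_le N : normc (c N - 1) * K N <= normc psi + e N + `|w N|.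
Proof.
have -> : normc (c N - 1) * K N = normc ((K N)%:C%C * (c N - 1)).
  by rewrite normcM normc_real gtr0_norm// mulrC.
rewrite (_ : _ * _ = psi + ((K N)%:C%C * (c N - 1) - (0 +i* w N)%C - psi) + (0 +i* w N)%C); last by ring.
apply: le_trans (le_normcD _ _) _; rewrite normc_imag lerD2r; exact: le_normcD.
Qed.

Let dd_le N : normc ((K N)%:C%C * (dd N - 1) - psi) <= B N.
Proof.
have E : (0 +i* w N)%C = (K N)%:C%C * (0 +i* (w N / K N))%C :> R[i].
  by apply/eqP; rewrite eq_complex/= !mul0r !mulr0 subrr addr0 eqxx mulrC divfK ?eqxx// gt_eqF.
rewrite (_ : _ - psi = ((K N)%:C%C * (c N - 1) - (0 +i* w N)%C - psi) +
   (K N)%:C%C * c N * (expi (- (w N / K N)) - 1 + (0 +i* (w N / K N))%C) -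
   (c N - 1) * (0 +i* w N)%C); last by rewrite /dd E; ring.
apply: le_trans (le_normcD _ _) _; rewrite normcN.
apply: le_trans (lerD (le_normcD _ _) (lexx _)) _; rewrite -/(e N) !normcM normc_real normc_imag.
rewrite (ger0_norm (ltW (K0 N))).
have h1 : K N * normc (c N) * normc (expi (- (w N / K N)) - 1 + (0 +i* (w N / K N))%C) <=
    2 * (w N ^+ 2 / K N).
  apply: (@le_trans _ _ (K N * 1 * (2 * (w N / K N) ^+ 2))).
    apply: ler_pM; rewrite ?mulr_ge0 ?normc_ge0 ?(ltW (K0 N))//; last exact: expi_taylor.
    by rewrite ler_wpM2l// ltW.
  by rewrite le_eqVlt; apply/orP; left; apply/eqP; field; rewrite gt_eqF.
have h2 : normc (c N - 1) * `|w N| <= (normc psi + e N) * ((K N)^-1 + w N ^+ 2 / K N) + w N ^+ 2 / K N.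
  apply: (@le_trans _ _ ((normc psi + e N + `|w N|) * (`|w N| / K N))).
    by rewrite mulrA ler_pdivlMr// mulrAC; apply: ler_wpM2r.
  rewrite mulrDl; apply: lerD.
    by apply: ler_wpM2l => //; rewrite addr_ge0// normc_ge0.
  by rewrite mulrA -expr2 real_normK ?num_real.
apply: le_trans (lerD (lerD (lexx _) h1) h2) _; rewrite /B; lra.
Qed.

Let zz N : R[i] := (K N)^-1%:C%C * psi.

Let dd1 N : normc (dd N) <= 1.
Proof. by rewrite normcM normc_expi mulr1. Qed.

Let zz_le0 N : complex.Re (zz N) <= 0.
Proof.
have := Re_psi_le0; rewrite /zz; case: psi => a b /= a0; rewrite mul0r subr0.
by apply: mulr_ge0_le0 => //; rewrite invr_ge0 ltW.
Qed.

Let dd_exp N : normc (dd N - cexp (zz N)) <= (B N + 4 * normc psi ^+ 2 / K N) / K N.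
Proof.
rewrite (_ : _ - _ = (dd N - 1 - zz N) - (cexp (zz N) - 1 - zz N)); last by ring.
apply: le_trans (le_normcD _ _) _; rewrite normcN mulrDl; apply: lerD.
  rewrite (_ : dd N - 1 - zz N = (K N)^-1%:C%C * ((K N)%:C%C * (dd N - 1) - psi)).
    have k0 : 0 <= (K N)^-1 by rewrite invr_ge0 ltW.
    by rewrite normcM normc_real (ger0_norm k0) mulrC; apply: ler_wpM2r.
  rewrite /zz mulrBr mulrA -rmorphM mulVf ?gt_eqF// rmorph1 mul1r; ring.
apply: le_trans (cexp_taylor (zz_le0 N)) _.
rewrite /zz normcM normc_real ger0_norm ?invr_ge0 ?(ltW (K0 N))// exprMn.
by rewrite le_eqVlt; apply/orP; left; apply/eqP; field; rewrite gt_eqF.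
Qed.

(** The drift is distributed over the factors, giving [dd N], whose [n]-th power is compared with
    [exp (n psi / K)] by telescoping. A rotation by [(n - h K) w / K] is left over, and it tends to
    1 because [n] is within 1 of [h K] and [w / K] vanishes. *)
Lemma power_limit : ccvg (fun N => c N ^+ n N * expi (- (h * w N))) (cexp (h%:C%C * psi)).
Proof.
have E N : c N ^+ n N * expi (- (h * w N)) = dd N ^+ n N * expi (((n N)%:R - h * K N) * (w N / K N)).
  have eX m t : expi t ^+ m = expi (m%:R * t) :> R[i].
    elim: m => [|m IH]; first by rewrite expr0 mul0r expi0.
    by rewrite exprS IH -expiD -natr1 mulrDl mul1r addrC.
  rewrite /dd exprMn eX -mulrA -expiD; congr (_ * expi _).
  by field; rewrite gt_eqF.
have nKh : (n N)%:R / K N @[N --> \oo] --> h.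
  apply/cvgrPdist_le => e1 e10; move: Kinv => /cvgrPdist_le/(_ _ e10); apply: filterS => N.
  rewrite sub0r normrN ger0_norm ?invr_ge0 ?(ltW (K0 N))//; apply: le_trans.
  rewrite (_ : h - _ = - (((n N)%:R - h * K N) / K N)); last by field; rewrite gt_eqF.
  by rewrite normrN normrM normfV (gtr0_norm (K0 N)) ler_piMl// invr_ge0 ltW.
have w0 : `|w N| / K N @[N --> \oo] --> (0 : R).
  apply: (squeeze0 _ (cvg0D Kinv wK)) => N; rewrite w_le andbT.
  by rewrite divr_ge0// ltW.
have h1 : ccvg (fun N => expi (((n N)%:R - h * K N) * (w N / K N))) 1.
  apply: ccvg_normc; apply: (squeeze0 _ (cvg0Ml 2 w0)) => N; apply/andP; split; first exact: normc_ge0.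
  apply: le_trans (normc_le_sum _) _; rewrite /= oppr0 addr0 [leRHS](_ : _ = `|w N| / K N + `|w N| / K N); last by rewrite mulr2n mulrDl mul1r.
  have H1 : `|((n N)%:R - h * K N) * (w N / K N)| <= `|w N| / K N.
    rewrite normrM [X in _ * X]normrM normfV (gtr0_norm (K0 N)) ler_piMl//.
    by rewrite divr_ge0// ltW.
  by apply: lerD; apply: le_trans H1; [exact: cosB1_le|exact: norm_sin_le].
have h2 : ccvg (fun N => cexp ((n N)%:R * zz N)) (cexp (h%:C%C * psi)).
  have EZ N : (n N)%:R * zz N = ((n N)%:R / K N)%:C%C * psi.
    by rewrite /zz mulrA rmorphM/= rmorph_nat.
  have cE (f g : R -> R) : continuous f -> continuous g ->
      (f ((n N)%:R / K N) * g ((n N)%:R / K N)) @[N --> \oo] --> f h * g h.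
    by move=> cf cg; apply: cvgM; apply: (cvg_comp _ _ nKh); [exact: cf|exact: cg].
  have psiE := ReImE psi; set a := complex.Re psi in psiE; set b := complex.Im psi in psiE.
  have ce : continuous (fun x : R => expR (x * a)).
    move=> x; apply: (@continuous_comp _ _ _ (fun x : R => x * a) expR); last exact: continuous_expR.
    by apply: cvgM; [exact: cvg_id|exact: cvg_cst].
  have cc : continuous (fun x : R => cos (x * b)).
    move=> x; apply: (@continuous_comp _ _ _ (fun x : R => x * b) cos); last exact: continuous_cos.
    by apply: cvgM; [exact: cvg_id|exact: cvg_cst].
  have cs : continuous (fun x : R => sin (x * b)).
    move=> x; apply: (@continuous_comp _ _ _ (fun x : R => x * b) sin); last exact: continuous_sin.
    by apply: cvgM; [exact: cvg_id|exact: cvg_cst].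
  have RE x : cexp (x%:C%C * psi) = (expR (x * a) * cos (x * b) +i* (expR (x * a) * sin (x * b)))%C.
    by rewrite psiE /cexp/= !mul0r subr0 addr0.
  have EZ' N : cexp ((n N)%:R * zz N) = (expR ((n N)%:R / K N * a) * cos ((n N)%:R / K N * b) +i*
     (expR ((n N)%:R / K N * a) * sin ((n N)%:R / K N * b)))%C by rewrite EZ; exact: RE.
  under eq_fun do rewrite EZ'.
  have -> : cexp (h%:C%C * psi) = (expR (h * a) * cos (h * b) +i* (expR (h * a) * sin (h * b)))%C.
    exact: RE.
  by split; [exact: (cE _ _ ce cc)|exact: (cE _ _ ce cs)].
have h3 : normc (dd N ^+ n N - cexp ((n N)%:R * zz N)) @[N --> \oo] --> (0 : R).
  have H := cvg0M nKh (cvg0D Bcvg (cvg0Ml (4 * normc psi ^+ 2) Kinv)).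
  apply: (squeeze0 _ H) => N; rewrite normc_ge0/= cexp_nat.
  apply: (le_trans (normc_subX (n N) (dd1 N) _)).
    by rewrite normc_cexp -expR0 ler_expR.
  by rewrite mulrAC -mulrA; apply: ler_wpM2l => //; exact: dd_exp.
under eq_fun do rewrite E.
rewrite -[cexp _]mulr1; apply: ccvgM => //.
exact: ccvg_close h3 h2.
Qed.

End power_limit.

End complex_limits.

Lemma sqr_unit_le {R : realType} {d} {E : measurableType d} (v : E -> R) (del : R) x :
  unit_jump v x ^+ 2 <= small_jump v del x ^+ 2 + \1_[set y | del <= `|v y|] x.
Proof.
rewrite /unit_jump /small_jump !indicE.
have u0 : 0 <= Num.min 1 `|v x| by rewrite le_min ler01 normr_ge0.
have [h|h] := leP `|v x| del.
  rewrite (mem_set (h : [set y | `|v y| <= del] x)) mulr1 -[leLHS]addr0; apply: lerD => //.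
  by rewrite -[leRHS]real_normK ?num_real// lerXn2r ?nnegrE// ge_min lexx orbT.
rewrite (mem_set (ltW h : [set y | del <= `|v y|] x)) -[leLHS]add0r; apply: lerD.
  exact: sqr_ge0.
by rewrite exprn_ile1// ge_min lexx.
Qed.

Lemma mul_le_weighted {R : realType} (a b t : R) : 0 <= a -> 0 <= b -> 0 < t ->
  a * b <= a ^+ 2 / t + t * b ^+ 2.
Proof.
move=> a0 b0 t0; rewrite -(ler_pM2r t0) mulrDl divfK ?gt_eqF//.
have := sqr_ge0 (a - t * b); rewrite sqrrB exprMn => h.
have : 0 <= a * b * t by rewrite !mulr_ge0// ltW.
rewrite (_ : t * b ^+ 2 * t = t ^+ 2 * b ^+ 2); last by ring.
rewrite (_ : a * (t * b) *+ 2 = 2 * (a * b * t)) in h; last by ring.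
lra.
Qed.

(** * Centering, cross terms and phases of two heavy-tailed coordinates *)

Section heavy_facts.
Context {R : realType} {d : measure_display} {E : measurableType d}.
Variables (P : R.-pker E ~> E) (pi : probability E R).
Variables (K w : nat -> R) (v : nat -> E -> R) (psi : R -> R[i]).
Hypothesis K1 : forall N, 1 <= K N.
Hypothesis KN : K N @[N --> \oo] --> +oo%R.
Hypothesis H : heavy P pi v K w psi.

Let K0 N : 0 < K N.
Proof. exact: lt_le_trans (K1 N). Qed.

Lemma inv_cvg0 : (K N)^-1 @[N --> \oo] --> (0 : R).
Proof.
have := cvg_comp _ _ KN (@powRN_cvg0 R 1 ltr01); apply: cvg_trans; apply: near_eq_cvg.
by apply: nearW => N; rewrite /= powR_inv1// ltW.
Qed.

Lemma heavy_unit_sqr : exists C, forall N, K N * (\int[pi]_x (unit_jump (v N) x ^+ 2))%R <= C.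
Proof.
have [del del0 Hd] := heavy_small H ltr01; have [C HC] := heavy_tail H del0.
exists (1 + C) => N; have mv := heavy_meas H N.
have mA : measurable [set y | del <= `|v N y|] by exact: measurable_norm_ge.
have b1 := bdd_meas_sqr (bdd_unit_jump mv); have b2 := bdd_meas_sqr (bdd_small_jump del mv).
have b3 : bdd_meas (\1_[set y | del <= `|v N y|] : E -> R) by exact: bdd_meas_indic.
apply: le_trans (lerD (Hd N) (HC N)); rewrite -mulrDr -Ex_indic// -ExD//.
apply: ler_wpM2l; first exact: ltW.
apply: le_Ex => //; first exact: bdd_measD.
by move=> x; exact: sqr_unit_le.
Qed.

(** The centering is within a constant of [K] times the mean of the jumps up to size 1, which is at
    most [K] times the mean of [unit_jump]. Its square divided by [K] is therefore controlled by
    [heavy_min]. *)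
Lemma heavy_centering : w N ^+ 2 / K N @[N --> \oo] --> (0 : R).
Proof.
have [C HC] := heavy_drift H ltr01.
have H2 := cvg0D (cvg0Ml 2 (heavy_min H)) (cvg0Ml (2 * C ^+ 2) inv_cvg0).
apply: (squeeze0 _ H2) => N; have mv := heavy_meas H N.
rewrite divr_ge0 ?sqr_ge0 ?(ltW (K0 N))//=.
have bu := bdd_unit_jump mv; have bs := bdd_small_jump 1 mv.
set m := (\int[pi]_x small_jump (v N) 1 x)%R in HC *.
have mu : `|\int[pi]_x small_jump (v N) 1 x|%R <= (\int[pi]_x unit_jump (v N) x)%R.
  have su x : `|small_jump (v N) 1 x| <= unit_jump (v N) x.
    rewrite /small_jump /unit_jump indicE; have [/set_mem/= h|_] := boolP (x \in _).
      by rewrite mulr1 min_r.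
    by rewrite mulr0 normr0 le_min ler01 normr_ge0.
  rewrite ler_norml; apply/andP; split.
    rewrite -[leLHS]mulN1r -ExZ//; apply: le_Ex => //; first exact: bdd_measZ.
    by move=> x; rewrite mulN1r; have := su x; rewrite ler_norml => /andP[].
  by apply: le_Ex => // x; have := su x; rewrite ler_norml => /andP[].
have wle : w N ^+ 2 <= 2 * (K N * (\int[pi]_x unit_jump (v N) x)%R) ^+ 2 + 2 * C ^+ 2.
  have h1 : (K N * (\int[pi]_x small_jump (v N) 1 x)%R) ^+ 2 <= (K N * (\int[pi]_x unit_jump (v N) x)%R) ^+ 2.
    rewrite !exprMn; apply: ler_wpM2l; first exact: sqr_ge0.
    rewrite -[leLHS]real_normK ?num_real//; apply: lerXn2r => //; rewrite nnegrE //.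
    exact: le_trans (normr_ge0 _) mu.
  have h2 : (w N - K N * (\int[pi]_x small_jump (v N) 1 x)%R) ^+ 2 <= C ^+ 2.
    rewrite -[leLHS]real_normK ?num_real//; apply: lerXn2r; rewrite ?nnegrE//.
      by apply: le_trans (HC N).
    by rewrite distrC; exact: HC.
  have := sqrD_le2 (K N * (\int[pi]_x small_jump (v N) 1 x)%R) (w N - K N * (\int[pi]_x small_jump (v N) 1 x)%R).
  rewrite addrC subrK => /le_trans; apply; apply: lerD; exact: ler_wpM2l.
rewrite ler_pdivrMr// mulrDl -[2 * C ^+ 2 * _ * _]mulrA mulVf ?gt_eqF// mulr1.
apply: (le_trans wle); rewrite lerD2r le_eqVlt; apply/orP; left; apply/eqP; ring.
Qed.

End heavy_facts.

Section phases.
Context {R : realType} {d : measure_display} {E : measurableType d}.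
Variables (P : R.-pker E ~> E) (pi : probability E R).
Hypothesis hinv : invariant_law P pi.
Local Notation q f := (\int[pi]_x (f x ^+ 2))%R.
Variables (K : nat -> R) (v1 v2 : nat -> E -> R) (w1 w2 : nat -> R) (psi1 psi2 : R -> R[i]).
Hypothesis K1 : forall N, 1 <= K N.
Hypothesis KN : K N @[N --> \oo] --> +oo%R.
Hypothesis H1 : heavy P pi v1 K w1 psi1.
Hypothesis H2 : heavy P pi v2 K w2 psi2.
Hypothesis joint : forall del, 0 < del ->
  K N * fine (pi [set x | del <= `|v1 N x| /\ del <= `|v2 N x|]) @[N --> \oo] --> (0 : R).

Let K0 N : 0 < K N.
Proof. exact: lt_le_trans (K1 N). Qed.

Let mv1 N : measurable_fun setT (v1 N) := heavy_meas H1 N.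
Let mv2 N : measurable_fun setT (v2 N) := heavy_meas H2 N.

(** Simultaneous large values are negligible by the joint tail condition. Otherwise one coordinate
    is small, and a weighted arithmetic-geometric inequality trades its small second moment for a
    small multiple [t] of the other one. The shares are [e / 2] and four times [e / 8]. *)
Lemma cross_cvg0 : K N * (\int[pi]_x (unit_jump (v1 N) x * unit_jump (v2 N) x))%R @[N --> \oo] --> (0 : R).
Proof.
have [C1 HC1] := heavy_unit_sqr K1 H1; have [C2 HC2] := heavy_unit_sqr K1 H2.
apply/cvgrPdist_le => e e0.
pose C := Num.max C1 C2; pose t := e / (8 * (`|C| + 1)).
have C0 : 0 < `|C| + 1 by rewrite ltr_wpDl.
have t0 : 0 < t by rewrite divr_gt0// mulr_gt0.
have Q0 : 0 < t * (e / 8) by rewrite mulr_gt0// divr_gt0.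
have [d1 d10 Hd1] := heavy_small H1 Q0; have [d2 d20 Hd2] := heavy_small H2 Q0.
pose del := Num.min d1 d2; have del0 : 0 < del by rewrite lt_min d10.
have e2 : 0 < e / 2 by rewrite divr_gt0.
move: (joint del0) => /cvgrPdist_le/(_ _ e2); apply: filterS => N.
rewrite !sub0r !normrN => hj.
have I0 : 0 <= (\int[pi]_x (unit_jump (v1 N) x * unit_jump (v2 N) x))%R.
  by apply: Ex_ge0 => x; rewrite mulr_ge0// unit_jump_ge0.
rewrite ger0_norm; last by rewrite mulr_ge0// ltW.
have mA : measurable [set x | del <= `|v1 N x| /\ del <= `|v2 N x|].
  rewrite (_ : [set x | _] = [set x | del <= `|v1 N x|] `&` [set x | del <= `|v2 N x|])//.
  by apply: measurableI; exact: measurable_norm_ge.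
have u1 := bdd_unit_jump (mv1 N); have u2 := bdd_unit_jump (mv2 N).
have s1 := bdd_meas_sqr (bdd_small_jump d1 (mv1 N)); have s2 := bdd_meas_sqr (bdd_small_jump d2 (mv2 N)).
have bA : bdd_meas (\1_[set x | del <= `|v1 N x| /\ del <= `|v2 N x|] : E -> R) by exact: bdd_meas_indic.
have uu1 := bdd_meas_sqr u1; have uu2 := bdd_meas_sqr u2.
have pw x : unit_jump (v1 N) x * unit_jump (v2 N) x <=
   \1_[set x | del <= `|v1 N x| /\ del <= `|v2 N x|] x +
   (t^-1 * small_jump (v1 N) d1 x ^+ 2 + t * unit_jump (v2 N) x ^+ 2) +
   (t^-1 * small_jump (v2 N) d2 x ^+ 2 + t * unit_jump (v1 N) x ^+ 2).
  have a0 : 0 <= (\1_[set x | del <= `|v1 N x| /\ del <= `|v2 N x|] x : R) by rewrite indicE.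
  have p1 : 0 <= t^-1 * small_jump (v1 N) d1 x ^+ 2 + t * unit_jump (v2 N) x ^+ 2.
    by apply: addr_ge0; apply: mulr_ge0; rewrite ?sqr_ge0 ?invr_ge0// ltW.
  have p2 : 0 <= t^-1 * small_jump (v2 N) d2 x ^+ 2 + t * unit_jump (v1 N) x ^+ 2.
    by apply: addr_ge0; apply: mulr_ge0; rewrite ?sqr_ge0 ?invr_ge0// ltW.
  have sj (v : E -> R) del' : `|v x| <= del' -> unit_jump v x ^+ 2 <= small_jump v del' x ^+ 2.
    move=> h; rewrite /small_jump indicE mem_set// mulr1 -[leRHS]real_normK ?num_real//.
    by rewrite lerXn2r ?nnegrE ?unit_jump_ge0// /unit_jump ge_min lexx orbT.
  have [h|h] := leP `|v1 N x| d1.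
    apply: (@le_trans _ _ (t^-1 * small_jump (v1 N) d1 x ^+ 2 + t * unit_jump (v2 N) x ^+ 2)); last first.
      by rewrite addrAC lerDr addr_ge0.
    apply: le_trans (mul_le_weighted (unit_jump_ge0 _ _) (unit_jump_ge0 _ _) t0) _.
    by rewrite lerD2r mulrC ler_wpM2l ?invr_ge0 ?(ltW t0)// sj.
  have [h'|h'] := leP `|v2 N x| d2.
    apply: (@le_trans _ _ (t^-1 * small_jump (v2 N) d2 x ^+ 2 + t * unit_jump (v1 N) x ^+ 2)); last first.
      by rewrite lerDr addr_ge0.
    rewrite mulrC; apply: le_trans (mul_le_weighted (unit_jump_ge0 _ _) (unit_jump_ge0 _ _) t0) _.
    by rewrite lerD2r mulrC ler_wpM2l ?invr_ge0 ?(ltW t0)// sj.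
  rewrite indicE mem_set/=; last by split; rewrite ge_min; apply/orP; [left|right]; exact: ltW.
  rewrite -addrA; apply: (@le_trans _ _ 1); last by rewrite lerDl addr_ge0.
  by rewrite mulr_ile1 ?unit_jump_ge0 ?unit_jump_le1.
have := le_Ex pi (bdd_measM u1 u2) (bdd_measD (bdd_measD bA (bdd_measD (bdd_measZ t^-1 s1) (bdd_measZ t uu2)))
   (bdd_measD (bdd_measZ t^-1 s2) (bdd_measZ t uu1))) pw.
rewrite (ExD pi (bdd_measD bA (bdd_measD (bdd_measZ t^-1 s1) (bdd_measZ t uu2)))
   (bdd_measD (bdd_measZ t^-1 s2) (bdd_measZ t uu1))) (ExD pi bA (bdd_measD (bdd_measZ t^-1 s1) (bdd_measZ t uu2))).
rewrite (ExD pi (bdd_measZ t^-1 s1) (bdd_measZ t uu2)) (ExD pi (bdd_measZ t^-1 s2) (bdd_measZ t uu1)).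
rewrite (ExZ pi t^-1 s1) (ExZ pi t uu2) (ExZ pi t^-1 s2) (ExZ pi t uu1) Ex_indic//.
move=> /(ler_wpM2l (ltW (K0 N))) /le_trans; apply.
rewrite !mulrDr -[leRHS](_ : e / 2 + (e / 8 + e / 8) + (e / 8 + e / 8) = _); last by lra.
have q1 : K N * (t^-1 * q (small_jump (v1 N) d1)) <= e / 8.
  by rewrite mulrCA ler_pdivrMl//; exact: Hd1.
have q2 : K N * (t^-1 * q (small_jump (v2 N) d2)) <= e / 8.
  by rewrite mulrCA ler_pdivrMl//; exact: Hd2.
have tC x : x <= C -> t * x <= e / 8.
  move=> xC; rewrite /t mulrAC ler_pdivrMr ?mulr_gt0//.
  rewrite (_ : e / 8 * (8 * _) = e * (`|C| + 1)); last by field.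
  apply: ler_wpM2l; first exact: ltW.
  by rewrite (le_trans xC)// (le_trans (ler_norm _))// lerDl.
have q3 : K N * (t * q (unit_jump (v2 N))) <= e / 8.
  by rewrite mulrCA; apply: tC; rewrite le_max HC2 orbT.
have q4 : K N * (t * q (unit_jump (v1 N))) <= e / 8.
  by rewrite mulrCA; apply: tC; rewrite le_max HC1.
by apply: lerD; [apply: lerD; [exact: le_trans (ler_norm _) hj|exact: lerD]|exact: lerD].
Qed.

Definition phase N (xi xi' : R) (x : E) := xi * v1 N x + xi' * v2 N x.

Lemma measurable_phase N xi xi' : measurable_fun setT (phase N xi xi').
Proof. by apply: measurable_funD; exact: measurable_funM. Qed.

Lemma norm_unit_le (v : E -> R) (xi : R) x (y : R) : `|y| <= 2 -> `|y| <= `|xi * v x| ->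
  `|y| <= (2 + `|xi|) * unit_jump v x.
Proof.
move=> y2 yv; rewrite /unit_jump; have [h|h] := leP 1 `|v x|.
  by rewrite mulr1 (le_trans y2)// lerDl.
by rewrite (le_trans yv)// normrM ler_wpM2r// lerDr.
Qed.

Lemma phase_unit_le N xi xi' B x : `|xi| <= B -> `|xi'| <= B ->
  `|cos (phase N xi xi' x) - 1| <= 2 * (2 + B) * (unit_jump (v1 N) x + unit_jump (v2 N) x) /\
  `|sin (phase N xi xi' x)| <= 2 * (2 + B) * (unit_jump (v1 N) x + unit_jump (v2 N) x).
Proof.
move=> xB xB'; rewrite /phase.
have T (v : E -> R) y : `|y| <= B -> `|cos (y * v x) - 1| <= (2 + B) * unit_jump v x /\
    `|sin (y * v x)| <= (2 + B) * unit_jump v x.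
  move=> yB; have le2 : (2 + `|y|) * unit_jump v x <= (2 + B) * unit_jump v x.
    by rewrite ler_wpM2r ?unit_jump_ge0// lerD2l.
  split; apply: le_trans le2; apply: norm_unit_le.
  - rewrite (le_trans (ler_normB _ _))// normr1 -[2]/(1 + 1 : R) lerD2r; exact: norm_cos_le1.
  - exact: cosB1_le.
  - by rewrite (le_trans (norm_sin_le1 _))// ler1n.
  - exact: norm_sin_le.
have [a1 a2] := T (v1 N) _ xB; have [b1 b2] := T (v2 N) _ xB'.
move: a1 a2 b1 b2; set a := xi * _; set b := xi' * _; set U1 := (2 + B) * _; set U2 := (2 + B) * _ => a1 a2 b1 b2.
rewrite -mulrA mulrDr -/U1 -/U2 cosD sinD.
have ca := norm_cos_le1 a; have sa := norm_sin_le1 a.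
have U10 : 0 <= U1 by exact: le_trans (normr_ge0 _) a1.
have U20 : 0 <= U2 by exact: le_trans (normr_ge0 _) b1.
have fin (z : R) : z <= U1 + (U2 + U2) -> z <= 2 * (U1 + U2).
  by move=> h; apply: (le_trans h); rewrite mulrDr ![2 * _]mulr_natl !mulr2n; lra.
split; apply: fin.
  rewrite (_ : _ - 1 = (cos a - 1) + (cos a * (cos b - 1) - sin a * sin b)); last by ring.
  apply: le_trans (ler_normD _ _) _; apply: lerD => //.
  apply: le_trans (ler_normB _ _) _; rewrite !normrM; apply: lerD.
    by apply: le_trans b1; rewrite ler_piMl.
  by apply: le_trans b2; rewrite ler_piMl.
apply: le_trans (ler_normD _ _) _; rewrite !normrM.
have h1 : `|sin a| * `|cos b| <= U1 by apply: le_trans a2; rewrite ler_piMr// norm_cos_le1.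
have h2 : `|cos a| * `|sin b| <= U2 by apply: le_trans b2; rewrite ler_piMl.
by apply: (le_trans (lerD h1 h2)); rewrite lerD2l lerDl.
Qed.

Definition phase_eps (B C : R) N := 16 * (2 + B) ^+ 2 * (C *
  ((\int[pi]_x unit_jump (v1 N) x)%R ^+ 2 + (\int[pi]_x unit_jump (v2 N) x)%R ^+ 2)).

(** The constants are uniform over frequencies bounded by [B], since the frequency will change from
    one block of time to the next. *)
Lemma phase_small B : 0 <= B -> exists C C', [/\ 0 <= C, 0 <= C' & forall N xi xi', `|xi| <= B -> `|xi'| <= B ->
  small_phase P pi (phase_eps B C N) (C' / K N) (phase N xi xi')].
Proof.
move=> B0; have [C1 HC1] := heavy_unit_sqr K1 H1; have [C2 HC2] := heavy_unit_sqr K1 H2.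
have C10 : 0 <= C1.
  by apply: le_trans (HC1 0%N); apply: mulr_ge0; [exact: ltW|exact: q_ge0].
have C20 : 0 <= C2.
  by apply: le_trans (HC2 0%N); apply: mulr_ge0; [exact: ltW|exact: q_ge0].
have [D1 D10 HD1] := heavy_dom H1; have [D2 D20 HD2] := heavy_dom H2.
exists (D1 + D2), (16 * (2 + B) ^+ 2 * (C1 + C2)); split.
- exact: addr_ge0.
- by apply: mulr_ge0; [apply: mulr_ge0 => //; exact: sqr_ge0|exact: addr_ge0].
move=> N xi xi' xB xB'; have mph := measurable_phase N xi xi'.
set th := phase N xi xi' in mph *.
have u1 := bdd_unit_jump (mv1 N); have u2 := bdd_unit_jump (mv2 N).
have bc : bdd_meas (fun x => cos (th x) - 1) by bdd.
have bs : bdd_meas (fun x => sin (th x)) by bdd.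
have bcc : bdd_meas (fun x => cos (th x)) by bdd.
have b1 : bdd_meas (fun _ : E => (1 : R)) by bdd.
have bu := bdd_measD u1 u2; have bBu := bdd_measZ (2 * (2 + B)) bu.
have A0 : 0 <= 2 * (2 + B) by rewrite mulr_ge0// addr_ge0.
have PU f : bdd_meas f -> (forall x, `|f x| <= 2 * (2 + B) * (unit_jump (v1 N) x + unit_jump (v2 N) x)) ->
    q (Pop P f) <= 8 * (2 + B) ^+ 2 * ((D1 + D2) * ((\int[pi]_x unit_jump (v1 N) x)%R ^+ 2 + (\int[pi]_x unit_jump (v2 N) x)%R ^+ 2)) /\
    q f <= 8 * (2 + B) ^+ 2 * ((C1 + C2) / K N).
  move=> bf fU.
  have p1 := bdd_meas_Pop P u1; have p2 := bdd_meas_Pop P u2.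
  have pp1 := bdd_meas_sqr p1; have pp2 := bdd_meas_sqr p2.
  have uu1 := bdd_meas_sqr u1; have uu2 := bdd_meas_sqr u2.
  have pw x : `|Pop P f x| <= 2 * (2 + B) * (Pop P (unit_jump (v1 N)) x + Pop P (unit_jump (v2 N)) x).
    have E1 := congr1 (fun f => f x) (PopD P u1 u2); have E2 := congr1 (fun f => f x) (PopZ P (2 * (2 + B)) bu).
    rewrite -E1 -E2 ler_norml; apply/andP; split.
      have E3 := congr1 (fun f => f x) (PopZ P (-1) bBu).
      rewrite -[leLHS]mulN1r -E3; apply: le_Pop => //; first exact: bdd_measZ.
      by move=> y; rewrite mulN1r; have := fU y; rewrite ler_norml => /andP[].
    by apply: le_Pop => // y; have := fU y; rewrite ler_norml => /andP[].
  have sq (z a b : R) : 0 <= a -> 0 <= b -> `|z| <= 2 * (2 + B) * (a + b) ->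
      z ^+ 2 <= 8 * (2 + B) ^+ 2 * (a ^+ 2 + b ^+ 2).
    move=> a0 b0 zab; rewrite -real_normK ?num_real//.
    apply: (@le_trans _ _ ((2 * (2 + B) * (a + b)) ^+ 2)).
      by rewrite lerXn2r ?nnegrE// mulr_ge0// addr_ge0.
    rewrite exprMn (_ : 8 * (2 + B) ^+ 2 * (a ^+ 2 + b ^+ 2) = (2 * (2 + B)) ^+ 2 * (2 * a ^+ 2 + 2 * b ^+ 2)).
      by apply: ler_wpM2l; [exact: sqr_ge0|exact: sqrD_le2].
    ring.
  have P0 (v : E -> R) (x : E) : measurable_fun setT v -> 0 <= Pop P (unit_jump v) x.
    by move=> mv; rewrite Pop_kernel_prob; apply: Ex_ge0 => y; exact: unit_jump_ge0.
  have c8 : 0 <= 8 * (2 + B) ^+ 2 by rewrite mulr_ge0 ?sqr_ge0.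
  split.
    have h := le_Ex pi (bdd_meas_sqr (bdd_meas_Pop P bf)) (bdd_measZ (8 * (2 + B) ^+ 2) (bdd_measD pp1 pp2))
      (fun x => sq _ _ _ (P0 _ x (mv1 N)) (P0 _ x (mv2 N)) (pw x)).
    apply: (le_trans h); rewrite (ExZ pi _ (bdd_measD pp1 pp2)) (ExD pi pp1 pp2).
    apply: ler_wpM2l => //; have [HD1' _] := HD1 N; have [HD2' _] := HD2 N.
    apply: (le_trans (lerD HD1' HD2')); rewrite mulrDl; apply: lerD.
      by rewrite mulrDr lerDl mulr_ge0 ?sqr_ge0.
    by rewrite mulrDr lerDr mulr_ge0 ?sqr_ge0.
  have h := le_Ex pi (bdd_meas_sqr bf) (bdd_measZ (8 * (2 + B) ^+ 2) (bdd_measD uu1 uu2))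
      (fun x => sq _ _ _ (unit_jump_ge0 _ _) (unit_jump_ge0 _ _) (fU x)).
  apply: (le_trans h); rewrite (ExZ pi _ (bdd_measD uu1 uu2)) (ExD pi uu1 uu2).
  apply: ler_wpM2l => //; rewrite ler_pdivlMr// mulrC mulrDr; exact: lerD.
have [pc qc] := PU _ bc (fun x => (phase_unit_le N x xB xB').1).
have [ps qs] := PU _ bs (fun x => (phase_unit_le N x xB xB').2).
have cen f : bdd_meas f -> q (fun x => Pop P f x - (\int[pi]_y f y)%R) <= q (Pop P f).
  by move=> bf; rewrite -(Ex_Pop hinv bf); apply: q_center; exact: bdd_meas_Pop.
split=> //.
  rewrite /phase_eps (_ : 16 * (2 + B) ^+ 2 = 8 * (2 + B) ^+ 2 + 8 * (2 + B) ^+ 2); last by ring.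
  rewrite mulrDl; apply: lerD.
    apply: le_trans pc; apply: le_trans (cen _ bc); rewrite le_eqVlt; apply/orP; left; apply/eqP.
    apply: eq_Rintegral => x _; rewrite (ExB pi bcc b1) Ex_cst.
    have /(congr1 (fun f => f x)) /= -> := PopB P bcc b1; rewrite Pop_cst; congr (_ ^+ 2); ring.
  by apply: le_trans ps; exact: cen.
rewrite (_ : 16 * (2 + B) ^+ 2 * (C1 + C2) / K N = 8 * (2 + B) ^+ 2 * ((C1 + C2) / K N) + 8 * (2 + B) ^+ 2 * ((C1 + C2) / K N)); last by ring.
exact: lerD.
Qed.

Lemma phase_eps_cvg0 B C : K N * phase_eps B C N @[N --> \oo] --> (0 : R).
Proof.
have := cvg0Ml (16 * (2 + B) ^+ 2 * C) (cvg0D (heavy_min H1) (heavy_min H2)).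
by apply: cvg_trans; apply: near_eq_cvg; apply: nearW => N; rewrite /phase_eps; ring.
Qed.

(** [e^(i(a+b)) - 1] is the sum of [e^(ia) - 1], [e^(ib) - 1] and their product. The product is
    negligible by [cross_cvg0], so the exponents add and the two limit coordinates are
    independent. *)
Lemma phase_charfun xi xi' : ccvg (fun N => (K N)%:C%C * (Exi pi (phase N xi xi') - 1) -
    (0 +i* (xi * w1 N + xi' * w2 N))%C) (psi1 xi + psi2 xi').
Proof.
pose B := `|xi| + `|xi'|; have xB : `|xi| <= B by rewrite lerDl.
have xB' : `|xi'| <= B by rewrite lerDr.
have T (v : E -> R) y x : `|y| <= B -> `|cos (y * v x) - 1| <= (2 + B) * unit_jump v x /\
    `|sin (y * v x)| <= (2 + B) * unit_jump v x.
  move=> yB; have le2 : (2 + `|y|) * unit_jump v x <= (2 + B) * unit_jump v x.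
    by rewrite ler_wpM2r ?unit_jump_ge0// lerD2l.
  split; apply: le_trans le2; apply: norm_unit_le.
  - rewrite (le_trans (ler_normB _ _))// normr1 -[2]/(1 + 1 : R) lerD2r; exact: norm_cos_le1.
  - exact: cosB1_le.
  - by rewrite (le_trans (norm_sin_le1 _))// ler1n.
  - exact: norm_sin_le.
pose c1 N x := cos (xi * v1 N x); pose s1 N x := sin (xi * v1 N x).
pose c2 N x := cos (xi' * v2 N x); pose s2 N x := sin (xi' * v2 N x).
have bc1 N : bdd_meas (c1 N) by apply: bdd_meas_cos; exact: measurable_funM.
have bs1 N : bdd_meas (s1 N) by apply: bdd_meas_sin; exact: measurable_funM.
have bc2 N : bdd_meas (c2 N) by apply: bdd_meas_cos; exact: measurable_funM.
have bs2 N : bdd_meas (s2 N) by apply: bdd_meas_sin; exact: measurable_funM.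
have b1 : bdd_meas (fun _ : E => (1 : R)) by bdd.
have bd1 N : bdd_meas (fun x => c1 N x - 1) by bdd.
have bd2 N : bdd_meas (fun x => c2 N x - 1) by bdd.
have A0 : 0 <= 2 + B by rewrite !addr_ge0.
have small (f g : nat -> E -> R) : (forall N, bdd_meas (f N)) -> (forall N, bdd_meas (g N)) ->
    (forall N x, `|f N x| <= (2 + B) * unit_jump (v1 N) x) ->
    (forall N x, `|g N x| <= (2 + B) * unit_jump (v2 N) x) ->
    K N * (\int[pi]_x (f N x * g N x))%R @[N --> \oo] --> (0 : R).
  move=> bf bg fu gu; have H := cvg0Ml ((2 + B) ^+ 2) cross_cvg0.
  apply/cvgrPdist_le => e e0; move: H => /cvgrPdist_le/(_ _ e0); apply: filterS => N.
  rewrite !sub0r !normrN => hh.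
  have uu := bdd_measM (bdd_unit_jump (mv1 N)) (bdd_unit_jump (mv2 N)).
  have bfg := bdd_measM (bf N) (bg N).
  have I0 : 0 <= (\int[pi]_x (unit_jump (v1 N) x * unit_jump (v2 N) x))%R.
    by apply: Ex_ge0 => x; rewrite mulr_ge0// unit_jump_ge0.
  have pw x : `|f N x * g N x| <= (2 + B) ^+ 2 * (unit_jump (v1 N) x * unit_jump (v2 N) x).
    rewrite normrM (_ : _ ^+ 2 * _ = (2 + B) * unit_jump (v1 N) x * ((2 + B) * unit_jump (v2 N) x)); last by ring.
    exact: ler_pM.
  have R0 : 0 <= (2 + B) ^+ 2 * (K N * (\int[pi]_x (unit_jump (v1 N) x * unit_jump (v2 N) x))%R).
    by apply: mulr_ge0; [exact: sqr_ge0|apply: mulr_ge0 => //; exact: ltW].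
  rewrite (ger0_norm R0) in hh; apply: le_trans hh; rewrite normrM (gtr0_norm (K0 N)) mulrCA; apply: ler_wpM2l; first exact: ltW.
  rewrite -ExZ//; have bz := bdd_measZ ((2 + B) ^+ 2) uu.
  rewrite ler_norml; apply/andP; split.
    rewrite -[leLHS]mulN1r -(ExZ pi _ bz); apply: le_Ex => //; first exact: bdd_measZ.
    by move=> x; rewrite mulN1r; have := pw x; rewrite ler_norml => /andP[].
  by apply: le_Ex => // x; have := pw x; rewrite ler_norml => /andP[].
have z1 := small (fun N x => c1 N x - 1) (fun N x => c2 N x - 1) bd1 bd2
  (fun N x => (T (v1 N) xi x xB).1) (fun N x => (T (v2 N) xi' x xB').1).
have z2 := small s1 s2 bs1 bs2
  (fun N x => (T (v1 N) xi x xB).2) (fun N x => (T (v2 N) xi' x xB').2).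
have z3 := small s1 (fun N x => c2 N x - 1) bs1 bd2
  (fun N x => (T (v1 N) xi x xB).2) (fun N x => (T (v2 N) xi' x xB').1).
have z4 := small (fun N x => c1 N x - 1) s2 bd1 bs2
  (fun N x => (T (v1 N) xi x xB).1) (fun N x => (T (v2 N) xi' x xB').2).
have ReD (x y : R[i]) : complex.Re (x + y) = complex.Re x + complex.Re y.
  by case: x y => a b [a' b'].
have ImD (x y : R[i]) : complex.Im (x + y) = complex.Im x + complex.Im y.
  by case: x y => a b [a' b'].
split.
  rewrite ReD (_ : (fun N => _) = (fun N => (K N * ((\int[pi]_x c1 N x)%R - 1) + K N * ((\int[pi]_x c2 N x)%R - 1)) +
     (K N * (\int[pi]_x ((c1 N x - 1) * (c2 N x - 1)))%R - K N * (\int[pi]_x (s1 N x * s2 N x))%R))).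
    rewrite -[X in _ --> X]addr0; apply: cvgD; last first.
      by rewrite -[X in _ --> X](subrr (0 : R)); exact: cvgB.
    by apply: cvgD; [exact: (heavy_cos H1)|exact: (heavy_cos H2)].
  apply/funext => N; rewrite /= !mul0r !subr0.
  have -> : (\int[pi]_x cos (phase N xi xi' x))%R =
    (\int[pi]_x (c1 N x + c2 N x - 1 + (c1 N x - 1) * (c2 N x - 1) - s1 N x * s2 N x))%R.
    by apply: eq_Rintegral => x _; rewrite /phase cosD -/(c1 N x) -/(c2 N x) -/(s1 N x) -/(s2 N x); ring.
  have y1 := bdd_measM (bd1 N) (bd2 N); have y2 := bdd_measM (bs1 N) (bs2 N).
  have y3 := bdd_measD (bc1 N) (bc2 N); have y4 := bdd_measB y3 b1; have y5 := bdd_measD y4 y1.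
  rewrite (ExB pi y5 y2) (ExD pi y4 y1) (ExB pi y3 b1) (ExD pi (bc1 N) (bc2 N)) Ex_cst; ring.
rewrite ImD (_ : (fun N => _) = (fun N => (K N * (\int[pi]_x s1 N x)%R - xi * w1 N + (K N * (\int[pi]_x s2 N x)%R - xi' * w2 N)) +
   (K N * (\int[pi]_x (s1 N x * (c2 N x - 1)))%R + K N * (\int[pi]_x ((c1 N x - 1) * s2 N x))%R))).
  rewrite -[X in _ --> X]addr0; apply: cvgD; last exact: cvg0D.
  by apply: cvgD; [exact: (heavy_sin H1)|exact: (heavy_sin H2)].
apply/funext => N; rewrite /= !mul0r !subr0 addr0.
have -> : (\int[pi]_x sin (phase N xi xi' x))%R =
  (\int[pi]_x (s1 N x + s2 N x + s1 N x * (c2 N x - 1) + (c1 N x - 1) * s2 N x))%R.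
  by apply: eq_Rintegral => x _; rewrite /phase sinD -/(c1 N x) -/(c2 N x) -/(s1 N x) -/(s2 N x); ring.
have y1 := bdd_measM (bs1 N) (bd2 N); have y2 := bdd_measM (bd1 N) (bs2 N).
have y3 := bdd_measD (bs1 N) (bs2 N); have y4 := bdd_measD y3 y1.
rewrite (ExD pi y4 y2) (ExD pi y3 y1) (ExD pi (bs1 N) (bs2 N)); ring.
Qed.

End phases.

Lemma sum_lt_ord m p : (\sum_(j < m) (j < p)%N)%N = minn m p.
Proof.
elim: m => [|m IH]; first by rewrite big_ord0 min0n.
rewrite big_ord_recr/= IH; have [mp|pm] := ltnP m p.
  by rewrite (minn_idPl mp) addn1.
by rewrite (minn_idPr (leqW pm)) addn0.
Qed.

Lemma Exi_shift {d} {T : measurableType d} {R : realType} (mu : probability T R) (f : T -> R) (c : R) :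
  measurable_fun setT f -> Exi mu (fun x => f x + c) = Exi mu f * expi c.
Proof.
move=> mf; have bc := bdd_meas_cos mf; have bs := bdd_meas_sin mf.
have z1 := bdd_measZ (cos c) bc; have z2 := bdd_measZ (sin c) bs.
have z3 := bdd_measZ (cos c) bs; have z4 := bdd_measZ (sin c) bc.
have E1 : (\int[mu]_x cos (f x + c))%R = cos c * (\int[mu]_x cos (f x))%R - sin c * (\int[mu]_x sin (f x))%R.
  rewrite -(ExZ mu _ bc) -(ExZ mu _ bs) -(ExB mu z1 z2); apply: eq_Rintegral => x _.
  by rewrite cosD; ring.
have E2 : (\int[mu]_x sin (f x + c))%R = cos c * (\int[mu]_x sin (f x))%R + sin c * (\int[mu]_x cos (f x))%R.
  rewrite -(ExZ mu _ bc) -(ExZ mu _ bs) -(ExD mu z3 z4); apply: eq_Rintegral => x _.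
  by rewrite sinD; ring.
by rewrite /Exi E1 E2; apply/eqP; rewrite eq_complex/=; apply/andP; split; apply/eqP; ring.
Qed.

(** * Increments of the chain over a time grid *)

Section chain_increments.
Context {R : realType} {d : measure_display} {E : measurableType d}
  {d'} {Om : measurableType d'} {Pr : probability Om R}.
Variables (P : R.-pker E ~> E) (pi : probability E R) (X : nat -> {RV Pr >-> E}).
Hypothesis hchain : markov_chain P X.
Hypothesis hlaw : forall B, measurable B -> distribution Pr (X 0%N) B = pi B.
Hypothesis hinv : invariant_law P pi.
Variable k : R.
Hypothesis k01 : 0 < k < 1.
Local Notation q f := (\int[pi]_x (f x ^+ 2))%R.
Hypothesis hgap : forall f : E -> R, bdd_meas f -> (\int[pi]_x f x = 0)%R ->
  q (Pop P f) <= k * q f.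
Variable K : nat -> R.
Hypothesis K1 : forall N, 1 <= K N.
Hypothesis KN : K N @[N --> \oo] --> +oo%R.

Let K0 N : 0 < K N.
Proof. exact: lt_le_trans (K1 N). Qed.

Lemma measurable_centered_sum (v : E -> R) (Kr w r : R) : measurable_fun setT v ->
  measurable_fun setT (fun om => centered_sum X v Kr w om r).
Proof.
move=> mv; apply: measurable_funB => //; apply: measurable_sum => i.
exact: (measurableT_comp mv (measurable_funP (X i))).
Qed.

Lemma centered_sumB (v : E -> R) (Kr w : R) om r s : 0 <= Kr -> 0 <= r -> r <= s ->
  centered_sum X v Kr w om s - centered_sum X v Kr w om r =
  \sum_(steps Kr r <= i < steps Kr s) v (X i om) - w * (s - r).
Proof.
move=> Kr0 r0 rs; have sab := steps_mono Kr0 r0 rs.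
rewrite /centered_sum -!(big_mkord xpredT (fun i => v (X i om))) (@big_cat_nat _ _ _ (steps Kr r) 0%N)//=.
ring.
Qed.

Section one_component.
Variables (v : nat -> E -> R) (w : nat -> R) (psi : R -> R[i]).
Hypothesis H : heavy P pi v K w psi.

(** The level [del] is chosen so high that a jump above it up to time [T] is unlikely; without such
    a jump [increment_bound] applies with constants that do not depend on [N]. *)
Lemma increments_tight h j eps : 0 < h -> 0 < eps -> exists2 L, 0 < L & forall N,
  fine (Pr [set om | L <= `|centered_sum X (v N) (K N) (w N) om (h * j.+1%:R) -
                            centered_sum X (v N) (K N) (w N) om (h * j%:R)|]) <= eps.
Proof.
move=> h0 eps0; pose T := h * j.+1%:R; have T0 : 0 <= T by rewrite mulr_ge0// ltW.
have e1 : 0 < eps / 2 / (T + 1) by rewrite !divr_gt0// ltr_wpDl.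
have [del del0 Hdel] := heavy_decay H e1.
have [C HC] := heavy_unit_sqr K1 H; have [C' HC'] := heavy_drift H del0.
pose Q := (1 + del ^+ 2) * C.
have HQ N : K N * q (small_jump (v N) del) <= Q.
  have mv := heavy_meas H N.
  have bu := bdd_meas_sqr (bdd_unit_jump mv).
  apply: (@le_trans _ _ ((1 + del ^+ 2) * (K N * q (unit_jump (v N))))); last first.
    by apply: ler_wpM2l => //; rewrite addr_ge0// sqr_ge0.
  rewrite mulrCA; apply: ler_wpM2l; first exact: ltW.
  rewrite -ExZ//; apply: le_Ex; [exact/bdd_meas_sqr/bdd_small_jump|exact: bdd_measZ|move=> x].
  rewrite /small_jump /unit_jump indicE; have [/set_mem/= hx|_] := boolP (x \in _); last first.
    by rewrite mulr0 expr0n/= mulr_ge0 ?sqr_ge0// addr_ge0// sqr_ge0.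
  rewrite mulr1 -[leLHS]real_normK ?num_real//; have [hu|hu] := leP 1 `|v N x|.
    rewrite expr1n mulr1; apply: (@le_trans _ _ (del ^+ 2)); last by rewrite lerDr.
    by rewrite lerXn2r ?nnegrE// ltW.
  by rewrite ler_peMl ?sqr_ge0// lerDl sqr_ge0.
have Q0 : 0 <= Q by apply: le_trans (HQ 0%N); apply: mulr_ge0; [exact: ltW|exact: q_ge0].
have C'0 : 0 <= C' by apply: le_trans (HC' 0%N).
have g0 := gap_const_ge0 k01.
have fc0 : 0 <= fluct_const k by apply: mulr_ge0 => //; apply: addr_ge0 => //; exact: mulr_ge0.
pose F := fluct_const k * (T + 2) * Q.
have F0 : 0 <= F by apply: mulr_ge0 => //; apply: mulr_ge0 => //; exact: addr_ge0.
pose e0 := 1 + F / (eps / 2).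
have e2 : 0 < eps / 2 by rewrite divr_gt0.
have e01 : 1 <= e0 by rewrite lerDl divr_ge0// ltW.
have e00 : 0 < e0 by exact: lt_le_trans e01.
have FQ : F / e0 ^+ 2 <= eps / 2.
  rewrite ler_pdivrMr ?exprn_gt0//; apply: (@le_trans _ _ (eps / 2 * e0)).
    by rewrite /e0 mulrDr mulr1 mulrCA divff ?gt_eqF// mulr1 lerDr ltW.
  by apply: ler_wpM2l; [exact: ltW|rewrite expr2 ler_peMl// ltW].
have L0 : 0 <= Num.sqrt Q + T * C' by apply: addr_ge0; [exact: sqrtr_ge0|exact: mulr_ge0].
exists (2 * e0 + (Num.sqrt Q + T * C')).
  by apply: ltr_wpDr => //; rewrite mulr_gt0.
move=> N; have mv := heavy_meas H N.
have [A [mA PA] HA] := increment_bound hchain hlaw hinv k01 hgap mv (K1 N) T0 e00 (HQ N) (HC' N).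
have mJ : measurable [set x | del <= `|v N x|] by exact: measurable_norm_ge.
have [A4 [mA4 PA4] HA4] := early_visit hchain hlaw hinv (steps (K N) T) mJ.
have KN0 := ltW (K0 N); have /andP[D1 _] := stepsP KN0 T0.
have m1 := measurable_centered_sum (K N) (w N) (h * j.+1%:R) mv.
have m2 := measurable_centered_sum (K N) (w N) (h * j%:R) mv.
have mI := measurable_norm_ge (2 * e0 + (Num.sqrt Q + T * C')) (measurable_funB m1 m2).
apply: (@le_trans _ _ (fine (Pr (A `|` A4)))).
  have mU : measurable (A `|` A4) by exact: measurableU.
  apply: fine_le; rewrite ?fin_num_measure//; apply: le_measure; rewrite ?inE//.
  move=> om /= hL; apply: contrapT => nA.
  have nA1 : ~ A om by move=> ?; apply: nA; left.
  have nA4 : ~ A4 om by move=> ?; apply: nA; right.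
  have hj0 : 0 <= h * j%:R by rewrite mulr_ge0// ltW.
  have hjj : h * j%:R <= T by rewrite /T ler_pM2l// ler_nat.
  have := HA om nA1 _ _ hj0 hjj (lexx T).
  have small i : (steps (K N) (h * j%:R) <= i < steps (K N) T)%N -> `|v N (X i om)| <= del.
    move=> /andP[_ iT]; rewrite leNgt; apply/negP => hv; apply: (HA4 om nA4 i iT).
    exact: ltW.
  move=> /(_ small); apply/negP; rewrite -leNgt; apply: le_trans hL.
  rewrite -addrA; do 2 apply: lerD => //; apply: ler_wpM2r => //.
  by rewrite gerBl.
apply: le_trans (prob_setU_le Pr mA mA4) _; rewrite [eps]splitr; apply: lerD.
  exact: le_trans PA FQ.
apply: le_trans PA4 _.
apply: (@le_trans _ _ (T * (K N * fine (pi [set x | del <= `|v N x|])))).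
  by rewrite mulrA [T * _]mulrC; apply: ler_wpM2r => //; exact: fine_ge0.
apply: (@le_trans _ _ (T * (eps / 2 / (T + 1)))); first exact: ler_wpM2l.
by rewrite mulrCA ler_piMr ?(ltW e2)// ler_pdivrMr ?ltr_wpDl// mul1r lerDl.
Qed.

End one_component.

Variables (v1 v2 : nat -> E -> R) (w1 w2 : nat -> R) (psi1 psi2 : R -> R[i]).
Hypothesis H1 : heavy P pi v1 K w1 psi1.
Hypothesis H2 : heavy P pi v2 K w2 psi2.
Hypothesis joint : forall del, 0 < del ->
  K N * fine (pi [set x | del <= `|v1 N x| /\ del <= `|v2 N x|]) @[N --> \oo] --> (0 : R).
Variables (h : R) (m : nat) (a b : nat -> R).
Hypothesis h0 : 0 < h.

Definition increment (v : nat -> E -> R) (w : nat -> R) N om j :=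
  centered_sum X (v N) (K N) (w N) om (h * j.+1%:R) -
  centered_sum X (v N) (K N) (w N) om (h * j%:R).

Let J N j := steps (K N) (h * j%:R).

Let J_mono N i j : (i <= j)%N -> (J N i <= J N j)%N.
Proof.
move=> ij; apply: steps_mono; rewrite ?(ltW (K0 N))//.
  by rewrite mulr_ge0// ltW.
by rewrite ler_pM2l// ler_nat.
Qed.

(** Counts the block ends already passed. This gives the block of [i], and the value [m] beyond the
    last one, so that a phase is defined at every index. *)
Let block N i := (\sum_(j < m) (J N j.+1 <= i)%N)%N.

Let blockE N i p : (p < m)%N -> (J N p <= i < J N p.+1)%N -> block N i = p.
Proof.
move=> pm /andP[pi1 pi2]; rewrite /block -[RHS](minn_idPr (ltnW pm)) -sum_lt_ord.
apply: eq_bigr => j _; congr nat_of_bool; apply/idP/idP => hj.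
  by rewrite ltnNge; apply/negP => pj; have := leq_trans (J_mono N (_ : p.+1 <= j.+1)%N) hj;
    rewrite ltnS => /(_ pj); rewrite leqNgt pi2.
exact: leq_trans (J_mono N hj) pi1.
Qed.

Let block_le N i : (block N i < m.+1)%N.
Proof.
rewrite ltnS /block -[leqRHS]card_ord -sum1_card; apply: leq_sum => j _.
exact: leq_b1.
Qed.

Let th N i := phase v1 v2 N (a (block N i)) (b (block N i)).

Let B := \sum_(j < m.+1) (`|a j| + `|b j|).

Let bound N i : `|a (block N i)| <= B /\ `|b (block N i)| <= B.
Proof.
have S0 : 0 <= \sum_(j < m.+1 | j != Ordinal (block_le N i)) (`|a j| + `|b j|).
  by apply: sumr_ge0 => j _; exact: addr_ge0.
rewrite /B (bigD1 (Ordinal (block_le N i)))//=; split.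
  by rewrite -addrA lerDl addr_ge0.
by rewrite addrAC lerDr addr_ge0.
Qed.

Let W N := \sum_(j < m) (a j * w1 N + b j * w2 N).

Let sumE N om : \sum_(j < m) (a j * increment v1 w1 N om j + b j * increment v2 w2 N om j) =
  phase_sum X (th N) (J N m) om + - (h * W N).
Proof.
have E1 p : (p <= m)%N -> \sum_(j < p) (a j * increment v1 w1 N om j + b j * increment v2 w2 N om j) =
    \sum_(0 <= i < J N p) th N i (X i om) - h * \sum_(j < p) (a j * w1 N + b j * w2 N).
  elim: p => [_|p IH pm].
    rewrite !big_ord0 mulr0 subr0 /J mulr0 /steps mulr0.
    by rewrite (_ : Num.truncn 0 = 0%N) ?big_geq//; exact: truncn0.
  rewrite !big_ord_recr/= (IH (ltnW pm)) (@big_cat_nat _ _ _ (J N p) 0%N _ _ _ (leq0n _) (J_mono N (leqnSn p)))/=.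
  have -> : \sum_(J N p <= i < J N p.+1) th N i (X i om) =
      a p * \sum_(J N p <= i < J N p.+1) v1 N (X i om) + b p * \sum_(J N p <= i < J N p.+1) v2 N (X i om).
    rewrite !mulr_sumr -big_split/=; apply: eq_big_nat => i hi.
    by rewrite /th (blockE pm hi).
  have hp0 : 0 <= h * p%:R by rewrite mulr_ge0// ltW.
  have hpp : h * p%:R <= h * p.+1%:R by rewrite ler_pM2l// ler_nat.
  rewrite /increment !(centered_sumB _ _ _ (ltW (K0 N)) hp0 hpp).
  rewrite (_ : h * p.+1%:R - h * p%:R = h); first by rewrite /J; ring.
  by rewrite -natr1; ring.
by rewrite (E1 m (leqnn m)) /phase_sum big_mkord.
Qed.

Let prodE N : \prod_(i < J N m) Exi pi (th N i) =
  \prod_(j < m) Exi pi (phase v1 v2 N (a j) (b j)) ^+ (J N j.+1 - J N j).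
Proof.
have E1 p : (p <= m)%N -> \prod_(0 <= i < J N p) Exi pi (th N i) =
   \prod_(j < p) Exi pi (phase v1 v2 N (a j) (b j)) ^+ (J N j.+1 - J N j).
  elim: p => [_|p IH pm].
    rewrite big_ord0 /J mulr0 /steps mulr0.
    by rewrite (_ : Num.truncn 0 = 0%N) ?big_geq//; exact: truncn0.
  rewrite big_ord_recr/= -(IH (ltnW pm)) (@big_cat_nat _ _ _ (J N p) 0%N _ _ _ (leq0n _) (J_mono N (leqnSn p)))/=.
  congr (_ * _); rewrite -prodr_const_nat; apply: eq_big_nat => i hi.
  by rewrite /th (blockE pm hi).
by rewrite -(E1 m (leqnn m)) big_mkord.
Qed.

(** The linear form in the increments is a phase sum whose frequency is constant on each block. The
    product approximation therefore yields powers of one-step characteristic functions, one for each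
    block, and [power_limit] applies to each. *)
Lemma increments_charfun :
  ccvg (fun N => Exi Pr (fun om => \sum_(j < m) (a j * increment v1 w1 N om j + b j * increment v2 w2 N om j)))
   (\prod_(j < m) cexp (h%:C%C * (psi1 (a j) + psi2 (b j)))).
Proof.
have B0 : 0 <= B by apply: sumr_ge0 => j _; exact: addr_ge0.
have [C [C' [C0 C'0 Hs]]] := phase_small hinv K1 H1 H2 B0.
have g0 := gap_const_ge0 k01.
pose eps N := phase_eps pi v1 v2 B C N.
have eps0 N : 0 <= eps N.
  apply: mulr_ge0; first by apply: mulr_ge0 => //; exact: sqr_ge0.
  by apply: mulr_ge0 => //; apply: addr_ge0; exact: sqr_ge0.
have ss N i : small_phase P pi (eps N) (C' / K N) (th N i).
  by have [b1 b2] := bound N i; exact: Hs.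
have mth N i : measurable_fun setT (th N i) by case: (ss N i).
have mps N : measurable_fun setT (phase_sum X (th N) (J N m)).
  by apply: measurable_sum => i; exact: (measurableT_comp (mth N i) (measurable_funP (X i))).
have CK N : 0 <= C' / K N by rewrite divr_ge0// ltW.
have bnd N := charfun_product hinv k01 hgap (eps0 N) (CK N) hchain hlaw (J N m) (ss N).
have EE N : Exi Pr (fun om => \sum_(j < m) (a j * increment v1 w1 N om j + b j * increment v2 w2 N om j)) =
    Exi Pr (phase_sum X (th N) (J N m)) * expi (- (h * W N)).
  rewrite -Exi_shift//; congr Exi; apply/funext => om; exact: sumE.
have PE N : \prod_(j < m) (Exi pi (phase v1 v2 N (a j) (b j)) ^+ (J N j.+1 - J N j) *
     expi (- (h * (a j * w1 N + b j * w2 N)))) = \prod_(i < J N m) Exi pi (th N i) * expi (- (h * W N)).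
  rewrite big_split/= prodE; congr (_ * _); rewrite /W.
  elim: (m) => [|p IH]; first by rewrite !big_ord0 mulr0 oppr0 expi0.
  by rewrite !big_ord_recr/= IH -expiD; congr expi; ring.
under eq_fun do rewrite EE.
apply: (ccvg_close (v := fun N => \prod_(i < J N m) Exi pi (th N i) * expi (- (h * W N)))); last first.
  under eq_fun do rewrite -PE.
  apply: (ccvg_prod (U := fun N j => Exi pi (phase v1 v2 N (a j) (b j)) ^+ (J N j.+1 - J N j) *
     expi (- (h * (a j * w1 N + b j * w2 N)))) (l := fun j => cexp (h%:C%C * (psi1 (a j) + psi2 (b j))))) => j jm.
  apply: (power_limit (c := fun N => Exi pi (phase v1 v2 N (a j) (b j))) (K := K)
    (w := fun N => a j * w1 N + b j * w2 N) (n := fun N => (J N j.+1 - J N j)%N)) => //.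
  - by move=> N; apply: normc_Exi_le1; exact: (measurable_phase H1 H2).
  - have HW := cvg0D (cvg0Ml (2 * a j ^+ 2) (heavy_centering K1 KN H1))
                     (cvg0Ml (2 * b j ^+ 2) (heavy_centering K1 KN H2)).
    apply: (squeeze0 _ HW) => N; rewrite divr_ge0 ?sqr_ge0 ?(ltW (K0 N))//= ler_pdivrMr//.
    rewrite mulrDl -![_ * (_ / K N) * K N]mulrA !divfK ?gt_eqF//.
    by apply: le_trans (sqrD_le2 _ _) _; rewrite !exprMn !mulrA.
  - exact: (phase_charfun K1 H1 H2 joint).
  (* The length of a block is a difference of integer parts, hence within 1 of [h * K N]. *)
  - move=> N; have hj0 : 0 <= h * j%:R by rewrite mulr_ge0// ltW.
    have hj1 : 0 <= h * j.+1%:R by rewrite mulr_ge0// ltW.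
    have /andP[g1 g2] := stepsP (ltW (K0 N)) hj0; have /andP[g3 g4] := stepsP (ltW (K0 N)) hj1.
    rewrite natrB ?J_mono// ler_norml /J; move: g3 g4.
    rewrite -[in X in _ <= X -> _]natr1 -[in X in X < _ -> _]natr1 mulrDr mulr1 mulrDr.
    by rewrite [h * K N]mulrC => g3 g4; apply/andP; split; lra.
(* The total error of the product: at most [K h m] steps, each costing
   [2 sqrt (C' / K * gap_const * eps)]. It vanishes because [K * eps] does. *)
have up : 2 * h * m%:R * Num.sqrt (C' * gap_const k * (K N * eps N)) @[N --> \oo] --> (0 : R).
  apply: cvg0Ml; rewrite -(sqrtr0 R).
  apply: (cvg_comp (fun N => C' * gap_const k * (K N * eps N)) Num.sqrt); last exact: sqrt_continuous.
  by apply: cvg0Ml; exact: (phase_eps_cvg0 H1 H2).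
apply: (squeeze0 _ up) => N; rewrite normc_ge0/= -mulrBl normcM normc_expi mulr1.
apply: (le_trans (bnd N)).
have hm0 : 0 <= h * m%:R by rewrite mulr_ge0// ltW.
have /andP[g1 _] := stepsP (ltW (K0 N)) hm0.
apply: (@le_trans _ _ (K N * (h * m%:R) * (2 * Num.sqrt (C' / K N * (gap_const k * eps N))))).
  by apply: ler_wpM2r => //; rewrite mulr_ge0// sqrtr_ge0.
rewrite (_ : C' / K N * (gap_const k * eps N) = (K N)^-1 ^+ 2 * (C' * gap_const k * (K N * eps N))); last first.
  by field; rewrite gt_eqF.
rewrite sqrtrM ?sqr_ge0// sqrtr_sqr ger0_norm ?invr_ge0 ?(ltW (K0 N))//.
by rewrite le_eqVlt; apply/orP; left; apply/eqP; field; rewrite gt_eqF.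
Qed.

End chain_increments.

(** * Increments of the Levy process *)

Section independent_factors.
Context {d d'} {T : measurableType d} {U : measurableType d'} {R : realType}.
Variables (mu : probability T R) (D : nat -> T -> U) (n : nat).
Hypothesis mD : forall k, measurable_fun setT (D k).
Hypothesis indep : forall B : nat -> set U, (forall k, measurable (B k)) ->
  mu (\bigcap_(k < n) (D k @^-1` B k)) = (\prod_(k < n) mu (D k @^-1` B k))%E.

Let bD (g : U -> R) k : bdd_meas g -> bdd_meas (fun w => g (D k w)).
Proof. exact: bdd_meas_comp. Qed.

(** Indicators are replaced by bounded functions one index at a time, by induction on the number [j]
    of general factors, with [bdd_meas_ind] at index [j]. *)
Lemma indep_prod (g : nat -> U -> R) : (forall k, bdd_meas (g k)) ->
  (\int[mu]_w (\prod_(k < n) g k (D k w)))%R = \prod_(k < n) (\int[mu]_w g k (D k w))%R.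
Proof.
suff H j : (j <= n)%N -> forall g : nat -> U -> R, (forall k, bdd_meas (g k)) ->
    (forall k, (j <= k)%N -> exists2 B, measurable B & g k = \1_B) ->
    (\int[mu]_w (\prod_(k < n) g k (D k w)))%R = \prod_(k < n) (\int[mu]_w g k (D k w))%R.
  (* Beyond [n] the factors are set to the indicator of the whole space, as the auxiliary claim asks
     for indicators from [j] on. *)
  move=> bg; pose g' k := if (k < n)%N then g k else \1_setT.
  have := H n (leqnn n) g'; rewrite (eq_bigr (fun k : 'I_n => (\int[mu]_w g k (D k w))%R)).
    move=> <-.
    - by apply: eq_Rintegral => w _; apply: eq_bigr => k _; rewrite /g' ltn_ord.
    - by move=> k; rewrite /g'; case: ifPn => // _; exact: bdd_meas_indic.
    - by move=> k nk; exists setT => //; rewrite /g' ltnNge nk.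
  by move=> k _; rewrite /g' ltn_ord.
elim: j => [_|j IH jn] {}g bg ig.
  have /choice[B HB] k : exists B, measurable B /\ g k = \1_B.
    by have [B mB gB] := ig k (leq0n k); exists B.
  have mB k : measurable (B k) by case: (HB k).
  have mDB k : measurable (D k @^-1` B k) by rewrite -[X in measurable X]setTI; exact: mD.
  have gE k w : g k (D k w) = \1_(D k @^-1` B k) w by case: (HB k) => _ ->; rewrite !indicE.
  have mI : measurable (\bigcap_(k < n) (D k @^-1` B k)) by exact: bigcap_measurableType.
  have -> : (\int[mu]_w (\prod_(k < n) g k (D k w)))%R =
      (\int[mu]_w \1_(\bigcap_(k < n) (D k @^-1` B k)) w)%R.
    apply: eq_Rintegral => w _; rewrite indicE.
    have [/set_mem h|h] := boolP (w \in _).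
      by rewrite big1// => k _; rewrite gE indicE (mem_set (h k (ltn_ord k))).
    have : exists k, (k < n)%N /\ ~ B k (D k w).
      apply: contrapT => h2; move: h; rewrite notin_setE; apply => k kn.
      by apply: contrapT => h3; apply: h2; exists k.
    move=> [k [kn nB]]; rewrite (bigD1 (Ordinal kn))//= gE indicE memNset//; exact: mul0r.
  rewrite Ex_indic// indep//.
  rewrite (_ : (\prod_(k < n) mu (D k @^-1` B k))%E = (\prod_(k < n) fine (mu (D k @^-1` B k)))%:E).
    by rewrite /=; apply: eq_bigr => k _; rewrite -Ex_indic//; apply: eq_Rintegral => w _; rewrite gE.
  rewrite (big_morph EFin EFinM (erefl _)); apply: eq_bigr => k _.
  by rewrite fineK// fin_num_measure.
pose H w := \prod_(k < n | k != Ordinal jn) g k (D k w).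
have bH : bdd_meas H.
  rewrite (_ : H = (fun w => \prod_(k < n) (if k != Ordinal jn then g k (D k w) else 1))).
    apply: (@bdd_meas_prod _ _ _ _ _ (fun (k : 'I_n) w => if k != Ordinal jn then g k (D k w) else 1)) => k.
    by case: (k != _); [exact: bD|exact: bdd_meas_cst].
  by apply/funext => w; rewrite /H big_mkcond.
pose c := \prod_(k < n | k != Ordinal jn) (\int[mu]_w g k (D k w))%R.
have E1 (f : U -> R) : bdd_meas f -> (\int[mu]_w (f (D j w) * H w))%R = (\int[mu]_w f (D j w))%R * c.
  move: f; apply: (@bdd_meas_ind _ U R (fun f => (\int[mu]_w (f (D j w) * H w))%R = (\int[mu]_w f (D j w))%R * c)).
  - move=> A mA; pose g' k := if k == j then \1_A else g k.
    have kne (k : 'I_n) : k != Ordinal jn -> (k == j :> nat) = false.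
      by apply: contraNF => /eqP e; apply/eqP; exact: val_inj.
    have g'j : g' j = \1_A by rewrite /g' eqxx.
    have := IH (ltnW jn) g'.
    rewrite [X in _ -> _ -> _ = X](bigD1 (Ordinal jn))//= g'j.
    have -> : \prod_(k < n | k != Ordinal jn) (\int[mu]_w g' k (D k w))%R = c.
      by apply: eq_bigr => k kj; rewrite /g' kne.
    move=> <-.
    + apply: eq_Rintegral => w _; rewrite (bigD1 (Ordinal jn))//= g'j; congr (_ * _).
      by apply: eq_bigr => k kj; rewrite /g' kne.
    + by move=> k; rewrite /g'; case: ifPn => // _; exact: bdd_meas_indic.
    + move=> k; rewrite leq_eqVlt => /orP[/eqP <-|jk].
        by exists A => //; rewrite /g' eqxx.
      by have [B mB gB] := ig k jk; exists B => //; rewrite /g' gtn_eqF.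
  - move=> f f' bf bf' h1 h2; have b1 := bD j bf; have b2 := bD j bf'.
    under eq_Rintegral do rewrite mulrDl.
    by rewrite (ExD mu (bdd_measM b1 bH) (bdd_measM b2 bH)) (ExD mu b1 b2) mulrDl h1 h2.
  - move=> x f bf h1; have b1 := bD j bf.
    under eq_Rintegral do rewrite -mulrA.
    by rewrite (ExZ mu _ (bdd_measM b1 bH)) (ExZ mu _ b1) h1 mulrA.
  - move=> f bf happ; have b1 := bD j bf.
    have [M M0 HM] := bdd_meas_bounded bH.
    apply/eqP; rewrite -subr_eq0 -normr_eq0 eq_le normr_ge0 andbT.
    apply/ler_addgt0Pr => e e0; rewrite add0r.
    have Mc : 0 < M + `|c| + 1 by rewrite ltr_wpDl// addr_ge0.
    have e1 : 0 < e / (M + `|c| + 1) by rewrite divr_gt0.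
    have [f' [bf' h' ff']] := happ _ e1; have b2 := bD j bf'.
    have k1 := norm_ExB_le mu (bdd_measM b1 bH) (bdd_measM b2 bH) (c := e / (M + `|c| + 1) * M)
      (fun w => ltac:(by rewrite -mulrBl normrM; apply: ler_pM)).
    have k2 := norm_ExB_le mu b1 b2 (fun w => ff' (D j w)).
    rewrite (_ : _ - _ = ((\int[mu]_w (f (D j w) * H w))%R - (\int[mu]_w (f' (D j w) * H w))%R) -
      ((\int[mu]_w f (D j w))%R - (\int[mu]_w f' (D j w))%R) * c); last by rewrite h'; ring.
    apply: le_trans (ler_normB _ _) _; rewrite normrM.
    have k3 : `|(\int[mu]_w f (D j w))%R - (\int[mu]_w f' (D j w))%R| * `|c| <= e / (M + `|c| + 1) * `|c|.
      by apply: ler_wpM2r.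
    apply: le_trans (lerD k1 k3) _; rewrite -mulrDr mulrAC ler_pdivrMr//.
    by apply: ler_wpM2l; [exact: ltW|rewrite lerDl].
rewrite [RHS](bigD1 (Ordinal jn))//= -/c -(E1 _ (bg j)).
by apply: eq_Rintegral => w _; rewrite (bigD1 (Ordinal jn)).
Qed.

Variable th : nat -> U -> R.
Hypothesis mth : forall k, measurable_fun setT (th k).

Let A p w := \sum_(k < p) th k (D k w).

Let mA p : measurable_fun setT (A p).
Proof. by apply: measurable_sum => k; exact: (measurableT_comp (mth k) (mD k)). Qed.

Let tail g p w := \prod_(p <= k < n) g k (D k w) : R.

(** Independence of [F] from the variables of index at least [p], in product form; it is propagated
    for the cosine and the sine of the partial sums. *)
Let splits F p := forall g : nat -> U -> R, (forall k, bdd_meas (g k)) ->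
  (\int[mu]_w (F w * tail g p w))%R = (\int[mu]_w F w)%R * \prod_(p <= k < n) (\int[mu]_w g k (D k w))%R.

Let b_tail g p : (forall k, bdd_meas (g k)) -> bdd_meas (tail g p).
Proof.
by move=> bg; rewrite /tail; apply: bdd_meas_prod => k; exact: bD.
Qed.

Let step p : (p < n)%N -> splits (fun w => cos (A p w)) p -> splits (fun w => sin (A p w)) p ->
  [/\ splits (fun w => cos (A p.+1 w)) p.+1, splits (fun w => sin (A p.+1 w)) p.+1 &
   Exi mu (A p.+1) = Exi mu (A p) * Exi mu (fun w => th p (D p w))].
Proof.
move=> pn hc hs.
have bc : bdd_meas (fun u => cos (th p u)) by exact: bdd_meas_cos.
have bs : bdd_meas (fun u => sin (th p u)) by exact: bdd_meas_sin.
have bcA : bdd_meas (fun w => cos (A p w)) by exact: bdd_meas_cos.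
have bsA : bdd_meas (fun w => sin (A p w)) by exact: bdd_meas_sin.
have key (g : nat -> U -> R) (f : U -> R) F : (forall k, bdd_meas (g k)) -> bdd_meas f -> splits F p ->
    (\int[mu]_w (F w * f (D p w) * tail g p.+1 w))%R =
    (\int[mu]_w F w)%R * (\int[mu]_w f (D p w))%R * \prod_(p.+1 <= k < n) (\int[mu]_w g k (D k w))%R.
  move=> bg bf hF; pose g' k := if k == p then f else g k.
  have bg' k : bdd_meas (g' k) by rewrite /g'; case: ifPn.
  have gk k : (p.+1 <= k < n)%N -> g' k = g k.
    by move=> /andP[pk _]; rewrite /g' gtn_eqF.
  have := hF g' bg'; rewrite (big_ltn pn) {2}/g' eqxx mulrA.
  rewrite (eq_big_nat _ _ (F2 := fun k => (\int[mu]_w g k (D k w))%R)); last first.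
    by move=> k hk; rewrite gk.
  move=> <-; apply: eq_Rintegral => w _; rewrite -mulrA; congr (_ * _).
  rewrite /tail (big_ltn pn) {1}/g' eqxx; congr (_ * _).
  by apply: eq_big_nat => k hk; rewrite gk.
have bb (F : T -> R) f (g : nat -> U -> R) : bdd_meas F -> bdd_meas f -> (forall k, bdd_meas (g k)) ->
    bdd_meas (fun w => F w * f (D p w) * tail g p.+1 w).
  move=> bF bf bg; have b1 := bD p bf; have b2 := b_tail p.+1 bg.
  exact: bdd_measM (bdd_measM bF b1) b2.
have cE (g : nat -> U -> R) : (forall k, bdd_meas (g k)) ->
   (\int[mu]_w (cos (A p.+1 w) * tail g p.+1 w))%R =
   ((\int[mu]_w cos (A p w))%R * (\int[mu]_w cos (th p (D p w)))%R -
    (\int[mu]_w sin (A p w))%R * (\int[mu]_w sin (th p (D p w)))%R) *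
   \prod_(p.+1 <= k < n) (\int[mu]_w g k (D k w))%R.
  move=> bg; rewrite mulrBl -(key g _ _ bg bc hc) -(key g _ _ bg bs hs).
  rewrite -(ExB mu (bb _ _ _ bcA bc bg) (bb _ _ _ bsA bs bg)); apply: eq_Rintegral => w _.
  by rewrite /A big_ord_recr/= cosD; ring.
have sE (g : nat -> U -> R) : (forall k, bdd_meas (g k)) ->
   (\int[mu]_w (sin (A p.+1 w) * tail g p.+1 w))%R =
   ((\int[mu]_w sin (A p w))%R * (\int[mu]_w cos (th p (D p w)))%R +
    (\int[mu]_w cos (A p w))%R * (\int[mu]_w sin (th p (D p w)))%R) *
   \prod_(p.+1 <= k < n) (\int[mu]_w g k (D k w))%R.
  move=> bg; rewrite mulrDl -(key g _ _ bg bc hs) -(key g _ _ bg bs hc).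
  rewrite -(ExD mu (bb _ _ _ bsA bc bg) (bb _ _ _ bcA bs bg)); apply: eq_Rintegral => w _.
  by rewrite /A big_ord_recr/= sinD; ring.
have b1 (k : nat) : bdd_meas (fun _ : U => (1 : R)) by exact: bdd_meas_cst.
have t1 w : tail (fun _ _ => 1) p.+1 w = 1 by rewrite /tail big1.
have p1 : \prod_(p.+1 <= k < n) (\int[mu]_w (1 : R))%R = 1 by rewrite big1// => k _; exact: Ex_cst.
have c1 := cE _ b1; have s1 := sE _ b1; rewrite p1 mulr1 in c1; rewrite p1 mulr1 in s1.
have c2 : (\int[mu]_w cos (A p.+1 w))%R = (\int[mu]_w (cos (A p.+1 w) * tail (fun _ _ => 1) p.+1 w))%R.
  by apply: eq_Rintegral => w _; rewrite t1 mulr1.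
have s2 : (\int[mu]_w sin (A p.+1 w))%R = (\int[mu]_w (sin (A p.+1 w) * tail (fun _ _ => 1) p.+1 w))%R.
  by apply: eq_Rintegral => w _; rewrite t1 mulr1.
split.
- by move=> g bg; rewrite cE// c2 c1.
- by move=> g bg; rewrite sE// s2 s1.
- rewrite /Exi c2 s2 c1 s1; apply/eqP; rewrite eq_complex/=.
  by apply/andP; split; apply/eqP; ring.
Qed.

Lemma indep_Exi : Exi mu (fun w => \sum_(k < n) th k (D k w)) =
  \prod_(k < n) Exi mu (fun w => th k (D k w)).
Proof.
suff H p : (p <= n)%N -> [/\ splits (fun w => cos (A p w)) p, splits (fun w => sin (A p w)) p &
    Exi mu (A p) = \prod_(k < p) Exi mu (fun w => th k (D k w))].
  by have [_ _] := H n (leqnn n).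
elim: p => [_|p IH pn]; last first.
  have [hc hs he] := IH (ltnW pn); have [h1 h2 h3] := step pn hc hs.
  by split=> //; rewrite h3 he big_ord_recr.
have A0 w : A 0 w = 0 by rewrite /A big_ord0.
split.
- move=> g bg; have := indep_prod bg; rewrite -(big_mkord xpredT (fun k => (\int[mu]_w g k (D k w))%R)).
  rewrite (_ : (\int[mu]_w cos (A 0 w))%R = 1); last first.
    by under eq_Rintegral do rewrite A0 cos0; exact: Ex_cst.
  move=> E0; rewrite mul1r -[RHS]E0; apply: eq_Rintegral => w _.
  by rewrite A0 cos0 mul1r /tail big_mkord.
- move=> g bg; rewrite (_ : (\int[mu]_w sin (A 0 w))%R = 0); last first.
    by under eq_Rintegral do rewrite A0 sin0; exact: Ex_cst.
  by rewrite mul0r; under eq_Rintegral do rewrite A0 sin0 mul0r; exact: Ex_cst.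
- rewrite big_ord0 /Exi.
  under eq_Rintegral do rewrite A0 cos0.
  rewrite Ex_cst; under eq_Rintegral do rewrite A0 sin0.
  by rewrite Ex_cst.
Qed.

End independent_factors.

Lemma Ex_same_law {d d'} {T : measurableType d} {U : measurableType d'} {R : realType}
    (mu : probability T R) (X Y : T -> U) (f : U -> R) :
  measurable_fun setT X -> measurable_fun setT Y ->
  (forall B, measurable B -> mu (X @^-1` B) = mu (Y @^-1` B)) -> bdd_meas f ->
  (\int[mu]_w f (X w))%R = (\int[mu]_w f (Y w))%R.
Proof.
move=> mX mY XY; have bX (g : U -> R) : bdd_meas g -> bdd_meas (fun w => g (X w)) by exact: bdd_meas_comp.
have bY (g : U -> R) : bdd_meas g -> bdd_meas (fun w => g (Y w)) by exact: bdd_meas_comp.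
move: f; apply: (@bdd_meas_ind _ U R (fun f => (\int[mu]_w f (X w))%R = (\int[mu]_w f (Y w))%R)).
- move=> A mA.
  have mXA : measurable (X @^-1` A) by rewrite -[X in measurable X]setTI; exact: mX.
  have mYA : measurable (Y @^-1` A) by rewrite -[X in measurable X]setTI; exact: mY.
  transitivity (\int[mu]_w \1_(X @^-1` A) w)%R; first by apply: eq_Rintegral => w _; rewrite !indicE.
  rewrite Ex_indic// XY//; rewrite -(Ex_indic mu mYA).
  by apply: eq_Rintegral => w _; rewrite !indicE.
- by move=> f g bf bg h1 h2; rewrite (ExD mu (bX _ bf) (bX _ bg)) (ExD mu (bY _ bf) (bY _ bg)) h1 h2.
- by move=> c f bf h1; rewrite (ExZ mu _ (bX _ bf)) (ExZ mu _ (bY _ bf)) h1.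
- move=> f bf happ; apply/eqP; rewrite -subr_eq0 -normr_eq0 eq_le normr_ge0 andbT.
  apply/ler_addgt0Pr => e e0; rewrite add0r.
  have e2 : 0 < e / 2 by rewrite divr_gt0.
  have [g [bg hg fg]] := happ _ e2.
  have k1 := norm_ExB_le mu (bX _ bf) (bX _ bg) (fun w => fg (X w)).
  have k2 := norm_ExB_le mu (bY _ bf) (bY _ bg) (fun w => fg (Y w)).
  rewrite (_ : _ - _ = ((\int[mu]_w f (X w))%R - (\int[mu]_w g (X w))%R) -
    ((\int[mu]_w f (Y w))%R - (\int[mu]_w g (Y w))%R)); last by rewrite hg; ring.
  by rewrite (splitr e); apply: le_trans (ler_normB _ _) _; exact: lerD.
Qed.

Lemma Ex_ae {d} {T : measurableType d} {R : realType} (mu : probability T R) (f g : T -> R) :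
  bdd_meas f -> bdd_meas g -> {ae mu, forall w, f w = g w} ->
  (\int[mu]_w f w)%R = (\int[mu]_w g w)%R.
Proof.
move=> bf bg fg; rewrite /Rintegral; congr fine; apply: ae_eq_integral => //.
- by apply/measurable_EFinP; case: bf.
- by apply/measurable_EFinP; case: bg.
- by move: fg; apply: filterS => w fw _; rewrite /= fw.
Qed.

Section levy_increments.
Context {R : realType} {d} {Om : measurableType d} (Pr : probability Om R).
Variables (Z : Om -> skorokhod (R * R)%type) (psi : R -> R -> R[i]).
Hypothesis hlevy : levy_process Pr Z.
Hypothesis hexp : forall t x y : R, 0 <= t ->
  charfun2 Pr (fun w => Z w t) x y = cexp (t%:C%C * psi x y).
Variables (h : R) (m : nat) (a b : nat -> R).
Hypothesis h0 : 0 < h.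

Definition levy_increment j w : R * R := Z w (h * j.+1%:R) - Z w (h * j%:R).

Let hj0 j : 0 <= h * j%:R.
Proof. by rewrite mulr_ge0// ltW. Qed.

Lemma measurable_pairB {d'} {T : measurableType d'} (f g : T -> R * R) :
  measurable_fun setT f -> measurable_fun setT g -> measurable_fun setT (fun w => f w - g w).
Proof.
move=> mf mg; apply: (@measurable_fun_pair _ _ _ _ _ _ (fun w => (f w).1 - (g w).1) (fun w => (f w).2 - (g w).2)).
  by apply: measurable_funB; exact: measurableT_comp.
by apply: measurable_funB; exact: measurableT_comp.
Qed.

Lemma measurable_levy_increment j : measurable_fun setT (levy_increment j).
Proof. by apply: measurable_pairB; exact: (levy_measurable hlevy). Qed.

(** Stationarity moves the increment to the interval from 0 to [h], and the process starts at 0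
    almost surely. *)
Lemma levy_increment_charfun (x y : R) j :
  Exi Pr (fun w => x * (levy_increment j w).1 + y * (levy_increment j w).2) = cexp (h%:C%C * psi x y).
Proof.
rewrite -hexp; last exact: ltW.
pose L (u : R * R) := x * u.1 + y * u.2.
have mL : measurable_fun setT L by apply: measurable_funD; exact: measurable_funM.
have mZ t : 0 <= t -> measurable_fun setT (fun w => Z w t) by exact: (levy_measurable hlevy).
have mZ0 := mZ 0 (lexx 0); have mZh := mZ h (ltW h0).
have mD : measurable_fun setT (fun w => Z w h - Z w 0) by exact: measurable_pairB.
have st B : measurable B -> Pr (levy_increment j @^-1` B) = Pr ((fun w => Z w h - Z w 0) @^-1` B).
  move=> mB; rewrite -[RHS](levy_stationary hlevy (hj0 j) (ltW h0) mB); congr (Pr _).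
  apply/seteqP; split=> w /=; rewrite /levy_increment -natr1 mulrDr mulr1; exact.
have K (f : R -> R) : bdd_meas (fun u => f (L u)) ->
    (\int[Pr]_w f (L (levy_increment j w)))%R = (\int[Pr]_w f (L (Z w h)))%R.
  move=> bf; rewrite (Ex_same_law (measurable_levy_increment j) mD st bf).
  apply: Ex_ae; [exact: (bdd_meas_comp mD bf)|exact: (bdd_meas_comp mZh bf)|].
  by have := levy_start hlevy; apply: filterS => w ->; rewrite subr0.
have bc : bdd_meas (fun u => cos (L u)) by exact: bdd_meas_cos.
have bs : bdd_meas (fun u => sin (L u)) by exact: bdd_meas_sin.
suff : ((\int[Pr]_w cos (L (levy_increment j w)))%R +i* (\int[Pr]_w sin (L (levy_increment j w)))%R)%C =
    charfun2 Pr (fun w => Z w h) x y by [].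
rewrite (K cos bc) (K sin bs) /charfun2 !unlock; reflexivity.
Qed.

Lemma levy_increments_charfun :
  Exi Pr (fun w => \sum_(j < m) (a j * (levy_increment j w).1 + b j * (levy_increment j w).2)) =
  \prod_(j < m) cexp (h%:C%C * psi (a j) (b j)).
Proof.
have nd : nondecreasing_seq (fun k : nat => h * k%:R).
  by move=> i j ij; rewrite ler_pM2l// ler_nat.
have t0 : 0 <= h * 0%:R by [].
have ind (B : nat -> set (R * R)) : (forall k, measurable (B k)) ->
    Pr (\bigcap_(k < m) (levy_increment k @^-1` B k)) = (\prod_(k < m) Pr (levy_increment k @^-1` B k))%E.
  by move=> mB; have := levy_independent hlevy m t0 nd mB.
pose th k (u : R * R) := a k * u.1 + b k * u.2.
have mth k : measurable_fun setT (th k) by apply: measurable_funD; exact: measurable_funM.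
rewrite (indep_Exi measurable_levy_increment ind mth).
by apply: eq_bigr => k _; exact: levy_increment_charfun.
Qed.

End levy_increments.

(** * Convergence in law *)

Lemma sum_double {R : realType} m (f : nat -> R) :
  \sum_(i < m.*2) f i = \sum_(j < m) (f j.*2 + f j.*2.+1).
Proof.
elim: m => [|m IH]; first by rewrite !big_ord0.
by rewrite doubleS !big_ord_recr/= IH addrA.
Qed.

Section discretized_paths.
Context {R : realType}.
Variables (h : R) (m : nat).
Hypothesis h0 : 0 < h.

(** The increments of the two coordinates are interleaved in one sequence, even positions for the
    first coordinate and odd ones for the second, so that [charfun_cvg] applies to them. *)
Definition path_of (y : nat -> R) : skorokhod (R * R)%type :=
  step_path (fun k => (\sum_(j < minn k m) y j.*2, \sum_(j < minn k m) y j.*2.+1)) h.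

Lemma path_of_unif_cont (F : skorokhod (R * R)%type -> R) : unif_continuous F ->
  unif_cont_coord m.*2 (F \o path_of).
Proof.
move=> uF eta eta0; have [T [e [T0 e0 HF]]] := uF _ eta0.
exists (e / m.+1%:R); first by rewrite divr_gt0.
move=> y y' yy'; apply: HF; apply: step_path_close => // p.
have key (f : nat -> nat) : (forall j, (j < m)%N -> (f j < m.*2)%N) ->
    `|\sum_(j < minn p m) y (f j) - \sum_(j < minn p m) y' (f j)| < e.
  move=> fm; rewrite -sumrB; apply: le_lt_trans (ler_norm_sum _ _ _) _.
  apply: (@le_lt_trans _ _ (\sum_(j < minn p m) e / m.+1%:R)).
    apply: ler_sum => j _; apply: ltW; apply: yy'; apply: fm.
    by apply: leq_trans (ltn_ord j) _; exact: geq_minr.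
  rewrite sumr_const card_ord -[X in X < _]mulr_natl mulrA ltr_pdivrMr// mulrC ltr_pM2l//.
  by rewrite ltr_nat ltnS; exact: geq_minr.
split; first by apply: (key double) => j jm; rewrite ltn_double.
by apply: (key (fun j => j.*2.+1)) => j jm; rewrite ltn_Sdouble.
Qed.

Lemma path_ofE (x : skorokhod (R * R)%type) : x 0 = 0 ->
  path_of (fun i => let D := x (h * i./2.+1%:R) - x (h * i./2%:R) in if odd i then D.2 else D.1) =
  discretize x h m.
Proof.
move=> x0; rewrite /path_of /discretize; congr (step_path _ h); apply/funext => k.
set p := minn k m; rewrite [RHS]surjective_pairing; congr pair.
  rewrite (eq_bigr (fun j : 'I_p => (x (h * j.+1%:R)).1 - (x (h * j%:R)).1)).
    by rewrite -(big_mkord xpredT (fun j => (x (h * j.+1%:R)).1 - (x (h * j%:R)).1)) telescope_sumr// mulr0 x0 subr0.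
  by move=> j _; rewrite odd_double doubleK.
rewrite (eq_bigr (fun j : 'I_p => (x (h * j.+1%:R)).2 - (x (h * j%:R)).2)).
  by rewrite -(big_mkord xpredT (fun j => (x (h * j.+1%:R)).2 - (x (h * j%:R)).2)) telescope_sumr// mulr0 x0 subr0.
by move=> j _; rewrite /= odd_double/= uphalf_double.
Qed.

End discretized_paths.

Section convergence.
Context {R : realType} {d : measure_display} {E : measurableType d}
  {d1} {Om : measurableType d1} {Pr : probability Om R}
  {d2} {Om2 : measurableType d2} {Pr2 : probability Om2 R}.
Variables (P : R.-pker E ~> E) (pi : probability E R) (X : nat -> {RV Pr >-> E}).
Hypothesis hchain : markov_chain P X.
Hypothesis hlaw : forall B, measurable B -> distribution Pr (X 0%N) B = pi B.
Hypothesis hinv : invariant_law P pi.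
Variable k : R.
Hypothesis k01 : 0 < k < 1.
Local Notation q f := (\int[pi]_x (f x ^+ 2))%R.
Hypothesis hgap : forall f : E -> R, bdd_meas f -> (\int[pi]_x f x = 0)%R ->
  q (Pop P f) <= k * q f.
Variables (K : nat -> R) (v1 v2 : nat -> E -> R) (w1 w2 : nat -> R) (psi1 psi2 : R -> R[i]).
Hypothesis K1 : forall N, 1 <= K N.
Hypothesis KN : K N @[N --> \oo] --> +oo%R.
Hypothesis H1 : heavy P pi v1 K w1 psi1.
Hypothesis H2 : heavy P pi v2 K w2 psi2.
Hypothesis joint : forall del, 0 < del ->
  K N * fine (pi [set x | del <= `|v1 N x| /\ del <= `|v2 N x|]) @[N --> \oo] --> (0 : R).
Variable Z : nat -> Om -> skorokhod (R * R)%type.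
Hypothesis ZE : forall N om r, 0 <= r -> Z N om r =
  (centered_sum X (v1 N) (K N) (w1 N) om r, centered_sum X (v2 N) (K N) (w2 N) om r).
Variable Zoo : Om2 -> skorokhod (R * R)%type.
Hypothesis hlevy : levy_process Pr2 Zoo.
Hypothesis hexp : forall t x y : R, 0 <= t ->
  charfun2 Pr2 (fun w => Zoo w t) x y = cexp (t%:C%C * (psi1 x + psi2 y)).

Let mZ N t : 0 <= t -> measurable_fun setT (fun om => Z N om t).
Proof.
move=> t0; rewrite (_ : (fun om => _) = (fun om => (centered_sum X (v1 N) (K N) (w1 N) om t,
  centered_sum X (v2 N) (K N) (w2 N) om t))); last by apply/funext => om; exact: ZE.
apply: measurable_fun_pair; apply: measurable_centered_sum.
  exact: (heavy_meas H1).
exact: (heavy_meas H2).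
Qed.

Let mZoo t : 0 <= t -> measurable_fun setT (fun om => Zoo om t).
Proof. exact: (levy_measurable hlevy). Qed.

Let Z0 N om : Z N om 0 = 0.
Proof.
rewrite ZE// /centered_sum /steps !mulr0 (_ : Num.truncn 0 = 0%N) ?big_ord0 ?subr0//.
Qed.

Section discretization.
Variables (h : R) (m : nat) (F : skorokhod (R * R)%type -> R) (M : R).
Hypothesis h0 : 0 < h.
Hypothesis uF : unif_continuous F.
Hypothesis FM : forall x, `|F x| <= M.

Let coord (x : skorokhod (R * R)%type) (i : nat) : R :=
  let D := x (h * i./2.+1%:R) - x (h * i./2%:R) in if odd i then D.2 else D.1.

Let mcoord {d'} {T : measurableType d'} (W : T -> skorokhod (R * R)%type) :
  (forall t, 0 <= t -> measurable_fun setT (fun om => W om t)) ->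
  forall i, measurable_fun setT (fun om => coord (W om) i).
Proof.
move=> mW i; have hj j : 0 <= h * j%:R by rewrite mulr_ge0// ltW.
have mD := measurable_pairB (mW _ (hj i./2.+1)) (mW _ (hj i./2)).
by rewrite /coord; case: odd; exact: (measurableT_comp _ mD).
Qed.

Let linE (x : skorokhod (R * R)%type) xi : lin m.*2 xi (coord x) =
  \sum_(j < m) (xi j.*2 * (x (h * j.+1%:R) - x (h * j%:R)).1 +
    xi j.*2.+1 * (x (h * j.+1%:R) - x (h * j%:R)).2).
Proof.
rewrite /lin (sum_double m (fun i => xi i * coord x i)); apply: eq_bigr => j _; rewrite /coord odd_double/= odd_double/=.
by rewrite uphalf_double doubleK.
Qed.

Let hj0 j : 0 <= h * j%:R.
Proof. by rewrite mulr_ge0// ltW. Qed.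

Lemma lin_cvg xi :
  ccvg (fun N => Exi Pr (fun om => lin m.*2 xi (coord (Z N om))))
       (Exi Pr2 (fun om => lin m.*2 xi (coord (Zoo om)))).
Proof.
have -> : Exi Pr2 (fun om => lin m.*2 xi (coord (Zoo om))) =
    \prod_(j < m) cexp (h%:C%C * (psi1 (xi j.*2) + psi2 (xi j.*2.+1))).
  rewrite -(levy_increments_charfun hlevy hexp m (fun j => xi j.*2) (fun j => xi j.*2.+1) h0).
  by congr Exi; apply/funext => om; exact: linE.
have := increments_charfun hchain hlaw hinv k01 hgap K1 KN H1 H2 joint m
  (fun j => xi j.*2) (fun j => xi j.*2.+1) h0.
rewrite (_ : (fun N => Exi Pr _) = (fun N => Exi Pr (fun om => lin m.*2 xi (coord (Z N om)))))//.
apply/funext => N; congr Exi; apply/funext => om; rewrite linE; apply: eq_bigr => j _.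
by rewrite !ZE.
Qed.

(** A discretized path is [path_of] its increments as soon as it starts at 0, which holds surely for
    the chain and almost surely for the Levy process. Uniform continuity of [F] then gives a
    uniformly continuous function of [2 m] real variables. *)
Lemma discretize_Ex_cvg :
  (\int[Pr]_om F (discretize (Z N om) h m))%R @[N --> \oo] -->
  (\int[Pr2]_om F (discretize (Zoo om) h m))%R.
Proof.
pose G := F \o path_of h m.
have uG : unif_cont_coord m.*2 G by exact: path_of_unif_cont.
have bG : exists M, forall y, `|G y| <= M by exists M => y; exact: FM.
have mY N i := mcoord (mZ N) i; have mYoo i := mcoord mZoo i.
have cosc xi : Ex_cvg Pr Pr2 (fun N om => coord (Z N om)) (fun om => coord (Zoo om)) (fun y => cos (lin m.*2 xi y)).
  by case: (lin_cvg xi).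
have sinc xi : Ex_cvg Pr Pr2 (fun N om => coord (Z N om)) (fun om => coord (Zoo om)) (fun y => sin (lin m.*2 xi y)).
  by case: (lin_cvg xi).
have tight i eps : (i < m.*2)%N -> 0 < eps -> exists2 L, 0 < L &
    \forall N \near \oo, fine (Pr [set om | L <= `|coord (Z N om) i|]) <= eps.
  move=> im eps0; have [L1 L10 HL1] := increments_tight hchain hlaw hinv k01 hgap K1 H1 i./2 h0 eps0.
  have [L2 L20 HL2] := increments_tight hchain hlaw hinv k01 hgap K1 H2 i./2 h0 eps0.
  rewrite /coord; case: (odd i); [exists L2|exists L1] => //; apply: nearW => N.
    apply: le_trans (HL2 N); rewrite le_eqVlt; apply/orP; left; apply/eqP.
    by congr (fine (Pr _)); apply/funext => om; rewrite /= !ZE.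
  apply: le_trans (HL1 N); rewrite le_eqVlt; apply/orP; left; apply/eqP.
  by congr (fine (Pr _)); apply/funext => om; rewrite /= !ZE.
have := charfun_cvg mY mYoo cosc sinc tight uG bG.
rewrite /Ex_cvg.
have -> : (\int[Pr2]_om G (coord (Zoo om)))%R = (\int[Pr2]_om F (discretize (Zoo om) h m))%R.
  have bF (d' : measure_display) (T' : measurableType d') (W : T' -> skorokhod (R * R)%type) :
      measurable_fun setT (fun om => F (W om)) -> bdd_meas (fun om => F (W om)).
    by move=> mFW; split=> //; exists M => om; exact: FM.
  apply: Ex_ae.
  - split; last by exists M => om; exact: FM.
    exact: (measurable_unif_cont_coord mYoo uG).
  - apply: bF; apply: (@measurable_step_path _ _ _ _ m h (fun k om => Zoo om (h * k%:R)) (unif_continuousW uF)).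
    by move=> j; exact: mZoo.
  - by have := levy_start hlevy; apply: filterS => om Zo; rewrite /G/= path_ofE.
rewrite (_ : (fun N => (\int[Pr]_w _)%R) = (fun N => (\int[Pr]_om F (discretize (Z N om) h m))%R))//.
by apply/funext => N; apply: eq_Rintegral => om _; rewrite /G/= path_ofE// Z0.
Qed.

End discretization.

(** The means of [F] along both processes are compared through their discretizations on one grid.
    The grid is fixed before [N]: it must be fine enough for the Levy process and for the partitions
    given by [oscillation], whose mesh does not depend on [N]. *)
Theorem heavy_cvg_in_law : cvg_in_law Pr Pr2 Z Zoo.
Proof.
apply: cvg_in_law_unif => // F M uF FM.
have M0 : 0 <= M by apply: le_trans (normr_ge0 _) (FM (path_of 1 0 (fun=> 0))).
have cF := unif_continuousW uF.
have bF (d' : measure_display) (T' : measurableType d') (W : T' -> skorokhod (R * R)%type) :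
    (forall t, 0 <= t -> measurable_fun setT (fun om => W om t)) -> bdd_meas (fun om => F (W om)).
  by move=> mW; split; [exact: (measurable_functional cF mW)|exists M => om; exact: FM].
have mdis (d' : measure_display) (T' : measurableType d') (W : T' -> skorokhod (R * R)%type) h m : 0 < h ->
    (forall t, 0 <= t -> measurable_fun setT (fun om => W om t)) ->
    measurable_fun setT (fun om => F (discretize (W om) h m)).
  move=> h0 mW; apply: (@measurable_step_path _ _ _ _ m h (fun k om => W om (h * k%:R)) cF) => j.
  by apply: mW; rewrite mulr_ge0// ltW.
apply/cvgrPdist_le => e e0; have e4 : 0 < e / 4 by rewrite divr_gt0.
have e8 : 0 < e / 8 by rewrite divr_gt0.
have [T [e1 [T0 e10 HF]]] := uF _ e8.
have eta0 : 0 < e / 16 / (M + 1) by rewrite !divr_gt0// ltr_wpDl.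
have [h1 h10 Hosc] := oscillation hchain hlaw hinv k01 hgap K1 KN H1 H2 ZE T0 e10 eta0.
have dcv : (\int[Pr2]_om F (discretize (Zoo om) n.+1%:R^-1 (n.+1 ^ 2)))%R @[n --> \oo] -->
    (\int[Pr2]_om F (Zoo om))%R.
  apply: (@Ex_bounded_cvg _ _ _ Pr2 _ _ M).
  - by move=> n; apply: mdis => //; rewrite invr_gt0.
  - by move=> n om; exact: FM.
  - move=> om; apply: (cvg_comp (fun n => discretize (Zoo om) n.+1%:R^-1 (n.+1 ^ 2)) F); last exact: cF.
    exact: discretize_cvg.
move: dcv => /cvgrPdist_le/(_ _ e4) dcv.
(* Beyond this bound the mesh [1 / (n + 1)] is below [h1] and [e1], and the horizon [n + 1] exceeds
   [T + 1]. *)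
pose A := T + 1 + h1^-1 + e1^-1.
have : \forall n \near \oo, `|(\int[Pr2]_om F (Zoo om))%R -
    (\int[Pr2]_om F (discretize (Zoo om) n.+1%:R^-1 (n.+1 ^ 2)))%R| <= e / 4 /\ A < n%:R.
  near=> n; split; near: n => //; exact: nbhs_infty_gtr.
move=> /filter_ex[n [dn An]]; pose h : R := n.+1%:R^-1; pose m := (n.+1 ^ 2)%N.
have n0 : (0 : R) < n.+1%:R by rewrite ltr0n.
have h0 : 0 < h by rewrite invr_gt0.
have nn : n%:R < n.+1%:R :> R by rewrite ltr_nat.
have ih1 : 0 < h1^-1 by rewrite invr_gt0.
have ie1 : 0 < e1^-1 by rewrite invr_gt0.
have hh1 : h <= h1.
  rewrite /h -[leRHS]invrK lef_pV2 ?posrE//; apply: ltW; apply: lt_trans nn; apply: le_lt_trans An.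
  by rewrite /A addrAC lerDr !addr_ge0// ltW.
have he1 : h < e1.
  rewrite /h -[ltRHS]invrK ltf_pV2 ?posrE//; apply: lt_trans nn; apply: le_lt_trans An.
  by rewrite /A lerDr !addr_ge0// ltW.
have h1' : h <= 1 by rewrite /h invf_le1// ler1n.
have Tm : T + h <= h * m%:R.
  have -> : h * m%:R = n.+1%:R.
    by rewrite /h /m natrX expr2 mulrA mulVf ?mul1r// gt_eqF.
  apply: (@le_trans _ _ (T + 1)); first by rewrite lerD2l.
  apply: ltW; apply: lt_trans nn; apply: le_lt_trans An.
  by rewrite /A -addrA lerDl addr_ge0// ltW.
have cN := @discretize_Ex_cvg h m F M h0 uF FM.
move: cN => /cvgrPdist_le/(_ _ e4) cN.
near=> N.
have [B [mB PB] HB] : exists2 B : set Om, measurable B /\ fine (Pr B) <= e / 16 / (M + 1) &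
   forall om, ~ B om -> good_partition (Z N om) e1 h1 T by near: N.
have cN' : `|(\int[Pr2]_om F (discretize (Zoo om) h m))%R -
   (\int[Pr]_om F (discretize (Z N om) h m))%R| <= e / 4 by near: N.
have bN : bdd_meas (fun om => F (discretize (Z N om) h m)).
  by split; [apply: mdis => //; exact: mZ|exists M => om; exact: FM].
have close : `|(\int[Pr]_om F (Z N om))%R - (\int[Pr]_om F (discretize (Z N om) h m))%R| <=
    e / 8 + 2 * M * fine (Pr B).
  apply: (norm_ExB_le_on Pr (bF _ _ _ (mZ N)) bN mB (ltW e8)).
    move=> om nB; apply: HF; apply: discretize_close => //.
    by apply: good_partition_mono (HB om nB).
  move=> om; rewrite mulr2n mulrDl mul1r; apply: le_trans (ler_normB _ _) _.
  by apply: lerD; exact: FM.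
have MB : 2 * M * fine (Pr B) <= e / 8.
  apply: (@le_trans _ _ (2 * M * (e / 16 / (M + 1)))).
    by apply: ler_wpM2l => //; exact: mulr_ge0.
  rewrite (_ : 2 * M * (e / 16 / (M + 1)) = e / 8 * (M / (M + 1))); last by field; rewrite gt_eqF ?ltr_wpDl.
  by rewrite ler_piMr ?(ltW e8)// ler_pdivrMr ?ltr_wpDl// mul1r lerDl.
have -> : (\int[Pr2]_om F (Zoo om))%R - (\int[Pr]_om F (Z N om))%R =
  ((\int[Pr2]_om F (Zoo om))%R - (\int[Pr2]_om F (discretize (Zoo om) h m))%R) +
  ((\int[Pr2]_om F (discretize (Zoo om) h m))%R - (\int[Pr]_om F (discretize (Z N om) h m))%R) -
  ((\int[Pr]_om F (Z N om))%R - (\int[Pr]_om F (discretize (Z N om) h m))%R) by ring.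
apply: le_trans (ler_normB _ _) _.
have s1 := le_trans (ler_normD _ _) (lerD dn cN').
apply: (le_trans (lerD s1 (le_trans close (lerD (lexx _) MB)))).
rewrite (_ : e / 4 + e / 4 + (e / 8 + e / 8) = e - e / 4); last by field.
by rewrite gerBl; exact: ltW.
Unshelve. all: by end_near. Qed.

End convergence.

(** * Application to the two rescaled sums *)

Lemma joint_jump_cvg0 {R : realType} {d : measure_display} {E : measurableType d}
    (pi : probability E R) (U V : E -> R) (a b C gam : R) (K : nat -> R) :
  measurable_fun setT U -> measurable_fun setT V -> 0 < a -> 0 < b ->
  Num.max a b < gam ->
  (forall lam, 0 < lam ->
    (pi [set x | lam <= `|U x| /\ lam <= `|V x|]%R <= (C / lam `^ gam)%:E)%E) ->
  (forall N, 1 <= K N) -> K N @[N --> \oo] --> +oo ->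
  forall del, 0 < del ->
  K N * fine (pi [set x | del <= `|jump U a K N x| /\ del <= `|jump V b K N x|])
    @[N --> \oo] --> (0 : R).
Proof.
move=> mU mV a0 b0 abgam HC K1 KN del del0.
set g := Num.max a b in abgam; have g0 : 0 < g by rewrite lt_max a0.
have K0 N : 0 < K N by apply: lt_le_trans (K1 N).
have mS (W1 W2 : E -> R) c : measurable_fun setT W1 -> measurable_fun setT W2 ->
    measurable [set x | c <= `|W1 x| /\ c <= `|W2 x|].
  move=> m1 m2; rewrite (_ : mkset _ = [set x | c <= `|W1 x|] `&` [set x | c <= `|W2 x|])//.
  by apply: measurableI; apply: (@measurable_geY _ _ _ (fun x => `|_ x|));
    exact: measurableT_comp.
have mj (W : E -> R) c N : measurable_fun setT W -> measurable_fun setT (jump W c K N).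
  by move=> mW; exact: measurable_funM.
(* As [K >= 1], both scales are at least [K^(1/g)] with [g] the larger index. A joint jump thus
   forces both variables above one common level, where the joint tail is of order [K^(- gam / g)],
   and [gam > g]. *)
have below (W : E -> R) c N x : 0 < c -> c <= g -> del <= `|jump W c K N x| ->
    del * K N `^ g^-1 <= `|W x|.
  move=> c0 cg; rewrite /jump normrM normfV (gtr0_norm (powR_gt0 _ (K0 N))).
  rewrite ler_pdivlMr ?powR_gt0//; apply: le_trans.
  by rewrite ler_pM2l//; apply: ler_powR => //; rewrite lef_pV2.
have HN N : K N * fine (pi [set x | del <= `|jump U a K N x| /\ del <= `|jump V b K N x|]) <=
    C / del `^ gam * K N `^ (- (gam / g - 1)).
  have L0 : 0 < del * K N `^ g^-1 by rewrite mulr_gt0// powR_gt0.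
  apply: (@le_trans _ _ (K N * (C / (del * K N `^ g^-1) `^ gam))).
    rewrite ler_pM2l// -lee_fin fineK ?fin_num_measure//; last first.
      by apply: mS; exact: mj.
    apply: le_trans (HC _ L0); apply: le_measure; rewrite ?inE; try exact: mS.
    - by apply: mS; exact: mj.
    - move=> x [/below h1 /below h2]; split; [apply: h1|apply: h2] => //.
        by rewrite /g le_max lexx.
      by rewrite /g le_max lexx orbT.
  rewrite powRM ?(ltW del0) ?powR_ge0// -powRrM invfM opprB.
  have -> : K N `^ (1 - gam / g) = K N * (K N `^ (g^-1 * gam))^-1.
    rewrite -[X in _ = X * _]powRr1 ?ltW// -powRN -powRD ?(mulrC g^-1)//.
    by rewrite (gt_eqF (K0 N)) implybT.
  by rewrite le_eqVlt; apply/orP; left; apply/eqP; ring.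
apply: (@squeeze0 R _ (fun N => C / del `^ gam * K N `^ (- (gam / g - 1)))).
- by move=> N; rewrite HN mulr_ge0 ?fine_ge0// ltW.
- apply: cvg0Ml; apply: (cvg_comp K (fun x => x `^ (- (gam / g - 1))) KN); apply: powRN_cvg0.
  by rewrite subr_gt0 ltr_pdivlMr// mul1r.
Qed.

Lemma centering_ne1 {R : realType} {d : measure_display} {E : measurableType d}
    (pi : probability E R) (V : E -> R) (b : R) (K : nat -> R) N :
  b != 1 -> centering pi V b K N = 0.
Proof. by rewrite /centering => /negbTE ->. Qed.

Lemma centered_sumE {R : realType} {d : measure_display} {E : measurableType d}
    {d1} {Om : measurableType d1} {Pr : probability Om R} (X : nat -> {RV Pr >-> E}) (V : E -> R) (b : R) (K : nat -> R) (w : R) N om r :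
  centered_sum X (jump V b K N) (K N) w om r =
  K N `^ (- b^-1) * birkhoff_sum V (fun k => X k) om (Num.truncn (K N * r)) - w * r.
Proof.
by rewrite /centered_sum /birkhoff_sum /steps mulr_sumr powRN; congr (_ - _);
  apply: eq_bigr => i _; rewrite /jump mulrC.
Qed.

Local Open Scope complex_scope.

Theorem theorem2p5 (R : realType)
  (d : measure_display) (E : borelPolishType R d)
  (d1 : measure_display) (Om : measurableType d1) (Pr : probability Om R)
  (P : R.-pker E ~> E) (pi : probability E R) (X : nat -> {RV Pr >-> E})
  (Q : R.-ker E ~> E) (p : E -> E -> R)
  (tau V : E -> R) (alpha calpha beta cp cm : R) (K : nat -> R)
  (hchain : markov_chain P X)
  (hlaw : forall B, measurable B -> distribution Pr (X 0%N) B = pi B)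
  (hinv : invariant_law P pi)
  (herg : ergodic_law P pi)
  (hA1 : spectral_gap P pi)
  (hA2 : kernel_splitting P pi Q p)
  (tau_meas : measurable_fun setT tau)
  (tau_lb : exists2 t_star : R, 0 < t_star & forall x, t_star <= tau x)
  (halpha : 0 < alpha < 1)
  (hcalpha : 0 < calpha)
  (tau_tail :
    tail_asymptotics pi (fun lam => [set x | lam <= tau x]) alpha calpha)
  (hA4 : tail_domination pi Q p tau)
  (V_meas : measurable_fun setT V)
  (hbeta : 0 < beta < 2)
  (hcp : 0 <= cp) (hcm : 0 <= cm) (hc : 0 < cp + cm)
  (V_tail_right :
    tail_asymptotics pi (fun lam => [set x | lam <= V x]) beta cp)
  (V_tail_left :
    tail_asymptotics pi (fun lam => [set x | V x <= - lam]) beta cm)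
  (V_centered : 1 < beta -> (\int[pi]_x (V x)%:E)%E = 0%E)
  (hB2 : tail_domination pi Q p (fun x => `|V x|))
  (hjoint : exists Cstar gamma : R,
    [/\ 0 < Cstar, Num.max alpha beta < gamma &
        forall lam : R, 0 < lam ->
          (pi [set x | lam <= tau x /\ lam <= `|V x|]%R
             <= (Cstar / lam `^ gamma)%:E)%E])
  (K_incr : nondecreasing_seq K)
  (K_infty : K N @[N --> \oo] --> +oo)
  (d2 : measure_display) (Om2 : measurableType d2) (Pr2 : probability Om2 R)
  (Z : Om2 -> skorokhod (R * R)%type)
  (hlevy : levy_process Pr2 Z)
  (hexponent : forall t xi1 xi2 : R, 0 <= t ->
    charfun2 Pr2 (fun w => Z w t) xi1 xi2 =
    cexp (t%:C * (levy_exponent beta cp cm xi1 +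
                  levy_exponent alpha calpha 0 xi2))) :
  (beta != 1 ->
     cvg_in_law Pr Pr2
       (fun N w => scaled_process (K N) alpha beta
          (birkhoff_sum V (fun k => X k) w) (birkhoff_sum tau (fun k => X k) w))
       Z) /\
  (beta = 1 ->
     (exists2 beta' : R, 1 < beta' &
        (ereal_sup [set 'N[pi]_beta'%:E[transition_op P (truncation V (K N))]
                   | N in [set N | (1 <= N)%N]] < +oo)%E) ->
     cvg_in_law Pr Pr2
       (fun N w => centered_process (K N) alpha
          (\int[pi]_x truncation V (K N) x)%R
          (birkhoff_sum V (fun k => X k) w) (birkhoff_sum tau (fun k => X k) w))
       Z).
Proof.
have [k k01 hgap] := spectral_gap_sqr hinv hA1.
have [tstar tstar0 tauge] := tau_lb.
have tau0 x : 0 < tau x by exact: lt_le_trans (tauge x).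
have abs_tau x : `|tau x| = tau x by rewrite gtr0_norm.
have /andP[a0 a1] := halpha; have /andP[b0 b2] := hbeta.
(* Since [tau] is positive its left tail is empty at positive levels: the coefficient is 0, and
   [tau] fits the two-sided framework. *)
have tau_left : tail_asymptotics pi (fun lam => [set x | tau x <= - lam]) alpha 0.
  rewrite /tail_asymptotics; apply: cvg_near_cst; near=> lam.
  rewrite (_ : [set x | tau x <= - lam] = set0) ?measure0 ?mulr0//.
  apply/seteqP; split => // x /=; apply/negP; rewrite -ltNge.
  apply: lt_trans (tau0 x); rewrite oppr_lt0; near: lam; exact: nbhs_pinfty_gt.
have tau_dom : tail_domination pi Q p (fun x => `|tau x|).
  by rewrite (_ : (fun x => `|tau x|) = tau)//; apply/funext.
have [C [gam [C0 gammax HC]]] := hjoint.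
(* The rescaling estimates assume [K >= 1], which holds from some rank on; convergence in law
   ignores finitely many terms. *)
have [N0 HN0] : exists N0, forall N, 1 <= K (N + N0)%N.
  have [N0 _ HN0] : \forall N \near \oo, 1 <= K N.
    by move/cvgryPge : K_infty; exact.
  by exists N0 => N; apply: HN0; exact: leq_addl.
pose K' N := K (N + N0)%N.
have K'oo : K' N @[N --> \oo] --> +oo by rewrite cvg_shiftn.
have H1 := heavy_scaled hA2 V_meas b0 b2 hcp hcm V_tail_right V_tail_left V_centered hB2 HN0 K'oo.
have a2 : alpha < 2 by rewrite (lt_trans a1)// ltr1n.
have tau_centered : 1 < alpha -> (\int[pi]_x (tau x)%:E)%E = 0%E by rewrite (lt_gtF a1).
have H2 := heavy_scaled hA2 tau_meas a0 a2 (ltW hcalpha) (lexx 0) tau_tail tau_left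
  tau_centered tau_dom HN0 K'oo.
have joint := @joint_jump_cvg0 _ _ _ pi V tau beta alpha C gam K'.
have shift (Z' : nat -> Om -> skorokhod (R * R)%type) :
    (forall N om r, 0 <= r -> Z' (N + N0)%N om r =
      (centered_sum X (jump V beta K' N) (K' N) (centering pi V beta K' N) om r,
       centered_sum X (jump tau alpha K' N) (K' N) (centering pi tau alpha K' N) om r)) ->
    cvg_in_law Pr Pr2 Z' Z.
  move=> Z'E F cF bF; rewrite -(cvg_shiftn N0).
  apply: (heavy_cvg_in_law hchain hlaw hinv k01 hgap HN0 K'oo H1 H2 _ Z'E hlevy hexponent) => //.
  apply: joint => //.
    by rewrite maxC.
  move=> lam lam0; rewrite (_ : mkset _ = [set x | lam <= tau x /\ lam <= `|V x|]); first exact: HC.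
  by apply/seteqP; split=> x /= []; rewrite abs_tau.
have tauE N om r : centered_sum X (jump tau alpha K' N) (K' N) (centering pi tau alpha K' N) om r =
    K' N `^ (- alpha^-1) * birkhoff_sum tau (fun k => X k) om (Num.truncn (K' N * r)).
  by rewrite centered_sumE centering_ne1 ?lt_eqF// mul0r subr0.
split=> [b1|b1 _]; apply: shift => N om r _; rewrite tauE centered_sumE.
  by rewrite centering_ne1// mul0r subr0.
(* At [beta = 1] the centering is the mean of the truncated variable, the drift subtracted in
   [centered_path]. *)
by rewrite /centering b1 eqxx invr1 powR_inv1//; apply: le_trans (HN0 N).
Unshelve. all: by end_near. Qed.
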